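(* Let $(M,g)$ be a compact Riemannian manifold of dimension $n\ge2$, possibly with boundary, and let $\rho$ and $\sigma$ be two positive continuous functions (densities) on $M$. Then $$\mu_1(\rho,\sigma)\ge\frac14\,h_{\sigma,\sigma}(M)\,h_{\rho,\sigma}(M).$$
   Context: $v_g$ is the Riemannian volume element of $g$. For positive functions $\rho,\sigma$ on $M$ and $k\ge0$, $$\mu_k(\rho,\sigma)=\inf_{E\in S_{k+1}}\sup_{u\in E\setminus\{0\}}\frac{\int_M|\nabla u|^2\sigma\,v_g}{\int_Mu^2\rho\,v_g},$$ where $S_k$ is the set of $k$-dimensional vector subspaces of $H^1(M)$ (numbering starts at $0$). For positive densities $\rho,\sigma$, $$h_{\rho,\sigma}(M)=\inf_{|D|_\sigma\le\frac12|M|_\sigma}\frac{|\partial D\setminus\partial M|_\sigma}{|D|_\rho},$$ where $D$ ranges over nonempty open subsets of $M$ such that $\partial D\setminus\partial M$ is a smooth hypersurface, $|D|_\rho=\int_D\rho\,v_g$, $|D|_\sigma=\int_D\sigma\,v_g$, and $|\partial D\setminus\partial M|_\sigma$ is the $(n-1)$-dimensional volume of $\partial D\setminus\partial M$ weighted by $\sigma$ (the integral of $\sigma$ against the induced Riemannian hypersurface measure). The constant $h_{\sigma,\sigma}(M)$ is obtained by taking $\rho=\sigma$. *)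

(* Defs.v *)
From HB Require Import structures.
From mathcomp Require Import all_boot all_order all_algebra.
From mathcomp Require Import all_classical all_reals all_analysis.

Set Implicit Arguments.
Unset Strict Implicit.
Unset Printing Implicit Defensive.

Import Order.TTheory GRing.Theory Num.Theory.
Import numFieldNormedType.Exports.

Local Open Scope classical_set_scope.
Local Open Scope ring_scope.

(* C^k real functions on an open set U of R^m, by iterated partial derivatives *)
Fixpoint Ck (R : realType) (m k : nat) (U : set 'rV[R]_m) (f : 'rV[R]_m -> R)
    : Prop :=
  (forall x, U x -> {for x, continuous f}) /\
  match k with
  | 0%N => True
  | k'.+1 => forall i : 'I_m,
      (forall x, U x -> derivable f x (delta_mx 0 i)) /\
      Ck k' U (fun x => 'D_(delta_mx 0 i) f x)
  end.

(* On a set A that need not be open (here: relatively open in a half-space),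
   smooth means locally the restriction of a C^oo function defined on an open
   set of R^m. *)
Definition smooth_on (R : realType) (m : nat) (A : set 'rV[R]_m)
    (f : 'rV[R]_m -> R) : Prop :=
  forall x, A x -> exists (U : set 'rV[R]_m) (F : 'rV[R]_m -> R),
    [/\ open U, U x, forall k, Ck k U F & forall y, A y -> U y -> F y = f y].

Definition test_function (R : realType) (m : nat) (U : set 'rV[R]_m)
    (psi : 'rV[R]_m -> R) : Prop :=
  (forall k, Ck k [set: 'rV[R]_m] psi) /\
  exists K : set 'rV[R]_m,
    [/\ compact K, K `<=` U & forall x, ~ K x -> psi x = 0].

(* Integral over R^m with respect to m-dimensional Lebesgue measure, as an
   iterated integral: by Tonelli and Fubini this is the Lebesgue integral for
   the Borel functions that are nonnegative or integrable. *)
Fixpoint integralRn (R : realType) (m : nat)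
    : ('rV[R]_m -> \bar R) -> \bar R :=
  match m return ('rV[R]_m -> \bar R) -> \bar R with
  | 0%N => fun f => f 0
  | m'.+1 => fun f =>
      (\int[@lebesgue_measure R]_t
         integralRn (fun y : 'rV[R]_m' =>
                       f (row_mx (const_mx t : 'rV[R]_1) y)))%E
  end.

Section Manifold.
Variables (R : realType) (n : nat) (M : ptopologicalType).
(* all manifolds below have dimension n.+1 *)

Definition halfspace : set 'rV[R]_n.+1 := [set x | 0 <= x 0 ord0].

(* [cmap] is only meaningful on [cdom] and [cinv] on the image of [cdom]. *)
Record chart := Chart {
  cdom : set M;
  cmap : M -> 'rV[R]_n.+1;
  cinv : 'rV[R]_n.+1 -> M }.

Definition is_chart (c : chart) : Prop :=
  [/\ open (cdom c),
      exists W, open W /\ cmap c @` cdom c = W `&` halfspace,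
      forall p, cdom c p -> cinv c (cmap c p) = p,
      {within cdom c, continuous (cmap c)} &
      {within cmap c @` cdom c, continuous (cinv c)}].

Definition smooth_transition (c c' : chart) : Prop :=
  forall j, smooth_on (cmap c @` (cdom c `&` cdom c'))
              (fun x => cmap c' (cinv c x) 0 j).

Definition compatible (c c' : chart) : Prop :=
  smooth_transition c c' /\ smooth_transition c' c.

(* a maximal C^oo atlas of charts with values in a half-space *)
Record smoothStructure := SmoothStructure {
  atlas : set chart;
  atlas_chart : forall c, atlas c -> is_chart c;
  atlas_cover : forall p, exists2 c, atlas c & cdom c p;
  atlas_compatible : forall c c', atlas c -> atlas c' -> compatible c c';
  atlas_maximal : forall c, is_chart c ->
    (forall c', atlas c' -> compatible c c') -> atlas c }.

Definition mboundary (X : smoothStructure) : set M :=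
  [set p | exists c, [/\ atlas X c, cdom c p & cmap c p 0 ord0 = 0]].

(* The metric is given by its matrix (g_ij) in each chart.  The change of
   coordinates rule is only required at interior points, where the Jacobian
   matrix of the transition map makes sense; at boundary points it follows by
   continuity.  The matrix ['J f x] acts on row vectors. *)
Record riemannianMetric (X : smoothStructure) := RiemannianMetric {
  gmx : chart -> M -> 'M[R]_n.+1;
  gmx_sym : forall c p, atlas X c -> cdom c p -> (gmx c p)^T = gmx c p;
  gmx_pos : forall c p (w : 'rV[R]_n.+1), atlas X c -> cdom c p -> w != 0 ->
    0 < (w *m gmx c p *m w^T) 0 0;
  gmx_smooth : forall c i j, atlas X c ->
    smooth_on (cmap c @` cdom c) (fun x => gmx c (cinv c x) i j);
  gmx_transition : forall c c' p, atlas X c -> atlas X c' ->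
    cdom c p -> cdom c' p -> ~ mboundary X p ->
    gmx c p = 'J (cmap c' \o cinv c) (cmap c p) *m gmx c' p *m
              ('J (cmap c' \o cinv c) (cmap c p))^T }.

Definition borel := g_sigma_algebraType (@open M).

Variables (X : smoothStructure) (g : riemannianMetric X).

(* v is the Riemannian volume: dv = sqrt (det (g_ij)) dx in every chart *)
Definition is_volume (v : {measure set borel -> \bar R}) : Prop :=
  forall (c : chart) (A : set borel), atlas X c -> measurable A ->
    A `<=` cdom c ->
    v A = integralRn (fun x : 'rV[R]_n.+1 =>
      (\1_(cmap c @` A) x * Num.sqrt (\det (gmx g c (cinv c x))))%:E).

(* Chart adapted to S: in it, S is the slice where the last coordinate is 0.
   (The first coordinate is the one that defines the half-space.) *)
Definition slice_chart (S : set M) (c : chart) : Prop :=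
  atlas X c /\ forall p, cdom c p -> (S p <-> cmap c p 0 ord_max = 0).

Definition smooth_hypersurface (S : set M) : Prop :=
  forall p, S p -> exists2 c, slice_chart S c & cdom c p.

Definition slice_embedding (y : 'rV[R]_n) : 'rV[R]_n.+1 :=
  \row_i (if unlift ord_max i is Some j then y 0 j else 0).

(* nu is the measure on S of the metric induced by g, extended by zero to M.
   In an adapted chart the matrix of the induced metric is (g_ij) without its
   last row and column. *)
Definition is_hypersurface_measure (S : set M)
    (nu : {measure set borel -> \bar R}) : Prop :=
  nu (~` S) = 0%E /\
  forall (c : chart) (A : set borel), slice_chart S c -> measurable A ->
    A `<=` cdom c ->
    nu A = integralRn (fun y : 'rV[R]_n =>
      (\1_(cmap c @` A) (slice_embedding y) *
       Num.sqrt (\det (row' ord_max (col' ord_max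
         (gmx g c (cinv c (slice_embedding y)))))))%:E).

Variable v : {measure set borel -> \bar R}.

(* [w p 0 i] is the weak i-th partial derivative of u in the chart c *)
Definition weak_partials (c : chart) (u : M -> R) (w : M -> 'rV[R]_n.+1)
    : Prop :=
  forall i : 'I_n.+1,
    measurable_fun (cdom c : set borel) (fun p : borel => w p 0 i) /\
    forall psi, test_function (cmap c @` (cdom c `\` mboundary X)) psi ->
      integralRn (fun x => (u (cinv c x) * 'D_(delta_mx 0 i) psi x)%:E) =
      (- integralRn (fun x => (w (cinv c x) 0 i * psi x)%:E))%E.

(* e = |grad u|^2 = g^ij (d_i u) (d_j u), for u with square integrable weak
   gradient; such an e is unique up to a v-negligible set. *)
Definition is_gradsq (u e : M -> R) : Prop :=
  v.-integrable [set: borel] (EFin \o e) /\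
  forall c, atlas X c -> exists2 w, weak_partials c u w &
    forall p, cdom c p -> ~ mboundary X p ->
      e p = (w p *m invmx (gmx g c p) *m (w p)^T) 0 0.

Definition gradsq (u : M -> R) : M -> R := xget (fun=> 0) (is_gradsq u).

(* Elements of H^1(M) are represented by Borel functions; equality in H^1(M)
   is equality v-almost everywhere. *)
Definition H1 : set (M -> R) :=
  [set u | [/\ measurable_fun [set: borel] (u : borel -> R),
               v.-integrable [set: borel] (fun x => (u x ^+ 2)%:E) &
               exists e, is_gradsq u e]].

Definition aeeq (u1 u2 : M -> R) : Prop :=
  {ae v, forall x : borel, u1 x = u2 x}.

Definition lincomb (k : nat) (a : 'I_k -> R) (b : 'I_k -> M -> R) : M -> R :=
  fun x => \sum_i a i * b i x.

(* S_k, the k-dimensional vector subspaces of H^1(M), each of which is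
   represented by the set of all representatives of its elements *)
Definition subspaceH1 (k : nat) (E : set (M -> R)) : Prop :=
  [/\ E `<=` H1,
      forall u1 u2, E u1 -> H1 u2 -> aeeq u1 u2 -> E u2,
      E (fun=> 0),
      forall (a : R) u1 u2, E u1 -> E u2 -> E (fun x => a * u1 x + u2 x) &
      exists b : 'I_k -> M -> R,
        [/\ forall i, E (b i),
            forall a, aeeq (lincomb a b) (fun=> 0) -> forall i, a i = 0 &
            forall u, E u -> exists a, aeeq u (lincomb a b)]].

Local Open Scope ereal_scope.

Definition rayleigh (rho sigma : M -> R) (u : M -> R) : \bar R :=
  (\int[v]_x (gradsq u x * sigma x)%:E) / (\int[v]_x (u x ^+ 2 * rho x)%:E).

Definition mu (k : nat) (rho sigma : M -> R) : \bar R :=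
  ereal_inf [set ereal_sup [set rayleigh rho sigma u | u in
                              [set u | E u /\ ~ aeeq u (fun=> 0%R)]]
            | E in subspaceH1 k.+1].

Definition weighted_volume (rho : M -> R) (D : set M) : \bar R :=
  \int[v]_(x in D) (rho x)%:E.

(* the measure nu below exists and is unique *)
Definition cheeger (rho sigma : M -> R) : \bar R :=
  ereal_inf [set r | exists (D : set M) (nu : {measure set borel -> \bar R}),
    let S := (closure D `\` interior D) `\` mboundary X in
    [/\ open D /\ D !=set0,
        weighted_volume sigma D
          <= (2^-1)%:E * weighted_volume sigma [set: M],
        smooth_hypersurface S,
        is_hypersurface_measure S nu &
        r = (\int[nu]_(x in S) (sigma x)%:E) / weighted_volume rho D]].

End Manifold.

(* Main.v *)
Require Import Defs.
From HB Require Import structures.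
From mathcomp Require Import all_boot all_order all_algebra.
From mathcomp Require Import all_classical all_reals all_analysis.
From mathcomp Require Import measurable_realfun.
From mathcomp Require Import perm ring lra.

Set Implicit Arguments.
Unset Strict Implicit.
Unset Printing Implicit Defensive.

Import Order.TTheory GRing.Theory Num.Theory.
Import numFieldNormedType.Exports.

Local Open Scope classical_set_scope.
Local Open Scope ring_scope.

(** For a smooth function f with sigma-median m, the coarea formula
    int |grad f| phi dv = int_t int_(f = t) phi dt and the definition of the Cheeger constants, applied
    to the sets f > t for the almost every t that are regular values (Sard), give
    h_ss int w^2 sigma <= 2 int w |grad f| sigma and h_rs int w^2 rho <= 2 int w |grad f| sigma
    for w = (f - m)^+, and Young's inequality combines them into
    h_ss h_rs int w^2 rho <= 4 int_(f > m) |grad f|^2 sigma; the same holds for -f.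

    The measure of a level set is built from charts of the maximal atlas in which f is the last
    coordinate.  That its density does not depend on the chart is obtained without a change of
    variables theorem: given two charts adapted to the same hypersurface, a third one, which is again
    in the maximal atlas, has the tangential coordinates of the second and the transversal coordinate
    of the first, and the volume [v] has the prescribed density in all of them.

    A function u of H^1 is approximated by gluing mollifications in finitely many charts.  Only
    |grad u|^2, and not grad u itself, is known to be independent of the chart, but
    |sum chi_i w_i|^2 <= sum chi_i |w_i|^2 suffices for int |grad f|^2 sigma to be asymptotically
    bounded by int |grad u|^2 sigma.  At the boundary the mollifiers are supported in the direction
    of the interior.  Finally every plane in H^1 contains some u <> 0 with int u rho = 0, for which
    int u^2 rho <= int (u - m)^2 rho for every m. *)

(** * Calculus of C^k functions *)

(** The frontier of an admissible domain is asked to be smooth only off [mboundary X], so Sard's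
    theorem and the adapted charts concern interior points alone, and these have charts with open
    image. All knowledge about [v] comes from [is_volume], which prescribes its density in every
    chart of the maximal atlas at once; two charts are compared by integrating one function in both.

    Only the inequality [<=] of the coarea formula is used: the points outside the level charts can
    only increase the right side.

    The constant 4 has two sources. Differentiating [w ^+ 2] in the layer cake formula gives a
    factor 2, and Young's inequality is applied with weight [a1 / 2], half of which absorbs the term
    in [sigma]: this yields [a1 ^+ 2 * int w^2 sigma <= 4 G] and then
    [a1 * a2 * int w^2 rho <= 2 G + 2 G], with [G] the energy on [f > m].

    A Cheeger constant is an extended real. Therefore the estimates are made with arbitrary positive
    real lower bounds [a1] and [a2], and the product is recovered only at the end. Likewise [gradsq]
    is a choice among many candidates, and only the property [is_gradsq] of the chosen one
    enters. *)

Section CkCalculus.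
Context {R : realType}.

Notation e_ i := (delta_mx 0 i).

Lemma line_derive m (f : 'rV[R]_m -> R) x v t :
  derivable f (x + t *: v) v ->
  is_derive t 1 (fun s => f (x + s *: v)) ('D_v f (x + t *: v)).
Proof.
have E : (fun h : R => h^-1 *: (((fun s => f (x + s *: v)) \o shift t) (h *: 1)
            - f (x + t *: v))) =
         (fun h : R => h^-1 *: ((f \o shift (x + t *: v)) (h *: v)
            - f (x + t *: v))).
  apply/funext => h /=; rewrite [h *: 1]mulr1 scalerDl.
  by congr (_ *: (f _ - _)); rewrite addrCA.
move=> df; apply: DeriveDef; first by rewrite /derivable E.
by rewrite /derive E.
Qed.

Lemma line_continuous m (x v : 'rV[R]_m) : continuous (fun t : R => x + t *: v).
Proof.
move=> t; apply: cvgD; first exact: cvg_cst.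
by apply: cvgZr_tmp; exact: cvg_id.
Qed.

(** The segment is parametrised by [t] in [0, 1] rather than by length, which makes the formula
    uniform in the sign of [h] and includes [h = 0]. *)
Lemma line_MVT m (f : 'rV[R]_m -> R) x v (h : R) :
  (forall t, 0 <= t <= 1 -> derivable f (x + (t * h) *: v) v) ->
  exists2 t, 0 <= t <= 1 & f (x + h *: v) - f x = 'D_v f (x + (t * h) *: v) * h.
Proof.
move=> df.
pose g (t : R) := f (x + (t * h) *: v).
have dg (t : R) : 0 <= t <= 1 -> is_derive t 1 g ('D_v f (x + (t * h) *: v) * h).
  move=> t01.
  have dl : is_derive t 1 (fun s : R => s * h) h.
    by apply: is_derive_eq; rewrite scaler0 add0r [LHS]mulr1.
  exact: (@is_derive1_comp _ (fun t => f (x + t *: v)) (fun s : R => s * h) t _ _ (line_derive (df t t01)) dl).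
have [t||c] := @MVT_segment _ g (fun t => 'D_v f (x + (t * h) *: v) * h) 0 1 ler01.
- by rewrite in_itv /= => /andP[t0 t1]; apply: dg; rewrite !ltW.
- apply: derivable_within_continuous => t; rewrite in_itv /= => t01.
  exact: (ex_derive (is_derive := dg t t01)).
rewrite in_itv /= => c01; rewrite /g mul1r mul0r scale0r addr0 subr0 mulr1 => E.
by exists c.
Qed.

Lemma Ck_sub m k (U V : set 'rV[R]_m) f : V `<=` U -> Ck k U f -> Ck k V f.
Proof.
move=> VU; elim: k f => [|k IH] f /= [cf df]; split => //.
- by move=> x /VU/cf.
- by move=> x /VU/cf.
- by move=> i; have [d1 d2] := df i; split => [x /VU/d1//|]; exact: IH.
Qed.

(** The derivatives in [Ck] are those of the total function [f], so every clause is a condition at a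
    single point of [U], and [U] may be cut into singletons. *)
Lemma Ck_pt m k (U : set 'rV[R]_m) f :
  (forall x, U x -> Ck k [set x] f) -> Ck k U f.
Proof.
elim: k f => [|k IH] f /= H.
  by split => // x /H[/(_ x erefl)].
split => [x /H[/(_ x erefl)]//|i]; split.
  by move=> x /H [_ /(_ i)[/(_ x erefl)]].
by apply: IH => x /H [_ /(_ i)[]].
Qed.

Lemma Ck_local m k (U : set 'rV[R]_m) f :
  (forall x, U x -> exists V, V x /\ Ck k V f) -> Ck k U f.
Proof.
by move=> H; apply: Ck_pt => x /H [V [Vx]]; apply: Ck_sub => y ->.
Qed.

Lemma CkS m k (U : set 'rV[R]_m) f : Ck k.+1 U f -> Ck k U f.
Proof.
elim: k f => [|k IH] f /= [cf df]; split => // i.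
by have [d1 d2] := df i; split => //; apply: IH.
Qed.

Lemma Ck_le m k l (U : set 'rV[R]_m) f : (k <= l)%N -> Ck l U f -> Ck k U f.
Proof.
elim: l => [|l IH]; first by rewrite leqn0 => /eqP ->.
by rewrite leq_eqVlt ltnS => /predU1P[->//|kl] /CkS; exact: IH.
Qed.

Lemma Ck_cont m k (U : set 'rV[R]_m) f x : Ck k U f -> U x -> {for x, continuous f}.
Proof. by case: k => [|k] [cf _] /cf. Qed.

Lemma CkD1 m k (U : set 'rV[R]_m) f i : Ck k.+1 U f -> Ck k U ('D_(e_ i) f).
Proof. by move=> [_ /(_ i)[]]. Qed.

Lemma Ck_derivable m k (U : set 'rV[R]_m) f i x : Ck k.+1 U f -> U x ->
  derivable f x (e_ i).
Proof. by move=> [_ /(_ i)[d _]] /d. Qed.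

(** Openness matters: equality on [U] transfers derivatives because it holds in a neighbourhood of
    each point of [U]. *)
Lemma Ck_eq m k (U : set 'rV[R]_m) f g : open U -> (forall x, U x -> f x = g x) ->
  Ck k U f -> Ck k U g.
Proof.
move=> oU; elim: k f g => [|k IH] f g fg /= [cf df].
- split=> // x Ux; suff: g @ x --> g x by []; rewrite -(fg x Ux).
  have N : \near x, f x = g x by apply: filterS (open_nbhs_nbhs (conj oU Ux)) => y /fg.
  by apply: cvg_trans (cf x Ux); exact: near_eq_cvg N.
- have N x : U x -> \near x, f x = g x.
    by move=> Ux; apply: filterS (open_nbhs_nbhs (conj oU Ux)) => y /fg.
  split=> [x Ux|i].
    suff: g @ x --> g x by []; rewrite -(fg x Ux).
    by apply: cvg_trans (cf x Ux); exact: near_eq_cvg (N x Ux).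
  split=> [x Ux|].
    by apply: near_eq_derivable (N x Ux) _; exact: (df i).1.
  by apply: IH (df i).2 => x Ux; exact/near_eq_derive/N.
Qed.

Lemma Ck_cst m k (U : set 'rV[R]_m) (c : R) : Ck k U (fun=> c).
Proof.
have H : forall x : 'rV[R]_m, {for x, continuous (fun=> c)} by move=> x; exact: cst_continuous.
elim: k c H => [|k IH] c H /=; split => //.
move=> i; split=> [x _|]; first exact: derivable_cst.
rewrite [X in Ck k U X](_ : _ = fun=> 0); last by apply/funext => x; exact: derive_cst.
by apply: IH => x; exact: cst_continuous.
Qed.

Lemma CkD m k (U : set 'rV[R]_m) f g : open U -> Ck k U f -> Ck k U g ->
  Ck k U (fun x => f x + g x).
Proof.
move=> oU; elim: k f g => [|k IH] f g /= [cf df] [cg dg].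
  by split=> // x Ux; apply: continuousD; [exact: (cf x Ux)|exact: (cg x Ux)].
split=> [x Ux|i]; first by apply: continuousD; [exact: (cf x Ux)|exact: (cg x Ux)].
split=> [x Ux|]; first by apply: derivableD; [exact: (df i).1|exact: (dg i).1].
apply: Ck_eq (IH _ _ (df i).2 (dg i).2) => // x Ux.
by rewrite deriveD //; [exact: (df i).1|exact: (dg i).1].
Qed.

Lemma CkM m k (U : set 'rV[R]_m) f g : open U -> Ck k U f -> Ck k U g ->
  Ck k U (fun x => f x * g x).
Proof.
move=> oU; elim: k f g => [|k IH] f g.
  by move=> [cf df] [cg dg]; split=> // x Ux; apply: continuousM; [exact: (cf x Ux)|exact: (cg x Ux)].
move=> Cf Cg; split=> [x Ux|i].
  by apply: continuousM; [exact: (Ck_cont Cf)|exact: (Ck_cont Cg)].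
split=> [x Ux|].
  by apply: derivableM; [exact: Ck_derivable Cf Ux|exact: Ck_derivable Cg Ux].
have := CkD oU (IH _ _ (CkS Cf) (CkD1 i Cg)) (IH _ _ (CkS Cg) (CkD1 i Cf)).
apply: Ck_eq => // x Ux.
by rewrite deriveM //; [exact: Ck_derivable Cf Ux|exact: Ck_derivable Cg Ux].
Qed.

Lemma CkN m k (U : set 'rV[R]_m) f : open U -> Ck k U f -> Ck k U (fun x => - f x).
Proof.
move=> oU /(CkM oU (Ck_cst k U (-1))); apply: Ck_eq => // x _.
by rewrite mulN1r.
Qed.

Lemma CkB m k (U : set 'rV[R]_m) f g : open U -> Ck k U f -> Ck k U g ->
  Ck k U (fun x => f x - g x).
Proof. by move=> oU Cf Cg; apply: CkD => //; exact: CkN. Qed.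

Lemma Ck_sum m k (U : set 'rV[R]_m) I (r : seq I) (P : pred I) (F : I -> 'rV[R]_m -> R) :
  open U -> (forall i, P i -> Ck k U (F i)) ->
  Ck k U (fun x => \sum_(i <- r | P i) F i x).
Proof.
move=> oU CF; elim: r => [|i r IH].
  by apply: Ck_eq (Ck_cst k U 0) => // x _; rewrite big_nil.
case: (boolP (P i)) => Pi.
  by apply: Ck_eq (CkD oU (CF i Pi) IH) => // x _; rewrite big_cons Pi.
by apply: Ck_eq IH => // x _; rewrite big_cons (negbTE Pi).
Qed.

Lemma Ck_prod m k (U : set 'rV[R]_m) I (r : seq I) (P : pred I) (F : I -> 'rV[R]_m -> R) :
  open U -> (forall i, P i -> Ck k U (F i)) ->
  Ck k U (fun x => \prod_(i <- r | P i) F i x).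
Proof.
move=> oU CF; elim: r => [|i r IH].
  by apply: Ck_eq (Ck_cst k U 1) => // x _; rewrite big_nil.
case: (boolP (P i)) => Pi.
  by apply: Ck_eq (CkM oU (CF i Pi) IH) => // x _; rewrite big_cons Pi.
by apply: Ck_eq IH => // x _; rewrite big_cons (negbTE Pi).
Qed.

Lemma is_derive_coord m (x v : 'rV[R]_m) j : is_derive x v (fun y : 'rV[R]_m => y 0 j) (v 0 j).
Proof.
have d : differentiable (fun N : 'rV[R]_m => N 0 j : R) x.
  exact: differentiable_coord.
have di : derivable (@id 'rV[R]_m) x v by exact: derivable_id.
have /derivable_mxP/(_ 0 j) dx := di.
apply: DeriveDef; first exact: dx.
have := derive_mx di; rewrite derive_id => /matrixP /(_ 0 j).
by rewrite !mxE => ->.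
Qed.

Lemma Ck_coord m k (U : set 'rV[R]_m) j : Ck k U (fun x => x 0 j).
Proof.
case: k => [|k]; split => //; try by move=> x _; exact: coord_continuous.
move=> i; split=> [x _|]; first exact: (ex_derive (is_derive := is_derive_coord x _ j)).
rewrite [X in Ck k U X](_ : _ = fun=> (e_ i : 'rV[R]_m) 0 j); first exact: Ck_cst.
by apply/funext => x; have := is_derive_coord x (e_ i) j; case.
Qed.

Lemma CkV m k (U : set 'rV[R]_m) f : open U -> (forall x, U x -> f x != 0) ->
  Ck k U f -> Ck k U (fun x => (f x)^-1).
Proof.
move=> oU f0; elim: k => [|k IH] Cf.
  by split=> // x Ux; apply: continuousV; [exact: f0|exact: (Ck_cont Cf)].
split=> [x Ux|i].
  by apply: continuousV; [exact: f0|exact: (Ck_cont Cf)].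
split=> [x Ux|].
  by apply: derivableV; [exact: f0|exact: Ck_derivable Cf Ux].
have IV := IH (CkS Cf).
have := CkN oU (CkM oU (CkM oU IV IV) (CkD1 i Cf)).
apply: Ck_eq => // x Ux.
rewrite deriveV; [|exact: f0|exact: Ck_derivable Cf Ux].
by rewrite [_ *: _]mulNr; congr (- (_ * _)); rewrite -expr2 exprVn.
Qed.


Lemma row_basis m (v : 'rV[R]_m) : v = \sum_i v 0 i *: e_ i.
Proof.
apply/rowP => j; rewrite summxE (bigD1 j) //= big1 ?addr0 => [|i ij].
  by rewrite !mxE !eqxx mulr1.
by rewrite !mxE /= eq_sym (negbTE ij) mulr0.
Qed.

Lemma le_mx_norm m (v : 'rV[R]_m) i : `|v 0 i| <= `|v|.
Proof. by rewrite [leRHS]/Num.norm /= mx_normrE; exact: (le_bigmax _ _ (0, i)). Qed.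

Lemma mx_norm_le m (v : 'rV[R]_m) e : 0 <= e -> (forall i, `|v 0 i| <= e) -> `|v| <= e.
Proof.
move=> e0 H; rewrite [leLHS]/Num.norm /= mx_normrE; apply/bigmax_leP; split=> // -[i j] _ /=.
by rewrite ord1.
Qed.

Definition grad m (f : 'rV[R]_m -> R) (x : 'rV[R]_m) : 'rV[R]_m :=
  \row_i 'D_(e_ i) f x.

(** The corners of the staircase path from 0 to [h], which changes one coordinate at a time;
    [truncS] is one step of it. *)
Definition trunc m (h : 'rV[R]_m) (k : nat) : 'rV[R]_m :=
  \row_i (if (i < k)%N then h 0 i else 0).

Lemma truncS m (h : 'rV[R]_m) (k : 'I_m) : trunc h k.+1 = trunc h k + h 0 k *: e_ k.
Proof.
apply/rowP => i; rewrite !mxE eqxx /= ltnS leq_eqVlt.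
case: eqVneq => [/val_inj ->|ik]; first by rewrite eqxx ltnn mulr1 add0r.
rewrite (negbTE (_ : i != k)) /= ?mulr0 ?addr0 //.
Qed.

(** The increment is telescoped along the staircase [trunc h k]. The mean value theorem turns each
    step into a partial derivative at a point within [|h|] of [x], where continuity keeps it within
    [e / m.+1] of its value at [x]. The divisor [m.+1] is nonzero also in dimension 0. *)
Lemma C1_approx m (U : set 'rV[R]_m) f x : open U -> Ck 1 U f -> U x ->
  forall e, 0 < e -> \forall h \near (0 : 'rV[R]_m),
    `|f (x + h) - f x - \sum_i h 0 i * 'D_(e_ i) f x| <= e * `|h|.
Proof.
move=> oU Cf Ux e e0.
pose e' := e / m.+1%:R; have e'0 : 0 < e' by rewrite divr_gt0.
have N : \forall y \near x, U y /\ forall i, `|'D_(e_ i) f y - 'D_(e_ i) f x| <= e'.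
  near=> y; split; first by near: y; exact: open_nbhs_nbhs.
  near: y; apply: filter_forall => i.
  have /cvgrPdist_le/(_ _ e'0) : 'D_(e_ i) f @ x --> 'D_(e_ i) f x.
    exact: (Ck_cont (CkD1 i Cf) Ux).
  by apply: filterS => y; rewrite distrC.
have [d /= d0 dN] := (nbhs_ballP _ _).1 N.
apply/nbhs_ballP; exists d => //= h; rewrite -ball_normE /= sub0r normrN => hd.
have Bd y : `|y - x| <= `|h| -> U y /\ forall i, `|'D_(e_ i) f y - 'D_(e_ i) f x| <= e'.
  move=> yh; apply: dN; rewrite -ball_normE /= distrC; exact: le_lt_trans hd.
have step (k : 'I_m) : `|f (x + trunc h k.+1) - f (x + trunc h k) - h 0 k * 'D_(e_ k) f x|
    <= e' * `|h|.
  have Bt t : 0 <= t <= 1 -> `|(x + trunc h k + (t * h 0 k) *: e_ k) - x| <= `|h|.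
    move=> /andP[t0 t1]; rewrite addrAC [x + _ - x]addrC addKr.
    apply: mx_norm_le => // i; rewrite !mxE eqxx /=.
    case: eqVneq => [->|ik]; rewrite ?ltnn ?mulr1 ?mulr0 ?add0r ?addr0.
      rewrite normrM (ger0_norm t0) -[leRHS]mul1r.
      by apply: ler_pM => //; exact: le_mx_norm.
    by case: ifP => _; rewrite ?normr0 //; exact: le_mx_norm.
  have [t t01] := @line_MVT m f (x + trunc h k) (e_ k) (h 0 k) (fun t t01 =>
    Ck_derivable Cf (Bd _ (Bt t t01)).1).
  rewrite truncS addrA => ->; rewrite [_ * h 0 k]mulrC -mulrBr normrM mulrC.
  apply: ler_pM => //; last exact: le_mx_norm.
  exact: (Bd _ (Bt t t01)).2.
have -> : f (x + h) - f x = \sum_(k < m) (f (x + trunc h k.+1) - f (x + trunc h k)).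
  rewrite -(big_mkord xpredT (fun k => f (x + trunc h k.+1) - f (x + trunc h k))).
  rewrite telescope_sumr //; congr (f _ - f _).
    by congr (x + _); apply/rowP => i; rewrite mxE ltn_ord.
  rewrite (_ : trunc h 0 = 0) ?addr0 //.
  by apply/rowP => i; rewrite !mxE.
rewrite -sumrB; apply: (le_trans (ler_norm_sum _ _ _)).
apply: (@le_trans _ _ (\sum_(k < m) e' * `|h|)); first by apply: ler_sum => k _; exact: step.
rewrite sumr_const card_ord -mulrnAl; apply: ler_wpM2r => //.
rewrite /e' -[leRHS]mulr1 -mulrnAr; apply: ler_wpM2l; first exact: ltW.
rewrite -mulr_natl ler_pdivrMr // mul1r ler_nat //.
Unshelve. all: by end_near. Qed.

(** The bridge from partial derivatives, in which [Ck] is phrased, to Frechet differentiability, for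
    which there is a chain rule. *)
Lemma C1_differentiable m (U : set 'rV[R]_m) f x : open U -> Ck 1 U f -> U x ->
  differentiable f x.
Proof.
move=> oU Cf Ux.
have Llin : linear (fun h : 'rV[R]_m => \sum_i h 0 i * 'D_(e_ i) f x : R).
  move=> a u v; rewrite scaler_sumr -big_split; apply: eq_bigr => i _.
  by rewrite !mxE /= mulrDl [_ *: _]mulrA.
pose Lm := GRing.isLinear.Build _ _ _ _ _ Llin.
pose L : {linear 'rV[R]_m -> R} := HB.pack (fun h : 'rV[R]_m => \sum_i h 0 i * 'D_(e_ i) f x : R) Lm.
have Lc : continuous L.
  move=> h; apply: (@Ck_cont m 0 setT) => //; apply: Ck_sum => [|i _]; first exact: openT.
  by apply: CkM; [exact: openT|exact: Ck_coord|exact: Ck_cst].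
have E : (f : 'rV[R]_m -> R^o) \o shift x = cst (f x) + (L : 'rV[R]_m -> R^o) +o_ (0 : 'rV[R]_m) id.
  apply/eqaddoP => _/posnumP[e]; have := C1_approx oU Cf Ux [gt0 of e%:num].
  apply: filterS => h /=; rewrite [x + h]addrC => H.
  rewrite (_ : (_ : 'rV[R]_m -> R) h = f (h + x) - f x - \sum_i h 0 i * 'D_(e_ i) f x) //.
  by rewrite /= opprD addrA.
have dL := diff_unique Lc E.
by apply/diff_locallyP; rewrite dL; split.
Qed.

Lemma row_cvg (T : Type) (F : set_system T) p (phi : 'I_p -> T -> R) (l : 'I_p -> R) :
  Filter F -> (forall j, phi j x @[x --> F] --> l j) ->
  (\row_j phi j x : 'rV[R]_p) @[x --> F] --> (\row_j l j : 'rV[R]_p).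
Proof.
move=> FF H; apply/cvgrPdist_le => e e0.
have : \forall x \near F, forall j, `|l j - phi j x| <= e.
  by apply: filter_forall => j; have /cvgrPdist_le/(_ _ e0) := H j.
apply: filterS => x Hx; apply: mx_norm_le; first exact: ltW.
by move=> j; rewrite !mxE.
Qed.

Lemma coord_cvg (T : Type) (F : set_system T) p (z : T -> 'rV[R]_p) (l : 'rV[R]_p) j :
  Filter F -> z t @[t --> F] --> l -> z t 0 j @[t --> F] --> l 0 j.
Proof.
move=> FF zl; apply/cvgrPdist_le => e e0; move/cvgrPdist_le : zl => /(_ e e0).
apply: filterS => t; apply: le_trans.
by have := le_mx_norm (l - z t) j; rewrite !mxE.
Qed.

Section line.
Context (W : normedModType R).

Lemma line_quot (V : normedModType R) (f : W -> V) x v :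
  (fun h : R => h^-1 *: (((fun s => f (x + s *: v)) \o shift 0) (h *: 1)
            - f (x + 0 *: v))) =
         (fun h : R => h^-1 *: ((f \o shift x) (h *: v) - f x)).
Proof.
apply/funext => h /=; rewrite [h *: 1]mulr1 scale0r addr0 addr0.
by congr (_ *: (f _ - _)); rewrite addrC.
Qed.

Lemma derivable_line (V : normedModType R) (f : W -> V) x v :
  derivable f x v <-> derivable (fun s : R => f (x + s *: v)) 0 1.
Proof. by rewrite /derivable line_quot. Qed.

Lemma derive_line (V : normedModType R) (f : W -> V) x v :
  'D_v f x = 'D_1 (fun s : R => f (x + s *: v)) 0.
Proof. by rewrite /derive line_quot. Qed.

End line.

Lemma derive_coordE (V : normedModType R) p (F : V -> 'rV[R]_p) (x v : V) (j : 'I_p) :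
  derivable F x v -> ('D_v F x) 0 j = 'D_v (fun y => F y 0 j) x.
Proof. by move=> dF; rewrite derive_mx // mxE. Qed.

(** The inner map is only derivable in the direction [v]. Restricted to the line [x + s v] it
    becomes a function of one real variable, for which derivability already means differentiability,
    and the chain rule is applied there. *)
Lemma is_derive_comp m p (V : set 'rV[R]_p) (f : 'rV[R]_p -> R)
    (phi : 'I_p -> 'rV[R]_m -> R) (x v : 'rV[R]_m) :
  open V -> Ck 1 V f -> V (\row_j phi j x) ->
  (forall j, derivable (phi j) x v) ->
  is_derive x v (fun y => f (\row_j phi j y))
    (\sum_j 'D_(e_ j) f (\row_j phi j x) * 'D_v (phi j) x).
Proof.
move=> oV Cf Vx dphi.
pose F y := (\row_j phi j y : 'rV[R]_p).
have dF : derivable F x v.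
  apply/derivable_mxP => i j; rewrite ord1.
  by rewrite (_ : (fun y => _) = phi j) //; apply/funext => y; rewrite mxE.
pose L (s : R) := F (x + s *: v).
have dL : differentiable L (0 : R) by apply/derivable1_diffP; exact: (derivable_line F x v).1 dF.
have L0 : L 0 = F x by rewrite /L scale0r addr0.
have df : differentiable f (L 0) by rewrite L0; exact: C1_differentiable Cf Vx.
have dfL : differentiable (f \o L) (0 : R) by exact: differentiable_comp.
apply: DeriveDef.
  by apply/derivable_line; apply/derivable1_diffP.
rewrite derive_line -[fun s => _]/(f \o L) deriveE // diff_comp //=.
rewrite -(deriveE (1 : R) dL) -(derive_line F x v) L0 [in LHS](row_basis ('D_v F x)) linear_sum.
apply: eq_bigr => j _; rewrite linearZ /= [LHS]mulrC; congr (_ * _).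
  by rewrite deriveE //; exact: C1_differentiable Cf Vx.
by rewrite derive_coordE //; congr derive; apply/funext => y; rewrite mxE.
Qed.

(** By induction on [k]: a partial derivative of the composite is a sum of products of ['D_(e_ j) f]
    composed with [phi], which is [C^k] by induction, and of partial derivatives of [phi]. *)
Lemma Ck_comp m p k (U : set 'rV[R]_m) (V : set 'rV[R]_p) (f : 'rV[R]_p -> R)
    (phi : 'I_p -> 'rV[R]_m -> R) :
  open U -> open V -> (forall x, U x -> V (\row_j phi j x)) ->
  (forall j, Ck k U (phi j)) -> Ck k V f ->
  Ck k U (fun x => f (\row_j phi j x)).
Proof.
move=> oU oV UV; elim: k f => [|k IH] f Cphi Cf.
  split=> // x Ux; apply: (@continuous_comp _ _ _ (fun x => \row_j phi j x)).
    by apply: (row_cvg (F := nbhs x)) => j; exact: (Ck_cont (Cphi j) Ux).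
  by apply: (Ck_cont Cf); exact: UV.
have d x i : U x -> is_derive x (e_ i) (fun y => f (\row_j phi j y))
    (\sum_j 'D_(e_ j) f (\row_j phi j x) * 'D_(e_ i) (phi j) x).
  move=> Ux; apply: (@is_derive_comp _ _ V) => //; first by apply: Ck_le Cf.
    exact: UV.
  by move=> j; exact: Ck_derivable (Cphi j) Ux.
split=> [x Ux|i].
  apply: (@continuous_comp _ _ _ (fun x => \row_j phi j x)).
    by apply: (row_cvg (F := nbhs x)) => j; exact: (Ck_cont (Cphi j) Ux).
  by apply: (Ck_cont Cf); exact: UV.
split=> [x Ux|]; first exact: (ex_derive (is_derive := d x i Ux)).
have := @Ck_sum m k U _ (index_enum 'I_p) xpredT (fun j x => 'D_(e_ j) f (\row_j phi j x) * 'D_(e_ i) (phi j) x) oU.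
move=> /(_ (fun j _ => CkM oU (IH _ (fun l => CkS (Cphi l)) (CkD1 j Cf)) (CkD1 i (Cphi j)))).
by apply: Ck_eq => // x Ux; have := d x i Ux; case.
Qed.

Lemma Jacobian_grad m p (U : set 'rV[R]_m) (F : 'rV[R]_m -> 'rV[R]_p) x :
  open U -> U x -> (forall j, Ck 1 U (fun y => F y 0 j)) ->
  'J F x = \matrix_(i, j) 'D_(e_ i) (fun y => F y 0 j) x.
Proof.
move=> oU Ux CF.
have dF i : derivable F x (e_ i).
  by apply/derivable_mxP => a j; rewrite ord1; exact: Ck_derivable (CF j) Ux.
have dfF : differentiable F x.
  have -> : F = \sum_j (fun y => F y 0 j *: (e_ j : 'rV[R]_p)).
    by apply/funext => y; rewrite [LHS]row_basis fct_sumE.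
  apply: differentiable_sum => j; apply: differentiableZl.
  exact: C1_differentiable (CF j) Ux.
apply/matrixP => i j; rewrite [RHS]mxE -derive_coordE // deriveEjacobian //.
by rewrite -rowE [RHS]mxE.
Qed.


Definition Cinf m (U : set 'rV[R]_m) (f : 'rV[R]_m -> R) := forall k, Ck k U f.

Definition repl m (i : 'I_m) (x : 'rV[R]_m) (a : R) : 'rV[R]_m :=
  \row_j (if j == i then a else x 0 j).

Lemma ball_coordP m (x y : 'rV[R]_m) r : 0 < r ->
  ball x r y <-> (forall i, `|x 0 i - y 0 i| < r).
Proof.
move=> r0; split=> [[_ H] i|H]; first exact: H.
by split=> // i j; rewrite ord1; exact: H.
Qed.

(** * Inverse function theorem for a map that changes one coordinate *)

Section straightening.
Context (m : nat) (w : 'rV[R]_m -> R) (i : 'I_m) (x0 : 'rV[R]_m) (r : R).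
Hypothesis r0 : 0 < r.
Let O := ball x0 r.
Hypothesis Cw : Cinf O w.
Hypothesis dw0 : 'D_(e_ i) w x0 != 0.
Hypothesis dw : forall y, O y -> 0 < 'D_(e_ i) w y * 'D_(e_ i) w x0.

(** Since [Phi] changes a single coordinate, inverting it is a one-dimensional problem on lines in
    the direction [e_ i]. The hypothesis [dw] says that the derivative of [w] along these lines
    keeps the sign it has at [x0]. *)
Let Phi x := repl i x (w x).

Let oO : open O. Proof. exact: ball_open. Qed.

Let dwN0 y : O y -> 'D_(e_ i) w y != 0.
Proof. by move=> /dw; apply: contraTneq => ->; rewrite mul0r ltxx. Qed.

Let Orepl (x : 'rV[R]_m) a b : O x -> O (x + a *: e_ i) -> 0 <= b <= 1 -> O (x + (b * a) *: e_ i).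
Proof.
move=> /(ball_coordP _ _ r0) Ox /(ball_coordP _ _ r0) Oa /andP[b0 b1].
apply/(ball_coordP _ _ r0) => j; move: (Ox j) (Oa j); rewrite !mxE.
set d := (_%:R); move: (x0 0 j) (x 0 j) => p q.
rewrite -mulrA; move: (a * d) => X H1 H2.
pose M := Num.max `|p - q| `|p - (q + X)|.
have MR : M < r by rewrite gt_max H1.
have [M1 M2] : `|p - q| <= M /\ `|p - (q + X)| <= M by rewrite !le_max !lexx orbT.
apply: le_lt_trans MR; move: M1 M2; rewrite !ler_norml => /andP[A1 A2] /andP[B1 B2].
by apply/andP; split; nra.
Qed.

Lemma straighten_MVT x a : O x -> O (x + a *: e_ i) ->
  exists t, [/\ 0 <= t <= 1, O (x + (t * a) *: e_ i) &
    w (x + a *: e_ i) - w x = 'D_(e_ i) w (x + (t * a) *: e_ i) * a].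
Proof.
move=> Ox Oa; have [t t01|t t01 E] := @line_MVT m w x (e_ i) a.
  by apply: (Ck_derivable (Cw 1)); exact: Orepl.
by exists t; split=> //; exact: Orepl.
Qed.

(** Two points with the same image differ by a multiple of [e_ i]; the mean value theorem writes the
    zero increment of [w] as this multiple times a nonzero derivative. *)
Lemma straighten_inj x y : O x -> O y -> Phi x = Phi y -> x = y.
Proof.
move=> Ox Oy E.
have xy : y = x + (y 0 i - x 0 i) *: e_ i.
  apply/rowP => j; rewrite !mxE eqxx /=; case: eqVneq => [->|ji].
    by rewrite mulr1 addrC subrK.
  have /rowP/(_ j) := E; rewrite !mxE (negbTE ji) => ->.
  by rewrite mulr0 addr0.
have Oy' := Oy; rewrite xy in Oy'.
have [t [t01 Ot]] := straighten_MVT Ox Oy'.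
have /rowP/(_ i) := E; rewrite !mxE eqxx -xy => ->; rewrite subrr.
move/esym/eqP; rewrite mulf_eq0 (negbTE (dwN0 Ot)) /= => /eqP d0.
by rewrite xy d0 scale0r addr0.
Qed.

(** This gives at once the openness of images and the continuity of the inverse. The increment of
    [w] from [x] has opposite signs at [x + s e_ i] and [x - s e_ i]; the signs persist for [y] near
    [Phi x], and the intermediate value theorem produces [z] between the two ends. *)
Lemma straighten_near x e : O x -> 0 < e ->
  \forall y \near Phi x, exists z, [/\ O z, Phi z = y & `|z - x| <= e].
Proof.
move=> Ox e0.
have [d /= d0 dO] := (nbhs_ballP _ _).1 (open_nbhs_nbhs (conj oO Ox)).
pose s := Num.min e (d / 2); have s0 : 0 < s by rewrite lt_min e0 divr_gt0.
have se : s <= e by rewrite ge_min lexx.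
have sd : s < d by rewrite gt_min; apply/orP; right; rewrite ltr_pdivrMr // ltr_pMr // ltr1n.
have Os a : `|a| <= s -> O (x + a *: e_ i).
  move=> la; apply: dO; apply/(ball_coordP _ _ d0) => j; rewrite !mxE eqxx /= opprD addNKr normrN.
  apply: le_lt_trans sd; apply: le_trans la.
  by case: (j == i); rewrite ?mulr1 ?mulr0 // normr0.
(* The candidates for a preimage of [y]: all coordinates except the [i]-th are forced, so only the
   parameter [a] is left to be found. *)
pose P (a : R) y := repl i y (x 0 i + a).
have P0 a : P a (Phi x) = x + a *: e_ i.
  apply/rowP => j; rewrite !mxE eqxx /=; case: eqVneq => [->|]; first by rewrite mulr1.
  by rewrite mulr0 addr0.
have Pc a : continuous (P a).
  move=> y; apply: (row_cvg (F := nbhs y)) => j.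
  by case: eqVneq => _; [exact: cvg_cst|exact: coord_continuous].
have sgn : (w (x + s *: e_ i) - w x) * (w (x + (- s) *: e_ i) - w x) < 0.
  have Op : O (x + s *: e_ i) by apply: Os; rewrite gtr0_norm.
  have Om : O (x + (- s) *: e_ i) by apply: Os; rewrite normrN gtr0_norm.
  have [t [_ O1 ->]] := straighten_MVT Ox Op.
  have [t' [_ O2 ->]] := straighten_MVT Ox Om.
  move: (dw O1) (dw O2) s0; set A := 'D_(_) _ _; set B := 'D_(_) _ _; set C := 'D_(_) _ _.
  move=> h1 h2 h3.
  have AC : 0 < A * C.
    have : 0 < (A * B) * (C * B) by exact: mulr_gt0.
    by rewrite mulrACA pmulr_lgt0 // -expr2 exprn_even_gt0.
  by rewrite mulrACA mulrN pmulr_rlt0 // oppr_lt0 mulr_gt0.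
have wP a : `|a| <= s -> (w (P a y) - y 0 i) @[y --> Phi x] --> (w (x + a *: e_ i) - w x).
  move=> la; apply: (cvgB (F := nbhs (Phi x))); last first.
    by rewrite (_ : w x = Phi x 0 i); [exact: coord_continuous|rewrite mxE eqxx].
  rewrite -P0; apply: (@continuous_comp _ _ _ (P a) w); first exact: Pc.
  by rewrite P0; apply: (Ck_cont (Cw 0)); exact: Os.
have N1 : \forall y \near Phi x,
   (w (P s y) - y 0 i) * (w (P (- s) y) - y 0 i) < 0.
  have : ((w (P s y) - y 0 i) * (w (P (- s) y) - y 0 i)) @[y --> Phi x] -->
     (w (x + s *: e_ i) - w x) * (w (x + (- s) *: e_ i) - w x).
    by apply: (cvgM (F := nbhs (Phi x))); apply: wP; rewrite ?normrN gtr0_norm.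
  by move/cvgr_lt; apply.
near=> y.
have yx j : j != i -> `|y 0 j - x 0 j| < s.
  move=> ji; have : ball (Phi x) s y by near: y; exact: nbhsx_ballx.
  by move=> /(ball_coordP _ _ s0)/(_ j); rewrite mxE (negbTE ji) distrC.
have OP a : `|a| <= s -> O (P a y) /\ `|P a y - x| <= s.
  move=> la.
  have H j : `|P a y 0 j - x 0 j| <= s.
    by rewrite !mxE; case: eqVneq => [->|ji]; rewrite ?[_ + a]addrC ?addrK // ltW // yx.
  split; last by apply: mx_norm_le => [|j]; [exact: ltW|rewrite !mxE; have := H j; rewrite mxE].
  by apply: dO; apply/(ball_coordP _ _ d0) => j; rewrite distrC; exact: le_lt_trans (H j) sd.
pose g a := w (P a y) - y 0 i.
have gc : {within `[- s, s], continuous g}.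
  apply: continuous_in_subspaceT => a; rewrite inE /= in_itv /= -ler_norml => la.
  apply: cvgB; last exact: cvg_cst.
  apply: (@continuous_comp _ _ _ (fun a => P a y) w); last first.
    by apply: (Ck_cont (Cw 0)); exact: (OP a la).1.
  apply: (row_cvg (F := nbhs a)) => j; case: eqVneq => _; last exact: cvg_cst.
  by apply: cvgD; [exact: cvg_cst|exact: cvg_id].
have g0 : (w (P s y) - y 0 i) * (w (P (- s) y) - y 0 i) < 0 by near: y; exact: N1.
have {}g0 : g s * g (- s) < 0 by [].
have [a ai ga] : exists2 a, a \in `[- s, s] & g a = 0.
  apply: IVT => //; first by rewrite ge0_cp // ltW.
  move: g0; case: (lerP (g (- s)) (g s)) => lg g0; apply/andP; split; nra.
have la : `|a| <= s by move: ai; rewrite in_itv /= ler_norml.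
exists (P a y); split; first exact: (OP a la).1; last exact: le_trans (OP a la).2 se.
apply/rowP => j; rewrite !mxE; case: eqVneq => [->|//].
by apply/eqP; rewrite -subr_eq0; apply/eqP.
Unshelve. all: by end_near. Qed.


Definition straighten_inv (y : 'rV[R]_m) : 'rV[R]_m := xget 0 [set z | O z /\ Phi z = y].

Lemma straighten_invP x : O x -> straighten_inv (Phi x) = x.
Proof.
move=> Ox; rewrite /straighten_inv; case: xgetP => [z _ [Oz]|/(_ x)[]//].
exact: straighten_inj.
Qed.

Lemma straighten_open (O' : set 'rV[R]_m) : open O' -> O' `<=` O -> open (Phi @` O').
Proof.
move=> oO' sO; rewrite openE => _ [x O'x <-].
have [d /= d0 dO] := (nbhs_ballP _ _).1 (open_nbhs_nbhs (conj oO' O'x)).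
have := straighten_near (sO _ O'x) (_ : 0 < d / 2); rewrite divr_gt0 // => /(_ isT).
apply: filterS => y [z [Oz <- zx]]; exists z => //; apply: dO.
rewrite -ball_normE /= distrC; apply: le_lt_trans zx _.
by rewrite ltr_pdivrMr // ltr_pMr // ltr1n.
Qed.

Lemma straighten_inv_cont x : O x ->
  straighten_inv y @[y --> Phi x] --> x.
Proof.
move=> Ox; apply/(@cvgrPdist_le _ _ _ (nbhs (Phi x))) => e e0.
have := straighten_near Ox e0; apply: filterS => y [z [Oz <- zx]].
by rewrite straighten_invP // distrC.
Qed.

(** Let [De t] be the increment of the [i]-th coordinate of the inverse. The equation
    [w (z t) = w x + t * (i == j)] and the mean value theorem determine [De t] exactly, as a
    quotient whose denominator is a derivative of [w] at an intermediate point. The limit of this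
    quotient uses only the continuity of the inverse. *)
Lemma straighten_derive x j : O x ->
  is_derive (Phi x) (e_ j) (fun y => straighten_inv y 0 i)
    (((i == j)%:R - (i != j)%:R * 'D_(e_ j) w x) / 'D_(e_ i) w x).
Proof.
move=> Ox; set y := Phi x; set l := _ / _.
pose z t := straighten_inv (y + t *: e_ j).
pose De t := z t 0 i - x 0 i.
(* [xt t] is [z t] with its [i]-th coordinate put back to that of [x], so that both lie on one line
   in the direction [e_ i]. *)
pose xt (t : R) := x + ((i != j)%:R * t) *: e_ j.
have yc : (fun t : R => y + t *: e_ j) @ 0 --> y.
  by have := @line_continuous m y (e_ j) 0; rewrite /continuous_at scale0r addr0.
have xc : xt @ 0 --> x.
  rewrite -[X in _ --> X]addr0; apply: cvgD; first exact: cvg_cst.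
  rewrite -[X in _ --> X](scale0r (e_ j)); apply: cvgZr_tmp.
  rewrite -[X in _ --> X](mulr0 (i != j)%:R).
  by apply: cvgM; [exact: cvg_cst|exact: cvg_id].
have zc : z @ 0 --> x by apply: cvg_comp (straighten_inv_cont Ox).
have Dc : De @ 0 --> 0.
  rewrite -[X in _ --> X](subrr (x 0 i)); apply: cvgB; last exact: cvg_cst.
  exact: (coord_cvg (F := nbhs (0 : R)) _ zc).
have Nz : \forall t \near (0 : R), O (z t) /\ Phi (z t) = y + t *: e_ j.
  have H : \forall t \near (0 : R), exists u, [/\ O u, Phi u = y + t *: e_ j & `|u - x| <= 1].
    exact: (yc _ (straighten_near Ox ltr01)).
  apply: filterS H => t [u [Ou Eu _]].
  by rewrite /z -Eu straighten_invP.
have zE t : Phi (z t) = y + t *: e_ j -> z t = xt t + De t *: e_ i.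
  move=> /rowP E; apply/rowP => k; have := E k; rewrite !mxE eqxx /= /De.
  case: (eqVneq k i) => [->|ki]; last first.
    move=> ->; rewrite mulr0 addr0; congr (_ + _).
    case: (eqVneq i j) => [ij|_]; last by rewrite mul1r.
    by rewrite -ij (negbTE ki) !mulr0.
  move=> _; rewrite mulr1.
  have -> : (i != j)%:R * t * (i == j)%:R = 0 :> R.
    by case: (i == j); rewrite ?mul0r ?mulr0.
  by rewrite addr0 addrC subrK.
have wE t : Phi (z t) = y + t *: e_ j -> w (z t) = w x + t * (i == j)%:R.
  by move=> /rowP/(_ i); rewrite !mxE !eqxx.
pose P t s := [/\ 0 <= s <= 1, O (xt t + (s * De t) *: e_ i) &
   w (xt t + De t *: e_ i) - w (xt t) = 'D_(e_ i) w (xt t + (s * De t) *: e_ i) * De t].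
pose s t : R := xget 0 (P t).
have Ns : \forall t \near (0 : R), P t (s t).
  near=> t.
  have [Oz Ez] : O (z t) /\ Phi (z t) = y + t *: e_ j by near: t.
  have Oxt : O (xt t) by near: t; exact: (xc _ (open_nbhs_nbhs (conj oO Ox))).
  have Os0 : O (xt t + De t *: e_ i) by rewrite -zE.
  have [s0 Hs0] := straighten_MVT Oxt Os0.
  by rewrite /s; apply: (xgetPex 0); exists s0; exact: Hs0.
have xic : xt t + (s t * De t) *: e_ i @[t --> (0 : R)] --> x.
  rewrite -[X in _ --> X]addr0; apply: cvgD; first exact: xc.
  rewrite -[X in _ --> X](scale0r (e_ i)); apply: cvgZr_tmp.
  apply/cvgrPdist_le => e e0; move/cvgrPdist_le : Dc => /(_ e e0) Dc.
  near=> t.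
  have [/andP[s0 s1] _ _] : P t (s t) by near: t.
  rewrite sub0r normrN normrM (ger0_norm s0).
  have : `|De t| <= e by rewrite -normrN -sub0r; near: t.
  by move=> De_e; rewrite -[leRHS]mul1r; apply: ler_pM.
have Dxi : 'D_(e_ i) w (xt t + (s t * De t) *: e_ i) @[t --> (0 : R)] --> 'D_(e_ i) w x.
  exact: (cvg_comp _ _ xic (Ck_cont (CkD1 i (Cw 1)) Ox)).
have qc : t^-1 * (w (xt t) - w x) @[t --> 0^'] --> (i != j)%:R * 'D_(e_ j) w x.
  case: (eqVneq i j) => ij.
    rewrite mul0r (_ : (fun t => _) = fun=> 0); first exact: cvg_cst.
    by apply/funext => t; rewrite /xt ij eqxx /= mul0r scale0r addr0 subrr mulr0.
  rewrite mul1r; have := Ck_derivable (i := j) (Cw 1) Ox.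
  move=> /cvg_ex[d dE]; have -> : 'D_(e_ j) w x = d by apply: cvg_lim.
  apply: cvg_trans dE; rewrite (_ : (fun t => t^-1 * _) = fun h => h^-1 *: ((w \o shift x) (h *: e_ j) - w x)) //.
  by apply/funext => t; rewrite /xt ij mul1r /= [t *: _ + x]addrC.
have lc : (((i == j)%:R - t^-1 * (w (xt t) - w x)) / 'D_(e_ i) w (xt t + (s t * De t) *: e_ i))
     @[t --> 0^'] --> l.
  apply: cvgM; first by apply: cvgB; [exact: cvg_cst|exact: qc].
  by apply: cvgV; [exact: dwN0|exact: cvg_within_filter Dxi].
have Q : (fun h : R => h^-1 *: (((fun y => straighten_inv y 0 i : R) \o shift y) (h *: e_ j) - straighten_inv y 0 i))
   @ 0^' --> l.
  apply: cvg_trans lc; apply: (near_eq_cvg (F := 0^')).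
  have Nz' : \forall t \near 0^', O (z t) /\ Phi (z t) = y + t *: e_ j.
    exact: (cvg_within _ Nz).
  have Ns' : \forall t \near 0^', P t (s t) by exact: (cvg_within _ Ns).
  near=> t.
  have t0 : t != 0 by near: t; exact: nbhs_dnbhs_neq.
  have [Oz Ez] : O (z t) /\ Phi (z t) = y + t *: e_ j by near: t.
  have [_ Oxi] : P t (s t) by near: t.
  rewrite -zE // wE // => E.
  rewrite /= straighten_invP // [t *: _ + y]addrC -/(z t) -/(De t).
  have := dwN0 Oxi; set D := 'D_(_) _ _ in E *; move=> D0.
  have DE : De t = (w x + t * (i == j)%:R - w (xt t)) / D by rewrite E [D * _]mulrC mulfK.
  rewrite -[RHS]/(t^-1 * De t) DE; field.
  by rewrite t0 D0.
apply: DeriveDef; first by apply/cvg_ex; exists l; exact: Q.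
by apply: cvg_lim => //; exact: Q.
Unshelve. all: by end_near. Qed.

(** A bootstrap on the order: by [straighten_derive] the partial derivatives of the [i]-th
    coordinate are rational expressions in derivatives of [w] composed with the inverse itself,
    hence of the class already known for the inverse. The other coordinates are unchanged by
    [Phi]. *)
Lemma straighten_Cinf j : Cinf (Phi @` O) (fun y => straighten_inv y 0 j).
Proof.
have oI : open (Phi @` O) by exact: straighten_open.
have ne k : k != i -> Cinf (Phi @` O) (fun y => straighten_inv y 0 k).
  move=> ki l; apply: Ck_eq (Ck_coord l _ k) => // _ [x Ox <-].
  by rewrite straighten_invP // mxE (negbTE ki).
case: (eqVneq j i) => [->|/ne//] k {j}.
elim: k => [|k IH].
  split=> // _ [x Ox <-]; rewrite /prop_for /continuous_at straighten_invP //.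
  by apply: (coord_cvg (F := nbhs (Phi x))); exact: straighten_inv_cont.
have CI f : Cinf O f -> Ck k (Phi @` O) (fun y => f (straighten_inv y)).
  move=> Cf.
  have := @Ck_comp m m k (Phi @` O) O f (fun j y => straighten_inv y 0 j) oI oO.
  move=> H; have := H _ _ (Cf k).
  rewrite (_ : (fun x => f (\row_j _)) = fun x => f (straighten_inv x)); last first.
    by apply/funext => y; congr f; apply/rowP => j; rewrite mxE.
  apply => [_ [x Ox <-]|j].
    by rewrite (_ : \row_j _ = x) //; apply/rowP => j; rewrite mxE straighten_invP.
  by case: (eqVneq j i) => [->//|/ne].
have d y j : (Phi @` O) y -> is_derive y (e_ j) (fun y => straighten_inv y 0 i)
    (((i == j)%:R - (i != j)%:R * 'D_(e_ j) w (straighten_inv y)) / 'D_(e_ i) w (straighten_inv y)).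
  by move=> [x Ox <-]; rewrite straighten_invP //; exact: straighten_derive.
split=> [y [x Ox <-]|j].
  rewrite /prop_for /continuous_at straighten_invP //.
  by apply: (coord_cvg (F := nbhs (Phi x))); exact: straighten_inv_cont.
split=> [y Iy|]; first exact: (ex_derive (is_derive := d y j Iy)).
have H : Ck k (Phi @` O) (fun y => (((i == j)%:R - (i != j)%:R * 'D_(e_ j) w (straighten_inv y)) / 'D_(e_ i) w (straighten_inv y))).
  apply: CkM => //.
    apply: CkB => //; first exact: Ck_cst.
    apply: CkM => //; first exact: Ck_cst.
    by apply: (CI ('D_(e_ j) w)) => l; exact: (CkD1 j (Cw l.+1)).
  apply: CkV => //.
    by move=> _ [x Ox <-]; rewrite straighten_invP // dwN0.
  by apply: (CI ('D_(e_ i) w)) => l; exact: (CkD1 i (Cw l.+1)).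
apply: Ck_eq H => // y Iy.
by have := d y j Iy; case.
Qed.

End straightening.

End CkCalculus.

(** * Sard's theorem for real functions *)

Section Sard.
Context {R : realType}.
Notation e_ i := (delta_mx 0 i).

Lemma Ck_compF m p k (U : set 'rV[R]_m) (V : set 'rV[R]_p) (f : 'rV[R]_p -> R)
    (F : 'rV[R]_m -> 'rV[R]_p) :
  open U -> open V -> (forall x, U x -> V (F x)) ->
  (forall j, Ck k U (fun x => F x 0 j)) -> Ck k V f ->
  Ck k U (fun x => f (F x)).
Proof.
move=> oU oV UV CF Cf; have E x : \row_j F x 0 j = F x by apply/rowP => j; rewrite mxE.
apply: (@Ck_eq _ _ _ _ (fun x => f (\row_j F x 0 j))) => // [x _|]; first by rewrite E.
by apply: (Ck_comp oU oV) => // x Ux; rewrite E; exact: UV.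
Qed.

Lemma is_derive_compF m p (V : set 'rV[R]_p) (f : 'rV[R]_p -> R)
    (F : 'rV[R]_m -> 'rV[R]_p) (x v : 'rV[R]_m) :
  open V -> Ck 1 V f -> V (F x) ->
  (forall j, derivable (fun y => F y 0 j) x v) ->
  is_derive x v (fun y => f (F y))
    (\sum_j 'D_(e_ j) f (F x) * 'D_v (fun y => F y 0 j) x).
Proof.
move=> oV Cf Vx dF; have E y : \row_j F y 0 j = F y by apply/rowP => j; rewrite mxE.
have := @is_derive_comp _ _ _ V f (fun j y => F y 0 j) x v oV Cf; rewrite E => /(_ Vx dF).
by rewrite (_ : (fun y => f (\row_j F y 0 j)) = fun y => f (F y)) //; apply/funext => y; rewrite E.
Qed.

(** The balls with rational centre and radius [1 / k.+1] form a countable base; [F] enumerates the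
    traces on [A] of those balls for which [Q] holds, and every point of [A] lies in one of them. It
    serves for null sets, for sets covered by countably many charts and for unions of boxes. *)
Lemma rV_lindelof m (Q : set (set 'rV[R]_m)) (A : set 'rV[R]_m) :
  Q set0 -> (forall B C, B `<=` C -> Q C -> Q B) ->
  (forall F : nat -> set 'rV[R]_m, (forall n, Q (F n)) -> Q (\bigcup_n F n)) ->
  (forall x, A x -> exists O, [/\ open O, O x & Q (A `&` O)]) -> Q A.
Proof.
move=> Q0 QS QU QA.
pose box (p : 'rV[rat]_m * nat) : set 'rV[R]_m := ball (map_mx ratr p.1 : 'rV[R]_m) p.2.+1%:R^-1.
pose F n := if unpickle n is Some p then
  (if pselect (Q (A `&` box p)) then A `&` box p else set0) else set0.
have QF n : Q (F n).
  by rewrite /F; case: (unpickle n) => [p|//]; case: pselect.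
apply: (QS _ _ _ (QU F QF)) => x Ax; have [W [oW Wx QW]] := QA x Ax.
have [e /= e0 eW] := (nbhs_ballP _ _).1 (open_nbhs_nbhs (conj oW Wx)).
pose k := Num.truncn (2 / e).
have k1 : 0 < k.+1%:R^-1 :> R by rewrite invr_gt0.
have ke : k.+1%:R^-1 + k.+1%:R^-1 <= e.
  rewrite -mulr2n -[_ *+ 2]mulr_natl ler_pdivrMr // -ler_pdivrMl //.
  by rewrite mulrC ltW // truncnS_gt.
have /choice[q Hq] : forall i, exists q : rat, `|ratr q - x 0 i| < k.+1%:R^-1.
  move=> i; have [|q] := @rat_in_itvoo R (x 0 i - k.+1%:R^-1) (x 0 i + k.+1%:R^-1).
    by rewrite ltrD2l (lt_trans _ k1) // oppr_lt0.
  rewrite in_itv /= => H; exists q.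
  rewrite ltr_norml; move: (ratr q : R) (x 0 i) (k.+1%:R^-1 : R) H => a b d /andP[A1 A2].
  by apply/andP; split; lra.
pose p : 'rV[rat]_m * nat := (\row_i q i, k).
have bx : box p x.
  by apply/ball_coordP => // i; rewrite !mxE; exact: Hq.
exists (pickle p) => //; rewrite /F pickleK.
case: pselect => // -[]; apply: (QS _ _ _ QW) => y [Ay By]; split => //; apply: eW.
apply: le_ball ke _ _; apply: ball_triangle By; exact: ball_sym.
Qed.

Lemma derive_grad m (U : set 'rV[R]_m) f x v : open U -> Ck 1 U f -> U x ->
  'D_v f x = \sum_i v 0 i * 'D_(e_ i) f x.
Proof.
move=> oU Cf Ux; have df := C1_differentiable oU Cf Ux.
rewrite deriveE // [in LHS](row_basis v) linear_sum; apply: eq_bigr => i _.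
by rewrite linearZ deriveE.
Qed.

Lemma ball_segment m (c z y : 'rV[R]_m) r t : ball c r z -> ball c r y -> 0 <= t <= 1 ->
  ball c r (z + t *: (y - z)).
Proof.
rewrite -!ball_normE /= => cz cy /andP[t0 t1].
have -> : c - (z + t *: (y - z)) = (1 - t) *: (c - z) + t *: (c - y).
  by apply/rowP => i; rewrite !mxE; ring.
apply: (le_lt_trans (ler_normD _ _)); rewrite !normrZ ger0_norm ?subr_ge0 // ger0_norm //.
pose M := Num.max `|c - z| `|c - y|.
have MR : M < r by rewrite gt_max cz.
have [M1 M2] : `|c - z| <= M /\ `|c - y| <= M by rewrite !le_max !lexx orbT.
by apply: le_lt_trans MR; nra.
Qed.

(** The bound is asked on the segment only, because in [taylor_flat] it is a power of [|y - z|] that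
    controls the derivatives just between [z] and [y]. *)
Lemma grad_bound m (c : 'rV[R]_m) r g z y K : ball c r z -> ball c r y ->
  Ck 1 (ball c r) g ->
  (forall t i, 0 <= t <= 1 -> `|'D_(e_ i) g (z + t *: (y - z))| <= K) ->
  `|g y - g z| <= m%:R * K * `|y - z|.
Proof.
move=> Bz By Cg HK; have oB : open (ball c r) by exact: ball_open.
have [t t01|t t01] := @line_MVT _ m g z (y - z) 1.
  rewrite mulr1; apply: diff_derivable; apply: (C1_differentiable oB Cg).
  exact: ball_segment.
rewrite scale1r mulr1 [z + _]addrC subrK mulr1 => ->.
rewrite (derive_grad _ oB Cg); last exact: ball_segment.
apply: (le_trans (ler_norm_sum _ _ _)).
apply: (@le_trans _ _ (\sum_(i < m) `|y - z| * K)).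
  apply: ler_sum => i _; rewrite normrM; apply: ler_pM => //; first exact: le_mx_norm.
  exact: HK.
by rewrite sumr_const card_ord -[_ *+ m]mulr_natl; lra.
Qed.

Definition pds m (a : seq 'I_m) (f : 'rV[R]_m -> R) : 'rV[R]_m -> R :=
  foldr (fun i g => 'D_(e_ i) g) f a.

Lemma pds_rcons m (a : seq 'I_m) i f : pds (rcons a i) f = pds a ('D_(e_ i) f).
Proof. by rewrite /pds foldr_rcons. Qed.

Lemma pds_Cinf m (U : set 'rV[R]_m) a f : Cinf U f -> Cinf U (pds a f).
Proof. by move=> Cf; elim: a => [//|i a IH] k; exact: CkD1 (IH k.+1). Qed.

(** The induction hypothesis bounds each first derivative by a power of the distance to [z], and
    [grad_bound] integrates this bound along the segment, at the price of one factor [m] for each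
    order. *)
Lemma taylor_flat m (c : 'rV[R]_m) r k g z K : Cinf (ball c r) g -> ball c r z -> 0 <= K ->
  (forall a, (size a <= k)%N -> pds a g z = 0) ->
  (forall a y, size a = k.+1 -> ball c r y -> `|pds a g y| <= K) ->
  forall y, ball c r y -> `|g y| <= m%:R ^+ k.+1 * K * `|y - z| ^+ k.+1.
Proof.
elim: k g => [|k IH] g Cg Bz K0 g0 gK y By.
  rewrite !expr1 -[g y]subr0 -(g0 [::] erefl) /=.
  apply: (grad_bound Bz By (Cg 1)) => // t i t01; apply: (gK [:: i]) => //.
  exact: (ball_segment Bz By t01).
have CD i : Cinf (ball c r) ('D_(e_ i) g) by move=> l; exact: (CkD1 i (Cg l.+1)).
have H i y' : ball c r y' -> `|'D_(e_ i) g y'| <= m%:R ^+ k.+1 * K * `|y' - z| ^+ k.+1.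
  move=> By'; apply: (IH _ (CD i) Bz K0 _ _ y' By').
  - by move=> a sa; rewrite -pds_rcons; apply: g0; rewrite size_rcons.
  - by move=> a y'' sa By''; rewrite -pds_rcons; apply: gK; rewrite ?size_rcons ?sa.
rewrite -[g y]subr0 -(g0 [::] erefl) /= [m%:R ^+ _]exprS [_ ^+ k.+2]exprSr mulrA -!mulrA.
rewrite [K * _]mulrA [m%:R ^+ _ * _]mulrA !mulrA -[X in X * `|_|]mulrA -[X in X * `|_|]mulrA.
apply: (grad_bound Bz By (Cg 1)).
move=> t i t01; apply: le_trans (H i _ (ball_segment Bz By t01)) _.
rewrite !mulrA ler_wpM2l // ?mulr_ge0 // lerXn2r ?nnegrE // addrC addKr normrZ.
by move: t01 => /andP[t0 t1]; rewrite ger0_norm // ler_piMl.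
Qed.

(** The cube is cut into [N.+1 ^ m] cells of side [d N = 2 r / N.+1]. The image of a cell lies in an
    interval of length [2 K (d N)^(m+1)], and since the exponent exceeds the dimension by one, the
    total length is of order [1 / N.+1]. *)
Lemma null_of_holder m (c : 'rV[R]_m) r (E : set 'rV[R]_m) (f : 'rV[R]_m -> R) K :
  0 < r -> E `<=` ball c r ->
  (forall x y, E x -> E y -> `|f x - f y| <= K * `|x - y| ^+ m.+1) ->
  (@lebesgue_measure R).-negligible (f @` E).
Proof.
move=> r0 Er fE.
wlog K0 : K fE / 0 < K.
  move=> H; apply: (H (`|K| + 1)); last by rewrite ltr_wpDl.
  move=> x y Ex Ey; apply: le_trans (fE x y Ex Ey) _; rewrite ler_wpM2r ?exprn_ge0 //.
  by rewrite (le_trans (ler_norm _)) // lerDl.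
pose T N := {ffun 'I_m -> 'I_N.+1}.
pose u N (x : 'rV[R]_m) i := (x 0 i - c 0 i + r) * N.+1%:R / (2 * r).
pose cell N (a : T N) : set 'rV[R]_m := [set x | E x /\ forall i, Num.truncn (u N x i) = a i].
pose d N : R := 2 * r / N.+1%:R.
have d0 N : 0 < d N by rewrite divr_gt0 // mulr_gt0.
pose L N := K * d N ^+ m.+1.
have L0 N : 0 < L N by rewrite mulr_gt0 // exprn_gt0.
(* A chosen point of the cell gives the centre of its interval. An empty cell gets the default point
   0, and its interval only enlarges the cover. *)
pose J N (a : T N) : set R := `[f (xget 0 (cell N a)) - L N, f (xget 0 (cell N a)) + L N]%classic.
have uge N x i : E x -> 0 <= u N x i < N.+1%:R.
  move=> /Er/(ball_coordP _ _ r0)/(_ i); rewrite ltr_norml => /andP[A1 A2].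
  rewrite /u; apply/andP; split.
    by rewrite divr_ge0 ?mulr_ge0 // ?(ltW r0) //; lra.
  rewrite ltr_pdivrMr ?mulr_gt0 // mulrC ltr_pM2l ?ltr0n //; lra.
have cover N x : E x -> exists2 a : T N, cell N a x & J N a (f x).
  move=> Ex.
  have ult i : (Num.truncn (u N x i) < N.+1)%N.
    by have /andP[A1 A2] := uge N x i Ex; rewrite truncn_lt_nat.
  pose a : T N := [ffun i => Ordinal (ult i)].
  have ca : cell N a x by split => // i; rewrite ffunE.
  exists a => //.
  have [Ez cz] : cell N a (xget 0 (cell N a)) by apply: xgetPex; exists x.
  rewrite /J /= in_itv /= -ler_distl.
  apply: le_trans (fE _ _ Ex Ez) _; rewrite ler_wpM2l ?(ltW K0) // lerXn2r ?nnegrE ?(ltW (d0 N)) //.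
  apply: mx_norm_le => [|i]; first exact: ltW.
  rewrite !mxE.
  have /andP[/truncn_itv/andP[A1 A2] _] := uge N x i Ex.
  have /andP[/truncn_itv/andP[B1 B2] _] := uge N _ i Ez.
  rewrite cz in B1 B2; have [_ cx] := ca; rewrite cx in A1 A2.
  rewrite -natr1 in A2 B2.
  have : `|u N x i - u N (xget 0 (cell N a)) i| <= 1.
    by rewrite ler_norml; apply/andP; split; lra.
  rewrite /u -mulrBl -mulrBl; set D := (_ - _).
  have -> : D = x 0 i - xget 0 (cell N a) 0 i by rewrite /D; ring.
  rewrite -mulrA normrM (ger0_norm (x := N.+1%:R / (2 * r))) ?divr_ge0 ?mulr_ge0 ?(ltW r0) //.
  by rewrite -ler_pdivlMr ?divr_gt0 ?mulr_gt0 // mul1r invf_div.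
pose S N : set R := \big[setU/set0]_(i < #|{: T N}|) J N (nth [ffun=> ord0] (enum {: T N}) i).
have mJ N a : measurable (J N a) by exact: measurable_itv.
have mS N : measurable (S N) by apply: bigsetU_measurable => i _; exact: mJ.
have muS N : (lebesgue_measure (S N) <= (2 * K * (2 * r) ^+ m.+1 / N.+1%:R)%:E)%E.
  apply: (le_trans (@Boole_inequality _ _ _ lebesgue_measure (fun i => J N (nth [ffun=> ord0] (enum {: T N}) i)) #|{: T N}| (fun i _ => mJ N _))).
  rewrite (eq_bigr (fun=> (2 * L N)%:E)); last first.
    move=> i _; rewrite /J; set v := f _.
    apply: (etrans (lebesgue_measure_itv `[v - L N, v + L N])); rewrite /= lte_fin ltrD2l -EFinD.
    by rewrite (lt_trans (_ : - L N < 0)) ?oppr_lt0 //; congr EFin; ring.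
  rewrite sumEFin lee_fin sumr_const card_ord card_ffun !card_ord /L /d expr_div_n.
  rewrite -[_ *+ (N.+1 ^ m)]mulr_natl natrX [N.+1%:R ^+ m.+1]exprS.
  have nz : N.+1%:R != 0 :> R by rewrite pnatr_eq0.
  rewrite le_eqVlt; apply/orP; left; apply/eqP.
  move: (N.+1%:R : R) nz => z nz.
  by rewrite invfM; field; rewrite nz expf_neq0.
exists (\bigcap_N S N); split.
- by apply: bigcapT_measurable.
- apply/eqP; rewrite eq_le measure_ge0 andbT; apply/lee_addgt0Pr => e e0; rewrite add0e.
  pose C := 2 * K * (2 * r) ^+ m.+1.
  pose N := Num.truncn (C / e).
  apply: (@le_trans _ _ (lebesgue_measure (S N))).
    apply: le_measure; rewrite ?inE; [exact: bigcapT_measurable|exact: mS|].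
    by move=> x H; exact: H.
  apply: le_trans (muS N) _; rewrite lee_fin ler_pdivrMr // [e * _]mulrC -ler_pdivrMr //.
  by rewrite ltW // truncnS_gt.
- move=> _ [x Ex <-] N _; have [a _ Ja] := cover N x Ex.
  rewrite /S -(bigcup_mkord _ (fun i => J N (nth [ffun=> ord0] (enum {: T N}) i))); exists (index a (enum {: T N})) => /=.
    by rewrite cardE index_mem mem_enum.
  by rewrite nth_index ?mem_enum.
Qed.

(** Provides a ball on which the hypotheses of the section on straightening hold. *)
Lemma straighten_box m (U : set 'rV[R]_m) w i x : open U -> Cinf U w -> U x ->
  'D_(e_ i) w x != 0 -> exists2 r, 0 < r &
   [/\ ball x r `<=` U, Cinf (ball x r) w &
       forall y, ball x r y -> 0 < 'D_(e_ i) w y * 'D_(e_ i) w x].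
Proof.
move=> oU Cw Ux wx.
have : \forall y \near x, U y /\ 0 < 'D_(e_ i) w y * 'D_(e_ i) w x.
  near=> y; split; first by near: y; exact: open_nbhs_nbhs.
  near: y.
  have : 'D_(e_ i) w y * 'D_(e_ i) w x @[y --> x] --> 'D_(e_ i) w x * 'D_(e_ i) w x.
    by apply: (cvgM (F := nbhs x)); [exact: (Ck_cont (CkD1 i (Cw 1)) Ux)|exact: cvg_cst].
  by move/cvgr_gt; apply; rewrite -expr2 exprn_even_gt0.
move=> /nbhs_ballP[r /= r0 rP]; exists r => //; split.
- by move=> y /rP[].
- by move=> k; apply: Ck_sub (Cw k) => y /rP[].
- by move=> y /rP[].
Unshelve. all: by end_near. Qed.

Definition ins m (i : 'I_m.+1) (y : 'rV[R]_m) (a : R) : 'rV[R]_m.+1 :=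
  \row_j (if unlift i j is Some k then y 0 k else a).

Definition del m (i : 'I_m.+1) (x : 'rV[R]_m.+1) : 'rV[R]_m :=
  \row_j x 0 (lift i j).

Lemma del_ins m (i : 'I_m.+1) y a : del i (ins i y a) = y.
Proof. by apply/rowP => j; rewrite !mxE liftK. Qed.

Lemma ins_del m (i : 'I_m.+1) x : ins i (del i x) (x 0 i) = x.
Proof. by apply/rowP => j; rewrite !mxE; case: unliftP => [k ->|->]; rewrite ?mxE. Qed.

Lemma ins_at m (i : 'I_m.+1) y a : ins i y a 0 i = a.
Proof. by rewrite mxE unlift_none. Qed.

Lemma Ck_ins m k (i : 'I_m.+1) (V : set 'rV[R]_m) a j :
  open V -> Ck k V (fun y => ins i y a 0 j).
Proof.
move=> oV; case: (unliftP i j) => [l ->|->].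
  by apply: Ck_eq (Ck_coord k V l) => // y _; rewrite mxE liftK.
by apply: Ck_eq (Ck_cst k V a) => // y _; rewrite ins_at.
Qed.

Lemma ins_continuous m (i : 'I_m.+1) a : continuous (fun y => ins i y a).
Proof.
move=> y; apply: (row_cvg (F := nbhs y)) => j; case: unliftP => [k _|_]; last exact: cvg_cst.
exact: coord_continuous.
Qed.

(* Induction on the dimension.  Where a partial derivative w of f vanishes but has a nonzero
   derivative itself, the level set of w is straightened to a hyperplane, on which f is critical;
   where all derivatives up to order m vanish, Taylor's formula gives f a Holder exponent m + 1. *)
Theorem Sard m (U : set 'rV[R]_m) f : open U -> Cinf U f ->
  (@lebesgue_measure R).-negligible (f @` [set x | U x /\ forall i, 'D_(e_ i) f x = 0]).
Proof.
have n0 (n : nat) (h : 'rV[R]_n -> R) : (@lebesgue_measure R).-negligible (h @` set0).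
  by rewrite image_set0; exact: negligible_set0.
have nS (n : nat) (h : 'rV[R]_n -> R) B C : B `<=` C ->
    (@lebesgue_measure R).-negligible (h @` C) -> (@lebesgue_measure R).-negligible (h @` B).
  by move=> BC; apply: negligibleS; exact: image_subset.
have nU (n : nat) (h : 'rV[R]_n -> R) (F : nat -> set 'rV[R]_n) :
    (forall k, (@lebesgue_measure R).-negligible (h @` F k)) ->
    (@lebesgue_measure R).-negligible (h @` (\bigcup_k F k)).
  by move=> H; rewrite image_bigcup; exact: negligible_bigcup.
elim: m U f => [|p IH] U f oU Cf.
  have Z : (@lebesgue_measure R).-negligible [set f 0].
    by apply/negligibleP => //; exact: lebesgue_measure_set1.
  apply: (negligibleS _ Z).
  by move=> _ [x _ <-] /=; congr f; apply/rowP => -[].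
set C := [set x | _ /\ _].
pose flat := C `&` [set x | forall a, (0 < size a <= p.+1)%N -> pds a f x = 0].
pose A n := if @unpickle (seq 'I_p.+1 * 'I_p.+1)%type n is Some (b, i) then
   C `&` [set x | pds b f x = 0 /\ 'D_(e_ i) (pds b f) x != 0] else set0.
have CU : C `<=` flat `|` \bigcup_n A n.
  move=> x Cx; have [|nf] := pselect (flat x); [by left|right].
  have [a a0 ax] : exists2 a, (0 < size a)%N & pds a f x != 0.
    apply: contrapT => H; apply: nf; split => // a /andP[a0 _].
    by apply/eqP; apply: contrapT => /negP ax; apply: H; exists a.
  (* The word [a] of a nonvanishing derivative is shortened until dropping one more letter gives a
     vanishing derivative; this happens before the word is exhausted, since the first derivatives
     vanish on [C]. *)
  elim: a a0 ax => [//|i b IHb] _ bx.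
  case: b IHb bx => [_ /=|j b IHb bx]; first by rewrite (Cx.2 i) eqxx.
  have [bx0|/IHb] := eqVneq (pds (j :: b) f x) 0; last exact.
  by exists (pickle (j :: b, i)) => //; rewrite /A pickleK.
suff H : (@lebesgue_measure R).-negligible (f @` flat `|` f @` (\bigcup_n A n)).
  by apply: (negligibleS _ H); rewrite -image_setU; exact: image_subset.
apply: negligibleU; last first.
  apply: (nU _ f) => n; rewrite /A; case: (unpickle n) => [[b i]|]; last exact: n0.
  set w := pds b f; set B := _ `&` _.
  have Cw : Cinf U w by exact: pds_Cinf.
  apply: (@rV_lindelof _ (fun B => (@lebesgue_measure R).-negligible (f @` B))).
  - exact: n0.
  - exact: nS.
  - exact: nU.
  move=> x [[Ux _] [_ wx]].
  have [r r0 [rU Cwr dwr]] := straighten_box oU Cw Ux wx.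
  exists (ball x r); split; [exact: ball_open|exact: ballxx|].
  pose Phi z := repl i z (w z); pose Psi := straighten_inv w i x r.
  have oI : open (Phi @` ball x r) by apply: (straighten_open r0 Cwr wx dwr) => //; exact: ball_open.
  pose V := [set y | (Phi @` ball x r) (ins i y 0)].
  have oV : open V by apply: open_comp => // y _; exact: ins_continuous.
  (* [g] is [f] on the hypersurface [w = 0], read in the straightened coordinates. A critical point
     of [f] on this hypersurface is a critical point of [g], which depends on one variable less. *)
  pose g y := f (Psi (ins i y 0)).
  have CPsi j : Cinf V (fun y => Psi (ins i y 0) 0 j).
    move=> k; apply: (@Ck_compF p p.+1 k V (Phi @` ball x r) (fun z => Psi z 0 j) (fun y => ins i y 0)) => //.
      by move=> l; exact: Ck_ins.
    exact: straighten_Cinf.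
  have PsiB y : V y -> ball x r (Psi (ins i y 0)).
    by move=> [z Bz Ez]; rewrite -Ez /Psi straighten_invP.
  have Cg : Cinf V g.
    move=> k; apply: (@Ck_compF p p.+1 k V (ball x r) f (fun y => Psi (ins i y 0))) => //.
    - exact: ball_open.
    - by move=> j; exact: CPsi.
    - by apply: Ck_sub (Cf k).
  apply: negligibleS (IH V g oV Cg) => _ [z [[Cz [wz _]] Bz] <-].
  have Ez : Phi z = ins i (del i z) 0.
    by rewrite -[LHS](ins_del i); congr ins; [apply/rowP => j|];
      rewrite !mxE ?eqxx // eq_sym (negbTE (neq_lift _ _)).
  have Vz : V (del i z) by exists z.
  have Pz : Psi (ins i (del i z) 0) = z by rewrite -Ez /Psi straighten_invP.
  exists (del i z); last by rewrite /g Pz.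
  split => // j.
  have H : is_derive (del i z) (e_ j) g (\sum_k 'D_(e_ k) f (Psi (ins i (del i z) 0)) * 'D_(e_ j) (fun y => Psi (ins i y 0) 0 k) (del i z)).
    apply: (@is_derive_compF p p.+1 (ball x r) f (fun y => Psi (ins i y 0))).
    - exact: ball_open.
    - by apply: Ck_sub (Cf 1).
    - by rewrite Pz.
    - by move=> k; exact: Ck_derivable (CPsi k 1) Vz.
  by case: H => _ ->; rewrite Pz big1 // => k _; rewrite Cz.2 mul0r.
apply: (@rV_lindelof _ (fun B => (@lebesgue_measure R).-negligible (f @` B))).
- exact: n0.
- exact: nS.
- exact: nU.
move=> x [[Ux _] _].
have [r0 /= r00 r0U] := (nbhs_ballP _ _).1 (open_nbhs_nbhs (conj oU Ux)).
(* With half the radius the closed ball still lies in [U], so compactness bounds all derivatives of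
   order [p.+2]. *)
pose r := r0 / 2; have r_gt0 : 0 < r by rewrite divr_gt0.
have rr0 : r < r0 by rewrite ltr_pdivrMr // ltr_pMr // ltr1n.
have clU y : closed_ball x r y -> U y.
  by rewrite closed_ballE // /closed_ball_ /= => H; apply: r0U; rewrite -ball_normE /=; exact: le_lt_trans rr0.
have brU : ball x r `<=` U by move=> y /subset_closed_ball/clU.
have cB : compact (closed_ball x r : set 'rV[R]_p.+1).
  apply: bounded_closed_compact; last exact: closed_ball_closed.
  exists (`|x| + r); split; first exact: num_real.
  move=> M HM y; rewrite closed_ballE // /closed_ball_ /= => xy.
  apply: le_trans (ltW HM); rewrite -[y](subrK x) addrC (le_trans (ler_normD _ _)) // lerD2l.
  by rewrite distrC.
have [K K0 HK] : exists2 K, 0 <= K & forall (a : (p.+2).-tuple 'I_p.+1) y, ball x r y -> `|pds a f y| <= K.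
  have /choice[K HK] : forall a : (p.+2).-tuple 'I_p.+1, exists K, forall y, ball x r y -> `|pds a f y| <= K.
    move=> a; have : compact (pds a f @` closed_ball x r).
      apply: continuous_compact => //; apply: continuous_in_subspaceT => y; rewrite inE => /clU Uy.
      exact: (Ck_cont (pds_Cinf a Cf 0) Uy).
    move=> /compact_bounded[M [_ HM]]; exists (M + 1) => y By.
    by apply: HM; [rewrite ltrDl|exists y => //; exact: subset_closed_ball].
  exists (\sum_a `|K a|) => [|a y By]; first exact: sumr_ge0.
  apply: le_trans (HK a y By) _; rewrite (bigD1 a) //= (le_trans (ler_norm _)) // lerDl.
  exact: sumr_ge0.
exists (ball x r); split; [exact: ball_open|exact: ballxx|].
(* The derivatives of orders 1 to [p.+1] vanish on [flat], which gives the exponent [p.+2], one more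
   than the dimension [p.+1]. As [f] itself need not vanish, Taylor's estimate is applied to its
   first derivatives and [grad_bound] passes to differences of values. *)
apply: (@null_of_holder _ x r _ f (p.+1%:R ^+ p.+2 * K)) => //.
move=> y z [_ By] [[Cz fz] Bz].
have := @grad_bound _ x r f z y (p.+1%:R ^+ p.+1 * K * `|y - z| ^+ p.+1) Bz By _ _.
have -> : p.+1%:R ^+ p.+2 * K * `|y - z| ^+ p.+2 =
    p.+1%:R * (p.+1%:R ^+ p.+1 * K * `|y - z| ^+ p.+1) * `|y - z|.
  by rewrite (exprS _ p.+1) (exprSr _ p.+1); move: (_ ^+ p.+1) (_ ^+ p.+1) => u v; ring.
apply.
  by apply: Ck_sub (Cf 1).
move=> t i t01; have Bt := ball_segment Bz By t01.
apply: (@le_trans _ _ (p.+1%:R ^+ p.+1 * K * `|z + t *: (y - z) - z| ^+ p.+1)); last first.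
  rewrite ler_wpM2l // ?mulr_ge0 // lerXn2r ?nnegrE // addrC addKr normrZ.
  by move: t01 => /andP[t0 t1]; rewrite ger0_norm // ler_piMl.
apply: (@taylor_flat p.+1 x r p ('D_(e_ i) f) z K) => //.
- by move=> k; apply: Ck_sub (CkD1 i (Cf k.+1)).
- by move=> a sa; rewrite -pds_rcons; apply: fz; rewrite size_rcons.
- move=> a y' sa By'; rewrite -pds_rcons.
  have sa' : size (rcons a i) == p.+2 by rewrite size_rcons sa.
  exact: (HK (Tuple sa') y' By').
Qed.

End Sard.

(** * Lebesgue measure on row vectors *)

Section Borel.
Context {R : realType}.

Lemma open_borel (T : ptopologicalType) (A : set T) : open A -> measurable (A : set (borel T)).
Proof. by move=> oA; exact: sub_sigma_algebra. Qed.

Lemma closed_borel (T : ptopologicalType) (A : set T) : closed A -> measurable (A : set (borel T)).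
Proof.
move=> cA; rewrite -[A]setCK; apply: measurableC; apply: open_borel.
exact: closed_openC.
Qed.

Lemma within_continuous_borel (T U : ptopologicalType) (D : set T) (f : T -> U) :
  measurable (D : set (borel T)) -> {within D, continuous f} ->
  measurable_fun (D : set (borel T)) (f : borel T -> borel U).
Proof.
move=> mD cf; apply: (@measurability _ _ (borel T) (borel U) D f (@open U)) => // _ [B oB <-].
have /continuousP/(_ _ oB)/open_subspaceP[V oV VE] := cf.
by rewrite setIC -VE; apply: measurableI => //; exact: open_borel.
Qed.

Lemma within_continuous_borelR (T : ptopologicalType) (D : set T) (f : T -> R) :
  measurable (D : set (borel T)) -> {within D, continuous f} ->
  measurable_fun (D : set (borel T)) (f : borel T -> R).
Proof.
move=> mD cf; apply: (measurability _ (RGenOpens.measurableE R)).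
move=> _ [_ [x [y ->]] <-].
have /continuousP/(_ `]x, y[%classic (interval_open _ _))/open_subspaceP := cf.
move=> /(_ isT isT) [V oV VE].
by rewrite setIC -VE; apply: measurableI => //; exact: open_borel.
Qed.

Lemma continuous_borel (T U : ptopologicalType) (f : T -> U) :
  continuous f -> measurable_fun [set: borel T] (f : borel T -> borel U).
Proof. by move=> cf; apply: within_continuous_borel => //; exact: continuous_subspaceT. Qed.

Lemma continuous_borelR (T : ptopologicalType) (f : T -> R) :
  continuous f -> measurable_fun [set: borel T] (f : borel T -> R).
Proof. by move=> cf; apply: within_continuous_borelR => //; exact: continuous_subspaceT. Qed.

Definition box m (a b : 'rV[R]_m) : set 'rV[R]_m := [set x | forall i, a 0 i < x 0 i < b 0 i].

Lemma box_open m (a b : 'rV[R]_m) : open (box a b).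
Proof.
rewrite openE => x ax; rewrite /interior.
exists (fun _ j => `]a 0 j, b 0 j[%classic) => [i j|y H i]; last first.
  by have := H 0 i; rewrite /= in_itv.
by rewrite (ord1 i); apply: near_in_itvoo; rewrite in_itv /=; exact: ax.
Qed.

Lemma box_borel m (a b : 'rV[R]_m) : measurable (box a b : set (borel 'rV[R]_m)).
Proof. by apply: open_borel; exact: box_open. Qed.

(** [rV_lindelof] is applied to the sets that are contained in some [W] inside [U] with [P W]; small
    boxes around the points of [U] qualify. *)
Lemma open_box_ind m (P : set (set 'rV[R]_m)) : P set0 -> (forall a b, P (box a b)) ->
  (forall F : nat -> set 'rV[R]_m, (forall n, P (F n)) -> P (\bigcup_n F n)) ->
  forall U, open U -> P U.
Proof.
move=> P0 Pb PU U oU.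
pose Q B := exists W, [/\ B `<=` W, W `<=` U & P W].
suff [W [UW WU PW]] : Q U by rewrite (_ : U = W) //; exact/seteqP.
apply: rV_lindelof.
- by exists set0; split => //; exact: sub0set.
- by move=> B C BC [W [CW WU PW]]; exists W; split => //; exact: subset_trans CW.
- move=> F /choice[W HW]; exists (\bigcup_n W n); split.
  + by apply: subset_bigcup => n _; have [] := HW n.
  + by apply: bigcup_sub => n _; have [] := HW n.
  + by apply: PU => n; have [] := HW n.
- move=> x Ux; have [e /= e0 eU] := (nbhs_ballP _ _).1 (open_nbhs_nbhs (conj oU Ux)).
  pose d : 'rV[R]_m := const_mx e.
  have bE : box (x - d) (x + d) `<=` ball x e.
    move=> y H; apply/ball_coordP => // i; rewrite distrC ltr_distl.
    by have := H i; rewrite !mxE.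
  exists (box (x - d) (x + d)); split.
  + exact: box_open.
  + by move=> i; rewrite !mxE ltrBlDr !ltrDl e0.
  + exists (box (x - d) (x + d)); split => //.
    by move=> y /bE/eU.
Qed.

Lemma measurable_rV d (T : measurableType d) m (D : set T) (f : T -> 'rV[R]_m) : 
  (forall i, measurable_fun D (fun t => f t 0 i)) ->
  measurable_fun D (f : T -> borel 'rV[R]_m).
Proof.
move=> mf mD; suff H : measurable_fun D (f : T -> borel 'rV[R]_m) by exact: H.
apply: (@measurability _ _ T (borel 'rV[R]_m) D f (@open 'rV[R]_m)) => // _ [B oB <-].
move: B oB; apply: open_box_ind.
- by rewrite preimage_set0 setI0.
- move=> a b.
  rewrite (_ : _ `&` _ = D `&` \bigcap_(i in [set: 'I_m]) (D `&` (fun t => f t 0 i) @^-1` `]a 0 i, b 0 i[%classic)).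
    apply: measurableI => //; apply: fin_bigcap_measurable => // i _.
    by apply: mf.
  apply/seteqP; split => [t [Dt H]|t [Dt H]]; split => //.
    by move=> i _; split => //=; rewrite in_itv /=; exact: H.
  by move=> i; have [_ /=] := H i I; rewrite in_itv.
- by move=> F mF; rewrite preimage_bigcup setI_bigcupr; exact: bigcupT_measurable.
Qed.

Lemma measurable_coord d (T : measurableType d) m (D : set T) (f : T -> borel 'rV[R]_m) i :
  measurable_fun D f -> measurable_fun D (fun t => f t 0 i).
Proof.
move=> mf; apply: (@measurableT_comp _ _ _ _ _ _ (fun y : borel 'rV[R]_m => y 0 i)) => //.
by apply: continuous_borelR; exact: coord_continuous.
Qed.

Lemma measurable_ins d (T : measurableType d) m (D : set T) i (f : T -> borel 'rV[R]_m) (t : T -> R) :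
  measurable_fun D f -> measurable_fun D t ->
  measurable_fun D ((fun x => ins i (f x) (t x)) : T -> borel 'rV[R]_m.+1).
Proof.
move=> mf mt; apply: measurable_rV => j.
case: (unliftP i j) => [k ->|->].
  rewrite (_ : (fun x => _) = fun x => f x 0 k); first exact: measurable_coord.
  by apply/funext => x; rewrite mxE liftK.
by rewrite (_ : (fun x => _) = t) //; apply/funext => x; rewrite ins_at.
Qed.

Lemma row_mx_ins m (t : R) (y : 'rV[R]_m) : row_mx (const_mx t : 'rV[R]_1) y = ins ord0 y t.
Proof.
apply/rowP => j; rewrite mxE /ins mxE; case: (unliftP ord0 j) => [k ->|->].
  case: splitP => l /= kl.
    by have := ltn_ord l; rewrite -kl.
  by congr (y 0 _); apply: val_inj; move: kl => /= [].
by case: splitP => l /= kl; rewrite ?mxE.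
Qed.

Lemma integralRnS m (f : 'rV[R]_m.+1 -> \bar R) :
  integralRn f = (\int[lebesgue_measure]_t integralRn (fun y => f (ins ord0 y t)))%E.
Proof.
by rewrite /=; apply: eq_integral => t _; congr integralRn; apply/funext => y; rewrite row_mx_ins.
Qed.

(** The parameter space [T] is arbitrary so that the induction on [m] can move the outer integration
    variable into it. The function has no sign, hence the two applications of Tonelli's theorem to
    its positive and negative parts. *)
Lemma measurable_integralRn d (T : measurableType d) m (f : T * borel 'rV[R]_m -> \bar R) :
  measurable_fun setT f -> measurable_fun setT (fun x => integralRn (fun y => f (x, y))).
Proof.
elim: m d T f => [|m IH] d T f mf.
  by apply: (@measurableT_comp _ _ _ _ _ _ f).
rewrite (_ : (fun x => _) = fun x => (\int[lebesgue_measure]_t integralRn (fun y => f (x, ins ord0 y t)))%E); last first.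
  by apply/funext => x; rewrite integralRnS.
pose G (p : T * R) := integralRn (fun y => f (p.1, ins ord0 y p.2)).
have mG : measurable_fun setT G.
  apply: (IH _ (T * R)%type (fun q => f (q.1.1, ins ord0 q.2 q.1.2))).
  apply: (@measurableT_comp _ _ _ _ _ _ f) => //; apply: measurable_fun_pair => /=.
    exact: measurableT_comp.
  by apply: measurable_ins => //; exact: measurableT_comp.
rewrite (_ : (fun x => _) = fun x => fubini_F lebesgue_measure (G^\+)%E x -
    fubini_F lebesgue_measure (G^\-)%E x)%E; last first.
  apply/funext => x; rewrite integralE /fubini_F; congr (_ - _)%E.
    by apply: eq_integral => t _; rewrite !funeposE.
  by apply: eq_integral => t _; rewrite !funenegE.
apply: emeasurable_funB.
  by apply: measurable_fun_fubini_tonelli_F => //; exact: measurable_funepos.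
by apply: measurable_fun_fubini_tonelli_F => //; exact: measurable_funeneg.
Qed.

End Borel.

(** * Image of a measure with a density *)

Section ImageDensity.
Context d1 d2 (X : measurableType d1) (Y : measurableType d2) (R : realType).
Variables (mu : {measure set X -> \bar R}) (w : X -> R) (s : X -> Y).
Hypotheses (mw : measurable_fun setT w) (w0 : forall x, (0 <= w x)%R) (ms : measurable_fun setT s).
Local Open Scope ereal_scope.
Import HBNNSimple.

(** The push-forward under [s] of the measure with density [w]. It expresses the volume in a chart,
    the product structure of [leb], and the pieces of the measure on a level set. *)
Definition imdens (A : set Y) := \int[mu]_x ((w x)%:E * (\1_A (s x))%:E).

Let mi A : measurable A -> measurable_fun setT (fun x => (w x)%:E * (\1_A (s x))%:E).
Proof.
move=> mA; apply: emeasurable_funM; apply/measurable_EFinP => //.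
by apply: (@measurableT_comp _ _ _ _ _ _ (\1_A : Y -> R)).
Qed.

Let imdens0 : imdens set0 = 0.
Proof. by apply: integral0_eq => x _; rewrite indic0 mule0. Qed.

Let imdens_ge0 A : 0 <= imdens A.
Proof. by apply: integral_ge0 => x _; rewrite mule_ge0 ?lee_fin // indicE. Qed.

Let imdens_sigma_additive : semi_sigma_additive imdens.
Proof.
move=> F mF tF mUF.
rewrite (_ : imdens _ = \sum_(n <oo) imdens (F n)).
  by apply: is_cvg_nneseries => n _ _; exact: imdens_ge0.
rewrite /imdens -integral_nneseries //; last 2 first.
- by move=> n; exact: mi.
- by move=> n x _; rewrite mule_ge0 // lee_fin ?indicE.
apply: eq_integral => x _.
have dE A : (\1_A (s x))%:E = \d_(s x) A :> \bar R by rewrite diracE.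
rewrite nneseriesZl; last by move=> n _; rewrite lee_fin indicE.
rewrite dE; congr (_ * _); under eq_eseriesr do rewrite dE.
exact: measure_semi_bigcup.
Qed.

HB.instance Definition _ := isMeasure.Build _ _ _ imdens imdens0 imdens_ge0 imdens_sigma_additive.

Definition imdens_measure : {measure set Y -> \bar R} := imdens.

Lemma integral_imdens (f : Y -> \bar R) : measurable_fun setT f -> (forall y, 0 <= f y) ->
  \int[imdens]_y f y = \int[mu]_x ((w x)%:E * f (s x)).
Proof.
move=> mf f0.
pose f_ : nat -> {nnsfun Y >-> R} := nnsfun_approx measurableT mf.
have mfs n : measurable_fun setT (fun x => (w x)%:E * (f_ n (s x))%:E).
  by apply: emeasurable_funM; apply/measurable_EFinP => //; exact: measurableT_comp.
transitivity (limn (fun n => \int[imdens]_x (f_ n x)%:E)).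
  rewrite -(@monotone_convergence _ _ _ imdens_measure) //.
  - apply: eq_integral => y _; apply/esym/cvg_lim => //.
    exact: cvg_nnsfun_approx.
  - by move=> n; exact/measurable_EFinP.
  - by move=> n y _; rewrite lee_fin.
  - by move=> y _ p q pq; rewrite lee_fin; exact/lefP/nd_nnsfun_approx.
transitivity (limn (fun n => \int[mu]_x ((w x)%:E * (f_ n (s x))%:E))); last first.
  rewrite -monotone_convergence //.
  - apply: eq_integral => x _; apply/cvg_lim => //.
    by apply: cvgeZl => //; exact: cvg_nnsfun_approx.
  - by move=> n y _; rewrite mule_ge0 ?lee_fin.
  - by move=> y _ p q pq; apply: lee_wpmul2l; rewrite lee_fin //; exact/lefP/nd_nnsfun_approx.
congr (limn _); apply/funext => n; set h := f_ n.
transitivity (\sum_(k \in range h) (k%:E * imdens (h @^-1` [set k]))).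
  under eq_integral do rewrite fimfunE -fsumEFin//.
  rewrite (@ge0_integral_fsum _ _ _ imdens_measure) //; last 2 first.
    - move=> r; apply/measurable_EFinP/measurableT_comp => //.
    - by move=> r y _; rewrite EFinM nnfun_muleindic_ge0.
  apply: eq_fsbigr => r; rewrite inE => -[y _ <-].
  under eq_integral do rewrite EFinM.
  rewrite (@ge0_integralZl _ _ _ imdens_measure) //; last 2 first.
    exact/measurable_EFinP.
    by rewrite lee_fin.
  by rewrite (@integral_indic _ _ _ imdens_measure) // setIT.
transitivity (\int[mu]_x \sum_(k \in range h) ((w x)%:E * (k * \1_(h @^-1` [set k]) (s x))%:E)); last first.
  apply: eq_integral => x _; rewrite -ge0_mule_fsumr; last by move=> r; rewrite EFinM nnfun_muleindic_ge0.
  by rewrite fsumEFin // -fimfunE.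
rewrite ge0_integral_fsum //; last 2 first.
  - move=> r; apply: emeasurable_funM; first exact/measurable_EFinP.
    apply/measurable_EFinP; apply: measurable_funM => //.
    by apply: (@measurableT_comp _ _ _ _ _ _ (\1_(h @^-1` [set r]) : Y -> R)).
  - move=> r x _; apply: mule_ge0; first by rewrite lee_fin.
    by rewrite EFinM nnfun_muleindic_ge0.
apply: eq_fsbigr => r; rewrite inE => -[y _ <-].
rewrite /imdens -ge0_integralZl//; last 3 first.
- exact: mi.
- by move=> x _; rewrite mule_ge0 // lee_fin ?indicE.
- by rewrite lee_fin.
by apply: eq_integral => x _; rewrite EFinM muleCA.
Qed.

End ImageDensity.

(** * The Borel measure behind the iterated integral *)

Section LebesgueRn.
Context {R : realType}.
Local Open Scope ereal_scope.

Definition vol m (a b : 'rV[R]_m) : R := (\prod_i Num.max 0 (b 0 i - a 0 i))%R.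

Let mR := @lebesgue_measure R.

Lemma box0 (a b : 'rV[R]_0) : box a b = setT.
Proof. by apply/seteqP; split => // x _ []. Qed.

Lemma ins_box m (a b : 'rV[R]_m.+1) k :
  (fun p : R * borel 'rV[R]_m => (ins k p.2 p.1 : borel 'rV[R]_m.+1)) @^-1` box a b =
  `]a 0%R k, b 0%R k[%classic `*` box (del k a) (del k b).
Proof.
apply/seteqP; split => [[t y] /= H|[t y] [/= H1 H2]].
  split; first by rewrite /= in_itv /=; have := H k; rewrite ins_at.
  by move=> i /=; have := H (lift k i); rewrite !mxE liftK.
move=> i; case: (unliftP k i) => [j ->|->].
  by have := H2 j; rewrite !mxE liftK.
by move: H1; rewrite in_itv /= ins_at.
Qed.

Lemma vol_del m (a b : 'rV[R]_m.+1) k :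
  vol a b = (Num.max 0 (b 0 k - a 0 k) * vol (del k a) (del k b))%R.
Proof.
rewrite /vol (bigD1_ord k) //=; congr (_ * _)%R.
by apply: eq_bigr => i _; rewrite !mxE.
Qed.

Lemma leb_itvoo (a b : R) : mR `]a, b[%classic = (Num.max 0 (b - a))%R%:E.
Proof.
rewrite /mR lebesgue_measure_itv /= lte_fin -EFinD -subr_gt0.
by case: (ltP 0%R (b - a)%R).
Qed.

(** [is_volume] speaks of the iterated integral [integralRn], while convergence theorems need a
    measure. It is built by induction as the image of a product measure under [ins ord0]. The
    volumes of boxes are part of the statement because they give the sigma-finiteness needed at the
    next dimension. *)
Lemma leb_exists m : exists mu : {measure set (borel 'rV[R]_m) -> \bar R},
  (forall f, measurable_fun setT f -> (forall x, 0 <= f x) -> \int[mu]_x f x = integralRn f) /\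
  (forall a b, mu (box a b) = (vol a b)%:E).
Proof.
elim: m => [|m [mu [IH1 IH2]]].
  exists (\d_(0%R : borel 'rV[R]_0)); split => [f mf f0|a b].
    by rewrite integral_dirac // diracT mul1e.
  transitivity ((\1_(box a b) (0%R : 'rV[R]_0))%:E : \bar R) => //.
  by rewrite indicE mem_set ?box0 // /vol big_ord0.
have sf : sigma_finite setT mu.
  pose e (n : nat) : 'rV[R]_m := const_mx n%:R.
  exists (fun n => box (- e n)%R (e n)).
    apply/seteqP; split => // x _; exists (Num.truncn `|x|).+1 => // i.
    rewrite !mxE -ltr_norml; apply: le_lt_trans (le_mx_norm _ _) _.
    exact: truncnS_gt.
  move=> n; split; first exact: box_borel.
  by rewrite IH2 ltry.
pose M2 := isSigmaFinite.Build _ _ _ (Measure.sort mu) sf.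
pose M1 := isSFinite.Build _ _ _ (Measure.sort mu) (sfinite_measure_sigma_finite sf).
pose mu' : {sigma_finite_measure set (borel 'rV[R]_m) -> \bar R} :=
  HB.pack_for (SigmaFiniteMeasure.type (borel 'rV[R]_m) R) (Measure.sort mu) M1 M2.
pose s (p : R * borel 'rV[R]_m) : borel 'rV[R]_m.+1 := ins ord0 p.2 p.1.
have ms : measurable_fun setT s by apply: measurable_ins.
pose nu := @imdens_measure _ _ _ _ R (mR \x mu') (fun=> 1%R) s (measurable_cst _) (fun=> ler01) ms.
have nuE f : measurable_fun setT f -> (forall x, 0 <= f x) ->
    \int[nu]_x f x = \int[mR \x mu']_p f (s p).
  by move=> mf f0; rewrite integral_imdens //; apply: eq_integral => p _; rewrite mul1e.
exists nu; split => [f mf f0|a b].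
  rewrite nuE // fubini_tonelli1 //; last exact: measurableT_comp.
  rewrite integralRnS; apply: eq_integral => t _; rewrite /fubini_F -IH1 //.
  apply: (measurableT_comp mf); exact: measurable_ins.
have mb : measurable (box a b : set (borel 'rV[R]_m.+1)) by exact: box_borel.
have ms' : measurable (s @^-1` box a b) by rewrite -[X in measurable X]setTI; exact: (ms).
have -> : nu (box a b) = \int[mR \x mu']_p (\1_(s @^-1` box a b) p)%:E.
  by rewrite /nu /= /imdens; apply: eq_integral => p _; rewrite mul1e.
rewrite integral_indic // setIT /s ins_box.
apply: (etrans (product_measure1E _ _ _ _)) => //; first exact: box_borel.
by rewrite (vol_del _ _ ord0) EFinM -leb_itvoo -IH2.
Qed.

Definition leb m : set (borel 'rV[R]_m) -> \bar R := sval (cid (leb_exists m)).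
HB.instance Definition _ m := Measure.on (@leb m).

Lemma leb_box m a b : leb (box a b : set (borel 'rV[R]_m)) = (vol a b)%:E.
Proof. by rewrite /leb; case: cid => mu /= []. Qed.

Lemma leb_ge0_integral m f : measurable_fun [set: borel 'rV[R]_m] f -> (forall x, 0 <= f x) ->
  \int[@leb m]_x f x = integralRn f.
Proof. by rewrite /leb; case: cid => mu /= [] H _; exact: H. Qed.

Lemma leb_sigma_finite m : sigma_finite setT (@leb m).
Proof.
pose e (n : nat) : 'rV[R]_m := const_mx n%:R.
exists (fun n => box (- e n)%R (e n)).
  apply/seteqP; split => // x _; exists (Num.truncn `|x|).+1 => // i.
  rewrite !mxE -ltr_norml; apply: le_lt_trans (le_mx_norm _ _) _.
  exact: truncnS_gt.
move=> n; split; first exact: box_borel.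
by rewrite leb_box ltry.
Qed.
HB.instance Definition _ m := Measure_isSigmaFinite.Build _ _ _ (@leb m) (@leb_sigma_finite m).

Lemma boxI m (a b c d : 'rV[R]_m) : box a b `&` box c d =
  box (\row_i Num.max (a 0%R i) (c 0%R i)) (\row_i Num.min (b 0%R i) (d 0%R i)).
Proof.
apply/seteqP; split => [x [H1 H2] i|x H].
  have := H1 i; have := H2 i; rewrite !mxE gt_max lt_min.
  by move=> /andP[-> ->] /andP[-> ->].
split=> i; have := H i; rewrite !mxE gt_max lt_min.
  by move=> /andP[/andP[-> _] /andP[-> _]].
by move=> /andP[/andP[_ ->] /andP[_ ->]].
Qed.

Lemma borel_box m : @measurable _ (borel 'rV[R]_m) = <<s [set A : set (borel 'rV[R]_m) | exists a b, A = box a b] >>.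
Proof.
apply/seteqP; split.
  apply: smallest_sub; first exact: smallest_sigma_algebra.
  have sa := @smallest_sigma_algebra _ setT [set A : set (borel 'rV[R]_m) | exists a b, A = box a b].
  apply: open_box_ind.
  - by case: sa.
  - by move=> a b; apply: sub_sigma_algebra; exists a, b.
  - by move=> F mF; case: sa => _ _; apply.
apply: smallest_sub; first exact: sigma_algebra_measurable.
by move=> _ [a [b ->]]; exact: box_borel.
Qed.

(** Boxes form a generating family stable under intersection, on which the volume is finite. The
    invariances of [leb] below, under the choice of the coordinate singled out and under
    translation, are thereby reduced to boxes. *)
Lemma leb_unique m (mu : {measure set (borel 'rV[R]_m) -> \bar R}) :
  (forall a b, mu (box a b) = (vol a b)%:E) -> forall A, measurable A -> mu A = leb A.
Proof.
move=> muE; have [F FT Fm] := leb_sigma_finite m.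
pose e (n : nat) : 'rV[R]_m := const_mx n%:R.
have H := @measure_unique _ R _ [set A : set (borel 'rV[R]_m) | exists a b, A = box a b]
  (fun n => box (- e n)%R (e n)) (borel_box m).
have S1 : setI_closed [set A : set (borel 'rV[R]_m) | exists a b, A = box a b].
  by move=> _ _ [a [b ->]] [c [d ->]]; rewrite boxI; eexists; eexists.
have S2 : \bigcup_n box (- e n)%R (e n) = setT.
  apply/seteqP; split => // x _; exists (Num.truncn `|x|).+1 => // i.
  rewrite !mxE -ltr_norml; apply: le_lt_trans (le_mx_norm _ _) _.
  exact: truncnS_gt.
move=> A mA; apply: (H S1 _ S2 mu (@leb m)) => //.
- by move=> n; eexists; eexists.
- by move=> _ [a [b ->]]; rewrite muE -leb_box.
- by move=> n; rewrite muE ltry.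
Qed.

Lemma integral_leb_eq m (mu : {measure set (borel 'rV[R]_m) -> \bar R}) f :
  (forall a b, mu (box a b) = (vol a b)%:E) ->
  \int[mu]_x f x = \int[@leb m]_x f x.
Proof. by move=> muE; apply: eq_measure_integral => A mA _; exact: leb_unique. Qed.

(** [integralRn] integrates the first coordinate outermost, whereas slices of a hypersurface are
    indexed by the last one; hence the arbitrary [k]. *)
Lemma leb_ins m k f : measurable_fun [set: borel 'rV[R]_m.+1] f -> (forall x, 0 <= f x) ->
  \int[@leb m.+1]_x f x = \int[mR]_t \int[@leb m]_y f (ins k y t).
Proof.
move=> mf f0; pose s (p : R * borel 'rV[R]_m) : borel 'rV[R]_m.+1 := ins k p.2 p.1.
have ms : measurable_fun setT s by apply: measurable_ins.
pose nu := @imdens_measure _ _ _ _ R (mR \x @leb m) (fun=> 1%R) s (measurable_cst _) (fun=> ler01) ms.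
transitivity (\int[nu]_x f x).
  apply/esym/integral_leb_eq => a b.
  have ms' : measurable (s @^-1` box a b).
    by rewrite -[X in measurable X]setTI; apply: (ms) => //; exact: box_borel.
  have -> : nu (box a b) = \int[mR \x @leb m]_p (\1_(s @^-1` box a b) p)%:E.
    by rewrite /nu /= /imdens; apply: eq_integral => p _; rewrite mul1e.
  rewrite integral_indic // setIT /s ins_box.
  apply: (etrans (product_measure1E _ _ _ _)) => //; first exact: box_borel.
  by rewrite (vol_del _ _ k) EFinM -leb_itvoo -leb_box.
rewrite integral_imdens //; under eq_integral do rewrite mul1e.
by rewrite fubini_tonelli1 //; exact: measurableT_comp.
Qed.

Lemma leb_shift m (h : 'rV[R]_m) f : measurable_fun [set: borel 'rV[R]_m] f -> (forall x, 0 <= f x) ->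
  \int[@leb m]_x f (x + h)%R = \int[@leb m]_x f x.
Proof.
move=> mf f0; pose s (x : borel 'rV[R]_m) : borel 'rV[R]_m := (x + h)%R.
have ms : measurable_fun setT s.
  by apply: continuous_borel => x; apply: (cvgD (F := nbhs x)); [exact: cvg_id|exact: cvg_cst].
pose nu := @imdens_measure _ _ _ _ R (@leb m) (fun=> 1%R) s (measurable_cst _) (fun=> ler01) ms.
transitivity (\int[nu]_x f x).
  by rewrite integral_imdens //; apply: eq_integral => x _; rewrite mul1e.
apply: integral_leb_eq => a b.
have ms' : measurable (s @^-1` box a b).
  by rewrite -[X in measurable X]setTI; apply: (ms) => //; exact: box_borel.
have -> : nu (box a b) = \int[@leb m]_p (\1_(s @^-1` box a b) p)%:E.
  by rewrite /nu /= /imdens; apply: eq_integral => p _; rewrite mul1e.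
rewrite integral_indic // setIT.
have -> : s @^-1` box a b = box (a - h) (b - h).
  by apply/seteqP; split => x H i; have := H i; rewrite !mxE ltrBlDr ltrBrDr.
apply: (etrans (leb_box _ _)); congr (_%:E); apply: eq_bigr => i _; rewrite !mxE.
by congr Num.max; ring.
Qed.

End LebesgueRn.

(** * Signed integrals and bump functions *)

Section SignedIntegral.
Context {R : realType}.
Local Open Scope ereal_scope.

(** Weak derivatives are tested with integrands of both signs. By Fubini's theorem the slices are
    integrable for almost every [t] only, so the inner integrals are compared almost everywhere. *)
Lemma integral_leb m (f : 'rV[R]_m -> \bar R) : (@leb R m).-integrable [set: borel 'rV[R]_m] f ->
  \int[@leb R m]_x f x = integralRn f.
Proof.
elim: m f => [|m IH] f fi.
  have mf := measurable_int _ fi.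
  rewrite integralE !leb_ge0_integral //=; last 2 first.
  - exact: measurable_funeneg.
  - exact: measurable_funepos.
  by rewrite [in RHS](funeposneg f).
have mf := measurable_int _ fi.
have mp := measurable_funepos mf; have mn := measurable_funeneg mf.
have mi t : measurable_fun [set: borel 'rV[R]_m] (fun y => ins ord0 y t : borel 'rV[R]_m.+1).
  exact: measurable_ins.
pose F (h : 'rV[R]_m.+1 -> \bar R) t := \int[@leb R m]_y h (ins ord0 y t).
have mF h : measurable_fun [set: borel 'rV[R]_m.+1] h -> (forall x, 0 <= h x) ->
    measurable_fun [set: R] (F h).
  move=> mh h0; rewrite (_ : F h = fun t => integralRn (fun y => h (ins ord0 y t))).
    apply: (@measurable_integralRn _ _ R m (fun p => h (ins ord0 p.2 p.1))).
    by apply: (measurableT_comp mh); exact: measurable_ins.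
  apply/funext => t; rewrite /F leb_ge0_integral //.
  exact: (measurableT_comp mh).
have F0 h : (forall x, 0 <= h x) -> forall t, 0 <= F h t.
  by move=> h0 t; exact: integral_ge0.
have Fi h : measurable_fun [set: borel 'rV[R]_m.+1] h -> (forall x, 0 <= h x) ->
    \int[@leb R m.+1]_x h x < +oo ->
    (@lebesgue_measure R).-integrable [set: R] (F h).
  move=> mh h0 hoo; apply/integrableP; split; first exact: mF.
  under eq_integral => t _ do rewrite gee0_abs ?F0 //.
  by rewrite /F -leb_ins.
have pi := Fi _ mp (funepos_ge0 f) (integrable_lty measurableT (integrable_funepos measurableT fi)).
have ni := Fi _ mn (funeneg_ge0 f) (integrable_lty measurableT (integrable_funeneg measurableT fi)).
rewrite integralE (@leb_ins _ _ ord0) // (@leb_ins _ _ ord0) //.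
rewrite integralRnS -/(F f^\+) -/(F f^\-) -integralB //.
apply: ae_eq_integral => //.
- by apply: emeasurable_funB; exact: mF.
- apply: (@measurable_integralRn _ _ R m (fun p => f (ins ord0 p.2 p.1))).
  by apply: (measurableT_comp mf); exact: measurable_ins.
have := integrable_ae measurableT pi; have := integrable_ae measurableT ni.
apply: filterS2 => t /(_ I) nf /(_ I) pf _.
have mft : measurable_fun [set: borel 'rV[R]_m] (fun y => f (ins ord0 y t)).
  exact: (measurableT_comp mf).
have E1 : F f^\+ t = \int[@leb R m]_y (fun y => f (ins ord0 y t))^\+ y.
  by apply: eq_integral => y _; rewrite !funeposE.
have E2 : F f^\- t = \int[@leb R m]_y (fun y => f (ins ord0 y t))^\- y.
  by apply: eq_integral => y _; rewrite !funenegE.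
rewrite -/(F f^\+ t) -/(F f^\- t) E1 E2 -integralE IH //; apply/integrableP; split => //.
rewrite -[fun x => `|_|]/(abse \o (fun y => f (ins ord0 y t))) fune_abse.
rewrite ge0_integralD //; last 2 first.
- exact: measurable_funepos.
- exact: measurable_funeneg.
rewrite -E1 -E2 ltey_eq fin_numD.
by rewrite pf nf.
Qed.

End SignedIntegral.

(** * Smooth bump functions *)

Section Bump.
Context {R : realType}.
Notation e_ i := (delta_mx 0 i).

(** The classical flat function [exp (- 1 / t)] is [expinv 0]; the powers of [1 / t] make the family
    closed under differentiation. *)
Definition expinv (k : nat) (t : R) : R := if 0 < t then t^-1 ^+ k * expR (- t^-1) else 0.

Lemma expinv_le k t : `|expinv k t| <= k.+1`!%:R * `|t|.
Proof.
rewrite /expinv; case: ltP => t0; last by rewrite normr0 mulr_ge0.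
rewrite ger0_norm ?(gtr0_norm t0); last by rewrite mulr_ge0 ?expR_ge0 // exprn_ge0 // invr_ge0 ltW.
have s0 : 0 < t^-1 by rewrite invr_gt0.
rewrite expRN ler_pdivrMr ?expR_gt0 //.
have := expR_ge1Dxn k (ltW s0); set E := expR _ => H.
have : t^-1 ^+ k.+1 / k.+1`!%:R <= E by apply: le_trans H; rewrite lerDr.
rewrite ler_pdivrMr ?ltr0n ?fact_gt0 // => H2.
rewrite exprS in H2.
have : t * (t^-1 * t^-1 ^+ k) <= t * (E * k.+1`!%:R) by rewrite ler_wpM2l // ltW.
rewrite [X in X <= _ -> _]mulrA mulfV ?mul1r; last by rewrite gt_eqF.
by move/le_trans; apply; rewrite le_eqVlt; apply/orP; left; apply/eqP; ring.
Qed.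

Lemma is_derive_expinv k t : is_derive t (1 : R) (expinv k) (expinv k.+2 t - k%:R * expinv k.+1 t).
Proof.
case: (ltrgtP t 0) => t0.
- have E : \forall x \near t, (fun=> 0) x = expinv k x.
    near=> x; rewrite /expinv ltNge ltW //.
    by near: x; exact: lt_nbhsl.
  have -> : expinv k.+2 t - k%:R * expinv k.+1 t = 0.
    by rewrite /expinv ltNge (ltW t0) /= mulr0 subr0.
  apply: (@near_eq_is_derive _ _ _ (fun=> 0) (expinv k) t 1 0 E).
- have E : \forall x \near t, (fun x => x^-1 ^+ k * expR (- x^-1)) x = expinv k x.
    near=> x; rewrite /expinv ifT //.
    by near: x; exact: lt_nbhsr.
  refine (@near_eq_is_derive _ _ _ (fun x : R => x^-1 ^+ k * expR (- x^-1)) (expinv k) t 1 (expinv k.+2 t - k%:R * expinv k.+1 t) E _).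
  have tn : t != 0 by rewrite gt_eqF.
  have d1 : is_derive t 1 (fun x : R => x^-1) (- t^-1 ^+ 2).
    rewrite exprVn; have := @is_deriveV R id t 1 1 tn (is_derive_id _ _).
    by rewrite /GRing.scale /= mulr1; exact.
  have d2 : is_derive t 1 (fun x : R => x^-1 ^+ k) (- k%:R * t^-1 ^+ k.+1).
    rewrite (_ : (fun x : R => _) = (fun x : R => x^-1) ^+ k); last first.
      by apply/funext => x; rewrite exprfctE.
    have := is_deriveX k d1 => H; apply: (is_derive_eq H).
    case: (k) => [|j]; rewrite /GRing.scale /= ?mulr0n; first by ring.
    by rewrite !exprS; ring.
  have d3 : is_derive t 1 (fun x : R => expR (- x^-1)) (expR (- t^-1) * t^-1 ^+ 2).
    have := @is_derive1_comp _ expR (fun x : R => - x^-1) t _ _ (is_derive_expR _) (is_deriveN d1).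
    by rewrite opprK.
  apply: (is_derive_eq (is_deriveM d2 d3)).
  by rewrite /expinv t0 /GRing.scale /= !exprS; ring.
- rewrite t0 {2 3}/expinv ltxx mulr0 subr0.
  have H : (h^-1 *: (expinv k (h + 0) - expinv k 0)) @[h --> (0:R)^'] --> (0:R).
    apply/cvgrPdist_le => e e0.
    near=> h.
    rewrite addr0 {2}/expinv ltxx subr0 sub0r normrN.
    (* At 0 the difference quotient of [expinv k] is [expinv k.+1], which tends to 0 by
       [expinv_le]. *)
    have -> : h^-1 *: expinv k h = expinv k.+1 h.
      rewrite /expinv; case: ifP => _; last by rewrite scaler0.
      by rewrite /GRing.scale /= exprS mulrA.
    apply: le_trans (expinv_le _ _) _; rewrite -ler_pdivlMl ?ltr0n ?fact_gt0 //.
    near: h; apply: dnbhs0_le; rewrite mulr_gt0 // invr_gt0 ltr0n fact_gt0.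
  apply: DeriveDef; last first.
    apply/cvg_lim => //.
    by under eq_fun do rewrite /= [_ *: 1]mulr1.
  by apply/cvg_ex; exists 0; under eq_fun do rewrite /= [_ *: 1]mulr1.
Unshelve. all: by end_near. Qed.

Lemma Cinf_expinv k : Cinf [set: 'rV[R]_1] (fun y => expinv k (y 0 0)).
Proof.
move=> K; elim: K k => [|K IH] k.
  split => // x _.
  apply: (@continuous_comp _ _ _ (fun y : 'rV[R]_1 => y 0 0) (expinv k)); first exact: coord_continuous.
  apply: differentiable_continuous; apply/derivable1_diffP.
  exact: (ex_derive (is_derive := is_derive_expinv k _)).
have D (y : 'rV[R]_1) i : is_derive y (e_ i) (fun y : 'rV[R]_1 => expinv k (y 0 0))
    (expinv k.+2 (y 0 0) - k%:R * expinv k.+1 (y 0 0)).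
  have E : (fun s : R => expinv k ((y + s *: e_ i) 0 0)) = (fun s : R => expinv k (y 0 0 + s)).
    by apply/funext => s; rewrite !mxE (ord1 i) eqxx mulr1.
  have d : is_derive (0 : R) 1 (fun s : R => expinv k (y 0 0 + s))
      (expinv k.+2 (y 0 0) - k%:R * expinv k.+1 (y 0 0)).
    have d1 : is_derive (0:R) (1:R) (fun s : R => y 0 0 + s) 1.
      have := is_deriveD (is_derive_cst (y 0 0) (0:R) (1:R)) (is_derive_id (0:R) (1:R)).
      by rewrite add0r.
    have := @is_derive1_comp _ (expinv k) (fun s : R => y 0 0 + s) 0 _ _ (is_derive_expinv k _) d1.
    by rewrite mulr1 addr0.
  apply: DeriveDef.
    by apply/derivable_line; rewrite E; exact: (ex_derive (is_derive := d)).
  by rewrite derive_line E; exact: (derive_val (is_derive := d)).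
split; first by move=> x; exact: (Ck_cont (IH k)).
move=> i; split => [x _|]; first exact: (ex_derive (is_derive := D x i)).
apply: (Ck_eq openT (f := fun y : 'rV[R]_1 => expinv k.+2 (y 0 0) - k%:R * expinv k.+1 (y 0 0))).
  by move=> x _; rewrite (derive_val (is_derive := D x i)).
by apply: CkB; [exact: openT|exact: IH|apply: CkM; [exact: openT|exact: Ck_cst|exact: IH]].
Qed.

(** The norm is the maximum norm, so a ball is a cube and a product over the coordinates has exactly
    the ball as the set where it is positive. *)
Definition bump m (c : 'rV[R]_m) (r : R) (x : 'rV[R]_m) : R :=
  \prod_i expinv 0 (r ^+ 2 - (x 0 i - c 0 i) ^+ 2).

Lemma bump_ge0 m (c : 'rV[R]_m) r x : 0 <= bump c r x.
Proof. by apply: prodr_ge0 => i _; rewrite /expinv; case: ifP => // _; rewrite mul1r expR_ge0. Qed.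

Lemma bump_gt0 m (c : 'rV[R]_m) r x : 0 < r -> ball c r x -> 0 < bump c r x.
Proof.
move=> r0 /(ball_coordP _ _ r0) H; apply: prodr_gt0 => i _; rewrite /expinv ifT ?mul1r ?expR_gt0 //.
by rewrite subr_gt0 -[X in X < _]real_normK ?num_real // ltr_pXn2r ?nnegrE ?(ltW r0) // distrC.
Qed.

Lemma bump_out m (c : 'rV[R]_m) r x : 0 < r -> ~ ball c r x -> bump c r x = 0.
Proof.
move=> r0 H; apply/eqP/negP => /negP /prodf_neq0 H2; apply: H.
apply/(ball_coordP _ _ r0) => i; have := H2 i isT; rewrite /expinv.
case: ifP; last by rewrite eqxx.
rewrite subr_gt0 -[X in X < _]real_normK ?num_real // ltr_pXn2r ?nnegrE ?(ltW r0) //.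
by rewrite distrC.
Qed.

Lemma bump_Cinf m (c : 'rV[R]_m) r : Cinf setT (bump c r).
Proof.
move=> k; apply: Ck_prod => [|i _]; first exact: openT.
apply: (Ck_eq openT (f := fun x => (fun y : 'rV[R]_1 => expinv 0 (y 0 0))
   (\row_j (fun x : 'rV[R]_m => r ^+ 2 - (x 0 i - c 0 i) ^+ 2) x))).
  by move=> x _; rewrite mxE.
apply: (@Ck_comp _ _ _ _ _ setT (fun y : 'rV[R]_1 => expinv 0 (y 0 0)) (fun=> fun x : 'rV[R]_m => r ^+ 2 - (x 0 i - c 0 i) ^+ 2)) => //; [exact: openT|exact: openT| |exact: Cinf_expinv].
move=> _; have Ci : Ck k [set: 'rV[R]_m] (fun x => x 0 i - c 0 i).
  by apply: CkB; [exact: openT|exact: Ck_coord|exact: Ck_cst].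
by apply: CkB; [exact: openT|exact: Ck_cst|apply: CkM; [exact: openT| |]].
Qed.

End Bump.

(** * Continuity of translations in L^2 *)

Section TranslationL2.
Context {R : realType} {m : nat}.
Implicit Types (V W : 'rV[R]_m -> R).
Local Open Scope ereal_scope.
Import HBNNSimple.

Local Notation mV := (fun V : 'rV[R]_m -> R => measurable_fun [set: borel 'rV[R]_m] (V : borel 'rV[R]_m -> R)).

Definition sqint V : \bar R := \int[@leb R m]_x (V x ^+ 2)%:E.

Lemma sqint_ge0 V : 0 <= sqint V.
Proof. by apply: integral_ge0 => x _; rewrite lee_fin sqr_ge0. Qed.

Lemma measurable_sqr V : mV V -> measurable_fun [set: borel 'rV[R]_m] (fun x => (V x ^+ 2)%:E).
Proof. by move=> mW; apply/measurable_EFinP; exact: measurable_funX. Qed.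

Lemma measurable_shift V h : mV V -> mV (fun x => V (x + h)%R).
Proof.
move=> mW; apply: (measurableT_comp mW).
by apply: continuous_borel => x; apply: (cvgD (F := nbhs x)); [exact: cvg_id|exact: cvg_cst].
Qed.

Lemma sqint_shift V h : mV V -> sqint (fun x => V (x + h)%R) = sqint V.
Proof.
by move=> mW; apply: (leb_shift h (measurable_sqr mW)) => x; rewrite lee_fin sqr_ge0.
Qed.

Lemma sqintZ a V : mV V -> sqint (fun x => a * V x)%R = (a ^+ 2)%:E * sqint V.
Proof.
move=> mW; rewrite /sqint -ge0_integralZl_EFin //.
- by apply: eq_integral => x _; rewrite exprMn EFinM.
- by move=> x _; rewrite lee_fin sqr_ge0.
- exact: measurable_sqr.
- exact: sqr_ge0.
Qed.

Lemma sqintD V W : mV V -> mV W ->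
  sqint (fun x => V x + W x)%R <= 2%:E * sqint V + 2%:E * sqint W.
Proof.
move=> mW mW'; rewrite /sqint -!ge0_integralZl_EFin //; first last.
- exact: measurable_sqr.
- by move=> x _; rewrite lee_fin sqr_ge0.
- exact: measurable_sqr.
- by move=> x _; rewrite lee_fin sqr_ge0.
rewrite -ge0_integralD //; first last.
- by apply: measurable_funeM; exact: measurable_sqr.
- by move=> x _; rewrite mule_ge0 // lee_fin sqr_ge0.
- by apply: measurable_funeM; exact: measurable_sqr.
- by move=> x _; rewrite mule_ge0 // lee_fin sqr_ge0.
apply: ge0_le_integral => //.
- by move=> x _; rewrite lee_fin sqr_ge0.
- by apply: measurable_sqr; exact: measurable_funD.
- by apply: emeasurable_funD; apply: measurable_funeM; exact: measurable_sqr.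
move=> x _; rewrite -!EFinM -EFinD lee_fin.
have := sqr_ge0 (V x - W x); nra.
Qed.

Lemma sqintD_le V W (a b : R) : mV V -> mV W -> sqint V <= a%:E -> sqint W <= b%:E ->
  sqint (fun x => V x + W x)%R <= (2 * a + 2 * b)%:E.
Proof.
move=> mW mW' Va Wb; apply: le_trans (sqintD mW mW') _.
rewrite [(_ + _)%:E]EFinD [(2 * a)%:E]EFinM [(2 * b)%:E]EFinM.
by apply: leeD; apply: lee_wpmul2l.
Qed.

Definition transl_cont V := mV V /\ forall e : R, (0 < e)%R -> exists2 d : R, (0 < d)%R &
  forall z : 'rV[R]_m, (`|z| < d)%R -> sqint (fun x => V (x + z) - V x)%R <= e%:E.

Lemma transl_contD V W : transl_cont V -> transl_cont W -> transl_cont (fun x => V x + W x)%R.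
Proof.
move=> [mW H] [mW' H']; split; first exact: measurable_funD.
move=> e e0; have e4 : (0 < e / 4)%R by rewrite divr_gt0.
have [d d0 Hd] := H _ e4; have [d' d'0 Hd'] := H' _ e4.
exists (Num.min d d'); first by rewrite lt_min d0.
move=> z; rewrite lt_min => /andP[zd zd'].
have -> : (fun x => V (x + z) + W (x + z) - (V x + W x))%R =
   (fun x => (V (x + z) - V x) + (W (x + z) - W x))%R by apply/funext => x; ring.
have -> : e = (2 * (e / 4) + 2 * (e / 4))%R by field.
apply: sqintD_le; [| |exact: Hd|exact: Hd'].
- by apply: measurable_funB => //; exact: measurable_shift.
- by apply: measurable_funB => //; exact: measurable_shift.
Qed.

Lemma transl_contZ a V : transl_cont V -> transl_cont (fun x => a * V x)%R.
Proof.
move=> [mW H]; split; first exact: measurable_funM.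
move=> e e0; have a0 : (0 < 1 + a ^+ 2)%R by rewrite ltr_wpDr // sqr_ge0.
have [d d0 Hd] := H _ (divr_gt0 e0 a0); exists d => // z zd.
have -> : (fun x => a * V (x + z) - a * V x)%R = (fun x => a * (V (x + z) - V x))%R.
  by apply/funext => x; ring.
rewrite sqintZ; last by apply: measurable_funB => //; exact: measurable_shift.
apply: le_trans (lee_wpmul2l _ (Hd z zd)) _; first by rewrite lee_fin sqr_ge0.
rewrite -EFinM lee_fin mulrCA ler_piMr ?(ltW e0) //.
by rewrite ler_pdivrMr // mul1r lerDr.
Qed.

Lemma transl_cont_lim V : mV V -> (forall e : R, (0 < e)%R -> exists W, [/\ transl_cont W &
  sqint (fun x => V x - W x)%R <= e%:E]) -> transl_cont V.
Proof.
move=> mW H; split => // e e0.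
(* The splitting into three terms by two uses of [sqintD_le] costs the factors 2, 4 and 4. *)
have e1 : (0 < e / 10)%R by rewrite divr_gt0.
have [W [[mW' HW] VW]] := H _ e1; have [d d0 Hd] := HW _ e1.
exists d => // z zd.
have mD : mV (fun x => V x - W x)%R by exact: measurable_funB.
have mDz := measurable_shift z mD; have mWz := measurable_shift z mW'.
have -> : (fun x => V (x + z) - V x)%R =
    (fun x => (V (x + z) - W (x + z)) + ((W (x + z) - W x) + (-1) * (V x - W x)))%R.
  by apply/funext => x; ring.
have mA : mV (fun x => W (x + z) - W x)%R by exact: measurable_funB.
have mB : mV (fun x => -1 * (V x - W x))%R by exact: measurable_funM.
have -> : e = (2 * (e / 10) + 2 * (2 * (e / 10) + 2 * (e / 10)))%R by field.
apply: sqintD_le => //; first exact: measurable_funD.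
  by rewrite (sqint_shift z mD).
apply: sqintD_le => //; first exact: Hd.
by rewrite sqintZ // sqrrN expr1n mul1e.
Qed.

Lemma transl_cont0 : transl_cont (fun=> 0%R).
Proof.
split; first exact: measurable_cst.
move=> e e0; exists 1%R => // z _; rewrite /sqint subrr expr0n /=.
by rewrite integral0 lee_fin ltW.
Qed.

Lemma transl_cont_sum I (r : seq I) (F : I -> 'rV[R]_m -> R) : (forall i, transl_cont (F i)) ->
  transl_cont (fun x => \sum_(i <- r) F i x)%R.
Proof.
move=> H; elim: r => [|i r IH].
  by under eq_fun do rewrite big_nil; exact: transl_cont0.
by under eq_fun do rewrite big_cons; exact: transl_contD.
Qed.

Lemma sqint_indic (A : set (borel 'rV[R]_m)) : measurable A -> sqint \1_A = leb A.
Proof.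
move=> mA; transitivity (\int[@leb R m]_x (\1_A x)%:E).
  by apply: eq_integral => x _; rewrite indicE; case: (x \in A); rewrite ?expr1n ?expr0n.
by rewrite integral_indic // setIT.
Qed.

(** For a box [A] and its translate [B] the identity [(1_A - 1_B)^2 + 2 * 1_(A and B) = 1_A + 1_B]
    reduces the claim to the volume of the overlap. This volume is the function [N], written with
    absolute values so that its continuity can be read off. *)
Lemma transl_cont_box (a b : 'rV[R]_m) : transl_cont \1_(box a b).
Proof.
have mb (c d : 'rV[R]_m) : measurable (box c d : set (borel 'rV[R]_m)) by exact: box_borel.
have mW : mV (\1_(box a b)) by exact: measurable_indic.
split => // e e0.
pose N (z : 'rV[R]_m) := (\prod_i (((b 0 i - a 0 i - `|z 0 i|) + `|b 0 i - a 0 i - `|z 0 i| |) / 2))%R.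
have maxE (t : R) : Num.max 0%R t = ((t + `|t|) / 2)%R.
  by case: (lerP 0 t) => t0; [rewrite ger0_norm|rewrite ltr0_norm] => //; lra.
have cN : {for (0%R : 'rV[R]_m), continuous N}.
  apply: (@Ck_cont _ m 0 setT) => //; apply: Ck_prod; first exact: openT.
  move=> i _; split => // x _; apply: (cvgM (F := nbhs x)); last exact: cvg_cst.
  have c1 : (b 0 i - a 0 i - `|y 0 i|)%R @[y --> x] --> (b 0 i - a 0 i - `|x 0 i|)%R.
    apply: (cvgB (F := nbhs x)); first exact: cvg_cst.
    by apply: (cvg_norm (F := nbhs x)); exact: coord_continuous.
  by apply: (cvgD (F := nbhs x)) => //; exact: (cvg_norm (F := nbhs x)).
have N0 : N 0%R = vol a b.
  by apply: eq_bigr => i _; rewrite mxE normr0 subr0 maxE.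
have e2 : (0 < e / 2)%R by rewrite divr_gt0.
have /nbhs_ballP[d /= d0 Hd] : nbhs (0%R : 'rV[R]_m) [set z | `|N 0 - N z| <= e / 2]%R.
  have /(@cvgrPdist_le _ _ _ (nbhs (0%R : 'rV[R]_m))) := cN : N y @[y --> (0%R : 'rV[R]_m)] --> N 0%R.
  exact.
exists d => // z zd.
have {}Hd : (vol a b - N z <= e / 2)%R.
  rewrite -N0; apply: le_trans (ler_norm _) _; apply: Hd.
  by rewrite -ball_normE /= sub0r normrN.
pose a' := (\row_i Num.max (a 0 i) ((a - z) 0 i))%R; pose b' := (\row_i Num.min (b 0 i) ((b - z) 0 i))%R.
have Nz : N z = vol a' b'.
  apply: eq_bigr => i _; rewrite !mxE -maxE; congr Num.max.
  case: (lerP 0%R (z 0%R i)) => H; [rewrite (ger0_norm H)|rewrite (ltr0_norm H)];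
    case: (lerP (a 0%R i) (a 0%R i - z 0%R i)%R); case: (lerP (b 0%R i) (b 0%R i - z 0%R i)%R); lra.
have sh : (fun x => \1_(box a b) (x + z) : R)%R = \1_(box (a - z) (b - z)).
  apply/funext => x; rewrite !indicE; congr (_%:R); congr nat_of_bool.
  by apply/idP/idP; rewrite !inE => H i; move: (H i); rewrite !mxE ltrBlDr ltrBrDr.
have E : sqint (fun x => \1_(box a b) (x + z) - \1_(box a b) x)%R + 2%:E * (vol a' b')%:E = 2%:E * (vol a b)%:E.
  have -> : (2%:E * (vol a b)%:E = \int[@leb R m]_x (\1_(box a b) (x + z))%:E + \int[@leb R m]_x (\1_(box a b) x)%:E).
    rewrite (leb_shift z (f := fun x => (\1_(box a b) x)%:E)); last 2 first.
    - exact/measurable_EFinP.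
    - by move=> x; rewrite lee_fin indicE.
    rewrite integral_indic // setIT.
    transitivity (leb (box a b : set (borel 'rV[R]_m)) + leb (box a b : set (borel 'rV[R]_m))) => //.
    by rewrite leb_box -EFinM -EFinD; congr (_%:E); ring.
  rewrite -[(vol a' b')%:E]leb_box -boxI.
  have -> : leb (box a b `&` box (a - z)%R (b - z)%R : set (borel 'rV[R]_m)) =
      \int[@leb R m]_x (\1_(box a b `&` box (a - z)%R (b - z)%R) x)%:E.
    by rewrite integral_indic ?setIT //; exact: measurableI.
  have mI : measurable_fun [set: borel 'rV[R]_m] (fun x => (\1_(box a b `&` box (a - z)%R (b - z)%R) x : R)%:E).
    by apply/measurable_EFinP; apply: measurable_indic; exact: measurableI.
  rewrite -ge0_integralZl_EFin //.
  rewrite /sqint -!ge0_integralD //; try by [move=> x _; rewrite lee_fin ?sqr_ge0 // indicE |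
    exact/measurable_EFinP/measurable_shift | exact/measurable_EFinP | exact: measurable_funeM |
    apply: measurable_sqr; apply: measurable_funB => //; exact: measurable_shift].
    apply: eq_integral => x _; rewrite -!EFinM -!EFinD; congr (_%:E).
    rewrite (congr1 (fun f => f x) sh) indicI /= !indicE.
    by case: (x \in _); case: (x \in _) => /=; rewrite ?expr1n ?expr0n /=; ring.
  by apply/measurable_EFinP; exact: measurable_shift.
move: E (sqint_ge0 (fun x => \1_(box a b) (x + z) - \1_(box a b) x)%R).
case: (sqint _) => [s| |]; last 2 first.
- by rewrite -!EFinM addye.
- by move=> _; rewrite leeNy_eq.
by rewrite -!EFinM -EFinD => -[E] _; rewrite lee_fin; move: E Hd; rewrite Nz; lra.
Qed.

(** Dynkin's theorem, starting from boxes. The intersection with a fixed box keeps all measures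
    finite, so complements become differences and disjoint countable unions become limits in L^2. *)
Lemma transl_cont_indic (Q1 Q2 : 'rV[R]_m) (A : set (borel 'rV[R]_m)) : measurable A ->
  transl_cont \1_(A `&` box Q1 Q2).
Proof.
pose Q := box Q1 Q2 : set (borel 'rV[R]_m).
have mQ : measurable Q by exact: box_borel.
rewrite borel_box => mA.
apply: (@dynkin_induction _ (borel 'rV[R]_m) _ (fun A => transl_cont \1_(A `&` box Q1 Q2)) (@borel_box R m) _ _ _ _ _ A mA) => {A mA}.
- move=> _ _ [a [b ->]] [c [d ->]]; rewrite boxI; by do 2 eexists.
- by rewrite setTI; exact: transl_cont_box.
- by move=> _ [a [b ->]]; rewrite boxI; exact: transl_cont_box.
- move=> S mS HS.
  have -> : (\1_(~` S `&` Q) : 'rV[R]_m -> R) = (fun x => \1_Q x + (-1) * \1_(S `&` Q) x)%R.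
    apply/funext => x; rewrite !indicE !in_setI in_setC.
    by case: (x \in S); case: (x \in Q) => /=; ring.
  by apply: transl_contD; [exact: transl_cont_box|exact: transl_contZ].
move=> F mF tF HF.
pose U := \bigcup_k F k `&` Q; pose G k := F k `&` Q.
have mG k : measurable (G k) by exact: measurableI.
have mU : measurable U by apply: measurableI => //; exact: bigcup_measurable.
have UE : U = \bigcup_k G k by rewrite /U setI_bigcupl.
pose P n := \big[setU/set0]_(k < n) G k.
have mP n : measurable (P n) by exact: bigsetU_measurable.
have PU n : P n `<=` U by rewrite UE; apply: bigsetU_bigcup.
have tP n : transl_cont \1_(P n).
  have -> : (\1_(P n) : 'rV[R]_m -> R) = (fun x => \sum_(k <- iota 0 n) \1_(G k) x)%R.
    apply/funext => x; rewrite /P; elim: n => [|n IH].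
      by rewrite big_ord0 big_nil indic0.
    rewrite big_ord_recr /= (_ : 0%N :: iota 1 n = iota 0 n ++ [:: n]); last by rewrite -[_ :: _]/(iota 0 n.+1) -addn1 iotaD.
    rewrite big_cat /= big_seq1 -IH !indicE in_setU.
    case: (boolP (x \in G n)) => xG; last by rewrite orbF addr0.
    rewrite (_ : (x \in \big[setU/set0]_(i < n) G i) = false) ?add0r //.
    apply/negP; rewrite inE -bigcup_mkord => -[k /= kn [Fk _]].
    move: xG; rewrite inE => -[Fn _].
    by have := tF k n I I (ex_intro _ x (conj Fk Fn)) => kE; rewrite kE ltnn in kn.
  by apply: transl_cont_sum => k; exact: HF.
have Qfin : leb Q < +oo by rewrite /Q leb_box ltry.
have Ufin : leb U < +oo.
  apply: le_lt_trans Qfin; apply: le_measure; rewrite ?inE //.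
  by move=> x [].
apply: transl_cont_lim; first exact: measurable_indic.
move=> e e0.
have cv : leb (P n) @[n --> \oo] --> leb U.
  have := @nondecreasing_cvg_mu _ _ _ (@leb R m) P mP; rewrite (_ : \bigcup_n P n = U); last first.
    by rewrite UE eqEsubset; split; [apply: bigcup_sub => n _; rewrite -UE; exact: PU|
       move=> x [k _ Gk]; exists k.+1 => //; rewrite /P big_ord_recr /=; right].
  apply => // i j ij; apply/subsetPset; exact: subset_bigsetU.
have Uf : leb U = (fine (leb U))%:E by rewrite fineK // ge0_fin_numE.
have /fine_cvgP[_ /cvgrPdist_le/(_ _ e0) [N _ /(_ N (leqnn N)) HN]] :
  leb (P n) @[n --> \oo] --> (fine (leb U))%:E by rewrite -Uf.
exists \1_(P N); split => //.
have leP : leb (P N) <= leb U by apply: le_measure => //; rewrite inE.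
have Pfin : leb (P N) < +oo by apply: le_lt_trans Ufin.
have Pf : leb (P N) = (fine (leb (P N)))%:E by rewrite fineK // ge0_fin_numE.
have -> : (fun x => \1_U x - \1_(P N) x)%R = (\1_(U `\` P N) : 'rV[R]_m -> R).
  apply/funext => x; rewrite !indicE in_setD.
  have : x \in P N -> x \in U by rewrite !inE => /PU.
  by case: (x \in P N) => [->|] //=; rewrite ?subrr // andbT subr0.
rewrite sqint_indic; last exact: measurableD.
have -> : leb (U `\` P N) = leb U - leb (P N).
  rewrite measureD //; congr (_ - leb _); apply/setIidr; exact: PU.
rewrite Uf Pf -EFinB lee_fin; apply: le_trans HN; exact: ler_norm.
Qed.

(** Simple functions increase to [V], and the squared differences are dominated by [V ^+ 2]. *)
Lemma transl_cont_L2_ge0 V (a b : 'rV[R]_m) : mV V -> (forall x, (0 <= V x)%R) ->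
  sqint V < +oo -> (forall x, ~ box a b x -> V x = 0%R) -> transl_cont V.
Proof.
move=> mW V0 Voo Vsupp; apply: transl_cont_lim => // e e0.
have mE : measurable_fun [set: borel 'rV[R]_m] (EFin \o V) by exact/measurable_EFinP.
pose f := nnsfun_approx measurableT mE.
have cf x : EFin \o f ^~ x @ \oo --> (V x)%:E.
  by apply: cvg_nnsfun_approx => // y _; rewrite lee_fin.
have cfr x : f ^~ x @ \oo --> V x by have /fine_cvgP[_] := cf x.
have fV n x : (f n x <= V x)%R.
  rewrite -(cvg_lim (@Rhausdorff R) (cfr x)); apply: nondecreasing_cvgn_le.
    by move=> i j ij; have /lefP := nd_nnsfun_approx measurableT mE ij; exact.
  by apply/cvg_ex; exists (V x).
have tf n : transl_cont (f n).
  have [r rE] : exists r : seq R, forall x, f n x = (\sum_(y <- r) y * \1_(f n @^-1` [set y]) x)%R.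
    exists (finmap.enum_fset (fset_set (range (f n)))) => x.
    by rewrite fimfunE fsbig_finite.
  (* The approximation lies between 0 and [V], hence vanishes off the box, and each of its level
     sets may be cut by the box as [transl_cont_indic] requires. *)
  have -> : (f n : 'rV[R]_m -> R) = (fun x => \sum_(y <- r) y * \1_(f n @^-1` [set y] `&` box a b) x)%R.
    apply/funext => x; case: (pselect (box a b x)) => bx.
      rewrite rE; apply: eq_bigr => i _; congr (_ * _)%R; rewrite !indicE in_setI; congr (_%:R).
      by rewrite (mem_set bx) andbT.
    rewrite [RHS]big1; last first.
      by move=> i _; rewrite indicE in_setI (memNset bx) andbF mulr0.
    by apply/le_anti; rewrite -{1}(Vsupp x bx) fV /= fun_ge0.
  apply: transl_cont_sum => i; apply: transl_contZ; apply: transl_cont_indic.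
  have mfn : measurable_fun [set: borel 'rV[R]_m] (f n) by [].
  by rewrite -[X in measurable X]setTI; apply: mfn => //; exact: measurable_set1.
have [] := @dominated_convergence _ _ _ (@leb R m) setT measurableT
  (fun n x => ((V x - f n x) ^+ 2)%:E) (fun=> 0) (fun x => (V x ^+ 2)%:E).
- by move=> n; apply: measurable_sqr; apply: measurable_funB.
- exact: measurable_cst.
- apply: aeW => x _; apply/cvg_EFin; first by apply: nearW.
  have H : (V x - f n x)%R @[n --> \oo] --> (0 : R)%R.
    by rewrite -(subrr (V x)); apply: cvgB => //; exact: cvg_cst.
  by rewrite -[X in _ --> X](expr0n R 2); under eq_fun do rewrite expr2; rewrite expr2; exact: cvgM.
- apply/integrableP; split; first exact: measurable_sqr.
  by under eq_integral do rewrite gee0_abs ?lee_fin ?sqr_ge0 //.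
- apply: aeW => x n _; rewrite gee0_abs lee_fin ?sqr_ge0 //.
  have := fV n x; have : (0 <= f n x)%R by exact: fun_ge0.
  move: (V x) (f n x) => p q; nra.
move=> _ + _; under eq_fun do under eq_integral do rewrite sube0 gee0_abs ?lee_fin ?sqr_ge0 //.
move=> /fine_cvgP[[N1 _ H1] /cvgrPdist_le/(_ _ e0) [N _ H2]].
pose k := maxn N1 N.
exists (f k); split => //.
have /= := H2 k (leq_maxr _ _); have /= := H1 k (leq_maxl _ _).
rewrite -/(sqint (fun x => V x - f k x)%R) sub0r normrN => /fineK <- H.
by rewrite lee_fin; apply: le_trans H; exact: ler_norm.
Qed.

Lemma transl_cont_L2 V (a b : 'rV[R]_m) : mV V ->
  sqint V < +oo -> (forall x, ~ box a b x -> V x = 0%R) -> transl_cont V.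
Proof.
move=> mW Voo Vs.
have -> : V = (fun x => Num.max (V x) 0 + (-1) * Num.max (- V x) 0)%R.
  by apply/funext => x; case: (lerP 0%R (V x)) => H; rewrite ?(max_idPl H);
     case: (lerP 0%R (- V x)) => H'; lra.
have mN : mV (fun x => - V x)%R by exact: measurable_funN.
have H W : mV W -> (forall x, (W x ^+ 2 = V x ^+ 2)%R) -> (forall x, ~ box a b x -> W x = 0%R) ->
    transl_cont (fun x => Num.max (W x) 0)%R.
  move=> mW' WV Ws; have mM : mV (fun x => Num.max (W x) 0)%R.
    by apply: measurable_maxr => //; exact: measurable_cst.
  apply: (transl_cont_L2_ge0 (a := a) (b := b)) => //.
  - by move=> x; rewrite le_max lexx orbT.
  - apply: le_lt_trans Voo; apply: ge0_le_integral => //.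
    + by move=> x _; rewrite lee_fin sqr_ge0.
    + exact: measurable_sqr.
    + exact: measurable_sqr.
    + move=> x _; rewrite lee_fin -WV; case: (lerP (W x) 0%R) => // _.
      by rewrite expr0n /= sqr_ge0.
  - by move=> x /Ws ->; rewrite maxxx.
apply: transl_contD; first exact: H.
apply: transl_contZ; apply: H => // x; first by rewrite sqrrN.
by move=> /Vs ->; rewrite oppr0.
Qed.

End TranslationL2.

(** * Mollification *)

Section TestFunctions.
Context {R : realType} {m : nat}.
Notation e_ i := (delta_mx 0 i).
Implicit Types (V eta : 'rV[R]_m -> R).

Definition bounded_support eta := exists2 r, 0 < r & forall x, ~ ball (0 : 'rV[R]_m) r x -> eta x = 0.

Lemma bounded_support_bound eta : Ck 0 setT eta -> bounded_support eta ->
  exists2 K, 0 <= K & forall x, `|eta x| <= K.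
Proof.
move=> [ce _] [r r0 H].
have cB : compact (closed_ball (0 : 'rV[R]_m) r : set 'rV[R]_m).
  apply: bounded_closed_compact; last exact: closed_ball_closed.
  exists r; split; first exact: num_real.
  move=> M HM y; rewrite closed_ballE // /closed_ball_ /= sub0r normrN => xy.
  by apply: le_trans (ltW HM).
have : compact (eta @` closed_ball (0 : 'rV[R]_m) r).
  by apply: continuous_compact => //; apply: continuous_in_subspaceT => y _; exact: ce.
move=> /compact_bounded[M [_ HM]].
exists (`|M| + 1) => [|x]; first by rewrite addr_ge0.
have [/subset_closed_ball b|/H ->] := pselect (ball (0 : 'rV[R]_m) r x).
  apply: HM; first by rewrite (le_lt_trans (ler_norm _)) // ltrDl.
  by exists x.
by rewrite normr0 addr_ge0.
Qed.

Lemma bounded_support_derive eta i : bounded_support eta -> bounded_support ('D_(e_ i) eta).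
Proof.
move=> [r r0 H]; exists (r + 1) => [|x xr]; first exact: addr_gt0.
have {}xr : r < `|x|.
  rewrite ltNge; apply/negP => xr'; apply: xr; rewrite -ball_normE /= sub0r normrN.
  by apply: le_lt_trans xr' _; rewrite ltrDl.
rewrite (@near_eq_derive _ _ _ eta (fun=> 0) x (e_ i)); first by rewrite derive_cst.
near=> y; apply: H; rewrite -ball_normE /= sub0r normrN; apply/negP; rewrite -leNgt.
apply/ltW; near: y.
have : `|y| @[y --> x] --> `|x| by exact: (cvg_norm (F := nbhs x)).
by move/cvgr_gt; apply.
Unshelve. all: by end_near. Qed.

Lemma bounded_support_lipschitz eta : Ck 1 setT eta -> bounded_support eta ->
  exists2 K, 0 <= K & forall x y, `|eta y - eta x| <= K * `|y - x|.
Proof.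
move=> Ce be.
have /choice[K HK] : forall i : 'I_m, exists K, 0 <= K /\ forall x, `|'D_(e_ i) eta x| <= K.
  move=> i; have [|K K0 HK] := bounded_support_bound _ (bounded_support_derive i be).
    exact: CkD1.
  by exists K.
exists (m%:R * \sum_i K i).
  by rewrite mulr_ge0 // sumr_ge0 // => i _; case: (HK i).
move=> x y; pose r := `|x| + `|y| + 1.
have r1 : 0 < r by rewrite ltr_wpDl // addr_ge0.
apply: (@grad_bound _ _ 0 r) => //.
- by rewrite -ball_normE /= sub0r normrN /r -addrA ltrDl ltr_wpDl.
- by rewrite -ball_normE /= sub0r normrN /r addrAC ltrDr ltr_wpDl.
- exact: Ck_sub Ce.
- move=> t i _; apply: le_trans ((HK i).2 _) _.
  by rewrite (bigD1 i) //= lerDl sumr_ge0 // => j _; case: (HK j).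
Qed.

Local Notation leb := (@leb R m).
Local Notation mfun V := (measurable_fun [set: borel 'rV[R]_m] (V : borel 'rV[R]_m -> R)).
Local Notation L1 V := (leb.-integrable [set: borel 'rV[R]_m] (EFin \o V)).

Lemma Ck_measurable eta k : Ck k setT eta -> mfun eta.
Proof. by move=> Ce; apply: continuous_borelR => x; exact: (Ck_cont Ce). Qed.

Lemma mfun_shift V h : mfun V -> mfun (fun y => V (y - h)).
Proof. exact: (@measurable_shift R m V (- h)). Qed.

Lemma L1M V eta K : L1 V -> mfun eta -> (forall x, `|eta x| <= K) -> L1 (fun y => V y * eta y).
Proof.
move=> iV me HK.
rewrite (_ : EFin \o _ = (EFin \o V) \* (EFin \o eta))%E; last by apply/funext => y; rewrite /= EFinM.
apply: integrableMl => //; exists K; split; first exact: num_real.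
by move=> M KM x _; exact: le_trans (HK x) (ltW KM).
Qed.

(** A convolution with the reflection of [eta]: the value at [x] averages [V] at the points [x + z]
    with [z] in the support of [eta]. A kernel supported in positive first coordinate thus looks
    into the half-space. *)
Definition conv V eta (x : 'rV[R]_m) : R := \int[leb]_y (V y * eta (y - x)).

Lemma L1conv V eta x : L1 V -> Ck 0 setT eta -> bounded_support eta -> L1 (fun y => V y * eta (y - x)).
Proof.
move=> iV Ce be; have [K _ HK] := bounded_support_bound Ce be.
by apply: (L1M iV) => //; apply: mfun_shift; exact: Ck_measurable Ce.
Qed.

Lemma L1abs V : L1 V -> L1 (fun y => `|V y|).
Proof. by move/(integrable_abse); rewrite (_ : abse \o _ = EFin \o (fun y => `|V y|)). Qed.

Lemma L1Zl V a : L1 V -> L1 (fun y => a * V y).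
Proof.
move=> iV; rewrite (_ : EFin \o _ = fun y => (a%:E * (EFin \o V) y)%E).
  exact: integrableZl.
by apply/funext => y; rewrite /= EFinM.
Qed.

Lemma L1D V V' : L1 V -> L1 V' -> L1 (fun y => V y + V' y).
Proof.
move=> iV iV'; rewrite (_ : EFin \o _ = (EFin \o V) \+ (EFin \o V'))%E.
  exact: integrableD.
by apply/funext => y; rewrite /= EFinD.
Qed.

Lemma L1B V V' : L1 V -> L1 V' -> L1 (fun y => V y - V' y).
Proof.
move=> iV iV'; rewrite (_ : EFin \o _ = (EFin \o V) \- (EFin \o V'))%E.
  exact: integrableB.
by apply/funext => y; rewrite /= EFinB.
Qed.

Lemma le_Rint_abs V W C : L1 V -> L1 W -> (forall y, `|W y| <= C * `|V y|) ->
  `|\int[leb]_y W y| <= C * \int[leb]_y `|V y|.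
Proof.
move=> iV iW H; apply: le_trans (le_normr_Rintegral _ iW) _ => //.
rewrite -RintegralZl //; last exact: L1abs.
by apply: le_Rintegral => //; [exact: L1abs|apply: L1Zl; exact: L1abs].
Qed.

Lemma conv_continuous V eta : L1 V -> Ck 1 setT eta -> bounded_support eta -> continuous (conv V eta).
Proof.
move=> iV Ce be x; have [K K0 HK] := bounded_support_lipschitz Ce be.
have C0 := CkS Ce.
set N1 := \int[leb]_y `|V y|; have I0 : 0 <= N1 by apply: Rintegral_ge0 => y _.
have KI : 0 < K * N1 + 1 by rewrite ltr_wpDl // mulr_ge0.
apply/(@cvgrPdist_le _ _ _ (nbhs x)) => e e0; near=> z.
have -> : conv V eta x - conv V eta z = \int[leb]_y (V y * eta (y - x) - V y * eta (y - z)).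
  by rewrite RintegralB //; exact: L1conv.
have iW : L1 (fun y => V y * eta (y - x) - V y * eta (y - z)) by apply: L1B; exact: L1conv.
have H : `|\int[leb]_y (V y * eta (y - x) - V y * eta (y - z))| <= (K * `|x - z|) * N1.
  apply: (le_Rint_abs iV iW) => y.
  rewrite -mulrBr normrM mulrC ler_wpM2r //; apply: le_trans (HK _ _) _.
  by rewrite ler_wpM2l // opprB addrC addrA subrK distrC.
apply: (le_trans H).
have zx : `|x - z| <= e / (K * N1 + 1).
  near: z; apply: (@cvgr_dist_le _ _ _ (nbhs x) _ id x); first exact: cvg_id.
  by rewrite divr_gt0.
move: zx; rewrite ler_pdivlMr // => zx; apply: le_trans zx.
by have := normr_ge0 (x - z); move: `|x - z| => t; nra.
Unshelve. all: by end_near. Qed.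

(** The sign comes from [x] entering through [eta (y - x)]. The derivative of [eta] is Lipschitz, so
    the difference quotients converge uniformly in [y], and the limit passes under the integral by
    an explicit estimate. *)
Lemma conv_derive V eta x i : L1 V -> Ck 2 setT eta -> bounded_support eta ->
  is_derive x (e_ i) (conv V eta) (- conv V ('D_(e_ i) eta) x).
Proof.
move=> iV Ce be.
have C1 : Ck 1 setT ('D_(e_ i) eta) by exact: CkD1.
have bD := bounded_support_derive i be.
have [K K0 HK] := bounded_support_lipschitz C1 bD.
have C0 : Ck 0 setT eta by apply: Ck_le Ce.
have C0' := CkS C1.
set N1 := \int[leb]_y `|V y|; have I0 : 0 <= N1 by apply: Rintegral_ge0 => y _.
have KI : 0 < K * N1 + 1 by rewrite ltr_wpDl // mulr_ge0.
have H : (h^-1 *: (conv V eta (h *: e_ i + x) - conv V eta x)) @[h --> (0:R)^'] -->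
    (- conv V ('D_(e_ i) eta) x).
  apply/cvgrPdist_le => e e0; near=> h.
  have h0 : h != 0 by near: h; exact: nbhs_dnbhs_neq.
  set z := _ + x.
  have i1 : L1 (fun y => V y * eta (y - z) - V y * eta (y - x)) by apply: L1B; exact: L1conv.
  have i2 := L1conv x iV C0' bD.
  have -> : - conv V ('D_(e_ i) eta) x - h^-1 *: (conv V eta z - conv V eta x) =
      \int[leb]_y ((-1) * (V y * 'D_(e_ i) eta (y - x)) - h^-1 * (V y * eta (y - z) - V y * eta (y - x))).
    rewrite RintegralB // ?RintegralZl //; last 2 first.
    - exact: L1Zl.
    - exact: L1Zl.
    by rewrite RintegralB ?mulN1r //; exact: L1conv.
  have iW := L1B (L1Zl (-1) i2) (L1Zl h^-1 i1).
  have B : `|\int[leb]_y ((-1) * (V y * 'D_(e_ i) eta (y - x)) - h^-1 * (V y * eta (y - z) - V y * eta (y - x)))|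
     <= (K * `|h|) * N1.
    apply: (le_Rint_abs iV iW) => y.
    have [t /andP[t0 t1] E] := @line_MVT R m eta (y - x) (e_ i) (- h) (fun t _ => Ck_derivable Ce I).
    have yz : y - z = y - x + (- h) *: e_ i by rewrite /z; apply/rowP => j; rewrite !mxE; ring.
    rewrite -mulrBr yz E; set A := 'D_(e_ i) eta (y - x); set B := 'D_(e_ i) eta (_ + _).
    have -> : -1 * (V y * A) - h^-1 * (V y * (B * - h)) = V y * (B - A) by field.
    rewrite normrM mulrC ler_wpM2r //.
    apply: le_trans (HK _ _) _; rewrite ler_wpM2l //.
    rewrite [X in `|X|](_ : _ = (t * - h) *: e_ i); last by apply/rowP => j; rewrite !mxE; ring.
    rewrite normrZ.
    have d1 : `|e_ i : 'rV[R]_m| <= 1.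
      by apply: mx_norm_le => // j; rewrite mxE; case: (_ && _); rewrite ?normr1 ?normr0.
    apply: le_trans (ler_wpM2l (normr_ge0 _) d1) _.
    by rewrite mulr1 normrM normrN ler_piMl // ger0_norm.
  apply: (le_trans B).
  have hx : `|h| <= e / (K * N1 + 1).
    by near: h; apply: dnbhs0_le; rewrite divr_gt0.
  move: hx; rewrite ler_pdivlMr // => hx; apply: le_trans hx.
  by have := normr_ge0 h; move: `|h| => t; nra.
apply: DeriveDef.
  by apply/cvg_ex; exists (- conv V ('D_(e_ i) eta) x); exact: H.
exact/cvg_lim.
Unshelve. all: by end_near. Qed.

Lemma conv_Cinf V eta : L1 V -> Cinf setT eta -> bounded_support eta -> Cinf setT (conv V eta).
Proof.
move=> iV Ce be k; elim: k eta Ce be => [|k IH] eta Ce be; first by split => // x _; exact: conv_continuous.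
split => [x _|i]; first exact: conv_continuous.
split => [x _|]; first exact: (ex_derive (is_derive := conv_derive x i iV (Ce 2) be)).
apply: (Ck_eq openT (f := fun x => - conv V ('D_(e_ i) eta) x)).
  by move=> x _; rewrite (derive_val (is_derive := conv_derive x i iV (Ce 2) be)).
apply: CkN; first exact: openT.
by apply: IH; [move=> j; exact: CkD1 (Ce j.+1)|exact: bounded_support_derive].
Qed.

Lemma conv_support V eta a b d x : (forall y, ~ box a b y -> V y = 0) ->
  (forall z, d <= `|z| -> eta z = 0) -> (forall y, box a b y -> d <= `|y - x|) -> conv V eta x = 0.
Proof.
move=> Va Ed H; rewrite /conv; transitivity (\int[leb]_y (0 : R)).
  apply: eq_Rintegral => y _; have [by_|/Va ->] := pselect (box a b y).
    by rewrite Ed ?mulr0 //; exact: H.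
  by rewrite mul0r.
by rewrite Rintegral_cst // mul0r.
Qed.

(* Jensen's inequality for the probability density [eta], followed by Tonelli's theorem. *)
Lemma conv_L2 V eta d e : 0 < d -> L1 V -> (sqint V < +oo)%E -> Cinf setT eta -> bounded_support eta ->
  (forall z, 0 <= eta z) -> \int[leb]_z eta z = 1 -> (forall z, d <= `|z| -> eta z = 0) ->
  (forall z, `|z| < d -> (sqint (fun x => (V (x + z) - V x)%R) <= e%:E)%E) ->
  (sqint (fun x => (conv V eta x - V x)%R) <= e%:E)%E.
Proof.
move=> d0 iV V2 Ce be e0 e1 ed Hd.
have mV : mfun V by have /measurable_EFinP := measurable_int _ iV.
have me : mfun eta by exact: Ck_measurable (Ce 0).
have [K K0 HK] := bounded_support_bound (Ce 0) be.
have E0 : (0 <= \int[leb]_z (eta z)%:E)%E by apply: integral_ge0 => z _; rewrite lee_fin.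
have Ee : (\int[leb]_z (eta z)%:E = 1)%E.
  move: E0 e1; rewrite /Rintegral; case: (integral _ _ _) => [r| |] //=; first by move=> _ ->.
  by move=> _ /esym/eqP; rewrite oner_eq0.
have ie : L1 eta.
  apply/integrableP; split; first exact/measurable_EFinP.
  by under eq_integral do rewrite gee0_abs ?lee_fin //; rewrite Ee ltry.
have mG : measurable_fun [set: borel 'rV[R]_m * borel 'rV[R]_m]
    (fun p => ((V (p.1 + p.2)%R - V p.1) ^+ 2 * eta p.2)%:E).
  apply/measurable_EFinP; apply: measurable_funM; last exact: measurableT_comp.
  apply: measurable_funX; apply: measurable_funB; last exact: measurableT_comp.
  suff ms : measurable_fun [set: borel 'rV[R]_m * borel 'rV[R]_m]
    ((fun p => p.1 + p.2) : borel 'rV[R]_m * borel 'rV[R]_m -> borel 'rV[R]_m) by exact: (measurableT_comp mV ms).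
  apply: measurable_rV => i.
  rewrite (_ : (fun t => _) = (fun t : borel 'rV[R]_m * borel 'rV[R]_m => t.1 0 i + t.2 0 i)).
    by apply: measurable_funD; apply: measurable_coord.
  by apply/funext => p; rewrite mxE.
have step x : (((conv V eta x - V x) ^+ 2)%:E <= \int[leb]_z ((V (x + z)%R - V x) ^+ 2 * eta z)%:E)%E.
  have iex : L1 (fun y => eta (y - x)).
    apply/integrableP; split; first by apply/measurable_EFinP; exact: (mfun_shift x me).
    under eq_integral do rewrite gee0_abs ?lee_fin //.
    rewrite (leb_shift (- x) (f := fun y => (eta y)%:E)) ?Ee ?ltry //; exact/measurable_EFinP.
  have Ex : \int[leb]_y eta (y - x) = 1.
    rewrite -e1 /Rintegral; congr fine; apply: (leb_shift (- x) (f := fun y => (eta y)%:E)).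
      exact/measurable_EFinP.
    by move=> y; rewrite lee_fin.
  have ic : L1 (fun y => V y * eta (y - x)) by exact: L1conv (Ce 0) be.
  have i2 : L1 (fun y => V y ^+ 2 * eta (y - x)).
    apply: (@L1M _ _ K) => //; last exact: mfun_shift.
    apply/integrableP; split; first exact: measurable_sqr.
    by under eq_integral do rewrite gee0_abs ?lee_fin ?sqr_ge0 //.
  set c := conv V eta x - V x.
  pose W y := (V y - V x) ^+ 2 * eta (y - x).
  have iW : L1 W.
    have := L1D (L1B i2 (L1Zl (2 * V x) ic)) (L1Zl (V x ^+ 2) iex).
    by congr (leb.-integrable _ _); apply/funext => y /=; congr (_%:E); rewrite /W; ring.
  (* Jensen's inequality by hand: [c ^+ 2] is the integral of
     [(2 c (V y - V x) - c ^+ 2) * eta (y - x)], and this integrand is at most [W y] because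
     [(V y - V x - c) ^+ 2] is nonnegative. *)
  have cE : c ^+ 2 = \int[leb]_y (2 * c * (V y * eta (y - x)) - (2 * c * V x + c ^+ 2) * eta (y - x)).
    rewrite RintegralB // ?RintegralZl //; last 2 first.
    - exact: L1Zl.
    - exact: L1Zl.
    by rewrite Ex mulr1 -/(conv V eta x) /c; ring.
  have cW : c ^+ 2 <= \int[leb]_y W y.
    rewrite cE; apply: le_Rintegral => //; first by apply: L1B; exact: L1Zl.
    move=> y _; rewrite /W; have := e0 (y - x); have := sqr_ge0 (V y - V x - c).
    by move: (eta _) => t; nra.
  have {}cW : ((c ^+ 2)%:E <= \int[leb]_y (W y)%:E)%E.
    have := cW; rewrite -lee_fin /Rintegral fineK //.
    exact: (integrable_fin_num measurableT iW).
  apply: (le_trans cW).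
  rewrite -(leb_shift x (f := fun y => (W y)%:E)).
  - rewrite le_eqVlt; apply/orP; left; apply/eqP; apply: eq_integral => z _.
    by rewrite /W addrK [(z + x)%R]addrC.
  - exact: measurable_int iW.
  - by move=> y; rewrite lee_fin mulr_ge0 ?sqr_ge0.
pose G (p : borel 'rV[R]_m * borel 'rV[R]_m) := ((V (p.1 + p.2)%R - V p.1) ^+ 2 * eta p.2)%:E.
have G0 p : (0 <= G p)%E by rewrite lee_fin mulr_ge0 ?sqr_ge0.
have mGx : measurable_fun [set: borel 'rV[R]_m] (fun x => \int[leb]_z G (x, z))%E.
  exact: measurable_fun_fubini_tonelli_F.
have H1 : (sqint (fun x => (conv V eta x - V x)%R) <= \int[leb]_x \int[leb]_z G (x, z))%E.
  apply: ge0_le_integral => //.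
  - by move=> x _; rewrite lee_fin sqr_ge0.
  - apply: measurable_sqr; apply: measurable_funB => //; apply: (@Ck_measurable _ 0).
    exact: conv_Cinf.
apply: (le_trans H1); rewrite fubini_tonelli //.
have -> : (e%:E = \int[leb]_z (e%:E * (eta z)%:E))%E.
  rewrite ge0_integralZl_EFin //.
  - by rewrite Ee mule1.
  - by move=> z _; rewrite lee_fin.
  - exact/measurable_EFinP.
  - by have := le_trans (sqint_ge0 _) (Hd 0 _); rewrite lee_fin; apply; rewrite normr0.
apply: ge0_le_integral => //.
- by move=> z _; exact: integral_ge0.
- exact: measurable_fun_fubini_tonelli_G.
- by apply: measurable_funeM; exact/measurable_EFinP.
move=> z _; have -> : (\int[leb]_x G (x, z) = (eta z)%:E * sqint (fun x => (V (x + z) - V x)%R))%E.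
  rewrite /sqint -ge0_integralZl_EFin //.
  - by apply: eq_integral => x _; rewrite /G /= mulrC EFinM.
  - by move=> x _; rewrite lee_fin sqr_ge0.
  - by apply: measurable_sqr; apply: measurable_funB => //; exact: measurable_shift.
have [zd|zd] := ltP `|z| d; last by rewrite ed // mule0 mul0e.
by rewrite muleC; apply: lee_wpmul2r; [rewrite lee_fin|exact: Hd].
Qed.

(* The support lies in the half-space where coordinate [i] is positive, so that convolution at a
   boundary point only sees interior values. *)
Lemma mollifier_exists (i : 'I_m) d : 0 < d -> exists eta, [/\ Cinf setT eta, bounded_support eta,
   forall z, 0 <= eta z, \int[leb]_z eta z = 1 & exists2 s, 0 < s &
   forall z, eta z != 0 -> s < z 0 i /\ `|z| < d].
Proof.
(* The bump has centre [2 s e_ i] and radius [s], so its support lies between the heights [s] and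
   [3 s = d]. *)
move=> d0; pose s := d / 3; have s0 : 0 < s by rewrite divr_gt0.
pose c : 'rV[R]_m := (2 * s) *: e_ i.
pose b := bump c s.
have ciE j : c 0 j = if j == i then 2 * s else 0 by rewrite !mxE eqxx /=; case: eqP => _; rewrite ?mulr1 ?mulr0.
have bsupp z : b z != 0 -> s < z 0 i /\ `|z| < d.
  have [bz _|/(bump_out s0)] := pselect (ball c s z); last by rewrite /b => ->; rewrite eqxx.
  have {}bz := (ball_coordP _ _ s0).1 bz; split.
    by have := bz i; rewrite ciE eqxx ltr_norml => /andP[_]; lra.
  have : ball (0 : 'rV[R]_m) d z.
    apply/(ball_coordP _ _ d0) => j; have := bz j; rewrite ciE mxE !ltr_norml.
    by case: eqP => _ /andP[b1 b2]; apply/andP; split; move: s0 b1 b2; rewrite /s; lra.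
  by rewrite -ball_normE /= sub0r normrN.
have Cb : Cinf setT b by exact: bump_Cinf.
have bb : bounded_support b.
  exists d => // x bx; apply/eqP; apply: contrapT => /negP /bsupp[_ xd]; apply: bx.
  by rewrite -ball_normE /= sub0r normrN.
have b0 z : 0 <= b z by exact: bump_ge0.
have mb : mfun b by exact: Ck_measurable (Cb 0).
have mE : measurable_fun [set: borel 'rV[R]_m] (fun z => (b z)%:E) by exact/measurable_EFinP.
have [K K0 HK] := bounded_support_bound (Cb 0) bb.
pose Q := box (const_mx (- d)) (const_mx d) : set (borel 'rV[R]_m).
have mQ : measurable Q by exact: box_borel.
have Ifin : (\int[leb]_z (b z)%:E < +oo)%E.
  apply: (@le_lt_trans _ _ (\int[leb]_z (K%:E * (\1_Q z)%:E))%E).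
    apply: ge0_le_integral => //.
    - by move=> z _; rewrite lee_fin.
    - by apply: measurable_funeM; exact/measurable_EFinP/measurable_indic.
    move=> z _; rewrite -EFinM lee_fin indicE.
    have [/eqP -> |bz] := boolP (b z == 0); first by rewrite mulr_ge0.
    rewrite mem_set ?mulr1; first by apply: le_trans (HK z); exact: ler_norm.
    move=> j; rewrite !mxE -ltr_norml; apply: le_lt_trans (le_mx_norm _ _) _.
    exact: (bsupp _ bz).2.
  rewrite ge0_integralZl_EFin // ?integral_indic ?setIT //.
  - by rewrite [X in (_ * X)%E](_ : _ = (vol (const_mx (- d)) (const_mx d : 'rV[R]_m))%:E) ?ltry //; exact: leb_box.
  - by apply/measurable_EFinP; exact: measurable_indic.
have Ipos : (0 < \int[leb]_z (b z)%:E)%E.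
  rewrite lt0e integral_ge0 ?andbT; last by move=> z _; rewrite lee_fin.
  apply/negP => /eqP I0.
  have : (\int[leb]_z `|(b z)%:E| = 0)%E by under eq_integral do rewrite gee0_abs ?lee_fin //.
  move=> /(ae_eq_integral_abs _ measurableT mE)[N [mN N0 HN]].
  pose B := box (c - const_mx s) (c + const_mx s).
  have BN : B `<=` N.
    move=> z Bz; apply: HN => /(_ Logic.I) /= /eqP; apply/negP; rewrite eqe gt_eqF //.
    apply: bump_gt0 => //; apply/(ball_coordP _ _ s0) => j.
    by have := Bz j; rewrite !mxE distrC ltr_norml; lra.
  have : (leb (B : set (borel 'rV[R]_m)) <= 0)%E.
    by rewrite -N0; apply: le_measure => //; rewrite inE //; exact: box_borel.
  apply/negP; rewrite -ltNge (_ : leb B = (vol (c - const_mx s) (c + const_mx s))%:E); last exact: leb_box.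
  by rewrite lte_fin; apply: prodr_gt0 => j _; rewrite !mxE lt_max; apply/orP; right; move: s0; lra.
pose I := \int[leb]_z b z.
have I0 : 0 < I by rewrite fine_gt0 // Ipos.
have ib : L1 b.
  by apply/integrableP; split => //; under eq_integral do rewrite gee0_abs ?lee_fin //.
exists (fun z => I^-1 * b z); split.
- by move=> k; apply: CkM; [exact: openT|exact: Ck_cst|exact: Cb].
- by case: bb => r r0 H; exists r => // x /H ->; rewrite mulr0.
- by move=> z; rewrite mulr_ge0 // invr_ge0 ltW.
- by rewrite RintegralZl // mulVf // gt_eqF.
- by exists s => // z bz; apply: bsupp; apply: contra_neq bz => ->; rewrite mulr0.
Qed.

End TestFunctions.

(** * Positive definite matrices *)

Section PositiveDefinite.
Context {R : realType} {m : nat}.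
Implicit Types (A : 'M[R]_m) (w z : 'rV[R]_m).

Definition bform A w z : R := (w *m A *m z^T) 0 0.

Definition posdef A := A^T = A /\ forall w, w != 0 -> 0 < bform A w w.

Lemma bformDl A w1 w2 z : bform A (w1 + w2) z = bform A w1 z + bform A w2 z.
Proof. by rewrite /bform !mulmxDl mxE. Qed.

Lemma bformZl A a w z : bform A (a *: w) z = a * bform A w z.
Proof. by rewrite /bform -!scalemxAl mxE. Qed.

Lemma bformE A w z : bform A w z = \sum_i \sum_j w 0 i * A i j * z 0 j.
Proof.
rewrite /bform mxE exchange_big /=; apply: eq_bigr => j _.
by rewrite !mxE mulr_suml.
Qed.

Lemma bformC A w z : A^T = A -> bform A w z = bform A z w.
Proof.
move=> As; rewrite !bformE exchange_big; apply: eq_bigr => i _; apply: eq_bigr => j _ /=.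
by rewrite -{1}As mxE; ring.
Qed.

Lemma bformDr A w z1 z2 : bform A w (z1 + z2) = bform A w z1 + bform A w z2.
Proof. by rewrite /bform linearD /= mulmxDr mxE. Qed.

Lemma bformZr A a w z : bform A w (a *: z) = a * bform A w z.
Proof. by rewrite /bform linearZ /= -scalemxAr mxE. Qed.

Lemma bform0l A z : bform A 0 z = 0.
Proof. by rewrite /bform !mul0mx mxE. Qed.

Lemma posdef_ge0 A w : posdef A -> 0 <= bform A w w.
Proof.
by move=> [_ H]; have [->|/H/ltW//] := eqVneq w 0; rewrite bform0l.
Qed.

Lemma sqr_norm_gt0 w : w != 0 -> 0 < \sum_i w 0 i ^+ 2.
Proof.
move=> w0; rewrite lt0r sumr_ge0 ?andbT; last by move=> i _; exact: sqr_ge0.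
apply: contra_neq w0 => /eqP; rewrite psumr_eq0; last by move=> i _; exact: sqr_ge0.
by move=> /allP H; apply/rowP => i; rewrite mxE; apply/eqP; rewrite -sqrf_eq0; exact: H.
Qed.

Lemma posdef_unit A : posdef A -> A \in unitmx.
Proof.
move=> [_ H]; rewrite -row_free_unit; apply: inj_row_free => w wA.
by apply/eqP; apply: contraT => /H; rewrite /bform wA mul0mx mxE ltxx.
Qed.

(* [det ((1 - t) + t A)] does not vanish on [0, 1] and equals 1 at 0. *)
Lemma posdef_det_gt0 A : posdef A -> 0 < \det A.
Proof.
move=> pA; have := posdef_unit pA; rewrite unitmxE unitfE => d0.
rewrite lt_neqAle eq_sym d0 /= leNgt; apply/negP => dA.
pose P : 'M[{poly R}]_m := \matrix_(i, j) (((i == j)%:R : R)%:P * (1 - 'X) + (A i j)%:P * 'X).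
have PE t : (\det P).[t] = \det ((1 - t)%:M + t *: A).
  rewrite -[LHS]/(horner_eval t (\det P)) -det_map_mx; congr determinant.
  apply/matrixP => i j; rewrite [LHS]mxE /= /horner_eval [P _ _]mxE !hornerE !mxE.
  by case: (i == j); rewrite ?mulr1n ?mulr0n; ring.
have [t /andP[t0 t1] /eqP tr] : exists2 t, 0 <= t <= 1 & root (- \det P) t.
  apply: poly_ivt => //; rewrite !hornerN !PE subr0 scale0r addr0 det1 subrr scale1r.
  rewrite (_ : _ + A = A); last by apply/matrixP => i j; rewrite !mxE mul0rn add0r.
  by rewrite lerN10 oppr_ge0 ltW.
have : (1 - t)%:M + t *: A \notin unitmx.
  by rewrite unitmxE unitfE -PE; move: tr; rewrite hornerN => /eqP; rewrite oppr_eq0 => ->.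
rewrite -row_free_unit => /negP; apply; apply: inj_row_free => w wA.
apply/eqP; apply: contraT => w0.
have := posdef_ge0 w pA; have := (pA.2 _ w0); have := sqr_norm_gt0 w0.
have : bform ((1 - t)%:M + t *: A) w w = 0 by rewrite /bform wA mul0mx mxE.
have -> : bform ((1 - t)%:M + t *: A) w w = (1 - t) * (\sum_i w 0 i ^+ 2) + t * bform A w w.
  rewrite /bform mulmxDr mulmxDl mxE mul_mx_scalar -scalemxAr -!scalemxAl !mxE.
  by congr (_ * _ + _); apply: eq_bigr => i _; rewrite mxE expr2.
by move: (\sum_i _) (bform _ _ _) => p q; nra.
Qed.

Lemma posdef_inv A : posdef A -> posdef (invmx A).
Proof.
move=> pA; have uA := posdef_unit pA; split; first by rewrite trmx_inv pA.1.
move=> w w0; have -> : bform (invmx A) w w = bform A (w *m invmx A) (w *m invmx A).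
  by rewrite /bform mulmxKV // trmx_mul trmx_inv pA.1 mulmxA.
apply: pA.2; apply: contra_neq w0 => w0.
by rewrite -[w](mulmxKV uA) w0 mul0mx.
Qed.

(** Cauchy-Schwarz for [invmx A] and the vectors [w] and [e *m A]: their pairing is [w 0 k], and the
    square of the second is [A k k]. Applied to the metric, it bounds weak partial derivatives by
    the norm of the gradient. *)
Lemma coord_le_bform A w k : posdef A -> w 0 k ^+ 2 <= A k k * bform (invmx A) w w.
Proof.
move=> pA; have pI := posdef_inv pA; have uA := posdef_unit pA.
pose e : 'rV[R]_m := delta_mx 0 k.
have AE : bform A e e = A k k.
  rewrite /bform /e -rowE trmx_delta -colE !mxE //.
have A0 : 0 < A k k.
  rewrite -AE; apply: pA.2; apply/negP => /eqP/rowP/(_ k)/eqP.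
  by rewrite !mxE !eqxx oner_eq0.
have E1 z : bform (invmx A) z (e *m A) = z 0 k.
  rewrite /bform trmx_mul pA.1 mulmxA mulmxKV // /e trmx_delta -colE mxE //.
have := posdef_ge0 (w - (w 0 k / A k k) *: (e *m A)) pI.
rewrite -scaleNr !(bformDl, bformDr, bformZl, bformZr) !E1 (bformC _ _ pI.1) !E1.
have -> : (e *m A) 0 k = A k k by rewrite /e -rowE mxE.
move=> H; rewrite -ler_pdivrMl //; move: H.
have An : A k k != 0 by rewrite gt_eqF.
set q := bform _ _ _ => H; rewrite -subr_ge0; apply: (le_trans H).
by rewrite le_eqVlt; apply/orP; left; apply/eqP; field.
Qed.

(** Expand the square of [t *: w - z] and divide by [t]. *)
Lemma bform_young A w z t : posdef A -> 0 < t ->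
  bform A (w + z) (w + z) <= (1 + t) * bform A w w + (1 + t^-1) * bform A z z.
Proof.
move=> pA t0; have := posdef_ge0 (t *: w - z) pA.
rewrite -scaleN1r !(bformDl, bformDr, bformZl, bformZr) (bformC z w pA.1).
set a := bform A w w; set b := bform A w z; set c := bform A z z => H.
rewrite -subr_ge0 (_ : _ - _ = t^-1 * (t * (t * a + -1 * b) + -1 * (t * b + -1 * c))).
  rewrite mulr_ge0 ?invr_ge0 ?(ltW t0) //; apply: (le_trans H).
  by rewrite le_eqVlt; apply/orP; left; apply/eqP; ring.
by field; rewrite gt_eqF.
Qed.

Lemma bform_suml A I (r : seq I) (P : pred I) (F : I -> 'rV[R]_m) z :
  bform A (\sum_(i <- r | P i) F i) z = \sum_(i <- r | P i) bform A (F i) z.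
Proof. by elim/big_rec2 : _ => [|i y x _ <-]; rewrite ?bform0l ?bformDl. Qed.

(** The weighted variance of the [F i] around their mean [S] is nonnegative; expanding it gives the
    difference of the two sides. *)
Lemma bform_jensen A I (r : seq I) (P : pred I) (chi : I -> R) (F : I -> 'rV[R]_m) : posdef A ->
  (forall i, P i -> 0 <= chi i) -> \sum_(i <- r | P i) chi i = 1 ->
  bform A (\sum_(i <- r | P i) chi i *: F i) (\sum_(i <- r | P i) chi i *: F i) <=
  \sum_(i <- r | P i) chi i * bform A (F i) (F i).
Proof.
move=> pA c0 c1; set S := \sum_(i <- r | P i) chi i *: F i.
have : 0 <= \sum_(i <- r | P i) chi i * bform A (F i - S) (F i - S).
  by apply: sumr_ge0 => i Pi; rewrite mulr_ge0 ?c0 // posdef_ge0.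
have -> : \sum_(i <- r | P i) chi i * bform A (F i - S) (F i - S) =
  \sum_(i <- r | P i) (chi i * bform A (F i) (F i) + (- 2%:R * (chi i * bform A (F i) S) + chi i * bform A S S)).
  apply: eq_bigr => i _; rewrite -scaleN1r !(bformDl, bformDr, bformZl, bformZr) (bformC S (F i) pA.1).
  by ring.
rewrite !big_split /= -mulr_sumr -mulr_suml c1 mul1r.
have -> : \sum_(i <- r | P i) chi i * bform A (F i) S = bform A S S.
  by rewrite {2}/S bform_suml; apply: eq_bigr => i _; rewrite bformZl.
by move: (\sum_(i <- r | P i) _) (bform A S S) => a b; lra.
Qed.

Lemma bform_sum_le A (K : finType) (F : K -> 'rV[R]_m) : posdef A ->
  bform A (\sum_i F i) (\sum_i F i) <= #|K|%:R * \sum_i bform A (F i) (F i).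
Proof.
move=> pA; have [K0|K0] := posnP #|K|.
  have P0 : (xpredT : pred K) =1 xpred0 by move=> i; have := card0_eq K0 i.
  by rewrite !(eq_bigl _ _ P0) !big_pred0_eq bform0l mulr0.
set k : R := #|K|%:R; have k0 : 0 < k by rewrite ltr0n.
have := @bform_jensen A K (index_enum K) xpredT (fun=> k^-1) (fun i => k *: F i) pA.
have -> : \sum_i (k^-1 *: (k *: F i)) = \sum_i F i.
  by apply: eq_bigr => i _; rewrite scalerA mulVf ?scale1r // gt_eqF.
move=> /(_ (fun i _ => _)) H; apply: le_trans (H _ _) _.
- by rewrite invr_ge0 ltW.
- by rewrite sumr_const -mulr_natl -/k mulfV // gt_eqF.
rewrite mulr_sumr; apply: ler_sum => i _; rewrite bformZl bformZr !mulrA mulVf ?mul1r //.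
by rewrite gt_eqF.
Qed.

Lemma bform_le_sqr A w C : (forall i j, `|A i j| <= C) -> bform A w w <= (m%:R * C) * \sum_i w 0 i ^+ 2.
Proof.
move=> H; rewrite bformE.
apply: (@le_trans _ _ (\sum_i \sum_j (C / 2 * w 0 i ^+ 2 + C / 2 * w 0 j ^+ 2))).
  apply: ler_sum => i _; apply: ler_sum => j _.
  have := H i j; rewrite ler_norml => /andP[]; move: (A i j) (w 0 i) (w 0 j) => a x y a1 a2.
  have := sqr_ge0 (x + y); have := sqr_ge0 (x - y); nra.
set S := \sum_i w 0 i ^+ 2.
rewrite (eq_bigr (fun i => m%:R * (C / 2 * w 0 i ^+ 2) + C / 2 * S)); last first.
  by move=> i _; rewrite big_split /= sumr_const card_ord -[_ *+ m]mulr_natl -mulr_sumr.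
rewrite big_split /= sumr_const card_ord -[_ *+ m]mulr_natl -!mulr_sumr -/S.
by rewrite le_eqVlt; apply/orP; left; apply/eqP; field.
Qed.

End PositiveDefinite.

(** Cramer's rule. In a chart whose last coordinate is [f], the last diagonal entry of the inverse
    metric is [|grad f|^2], so this identity turns volume density times [|grad f|] into the area
    density of the slices. *)
Lemma invmx_last (R : realType) n (A : 'M[R]_n.+1) : A \in unitmx ->
  \det A * invmx A ord_max ord_max = \det (row' ord_max (col' ord_max A)).
Proof.
move=> uA; rewrite /invmx uA !mxE mulrA mulfV ?mul1r; last by move: uA; rewrite unitmxE unitfE.
by rewrite /cofactor -signr_odd oddD addbb expr0 mul1r.
Qed.

(** * Charts and the boundary *)

Lemma continuous_preimage_open (T U : topologicalType) (f : T -> U) (A : set T) (B : set U) :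
  open A -> open B -> (forall x : T, A x -> {for x, continuous f}) -> open (A `&` f @^-1` B).
Proof.
move=> oA oB cf; rewrite openE => x [Ax Bx]; apply: filterI; first exact: open_nbhs_nbhs.
by apply: cf => //; exact: open_nbhs_nbhs.
Qed.

Section ManifoldCharts.
Context {R : realType} {n : nat} {M : ptopologicalType} (X : smoothStructure R n M).
Notation e_ i := (delta_mx 0 i).
Implicit Types (c : chart R n M) (p : M) (x : 'rV[R]_n.+1).

Definition hopen : set 'rV[R]_n.+1 := [set x | 0 < x 0 ord0].

Lemma hopen_open : open hopen.
Proof.
apply: (@open_comp _ _ (fun x : 'rV[R]_n.+1 => x 0 ord0) [set t : R | 0 < t]).
  by move=> x _; exact: coord_continuous.
exact: open_gt.
Qed.

(** The coordinates of the interior points of the chart. Unlike the whole image, this set is open in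
    the space of row vectors, and partial derivatives make sense on it. *)
Definition ichart c : set 'rV[R]_n.+1 := cmap c @` cdom c `&` hopen.

Lemma chart_open c : atlas X c -> open (cdom c).
Proof. by move=> /(atlas_chart (s := X))[]. Qed.

Lemma cmapK c p : atlas X c -> cdom c p -> cinv c (cmap c p) = p.
Proof. by move=> /(atlas_chart (s := X))[] _ _ H _ _; exact: H. Qed.

Lemma cinvK c x : atlas X c -> ichart c x -> cmap c (cinv c x) = x.
Proof. by move=> Xc [[p cp <-] _]; rewrite cmapK. Qed.

Lemma cinv_dom c x : atlas X c -> ichart c x -> cdom c (cinv c x).
Proof. by move=> Xc [[p cp <-] _]; rewrite cmapK. Qed.

Lemma ichart_cmap c p : cdom c p -> 0 < cmap c p 0 ord0 -> ichart c (cmap c p).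
Proof. by move=> cp p0; split => //; exists p. Qed.

Lemma cmap_ge0 c p : atlas X c -> cdom c p -> 0 <= cmap c p 0 ord0.
Proof.
move=> /(atlas_chart (s := X))[] _ [W [_ WE]] _ _ _ cp.
have : (cmap c @` cdom c) (cmap c p) by exists p.
by rewrite WE => -[].
Qed.

Lemma ichart_open c : atlas X c -> open (ichart c).
Proof.
move=> /(atlas_chart (s := X))[] _ [W [oW WE]] _ _ _.
have -> : ichart c = W `&` hopen.
  rewrite /ichart WE; apply/seteqP; split=> [x [[? _] ?]|x [? x0]]; split => //; split => //.
  by rewrite /halfspace /= ltW.
exact: (openI oW hopen_open).
Qed.

Lemma cmap_continuous c p : atlas X c -> cdom c p -> {for p, continuous (cmap c)}.
Proof.
move=> Xc cp; have [oc _ _ cc _] := atlas_chart Xc.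
by move: cc; rewrite continuous_open_subspace // => /(_ p); apply; rewrite inE.
Qed.

Lemma cinv_continuous c x : atlas X c -> ichart c x -> {for x, continuous (cinv c)}.
Proof.
move=> Xc cx; have [_ _ _ _ cc] := atlas_chart Xc.
have sI : ichart c `<=` cmap c @` cdom c by move=> y [].
have := (continuous_subspaceW sI cc); rewrite continuous_open_subspace; last exact: ichart_open.
by apply; rewrite inE.
Qed.

Definition tdom c c' : set 'rV[R]_n.+1 := ichart c `&` cinv c @^-1` cdom c'.

Lemma tdomP c c' p : atlas X c -> cdom c p -> cdom c' p -> 0 < cmap c p 0 ord0 -> tdom c c' (cmap c p).
Proof. by move=> Xc cp c'p p0; split; [exact: ichart_cmap|rewrite /preimage /= cmapK]. Qed.

Lemma tdom_open c c' : atlas X c -> atlas X c' -> open (tdom c c').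
Proof.
move=> Xc Xc'; apply: continuous_preimage_open; [exact: ichart_open|exact: chart_open|].
by move=> x cx; exact: cinv_continuous.
Qed.

Lemma trans_Cinf c c' j : atlas X c -> atlas X c' ->
  Cinf (tdom c c') (fun x => cmap c' (cinv c x) 0 j).
Proof.
move=> Xc Xc' k; apply: Ck_local => x tx.
have [/(_ j) st _] := atlas_compatible Xc Xc'.
have cx : (cmap c @` (cdom c `&` cdom c')) x.
  exists (cinv c x); last exact: (cinvK Xc tx.1).
  by split; [exact: (cinv_dom Xc tx.1)|exact: tx.2].
have [U [F [oU Ux CF FE]]] := st x cx.
have oO : open (U `&` tdom c c') by apply: openI => //; exact: tdom_open.
exists (U `&` tdom c c'); split => //.
apply: (Ck_eq oO (f := F)); last by apply: Ck_sub (CF k) => y [].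
move=> y [Uy [cy c'y]]; apply: FE => //; exists (cinv c y); last exact: cinvK.
by split => //; exact: cinv_dom.
Qed.

(* In the coordinates of c' the function [x_0] of c would have an interior minimum, hence the
   transition map would have a singular differential. *)
Lemma interior_invariant c c' p : atlas X c -> atlas X c' -> cdom c p -> cdom c' p ->
  0 < cmap c' p 0 ord0 -> 0 < cmap c p 0 ord0.
Proof.
move=> Xc Xc' cp c'p p'0; rewrite lt0r cmap_ge0 // andbT; apply/eqP => p0.
pose T y : 'rV[R]_n.+1 := cmap c (cinv c' y); pose x' := cmap c' p.
have tx : tdom c' c x' by exact: tdomP.
have oT : open (tdom c' c) by exact: tdom_open.
have CT j := trans_Cinf j Xc' Xc.
have Tx : T x' = cmap c p by rewrite /T cmapK.
have T0 i : 'D_(e_ i) (fun y => T y 0 ord0) x' = 0.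
  have [r /= r0 rT] := (nbhs_ballP _ _).1 (open_nbhs_nbhs (conj oT tx)).
  have lin t : t \in `]- r, r[ -> tdom c' c (x' + t *: e_ i).
    rewrite in_itv /= => /andP[t1 t2]; apply: rT; apply/(ball_coordP _ _ r0) => j.
    rewrite !mxE opprD addrA subrr sub0r normrN normrM.
    have : `|((0 == 0 :> 'I_1) && (j == i))%:R : R| <= 1 by case: (_ && _); rewrite ?normr1 ?normr0 //.
    have : `|t| < r by rewrite ltr_norml t1.
    by move=> a b; apply: le_lt_trans a; rewrite ler_piMr.
  rewrite derive_line.
  have H : is_derive (0 : R) 1 (fun s : R => T (x' + s *: e_ i) 0 ord0) 0.
    apply: (@derive1_at_min _ _ (- r) r).
    - by rewrite ge0_cp // ltW.
    - move=> t tr; have := @line_derive R _ (fun y => T y 0 ord0) x' (e_ i) t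
        (Ck_derivable (CT ord0 1) (lin t tr)).
      by move=> H; exact: (ex_derive (is_derive := H)).
    - by rewrite in_itv /= oppr_lt0 r0.
    - move=> t /lin tt; rewrite scale0r addr0 Tx p0; apply: cmap_ge0 => //.
      exact: tt.2.
  exact: (derive_val (is_derive := H)).
have [/(_ _) st _] := atlas_compatible Xc Xc'.
have cx : (cmap c @` (cdom c `&` cdom c')) (cmap c p) by exists p.
pose j0 : 'I_n.+1 := ord0.
(* The transition from [c] to [c'] is smooth near [cmap c p] only through an extension [F] across
   the boundary. Composed with [T], the extension is the [k]-th coordinate near [x'], and the chain
   rule exhibits the inverse of the differential of [T], one row of which vanishes by [T0]. *)
have key k : exists d : 'rV[R]_n.+1, forall i, \sum_j d 0 j * 'D_(e_ i) (fun y => T y 0 j) x' = (k == i)%:R.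
  have [U [F [oU Ux CF FE]]] := st k _ cx.
  exists (\row_j 'D_(e_ j) F (T x')) => i.
  have H : is_derive x' (e_ i) (fun y => F (T y))
      (\sum_j 'D_(e_ j) F (T x') * 'D_(e_ i) (fun y => T y 0 j) x').
    apply: (is_derive_compF oU (CF 1)); first by rewrite Tx.
    by move=> j; exact: Ck_derivable (CT j 1) tx.
  under eq_bigr do rewrite mxE.
  rewrite -(derive_val (is_derive := H)).
  have cT : {for x', continuous T}.
    apply: (@continuous_comp _ _ _ (cinv c') (cmap c)); first exact: cinv_continuous tx.1.
    by apply: cmap_continuous => //; exact: tx.2.
  rewrite -[RHS](_ : 'D_(e_ i) (fun y : 'rV[R]_n.+1 => y 0 k) x' = _); last first.
    by rewrite (derive_val (is_derive := is_derive_coord x' (e_ i) k)) mxE eqxx.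
  apply: near_eq_derive.
  have : nbhs x' (T @^-1` U `&` tdom c' c).
    apply: filterI; last exact: open_nbhs_nbhs.
    by apply: cT; rewrite Tx; exact: open_nbhs_nbhs.
  apply: filterS => y [Uy [cy ccy]]; rewrite FE //.
    by rewrite /T cmapK // cinvK.
  exists (cinv c' y) => //; split => //; exact: cinv_dom.
have /choice[d dE] := key.
pose D : 'M[R]_n.+1 := \matrix_(k, j) d k 0 j.
pose E : 'M[R]_n.+1 := \matrix_(j, i) 'D_(e_ i) (fun y => T y 0 j) x'.
have DE : D *m E = 1%:M.
  apply/matrixP => k i; rewrite !mxE -dE; apply: eq_bigr => j _; by rewrite !mxE.
have := mulmx1C DE => /matrixP/(_ ord0 ord0); rewrite !mxE eqxx big1; last first.
  by move=> j _; rewrite !mxE T0 mul0r.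
by move/esym/eqP; rewrite oner_eq0.
Qed.

(** [mboundary] is defined by the existence of one chart; by [interior_invariant] every chart gives
    the same answer. *)
Lemma mboundaryP c p : atlas X c -> cdom c p -> (mboundary X p <-> cmap c p 0 ord0 = 0).
Proof.
move=> Xc cp; split=> [[c' [Xc' c'p p0]]|]; last by exists c.
apply/eqP; have := cmap_ge0 Xc cp; rewrite le0r => /orP[//|p1].
by have := interior_invariant Xc' Xc c'p cp p1; rewrite p0 ltxx.
Qed.

Lemma mboundaryPn c p : atlas X c -> cdom c p -> (~ mboundary X p <-> 0 < cmap c p 0 ord0).
Proof.
move=> Xc cp; rewrite (mboundaryP Xc cp) lt0r cmap_ge0 // andbT; split => [H|/eqP//].
exact/eqP.
Qed.

Lemma closed_mboundary : closed (mboundary X).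
Proof.
rewrite -openC openE => p /= np.
have [c Xc cp] := atlas_cover X p.
have p0 := (mboundaryPn Xc cp).1 np.
have H : nbhs p (cdom c `&` cmap c @^-1` hopen).
  apply: open_nbhs_nbhs; split => //.
  apply: continuous_preimage_open; [exact: chart_open|exact: hopen_open|].
  by move=> q cq; exact: cmap_continuous.
by apply: filterS H => q [cq q0]; exact/(mboundaryPn Xc cq).
Qed.

Lemma ichartE c x : atlas X c -> ichart c x <-> exists p, [/\ cdom c p, ~ mboundary X p & cmap c p = x].
Proof.
move=> Xc; split=> [[[p cp <-] p0]|[p [cp bp <-]]].
  by exists p; split => //; exact/(mboundaryPn Xc cp).
by apply: ichart_cmap => //; exact/(mboundaryPn Xc cp).
Qed.

Definition rechart c (V : set 'rV[R]_n.+1) (Phi Psi : 'rV[R]_n.+1 -> 'rV[R]_n.+1) : chart R n M :=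
  Chart (cdom c `&` cmap c @^-1` V) (Phi \o cmap c) (cinv c \o Psi).

(** * New members of the maximal atlas *)

Section rechart.
Variables (c : chart R n M) (V V' : set 'rV[R]_n.+1) (Phi Psi : 'rV[R]_n.+1 -> 'rV[R]_n.+1).
Hypotheses (Xc : atlas X c) (oV : open V) (Vc : V `<=` ichart c) (oV' : open V') (V'h : V' `<=` hopen).
Hypotheses (PV : forall x, V x -> V' (Phi x)) (PV' : forall x, V' x -> V (Psi x)).
Hypotheses (PK : forall x, V x -> Psi (Phi x) = x) (PK' : forall x, V' x -> Phi (Psi x) = x).
Hypotheses (CP : forall j, Cinf V (fun x => Phi x 0 j)) (CP' : forall j, Cinf V' (fun x => Psi x 0 j)).

Let c2 := rechart c V Phi Psi.

Lemma rechart_image : cmap c2 @` cdom c2 = V'.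
Proof.
apply/seteqP; split=> [_ [p [cp Vp] <-]|x V'x]; first exact: PV.
have Vx := PV' V'x; exists (cinv c (Psi x)).
  by split; [exact: cinv_dom (Vc Vx)|rewrite /preimage /= cinvK //; exact: Vc].
by rewrite /= cinvK ?PK' //; exact: Vc.
Qed.

Let cont_rV (U : set 'rV[R]_n.+1) (F : 'rV[R]_n.+1 -> 'rV[R]_n.+1) x : (forall j, Cinf U (fun x => F x 0 j)) -> U x ->
  {for x, continuous F}.
Proof.
move=> CF Ux; have -> : F = (fun y => \row_j F y 0 j) by apply/funext => y; apply/rowP => j; rewrite mxE.
by apply: (row_cvg (F := nbhs x)) => j; exact: (Ck_cont (CF j 0) Ux).
Qed.

Lemma rechart_chart : is_chart c2.
Proof.
split.
- apply: continuous_preimage_open => //; first exact: chart_open.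
  by move=> p cp; exact: cmap_continuous.
- exists V'; split => //; rewrite rechart_image; apply/seteqP; split => [x Vx|x []//].
  by split => //; rewrite /halfspace /= ltW //; exact: V'h.
- by move=> p [cp Vp]; rewrite /= PK // cmapK.
- apply: continuous_in_subspaceT => p; rewrite inE => -[cp Vp].
  apply: (@continuous_comp _ _ _ (cmap c) Phi); first exact: cmap_continuous.
  exact: (cont_rV CP).
- rewrite rechart_image; apply: continuous_in_subspaceT => x; rewrite inE => Vx.
  apply: (@continuous_comp _ _ _ Psi (cinv c)); first exact: (cont_rV CP').
  by apply: cinv_continuous => //; exact/Vc/PV'.
Qed.

(** By maximality only compatibility with each [c'] of the atlas has to be checked. As [V] lies over
    interior points, [interior_invariant] places the overlap in the open part of [c'] too, and the
    transitions are composites of smooth maps between open sets. *)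
Lemma rechart_atlas : atlas X c2.
Proof.
apply: atlas_maximal; first exact: rechart_chart.
move=> c' Xc'; split => j x.
  move=> [p [[cp Vp] c'p] <-].
  have oU : open (V' `&` Psi @^-1` tdom c c').
    apply: continuous_preimage_open => //; first exact: tdom_open.
    by move=> y V'y; exact: (cont_rV CP').
  exists (V' `&` Psi @^-1` tdom c c'), (fun x => cmap c' (cinv c (Psi x)) 0 j); split => //.
    split; first exact: PV.
    by rewrite /preimage /= PK //; apply: tdomP => //; case: (Vc Vp).
  move=> k; apply: (@Ck_compF _ _ _ k _ _ (fun x => cmap c' (cinv c x) 0 j) Psi oU (tdom_open Xc Xc')).
  - by move=> y [].
  - by move=> l; apply: Ck_sub (CP' l k) => y [].
  - exact: trans_Cinf.
move=> [p [c'p [cp Vp]] <-].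
have p0 : 0 < cmap c' p 0 ord0.
  by apply: (interior_invariant Xc' Xc c'p cp); case: (Vc Vp).
pose T x : 'rV[R]_n.+1 := cmap c (cinv c' x).
have oU : open (tdom c' c `&` T @^-1` V).
  apply: continuous_preimage_open => //; first exact: tdom_open.
  by move=> y ty; apply: cont_rV ty => l; exact: trans_Cinf.
exists (tdom c' c `&` T @^-1` V), (fun x => Phi (T x) 0 j); split => //.
  by split; [exact: tdomP|rewrite /preimage /T /= cmapK].
move=> k; apply: (@Ck_compF _ _ _ k _ _ (fun x => Phi x 0 j) T oU oV).
- by move=> y [].
- by move=> l; apply: Ck_sub (trans_Cinf l Xc' Xc k) => y [].
- exact: CP.
Qed.

End rechart.

End ManifoldCharts.

(** * The volume in charts *)

Section MatrixSmooth.
Context {R : realType}.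

Lemma det_Ck m k p (U : set 'rV[R]_m) (G : 'rV[R]_m -> 'M[R]_p) : open U ->
  (forall i j, Ck k U (fun x => G x i j)) -> Ck k U (fun x => \det (G x)).
Proof.
move=> oU CG; rewrite /determinant; apply: Ck_sum => // s _.
by apply: CkM => //; [exact: Ck_cst|apply: Ck_prod => // i _].
Qed.

Lemma invmx_Ck m k p (U : set 'rV[R]_m) (G : 'rV[R]_m -> 'M[R]_p) i j : open U ->
  (forall x, U x -> \det (G x) != 0) ->
  (forall i j, Ck k U (fun x => G x i j)) -> Ck k U (fun x => invmx (G x) i j).
Proof.
move=> oU dG CG.
apply: (Ck_eq oU (f := fun x => (\det (G x))^-1 * ((-1) ^+ (j + i) * \det (row' j (col' i (G x)))))).
  by move=> x Ux; rewrite /invmx unitmxE unitfE dG // !mxE.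
apply: CkM => //; first by apply: CkV => //; exact: det_Ck.
apply: CkM => //; first exact: Ck_cst.
apply: det_Ck => // a b; apply: (Ck_eq oU (f := fun x => G x (lift j a) (lift i b))) => // x _.
by rewrite !mxE.
Qed.

End MatrixSmooth.

(** Only the slice where the first coordinate is 0 contributes to the outer integral, and it is a
    null set. This is why the boundary has no volume. *)
Lemma integralRn_first0 (R : realType) m (f : 'rV[R]_m.+1 -> \bar R) : (forall x : 'rV[R]_m.+1, x 0%R ord0 != 0%R -> f x = 0%E) ->
  integralRn f = 0%E.
Proof.
move=> H; rewrite integralRnS.
rewrite (_ : (fun t => _) = (fun t => integralRn (fun y => f (ins ord0 y t))) \_ [set 0%R]); last first.
  apply/funext => t; rewrite patchE; case: ifPn => // t0.
  have {}t0 : t != 0%R by apply: contraNneq t0 => ->; rewrite inE.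
  rewrite (_ : (fun y => _) = fun=> 0%E).
    by elim: (m) => [//|k IH] /=; under eq_integral do rewrite IH; rewrite integral0.
  by apply/funext => y; apply: H; rewrite ins_at.
by rewrite -integral_mkcond integral_set1.
Qed.

Lemma bigsetU_ord_sup (T : Type) N (U : 'I_N -> set T) i : U i `<=` \big[setU/set0]_(j < N) U j.
Proof. by move=> x Ux; rewrite (bigD1 i) //=; left. Qed.

Section ManifoldMeasure.
Context {R : realType} {n : nat} {M : ptopologicalType} (X : smoothStructure R n M).
Context (g : riemannianMetric X).
Notation e_ i := (delta_mx 0 i).
Implicit Types (c : chart R n M) (p : M) (x : 'rV[R]_n.+1).
Local Notation gx c := (fun x => gmx g c (cinv c x)).

Lemma gmx_posdef c p : atlas X c -> cdom c p -> posdef (gmx g c p).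
Proof. by move=> Xc cp; split; [exact: gmx_sym|move=> w w0; exact: gmx_pos]. Qed.

Lemma smooth_on_Ck (A U : set 'rV[R]_n.+1) f k : open U -> U `<=` A -> smooth_on A f -> Ck k U f.
Proof.
move=> oU UA sf; apply: Ck_local => x Ux; have [V [F [oV Vx CF FE]]] := sf x (UA _ Ux).
exists (V `&` U); split => //; apply: (Ck_eq (openI oV oU) (f := F)).
  by move=> y [Vy Uy]; apply: FE => //; exact: UA.
by apply: Ck_sub (CF k) => y [].
Qed.

Lemma gmx_Ck c i j k : atlas X c -> Ck k (ichart c) (fun x => gmx g c (cinv c x) i j).
Proof.
move=> Xc; apply: (smooth_on_Ck (A := cmap c @` cdom c)); [exact: (ichart_open Xc)|by move=> x []|].
exact: gmx_smooth.
Qed.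

Lemma gmx_det_gt0 c x : atlas X c -> ichart c x -> 0 < \det (gx c x).
Proof. by move=> Xc cx; apply/posdef_det_gt0/gmx_posdef => //; exact: (cinv_dom Xc cx). Qed.

Definition cdens c : 'rV[R]_n.+1 -> R := (fun x => Num.sqrt (\det (gx c x))) \_ (ichart c).

(** [cinv c] is meaningful on the image of the chart only. Patched outside [ichart c] by a default
    point it becomes a Borel map on the whole space, and the density [cdens c] is 0 wherever the
    default is taken. *)
Definition cpt c : borel 'rV[R]_n.+1 -> borel M := (cinv c : borel 'rV[R]_n.+1 -> borel M) \_ (ichart c).

Lemma cptE c x : ichart c x -> cpt c x = cinv c x.
Proof. by move=> cx; rewrite /cpt patchE mem_set. Qed.

Lemma cdensE c x : ichart c x -> cdens c x = Num.sqrt (\det (gx c x)).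
Proof. by move=> cx; rewrite /cdens patchE mem_set. Qed.

Lemma cdens_out c x : ~ ichart c x -> cdens c x = 0.
Proof. by move=> cx; rewrite /cdens patchE memNset. Qed.

Lemma cdens_ge0 c x : 0 <= cdens c x.
Proof. by rewrite /cdens patchE; case: ifP => // _; exact: sqrtr_ge0. Qed.

Lemma measurable_ichart c : atlas X c -> measurable (ichart c : set (borel 'rV[R]_n.+1)).
Proof. by move=> Xc; apply: open_borel; exact: (ichart_open Xc). Qed.

Lemma measurable_cpt c : atlas X c -> measurable_fun [set: borel 'rV[R]_n.+1] (cpt c).
Proof.
move=> Xc; apply: (measurable_restrictT _ (measurable_ichart Xc)).1.
apply: within_continuous_borel; first exact: (measurable_ichart Xc).
by apply: continuous_in_subspaceT => x; rewrite inE => cx; exact: (cinv_continuous Xc).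
Qed.

Lemma measurable_cdens c : atlas X c -> measurable_fun [set: borel 'rV[R]_n.+1] (cdens c : borel 'rV[R]_n.+1 -> R).
Proof.
move=> Xc; apply: (measurable_restrictT _ (measurable_ichart Xc)).1.
apply: within_continuous_borelR; first exact: (measurable_ichart Xc).
apply: continuous_in_subspaceT => x; rewrite inE => cx.
apply: (@continuous_comp _ _ _ (fun x => \det (gx c x)) Num.sqrt); last exact: sqrt_continuous.
apply: (@Ck_cont _ _ 0 (ichart c)) => //; apply: det_Ck; first exact: (ichart_open Xc).
by move=> i j; exact: gmx_Ck.
Qed.

Definition intdom c : set M := cdom c `\` mboundary X.

Lemma intdom_open c : atlas X c -> open (intdom c).
Proof.
by move=> Xc; apply: openI; [exact: (chart_open Xc)|apply: closed_openC; exact: closed_mboundary].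
Qed.

Lemma intdomP c x : atlas X c -> ichart c x -> intdom c (cinv c x).
Proof.
move=> Xc /(ichartE _ Xc)[p [cp bp <-]]; by rewrite (cmapK Xc cp); split.
Qed.

Lemma ichart_intdom c p : atlas X c -> intdom c p -> ichart c (cmap c p).
Proof. by move=> Xc [cp bp]; apply/(ichartE _ Xc); exists p. Qed.

Context (v : {measure set borel M -> \bar R}) (hv : is_volume g v).
Local Open Scope ereal_scope.

(** On [intdom c] the measure [v] is the image under [cpt c] of Lebesgue measure with density
    [cdens c]; this turns [is_volume], stated for sets, into a formula for integrals. *)
Lemma integral_chart c (f : borel M -> \bar R) : atlas X c -> measurable_fun [set: borel M] f ->
  (forall p, 0 <= f p) ->
  \int[v]_(p in intdom c) f p = \int[@leb R n.+1]_x ((cdens c x)%:E * f (cpt c x)).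
Proof.
move=> Xc mf f0; have mc := measurable_cpt Xc; have md := measurable_cdens Xc.
pose mu := imdens_measure (@leb R n.+1) md (cdens_ge0 c) mc.
have mD : measurable (intdom c : set (borel M)) by apply: open_borel; exact: intdom_open.
rewrite (@eq_measure_integral _ _ _ (intdom c : set (borel M)) mu); last first.
  move=> A mA Ac; rewrite (hv Xc mA); last by move=> p /Ac[].
  transitivity (imdens (@leb R n.+1) (cdens c) (cpt c) A) => //; rewrite /imdens leb_ge0_integral.
  - congr integralRn; apply/funext => x; rewrite -EFinM; congr (_%:E).
    have [cx|cx] := pselect (ichart c x).
      rewrite (cdensE cx) (cptE cx) mulrC; congr (_ * _)%R; rewrite !indicE; congr (_%:R); congr nat_of_bool.
      apply/idP/idP; rewrite !inE.
        by move=> [p Ap <-]; rewrite (cmapK Xc) //; case: (Ac _ Ap).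
      by move=> Ap; exists (cinv c x) => //; rewrite (cinvK Xc cx).
    rewrite cdens_out // mul0r indicE memNset ?mul0r // => -[p /[dup] Ap /Ac[cp bp] px].
    by apply: cx; rewrite -px; exact: ichart_intdom.
  - apply: emeasurable_funM; apply/measurable_EFinP => //.
    by apply: (@measurableT_comp _ _ _ _ _ _ (\1_A : borel M -> R)); [exact: measurable_indic|exact: mc].
  - by move=> x; rewrite mule_ge0 // lee_fin ?cdens_ge0 // indicE.
rewrite integral_mkcond integral_imdens.
- apply: eq_integral => x _; have [cx|cx] := pselect (ichart c x).
    by rewrite patchE mem_set // cptE //; exact: intdomP.
  by rewrite cdens_out // !mul0e.
- exact: md.
- exact: cdens_ge0.
- exact: mc.
- by apply: (measurable_restrictT _ mD).1; exact: measurable_funTS.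
- by move=> y; rewrite patchE; case: ifP.
Qed.

Lemma measurable_mboundary : measurable (mboundary X : set (borel M)).
Proof. by apply: closed_borel; exact: closed_mboundary. Qed.

Lemma v_boundary_chart c : atlas X c -> v (mboundary X `&` cdom c) = 0.
Proof.
move=> Xc; rewrite (hv Xc).
- apply: integralRn_first0 => x x0; rewrite indicE memNset ?mul0r // => -[p [bp cp] px].
  by move/eqP : x0; apply; rewrite -px; exact/(mboundaryP Xc cp).
- by apply: measurableI; [exact: measurable_mboundary|apply: open_borel; exact: (chart_open Xc)].
- by move=> p [].
Qed.

Definition chart_at p : chart R n M := sval (cid2 (atlas_cover X p)).

Lemma chart_atP p : atlas X (chart_at p).
Proof. by rewrite /chart_at; case: cid2. Qed.

Lemma chart_at_dom p : cdom (chart_at p) p.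
Proof. by rewrite /chart_at; case: cid2. Qed.

Hypothesis compactM : compact [set: M].

Lemma finite_subcover (U : M -> set M) : (forall p, open (U p)) -> (forall p, U p p) ->
  exists (N : nat) (q : 'I_N -> M), forall p, exists i, U (q i) p.
Proof.
move=> oU Up; move: compactM; rewrite compact_cover => /(_ M setT U (fun p _ => oU p)).
case=> [p _|D _ Dc]; first by exists p.
pose s : seq M := finmap.enum_fset D; exists (size s), (fun i => nth point s i) => p.
have [q qD Uq] := Dc p Logic.I; have qs : (index q s < size s)%N by rewrite index_mem.
by exists (Ordinal qs); rewrite /= nth_index // -index_mem.
Qed.

Lemma v_boundary : v (mboundary X) = 0.
Proof.
have [|p|N [q qc]] := @finite_subcover (fun p => cdom (chart_at p)).
- by move=> p; exact: (chart_open (chart_atP p)).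
- exact: chart_at_dom.
have : v.-negligible (\big[setU/set0]_(i < N) (mboundary X `&` cdom (chart_at (q i)))).
  elim/big_ind : _ => [|A B|i _]; [exact: negligible_set0|exact: negligibleU|].
  apply/negligibleP; last exact: (v_boundary_chart (chart_atP _)).
  apply: measurableI; first exact: measurable_mboundary.
  by apply: open_borel; exact: (chart_open (chart_atP _)).
move=> H; apply/negligibleP; first exact: measurable_mboundary.
apply: negligibleS H => p bp; have [i ip] := qc p.
by apply: (bigsetU_ord_sup (U := fun i => mboundary X `&` cdom (chart_at (q i))) (i := i)); split.
Qed.

(** [G] extends the metric matrix smoothly across the boundary. The entries of [G], of its inverse
    and the root of its determinant are continuous at [x0], so they are controlled on a full ball,
    and the constants hold up to the boundary. *)
Lemma local_bounds c x0 : atlas X c -> (cmap c @` cdom c) x0 -> exists r K, [/\ (0 < r)%R, (0 < K)%R,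
  forall x, ball x0 r x -> halfspace x -> (cmap c @` cdom c) x &
  forall x, ball x0 r x -> hopen x -> [/\ forall i j, (`|gx c x i j| <= K)%R,
     forall i j, (`|invmx (gx c x) i j| <= K)%R, (cdens c x <= K)%R & (1 <= K * cdens c x)%R]].
Proof.
move=> Xc cx0; have [_ [W [oW WE]] _ _ _] := atlas_chart Xc.
have Wx0 : W x0 by move: cx0; rewrite WE => -[].
have px0 : posdef (gx c x0) by case: cx0 => p cp <-; apply: gmx_posdef; rewrite ?(cmapK Xc).
have /choice[F HF] : forall ij : 'I_n.+1 * 'I_n.+1, exists UF : set 'rV[R]_n.+1 * ('rV[R]_n.+1 -> R),
   [/\ open UF.1, UF.1 x0, Cinf UF.1 UF.2 & forall y, (cmap c @` cdom c) y -> UF.1 y -> UF.2 y = gx c y ij.1 ij.2].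
  move=> [i j]; have [U [G [oU Ux CG GE]]] := gmx_smooth g i j Xc cx0.
  by exists (U, G).
pose G y : 'M[R]_n.+1 := \matrix_(i, j) (F (i, j)).2 y.
have [r0 /= r00 Hr0] : nbhs_ball (x0 : 'rV[R]_n.+1) [set y | (forall ij, (F ij).1 y) /\ W y].
  apply/nbhs_ballP; apply: filterI; last exact: open_nbhs_nbhs.
  by apply: (@filter_forall _ _ _ (nbhs x0)) => ij; have [oU Ux _ _] := HF ij; exact: open_nbhs_nbhs.
pose O1 := ball x0 r0; have oO1 : open O1 by exact: ball_open.
have CG i j k : Ck k O1 (fun x => G x i j).
  apply: (Ck_eq oO1 (f := (F (i, j)).2)); first by move=> x _; rewrite mxE.
  by have [_ _ CF _] := HF (i, j); apply: Ck_sub (CF k) => y /Hr0[+ _]; apply.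
have GE y : O1 y -> (cmap c @` cdom c) y -> G y = gx c y.
  move=> /Hr0[H _] cy; apply/matrixP => i j; rewrite mxE.
  by have [_ _ _ H2] := HF (i, j); rewrite H2 //; exact: H.
have O1x0 : O1 x0 by exact: ballxx.
have Gx0 : G x0 = gx c x0 by exact: GE.
have Cd : Ck 0 O1 (fun x => \det (G x)) by exact: det_Ck.
have cd : {for x0, continuous (fun x => \det (G x))} by exact: (Ck_cont Cd).
have d0 : (0 < \det (G x0))%R by rewrite Gx0; exact: posdef_det_gt0.
have [r1 /= r10 Hr1] : nbhs_ball (x0 : 'rV[R]_n.+1) [set y | (0 < \det (G y))%R /\ O1 y].
  apply/nbhs_ballP; apply: filterI; last exact: open_nbhs_nbhs.
  by move/cvgr_gt : cd; apply.
pose O2 := ball x0 r1; have oO2 : open O2 by exact: ball_open.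
have O2x0 : O2 x0 by exact: ballxx.
have Ci i j : Ck 0 O2 (fun x => invmx (G x) i j).
  apply: invmx_Ck => // [x /Hr1[/lt0r_neq0 //]|a b].
  by apply: Ck_sub (CG a b 0%N) => x /Hr1[].
pose S := (\sum_i \sum_j (`|G x0 i j| + `|invmx (G x0) i j|))%R.
have S0 : (0 <= S)%R by apply: sumr_ge0 => i _; apply: sumr_ge0 => j _; rewrite addr_ge0.
have Sle i j : (`|G x0 i j| + `|invmx (G x0) i j| <= S)%R.
  rewrite /S (bigD1 i) //= (bigD1 j) //= -addrA lerDl addr_ge0 //.
    by apply: sumr_ge0 => b _; rewrite addr_ge0.
  by apply: sumr_ge0 => a _; apply: sumr_ge0 => b _; rewrite addr_ge0.
pose s0 := Num.sqrt (\det (G x0)); have s00 : (0 < s0)%R by rewrite sqrtr_gt0.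
(* [K] strictly exceeds at [x0] every quantity to be bounded: matrix entries, density and inverse of
   the density. Strict inequalities persist nearby. *)
pose K := (S + s0 + s0^-1 + 1)%R.
have si0 : (0 < s0^-1)%R by rewrite invr_gt0.
have cs : {for x0, continuous (fun x => Num.sqrt (\det (G x)))}.
  by apply: (@continuous_comp _ _ _ (fun x => \det (G x)) Num.sqrt) => //; exact: sqrt_continuous.
have csi : {for x0, continuous (fun x => (Num.sqrt (\det (G x)))^-1)%R}.
  by apply: (cvgV (F := nbhs x0)) => //; rewrite gt_eqF.
have [r2 /= r20 Hr2] : nbhs_ball (x0 : 'rV[R]_n.+1) [set y | O2 y /\
   ((forall ij : 'I_n.+1 * 'I_n.+1, (`|G y ij.1 ij.2| < K)%R /\ (`|invmx (G y) ij.1 ij.2| < K)%R) /\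
   ((Num.sqrt (\det (G y)) < K)%R /\ ((Num.sqrt (\det (G y)))^-1 < K)%R))].
  apply/nbhs_ballP; apply: filterI; first exact: open_nbhs_nbhs.
  apply: filterI; last first.
    apply: filterI.
      by move/cvgr_lt : cs; apply; rewrite -/s0 /K; lra.
    by move/cvgr_lt : csi; apply; rewrite -/s0 /K; lra.
  apply: (@filter_forall _ _ _ (nbhs x0)) => -[i j] /=; have SK : (S < K)%R by rewrite /K; lra.
  apply: filterI.
    have c1 : `|G y i j|%R @[y --> x0] --> `|G x0 i j|%R.
      by apply: (cvg_norm (F := nbhs x0)); exact: (Ck_cont (CG i j 0%N)).
    move/cvgr_lt : c1; apply; apply: le_lt_trans SK; apply: le_trans (Sle i j).
    by rewrite lerDl.
  have c1 : `|invmx (G y) i j|%R @[y --> x0] --> `|invmx (G x0) i j|%R.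
    by apply: (cvg_norm (F := nbhs x0)); exact: (Ck_cont (Ci i j)).
  move/cvgr_lt : c1; apply; apply: le_lt_trans SK; apply: le_trans (Sle i j).
  by rewrite lerDr.
have sub x : ball x0 r2 x -> halfspace x -> (cmap c @` cdom c) x.
  by move=> /Hr2[/Hr1[_ /Hr0[_ Wx]] _] hx; rewrite WE.
exists r2, K; split => //; first by rewrite /K; lra.
move=> x bx hx; have cx : (cmap c @` cdom c) x by apply: sub => //; exact: ltW.
have [B2x [Hij [H1 H2]]] := Hr2 _ bx; have [dx B1x] := Hr1 _ B2x.
have icx : ichart c x by split.
rewrite (cdensE icx) -GE //; split => [i j|i j||].
- by have [] := Hij (i, j) => + _; exact: ltW.
- by have [] := Hij (i, j) => _; exact: ltW.
- exact: ltW.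
- by rewrite -ler_pdivrMr ?sqrtr_gt0 // mul1r ltW.
Qed.

Lemma v_locally_finite p : exists2 U : set M, open U /\ U p & v U < +oo.
Proof.
pose c := chart_at p; have Xc : atlas X c by exact: chart_atP.
have cp : cdom c p by exact: chart_at_dom.
have cx0 : (cmap c @` cdom c) (cmap c p) by exists p.
have [r [K [r0 K0 _ H]]] := local_bounds Xc cx0.
pose U := cdom c `&` cmap c @^-1` ball (cmap c p) r.
have oU : open U.
  apply: continuous_preimage_open; [exact: (chart_open Xc)|exact: ball_open|].
  by move=> q; exact: (cmap_continuous Xc).
exists U; first by split => //; split => //; exact: ballxx.
have mU : measurable (U : set (borel M)) by exact: open_borel.
have mI : measurable (intdom c : set (borel M)) by apply: open_borel; exact: (intdom_open Xc).
have -> : v U = v (U `&` intdom c).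
  apply/eqP; rewrite eq_le; apply/andP; split; last first.
    by apply: le_measure; rewrite ?inE //; exact: measurableI.
  have UE : U `<=` (U `&` intdom c) `|` mboundary X.
    move=> q [cq bq]; have [bdq|bdq] := pselect (mboundary X q); first by right.
    by left; split => //; split.
  have mUI : measurable (U `&` intdom c : set (borel M)) by exact: measurableI.
  apply: (@le_trans _ _ (v ((U `&` intdom c) `|` mboundary X))).
    apply: le_measure; rewrite ?inE //.
    by apply: measurableU => //; exact: measurable_mboundary.
  apply: le_trans (measureU2 _ mUI measurable_mboundary) _.
  by rewrite [X in _ + X]v_boundary adde0.
rewrite -[X in v X]setIC -[X in v (X `&` _)]setTI.
have -> : v ((setT `&` intdom c) `&` U) = \int[v]_(q in intdom c) (\1_U q)%:E.
  by rewrite integral_indic // setTI setIC.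
rewrite integral_chart //; last first.
  by apply/measurable_EFinP; exact: measurable_indic.
pose Q := box (cmap c p - const_mx r)%R (cmap c p + const_mx r)%R : set (borel 'rV[R]_n.+1).
have mQ : measurable Q by exact: box_borel.
apply: (@le_lt_trans _ _ (\int[@leb R n.+1]_x (K%:E * (\1_Q x)%:E))).
  apply: ge0_le_integral => //.
  - by move=> x _; rewrite mule_ge0 // lee_fin ?cdens_ge0 // indicE.
  - apply: emeasurable_funM; apply/measurable_EFinP; first exact: (measurable_cdens Xc).
    by apply: (@measurableT_comp _ _ _ _ _ _ (\1_U : borel M -> R)); [exact: measurable_indic|exact: (measurable_cpt Xc)].
  - by apply: measurable_funeM; exact/measurable_EFinP/measurable_indic.
  move=> x _; have [cx|cx] := pselect (ichart c x); last first.
    by rewrite cdens_out // mul0e mule_ge0 // lee_fin ?(ltW K0) // indicE.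
  rewrite cptE // -!EFinM lee_fin [X in (_ * X <= _)%R]indicE.
  have [Ux|Ux] := boolP (_ \in U); last by rewrite mulr0 mulr_ge0 ?(ltW K0) // indicE.
  move: Ux; rewrite inE => -[_]; rewrite /preimage /= (cinvK Xc cx) => bx.
  have [_ _ dK _] := H _ bx cx.2; rewrite mulr1 indicE mem_set ?mulr1 // => j.
  by have := (ball_coordP _ _ r0).1 bx j; rewrite !mxE distrC ltr_norml; lra.
rewrite ge0_integralZl_EFin ?(ltW K0) // ?integral_indic ?setIT //.
- by rewrite [X in _ * X](_ : _ = (vol (cmap c p - const_mx r) (cmap c p + const_mx r))%:E) ?ltry //; exact: leb_box.
- by apply/measurable_EFinP; exact: measurable_indic.
Qed.

Lemma v_finite : v setT < +oo.
Proof.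
have /choice[U HU] : forall p, exists U : set M, (open U /\ U p) /\ v U < +oo.
  by move=> p; have [U ? ?] := v_locally_finite p; exists U.
have [|p|N [q qc]] := @finite_subcover U.
- by move=> p; case: (HU p) => -[].
- by case: (HU p) => -[].
have mU p : measurable (U p : set (borel M)) by apply: open_borel; case: (HU p) => -[].
have E : setT `<=` \big[setU/set0]_(i < N) U (q i).
  by move=> p _; have [i ip] := qc p; apply: (bigsetU_ord_sup (U := fun i => U (q i)) (i := i)).
have mB : measurable (\big[setU/set0]_(i < N) U (q i) : set (borel M)) by exact: bigsetU_measurable.
apply: (@le_lt_trans _ _ (v (\big[setU/set0]_(i < N) U (q i) : set (borel M)))).
  by apply: le_measure; rewrite ?inE //; exact: measurableT.
apply: (@le_lt_trans _ _ (\sum_(i < N) v (U (q i)))).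
  pose P (A : set (borel M)) s := measurable A /\ v A <= s.
  suff [] : P (\big[setU/set0]_(i < N) U (q i)) (\sum_(i < N) v (U (q i))) by [].
  apply: big_ind2 => [|A a B b [mA Aa] [mB' Bb]|i _].
  - by split => //; rewrite measure0.
  - split; first exact: measurableU.
    by apply: le_trans (measureU2 _ mA mB') _; exact: leeD.
  - by split.
by apply: lte_sum_pinfty => i _; case: (HU (q i)).
Qed.

End ManifoldMeasure.

(** * Smooth functions and partitions of unity *)

Section SmoothOn.
Context {R : realType} {m : nat}.
Implicit Types (A : set 'rV[R]_m) (f h : 'rV[R]_m -> R).

Lemma smooth_on_cst A a : smooth_on A (fun=> a).
Proof. by move=> x Ax; exists setT, (fun=> a); split => // [|k]; [exact: openT|exact: Ck_cst]. Qed.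

Lemma smooth_on_op2 A f h (op : R -> R -> R) :
  (forall k (U : set 'rV[R]_m) F G, open U -> Ck k U F -> Ck k U G -> Ck k U (fun x => op (F x) (G x))) ->
  smooth_on A f -> smooth_on A h -> smooth_on A (fun x => op (f x) (h x)).
Proof.
move=> Cop sf sh x Ax; have [U [F [oU Ux CF FE]]] := sf x Ax; have [V [G [oV Vx CG GE]]] := sh x Ax.
exists (U `&` V), (fun x => op (F x) (G x)); split => //; first exact: openI.
  by move=> k; apply: Cop; [exact: openI|apply: Ck_sub (CF k) => y []|apply: Ck_sub (CG k) => y []].
by move=> y Ay [Uy Vy]; rewrite FE // GE.
Qed.

Lemma smooth_onD A f h : smooth_on A f -> smooth_on A h -> smooth_on A (fun x => f x + h x).
Proof. by apply: smooth_on_op2 => k U F G; exact: CkD. Qed.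

Lemma smooth_onM A f h : smooth_on A f -> smooth_on A h -> smooth_on A (fun x => f x * h x).
Proof. by apply: smooth_on_op2 => k U F G; exact: CkM. Qed.

Lemma smooth_on_sum A I (r : seq I) (F : I -> 'rV[R]_m -> R) : (forall i, smooth_on A (F i)) ->
  smooth_on A (fun x => \sum_(i <- r) F i x).
Proof.
move=> H; elim: r => [|i r IH].
  by under eq_fun do rewrite big_nil; exact: smooth_on_cst.
by under eq_fun do rewrite big_cons; exact: smooth_onD.
Qed.

Lemma smooth_onV A f : (forall x, A x -> f x != 0) -> smooth_on A f -> smooth_on A (fun x => (f x)^-1).
Proof.
move=> f0 sf x Ax; have [U [F [oU Ux CF FE]]] := sf x Ax.
have oV : open (U `&` F @^-1` [set t | t != 0]).
  apply: continuous_preimage_open => //.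
  by move=> y Uy; exact: (Ck_cont (CF 0%N)).
exists (U `&` F @^-1` [set t | t != 0]), (fun x => (F x)^-1); split => //.
- by split => //; rewrite /preimage /= FE // f0.
- by move=> k; apply: CkV => // [y []//|]; apply: Ck_sub (CF k) => y [].
- by move=> y Ay [Uy _]; rewrite FE.
Qed.

Lemma compact_closed_ball (x : 'rV[R]_m) r : 0 < r -> compact (closed_ball x r : set 'rV[R]_m).
Proof.
move=> r0; apply: bounded_closed_compact; last exact: closed_ball_closed.
exists (`|x| + r); split; first exact: num_real.
move=> M HM y; rewrite closed_ballE // /closed_ball_ /= => xy.
apply: le_trans (ltW HM); rewrite -[y](subrK x) addrC (le_trans (ler_normD _ _)) // lerD2l.
by rewrite distrC.
Qed.

End SmoothOn.

(** As [P] is monotone in its constant, the local constants can be replaced by one large constant,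
    by the filter form of compactness. *)
Lemma compact_locally_bounded (R : realType) (T : topologicalType) (K : set T) (P : R -> T -> Prop) :
  compact K -> (forall C C' y, C <= C' -> P C y -> P C' y) ->
  (forall x, K x -> exists C, \forall y \near x, P C y) -> exists C, forall y, K y -> P C y.
Proof.
move=> /compact_near_coveringP cK mP H.
have H' x : K x -> \forall x' \near x & i \near pinfty_nbhs R, P i x'.
  move=> Kx; have [C HC] := H x Kx; exists ([set y | P C y], [set i | C <= i]).
    by split => //=; exists C; split; [exact: num_real|move=> y /ltW].
  by move=> [y i] /= [Py Ci]; exact: mP Ci Py.
have [M [_ HM]] := cK R (pinfty_nbhs R) P _ H'.
by exists (M + 1) => y Ky; apply: (HM (M + 1)) => //; rewrite ltrDl.
Qed.

Section SmoothFunctions.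
Context {R : realType} {n : nat} {M : ptopologicalType} (X : smoothStructure R n M).
Context (hausdorffM : hausdorff_space M).
Notation e_ i := (delta_mx 0 i).
Implicit Types (c : chart R n M) (p : M) (x : 'rV[R]_n.+1) (f : M -> R).

Definition smf f := forall c, atlas X c -> smooth_on (cmap c @` cdom c) (f \o cinv c).

Lemma smf_Cinf c f : smf f -> atlas X c -> Cinf (ichart c) (f \o cinv c).
Proof.
move=> sf Xc k; apply: (smooth_on_Ck (A := cmap c @` cdom c)); [exact: (ichart_open Xc)|by move=> x []|].
exact: sf.
Qed.

Lemma chart_image_open c x (B : set M) : atlas X c -> (cmap c @` cdom c) x -> open B -> B (cinv c x) ->
  exists U : set 'rV[R]_n.+1, [/\ open U, U x & forall y, (cmap c @` cdom c) y -> U y -> B (cinv c y)].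
Proof.
move=> Xc cx oB Bx; have [_ _ _ _ /subspace_continuousP/(_ x cx) cc] := atlas_chart Xc.
have := cc _ (open_nbhs_nbhs (conj oB Bx)); rewrite {1}/nbhs /= => H.
have [r /= r0 Hr] := (nbhs_ballP _ _).1 H.
exists (ball x r); split; [exact: ball_open|exact: ballxx|].
by move=> y cy /Hr; exact.
Qed.

Lemma smf_continuous f : smf f -> continuous f.
Proof.
move=> sf p; have [c Xc cp] := atlas_cover X p.
have cx : (cmap c @` cdom c) (cmap c p) by exists p.
have [U [F [oU Ux CF FE]]] := sf c Xc _ cx.
have cF : {for p, continuous (F \o cmap c)}.
  by apply: continuous_comp; [exact: (cmap_continuous Xc)|exact: (Ck_cont (CF 0%N))].
have fp : f p = (F \o cmap c) p by rewrite /= FE //= (cmapK Xc).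
rewrite /continuous_at fp; apply: cvg_trans cF; apply: near_eq_cvg.
have oD : open (cdom c `&` cmap c @^-1` U).
  apply: continuous_preimage_open => //; first exact: (chart_open Xc).
  by move=> q cq; exact: (cmap_continuous Xc).
have : nbhs p (cdom c `&` cmap c @^-1` U) by apply: open_nbhs_nbhs.
by apply: filterS => q [cq Uq]; rewrite /= FE //= ?(cmapK Xc) //; exists q.
Qed.

Lemma smfM f h : smf f -> smf h -> smf (fun p => f p * h p).
Proof. by move=> sf sh c Xc; apply: smooth_onM; [exact: sf|exact: sh]. Qed.

Lemma smf_sum I (r : seq I) (F : I -> M -> R) : (forall i, smf (F i)) ->
  smf (fun p => \sum_(i <- r) F i p).
Proof. by move=> sF c Xc; apply: smooth_on_sum => i; exact: sF. Qed.

Lemma smf_cst (a : R) : smf (fun=> a).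
Proof. by move=> c Xc; exact: smooth_on_cst. Qed.

Lemma smfV f : (forall p, f p != 0) -> smf f -> smf (fun p => (f p)^-1).
Proof. by move=> f0 sf c Xc; apply: smooth_onV; [move=> x _; exact: f0|exact: sf]. Qed.

Definition lift_chart c (G : 'rV[R]_n.+1 -> R) p : R := if `[<cdom c p>] then G (cmap c p) else 0.

Lemma lift_chartE c G p : cdom c p -> lift_chart c G p = G (cmap c p).
Proof. by move=> cp; rewrite /lift_chart asboolT. Qed.

Lemma lift_chart_out c G p : ~ cdom c p -> lift_chart c G p = 0.
Proof. by move=> cp; rewrite /lift_chart asboolF. Qed.

Definition chart_ball c x r : set M := cdom c `&` cmap c @^-1` closed_ball x r.

(** The set is the image under [cinv c] of a compact piece of the half-space, and in a Hausdorff
    space compact sets are closed. Hence functions supported in it can be extended by zero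
    smoothly. *)
Lemma closed_chart_ball c x r : atlas X c -> 0 < r ->
  closed_ball x r `&` @halfspace R n `<=` cmap c @` cdom c -> closed (chart_ball c x r).
Proof.
move=> Xc r0 sub; have [_ _ _ _ cc] := atlas_chart Xc.
have cK : compact (closed_ball x r `&` @halfspace R n).
  apply: compact_closedI; first exact: compact_closed_ball.
  apply: (@closed_comp _ _ (fun x : 'rV[R]_n.+1 => x 0 ord0) [set t : R | 0 <= t]).
    by move=> y _; exact: coord_continuous.
  exact: closed_ge.
have -> : chart_ball c x r = cinv c @` (closed_ball x r `&` @halfspace R n).
  apply/seteqP; split=> [p [cp bp]|_ [y [by_ hy] <-]].
    exists (cmap c p); last exact: (cmapK Xc).
    by split => //; exact: (cmap_ge0 Xc).
  by have [p cp py] := sub y (conj by_ hy); split; rewrite /preimage /= -py (cmapK Xc) // py.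
apply: compact_closed => //; apply: continuous_compact => //.
exact: continuous_subspaceW cc.
Qed.

Lemma smf_lift c G x r : atlas X c -> 0 < r -> Cinf setT G ->
  closed_ball x r `&` @halfspace R n `<=` cmap c @` cdom c ->
  (forall y, ~ closed_ball x r y -> G y = 0) -> smf (lift_chart c G).
Proof.
move=> Xc r0 CG sub G0 c' Xc' y /[dup] cy [p c'p py].
have pE : cinv c' y = p by rewrite -py (cmapK Xc').
have [cp|cp] := pselect (cdom c p).
  have [/(_ _) st _] := atlas_compatible Xc' Xc.
  have ty : (cmap c' @` (cdom c' `&` cdom c)) y by exists p.
  have /choice[F HF] : forall j : 'I_n.+1, exists UF : set 'rV[R]_n.+1 * ('rV[R]_n.+1 -> R),
     [/\ open UF.1, UF.1 y, Cinf UF.1 UF.2 & forall z, (cmap c' @` (cdom c' `&` cdom c)) z -> UF.1 z -> UF.2 z = cmap c (cinv c' z) 0 j].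
    by move=> j; have [U [H [oU Ux CH HE]]] := st j y ty; exists (U, H).
  have [|U [oU Uy HU]] := chart_image_open Xc' cy (chart_open Xc); first by rewrite pE.
  have [r1 /= r10 Hr1] : nbhs_ball (y : 'rV[R]_n.+1) [set z | (forall j, (F j).1 z) /\ U z].
    apply/nbhs_ballP; apply: filterI; last exact: open_nbhs_nbhs.
    by apply: (@filter_forall _ _ _ (nbhs y)) => j; have [oV Vx _ _] := HF j; exact: open_nbhs_nbhs.
  have oB : open (ball y r1) by exact: ball_open.
  exists (ball y r1), (fun z => G (\row_j (F j).2 z)); split => //; first exact: ballxx.
    move=> k; apply: (@Ck_comp _ _ _ k (ball y r1) setT G (fun j => (F j).2)) => //; first exact: openT.
    by move=> j; have [_ _ CF _] := HF j; apply: Ck_sub (CF k) => z /Hr1[+ _]; apply.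
  move=> z cz bz; have [Fz Uz] := Hr1 _ bz; have cz' := HU z cz Uz.
  rewrite /= lift_chartE //; congr G; apply/rowP => j; rewrite mxE.
  have [_ _ _ FE] := HF j; rewrite FE //; exists (cinv c' z).
    by split => //; case: cz => q cq <-; rewrite (cmapK Xc').
  by case: cz => q cq <-; rewrite (cmapK Xc').
have cB : closed (chart_ball c x r) by exact: closed_chart_ball.
have [|U [oU Uy HU]] := chart_image_open Xc' cy (closed_openC cB).
  by rewrite pE => -[].
exists U, (fun=> 0); split => // [k|z cz Uz]; first exact: Ck_cst.
have := HU z cz Uz; rewrite /= /chart_ball => H.
have [cq|cq] := pselect (cdom c (cinv c' z)); last by rewrite lift_chart_out.
by rewrite lift_chartE // G0 // => b; apply: H; split.
Qed.

(** Near a boundary point the derivatives agree on [hopen] with those of a smooth extension [F],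
    which are continuous there; compactness of the closed ball then gives one constant. *)
Lemma smf_partial_bounded c f x r : smf f -> atlas X c -> 0 < r ->
  closed_ball x r `&` @halfspace R n `<=` cmap c @` cdom c ->
  exists C, forall y, closed_ball x r y -> hopen y -> forall k, `|'D_(e_ k) (f \o cinv c) y| <= C.
Proof.
move=> sf Xc r0 sub.
have := @compact_locally_bounded R _ (closed_ball x r : set 'rV[R]_n.+1)
  (fun C y => hopen y -> forall k, `|'D_(e_ k) (f \o cinv c) y| <= C) (compact_closed_ball r0) _ _.
case=> [C C' y CC H hy k|y by_|C HC]; first exact: le_trans (H hy k) CC.
  have [hy|hy] := lerP 0 (y 0 ord0); last first.
    exists 0; have c0 : {for y, continuous (fun z : 'rV[R]_n.+1 => z 0 ord0)} by exact: coord_continuous.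
    have /(@filterS _ (nbhs y)) : nbhs y [set z : 'rV[R]_n.+1 | z 0 ord0 < 0] by move/cvgr_lt : c0; apply.
    by apply => z /= zn; rewrite /hopen /= => /(lt_trans zn); rewrite ltxx.
  have [_ [W [oW WE]] _ _ _] := atlas_chart Xc.
  have cy : (cmap c @` cdom c) y by exact: sub.
  have Wy : W y by move: cy; rewrite WE => -[].
  have [U [F [oU Uy CF FE]]] := sf c Xc y cy.
  exists (\sum_k (`|'D_(e_ k) F y| + 1)).
  have H : \forall z \near y, (forall k, `|'D_(e_ k) F z| < `|'D_(e_ k) F y| + 1) /\ (U z /\ W z).
    apply: filterI; last by apply: filterI; exact: open_nbhs_nbhs.
    apply: (@filter_forall _ _ _ (nbhs y)) => k.
    have c1 : `|'D_(e_ k) F z| @[z --> y] --> `|'D_(e_ k) F y|.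
      by apply: (cvg_norm (F := nbhs y)); exact: (Ck_cont (CkD1 k (CF 1%N))).
    by have := cvgr_lt _ c1; apply; rewrite ltrDl.
  apply: filterS H => z [Fz [Uz Wz]] hz k.
  have cz : ichart c z by split => //; rewrite WE; split => //; exact: ltW.
  have -> : 'D_(e_ k) (f \o cinv c) z = 'D_(e_ k) F z.
    apply: near_eq_derive; have : nbhs z (U `&` ichart c).
      by apply: open_nbhs_nbhs; split => //; apply: openI => //; exact: (ichart_open Xc).
    by apply: filterS => a [Ua [ca _]]; rewrite FE.
  apply: le_trans (ltW (Fz k)) _; by rewrite (bigD1 k) //= lerDl sumr_ge0.
by exists C => y by_ hy; exact: HC.
Qed.

(** * Partition of unity with uniform bounds on the metric *)

Section partition.
Context (g : riemannianMetric X) (compactM : compact [set: M]).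
Local Notation gx c := (fun x => gmx g c (cinv c x)).

Record unity_cell := UnityCell {
  ucenter : M; uradius : R; ubound : R; ufun : M -> R }.

Definition uchart (a : unity_cell) := chart_at X (ucenter a).
Definition upoint (a : unity_cell) := cmap (uchart a) (ucenter a).

(** The function lives within the radius [uradius a], while the bounds hold on three times this
    radius: cut-off data are contained in the double radius, and mollifying enlarges supports by at
    most one more radius. *)
Definition is_unity_cell (a : unity_cell) : Prop :=
  [/\ 0 < uradius a /\ 0 < ubound a,
    closed_ball (upoint a) (3 * uradius a) `&` @halfspace R n `<=` cmap (uchart a) @` cdom (uchart a),
    forall x, closed_ball (upoint a) (3 * uradius a) x -> hopen x ->
      [/\ forall i j, `|gx (uchart a) x i j| <= ubound a,
         forall i j, `|invmx (gx (uchart a) x) i j| <= ubound a,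
         cdens g (uchart a) x <= ubound a & 1 <= ubound a * cdens g (uchart a) x],
    smf (ufun a) /\ (forall p, 0 <= ufun a p) &
    forall p, ufun a p != 0 -> cdom (uchart a) p /\ ball (upoint a) (uradius a) (cmap (uchart a) p)].

Lemma partition_of_unity : exists (N : nat) (a : 'I_N -> unity_cell),
  (forall i, is_unity_cell (a i)) /\ forall p, \sum_i ufun (a i) p = 1.
Proof.
have /choice[rK HrK] : forall q : M, exists rK : R * R,
  let c := chart_at X q in let x0 := cmap c q in
  [/\ 0 < rK.1 /\ 0 < rK.2, closed_ball x0 (3 * rK.1) `&` @halfspace R n `<=` cmap c @` cdom c &
    forall x, closed_ball x0 (3 * rK.1) x -> hopen x ->
      [/\ forall i j, `|gx c x i j| <= rK.2, forall i j, `|invmx (gx c x) i j| <= rK.2,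
         cdens g c x <= rK.2 & 1 <= rK.2 * cdens g c x]].
  move=> q; set c := chart_at X q; set x0 := cmap c q.
  have Xc : atlas X c by exact: chart_atP.
  have cx0 : (cmap c @` cdom c) x0 by exists q => //; exact: chart_at_dom.
  have [r [K [r0 K0 H1 H2]]] := local_bounds g Xc cx0.
  have cb x : closed_ball x0 (3 * (r / 4)) x -> ball x0 r x.
    rewrite closed_ballE; last by rewrite mulr_gt0 // divr_gt0.
    rewrite /closed_ball_ -ball_normE /= => /le_lt_trans; apply; move: r0; lra.
  (* A quarter makes the closed ball of triple radius fit into the open ball of [local_bounds]. *)
  exists (r / 4, K) => /=; split.
  - by split => //; rewrite divr_gt0.
  - by move=> x [/cb bx hx]; exact: H1.
  - by move=> x /cb bx hx; exact: H2.
pose th q := lift_chart (chart_at X q) (bump (cmap (chart_at X q) q) (rK q).1).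
have sth q : smf (th q).
  have [[r0 K0] sub _] := HrK q; have r3 : 0 < 3 * (rK q).1 by rewrite mulr_gt0.
  apply: (smf_lift (chart_atP X q) r3 _ sub); first exact: bump_Cinf.
  move=> y cy; apply: bump_out => // b; apply: cy.
  apply: subset_closed_ball; move: b; apply: le_ball; move: r0; lra.
have th0 q p : 0 <= th q p.
  rewrite /th /lift_chart; case: asboolP => // _; exact: bump_ge0.
have thq q : 0 < th q q.
  have [[r0 K0] _ _] := HrK q.
  by rewrite /th lift_chartE; [apply: bump_gt0 => //; exact: ballxx|exact: chart_at_dom].
have [|p|N [q qc]] := @finite_subcover _ compactM (fun q => [set p | 0 < th q p]).
- move=> q; apply: (@open_comp _ _ (th q) [set t : R | 0 < t]); last exact: open_gt.
  by move=> p _; exact: smf_continuous.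
- exact: thq.
pose S p := \sum_i th (q i) p.
have S0 p : 0 < S p.
  have [i ip] := qc p; rewrite /S (bigD1 i) //= ltr_pwDl //; exact: sumr_ge0.
have sS : smf S by apply: smf_sum => i; exact: sth.
exists N, (fun i => UnityCell (q i) (rK (q i)).1 (rK (q i)).2 (fun p => th (q i) p * (S p)^-1)).
split=> [i|p] /=; last by rewrite -mulr_suml -/(S p) mulfV // gt_eqF.
have [rK0 sub bd] := HrK (q i); split => //=.
  split; last by move=> p; rewrite mulr_ge0 // invr_ge0 ltW.
  by apply: smfM => //; apply: smfV => // p; rewrite gt_eqF.
move=> p; rewrite mulf_eq0 negb_or => /andP[+ _]; rewrite /th /lift_chart.
case: asboolP => [cp|]; last by rewrite eqxx.
have [b _ //|b] := pselect (ball (cmap (chart_at X (q i)) (q i)) (rK (q i)).1 (cmap (chart_at X (q i)) p)).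
by rewrite bump_out ?eqxx //; case: rK0.
Qed.

End partition.

(** * Differentials and their norms under change of chart *)

Section gradient.
Context (g : riemannianMetric X).

(* the coordinates in the chart c of the differential of f at p *)
Definition dform c f p : 'rV[R]_n.+1 := grad (f \o cinv c) (cmap c p).

(** The squared length of a covector, hence the inverse of the metric matrix. *)
Definition gnorm2 c p (w : 'rV[R]_n.+1) : R := bform (invmx (gmx g c p)) w w.

Lemma gnorm2_ge0 c p w : atlas X c -> cdom c p -> 0 <= gnorm2 c p w.
Proof. by move=> Xc cp; apply: posdef_ge0; apply: posdef_inv; exact: gmx_posdef. Qed.

Definition tjac c c' p : 'M[R]_n.+1 := 'J (cmap c' \o cinv c) (cmap c p).

Lemma tjacE c c' p : atlas X c -> atlas X c' -> intdom X c p -> cdom c' p ->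
  tjac c c' p = \matrix_(i, j) 'D_(e_ i) (fun y => cmap c' (cinv c y) 0 j) (cmap c p).
Proof.
move=> Xc Xc' [cp bp] c'p; apply: (@Jacobian_grad _ _ _ (tdom c c')).
- exact: (tdom_open Xc Xc').
- by apply: (tdomP Xc) => //; exact/(mboundaryPn Xc cp).
- by move=> j; exact: (trans_Cinf j Xc Xc' 1).
Qed.

(** Covectors are multiplied by [J^T] and the metric becomes [J *m g *m J^T], so the Jacobians
    cancel in the dual norm. [J] is invertible because this product is. *)
Lemma gnorm2_transport c c' p w : atlas X c -> atlas X c' -> intdom X c p -> cdom c' p ->
  gnorm2 c p (w *m (tjac c c' p)^T) = gnorm2 c' p w.
Proof.
move=> Xc Xc' [cp bp] c'p; have gE := gmx_transition g Xc Xc' cp c'p bp.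
rewrite /gnorm2 gE -/(tjac c c' p); set J := tjac c c' p.
have ug := posdef_unit (gmx_posdef g Xc cp).
have ug' := posdef_unit (gmx_posdef g Xc' c'p).
have uJ : J \in unitmx.
  by move: ug; rewrite gE -/(tjac c c' p) -/J unitmx_mul unitmx_mul => /andP[/andP[]].
have uJT : J^T \in unitmx by rewrite unitmx_tr.
have uJg : J *m gmx g c' p \in unitmx by rewrite unitmx_mul uJ.
have -> : invmx (J *m gmx g c' p *m J^T) = invmx J^T *m invmx (gmx g c' p) *m invmx J.
  have u3 : J *m gmx g c' p *m J^T \in unitmx by rewrite unitmx_mul uJg.
  have E : (J *m gmx g c' p *m J^T) *m (invmx J^T *m invmx (gmx g c' p) *m invmx J) = 1%:M.
    by rewrite -!mulmxA (mulmxA J^T) mulmxV // mul1mx (mulmxA (gmx g c' p)) mulmxV // mul1mx mulmxV.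
  by rewrite -[LHS]mulmx1 -E mulmxA mulVmx // mul1mx.
rewrite /bform trmx_mul trmxK.
rewrite !mulmxA -(mulmxA w J^T) mulmxV // mulmx1.
by rewrite -[w *m _ *m invmx J *m J]mulmxA mulVmx // mulmx1.
Qed.

Lemma dform_transition c c' p f : atlas X c -> atlas X c' -> intdom X c p -> cdom c' p ->
  Ck 1 (ichart c') (f \o cinv c') -> dform c f p = dform c' f p *m (tjac c c' p)^T.
Proof.
move=> Xc Xc' /[dup] ip [cp bp] c'p Cf; rewrite tjacE //.
pose T y : 'rV[R]_n.+1 := cmap c' (cinv c y).
have px : tdom c c' (cmap c p) by apply: (tdomP Xc) => //; exact/(mboundaryPn Xc cp).
have Tp : T (cmap c p) = cmap c' p by rewrite /T (cmapK Xc).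
have ic' : ichart c' (cmap c' p) by apply: (ichart_intdom Xc').
apply/rowP => i; rewrite !mxE.
have H : is_derive (cmap c p) (e_ i) (fun y => (f \o cinv c') (T y))
    (\sum_j 'D_(e_ j) (f \o cinv c') (T (cmap c p)) * 'D_(e_ i) (fun y => T y 0 j) (cmap c p)).
  apply: (is_derive_compF (ichart_open Xc') Cf); first by rewrite Tp.
  by move=> j; exact: Ck_derivable (trans_Cinf j Xc Xc' 1%N) px.
have -> : 'D_(e_ i) (f \o cinv c) (cmap c p) = 'D_(e_ i) (fun y => (f \o cinv c') (T y)) (cmap c p).
  apply: near_eq_derive; have : nbhs (cmap c p) (tdom c c').
    by apply: open_nbhs_nbhs; split => //; exact: (tdom_open Xc Xc').
  by apply: filterS => y [cy c'y]; rewrite /T /= (cmapK Xc').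
rewrite (derive_val (is_derive := H)); apply: eq_bigr => j _; by rewrite !mxE Tp.
Qed.

Lemma gnorm2_dform c c' p f : atlas X c -> atlas X c' -> intdom X c p -> cdom c' p -> smf f ->
  gnorm2 c p (dform c f p) = gnorm2 c' p (dform c' f p).
Proof.
move=> Xc Xc' ip c'p sf; rewrite (@dform_transition c c') ?gnorm2_transport //.
exact: (smf_Cinf sf Xc' 1%N).
Qed.

End gradient.

End SmoothFunctions.

(** * Chart independence of the measure of a slice *)

(** The hypothesis says that the map sends slices to slices: tangential directions acquire no
    component along [l]. The congruence therefore restricts to the tangential blocks. *)
Lemma minor_conj (R : realType) n (l : 'I_n.+1) (J G : 'M[R]_n.+1) :
  (forall i, J (lift l i) l = 0) ->
  row' l (col' l (J *m G *m J^T)) =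
  row' l (col' l J) *m row' l (col' l G) *m (row' l (col' l J))^T.
Proof.
move=> J0; apply/matrixP => i k; rewrite !mxE (bigD1_ord l) //= !mxE J0 mulr0 add0r.
apply: eq_bigr => b _; rewrite !mxE (bigD1_ord l) //= J0 mul0r add0r; congr (_ * _).
by apply: eq_bigr => a _; rewrite !mxE.
Qed.

Lemma measurable_inv_ge0 (R : realType) d (T : measurableType d) (f : T -> R) :
  (forall x, 0 <= f x) -> measurable_fun setT f -> measurable_fun setT (fun x => (f x)^-1).
Proof.
move=> f0 mf; rewrite (_ : (fun x => _) = (fun x => f x `^ (-1))).
  by apply: (measurableT_comp (measurable_powR _)).
by apply/funext => x; rewrite powR_inv1.
Qed.

Section LebSwap.
Context {R : realType}.
Local Open Scope ereal_scope.

Lemma integral_ball (a s : R) : (0 <= s)%R ->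
  \int[@lebesgue_measure R]_t (\1_(ball a s) t)%:E = (s *+ 2)%:E.
Proof.
move=> s0; rewrite integral_indic //; last exact: measurable_ball.
by apply: (etrans (congr1 _ (setIT _))); exact: lebesgue_measure_ball.
Qed.

Lemma leb_ins_swap m k f : measurable_fun [set: borel 'rV[R]_m.+1] f -> (forall x, 0 <= f x) ->
  \int[@leb R m.+1]_x f x = \int[@leb R m]_y \int[@lebesgue_measure R]_t f (ins k y t).
Proof.
move=> mf f0; rewrite (leb_ins k) //.
apply: (@fubini_tonelli _ _ _ _ _ (@lebesgue_measure R) (@leb R m) (fun p : R * borel 'rV[R]_m => f (ins k p.2 p.1))).
  by apply: (measurableT_comp mf); exact: measurable_ins.
by move=> p; exact: f0.
Qed.

End LebSwap.

Section Slice.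
Context {R : realType} {n : nat} {M : ptopologicalType} (X : smoothStructure R n.+1 M).
Context (g : riemannianMetric X) (v : {measure set borel M -> \bar R}) (hv : is_volume g v).
Notation e_ i := (delta_mx 0 i).
Notation l := (@ord_max n.+1).
Implicit Types (c : chart R n.+1 M) (p : M) (x : 'rV[R]_n.+2).
Local Notation gx c := (fun x => gmx g c (cinv c x)).

Definition minor c p : R := \det (row' l (col' l (gmx g c p))).

Definition mdens c : 'rV[R]_n.+2 -> R := (fun x => Num.sqrt (minor c (cinv c x))) \_ (ichart c).

Lemma mdensE c x : ichart c x -> mdens c x = Num.sqrt (minor c (cinv c x)).
Proof. by move=> cx; rewrite /mdens patchE mem_set. Qed.

Lemma mdens_out c x : ~ ichart c x -> mdens c x = 0.
Proof. by move=> cx; rewrite /mdens patchE memNset. Qed.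

Lemma mdens_ge0 c x : 0 <= mdens c x.
Proof. by rewrite /mdens patchE; case: ifP => // _; exact: sqrtr_ge0. Qed.

Lemma measurable_mdens c : atlas X c -> measurable_fun [set: borel 'rV[R]_n.+2] (mdens c : borel 'rV[R]_n.+2 -> R).
Proof.
move=> Xc; apply: (measurable_restrictT _ (measurable_ichart Xc)).1.
apply: within_continuous_borelR; first exact: (measurable_ichart Xc).
apply: continuous_in_subspaceT => x; rewrite inE => cx.
apply: (@continuous_comp _ _ _ (fun x => minor c (cinv c x)) Num.sqrt); last exact: sqrt_continuous.
apply: (@Ck_cont _ _ 0 (ichart c)) => //; apply: det_Ck; first exact: (ichart_open Xc).
move=> i j; apply: (Ck_eq (ichart_open Xc) (f := fun x => gx c x (lift l i) (lift l j))).
  by move=> y _; rewrite !mxE.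
exact: gmx_Ck.
Qed.

(** The area integral of [f] over the slice [x_l = t] of the chart [c]; [mdens] is the density of
    the induced metric. *)
Definition slice_int c t (f : borel M -> \bar R) : \bar R :=
  (\int[@leb R n.+1]_y ((mdens c (ins l y t))%:E * f (cpt c (ins l y t))))%E.

Section Independence.
Variables (c c' : chart R n.+1 M) (a b : R).
Hypotheses (Xc : atlas X c) (Xc' : atlas X c').
Let T x : 'rV[R]_n.+2 := cmap c' (cinv c x).
Let T' x : 'rV[R]_n.+2 := cmap c (cinv c' x).
Hypothesis Tab : forall x, tdom c c' x -> x 0 l = a -> T x 0 l = b.
Hypothesis Tba : forall x, tdom c' c x -> x 0 l = b -> T' x 0 l = a.

Let pa x := ins l (del l x) a.
Let pb x := ins l (del l x) b.
(** The coordinate change to the third chart: the tangential coordinates are those of [c'] at the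
    projection [pa x] onto the slice, and the last coordinate is kept from [c]. [Psi] is its
    inverse. *)
Let Phi x := ins l (del l (T (pa x))) (x 0 l).
Let Psi x := ins l (del l (T' (pb x))) (x 0 l).
Let V := ichart c `&` pa @^-1` tdom c c'.
Let V' := pb @^-1` tdom c' c `&` Psi @^-1` ichart c.

Let insdelE (x : 'rV[R]_n.+2) s j : ins l (del l x) s 0 j = if j == l then s else x 0 j.
Proof.
rewrite mxE; case: (unliftP l j) => [k ->|->]; last by rewrite eqxx.
by rewrite mxE eq_sym (negbTE (neq_lift _ _)).
Qed.

Let ins_l (x : 'rV[R]_n.+2) s : ins l (del l x) s 0 l = s.
Proof. by rewrite ins_at. Qed.

Let TT' x : tdom c c' x -> tdom c' c (T x) /\ T' (T x) = x.
Proof.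
move=> [cx c'x]; rewrite /T'.
have ccx : cdom c (cinv c x) by exact: (cinv_dom Xc cx).
have x0 : 0 < T x 0 ord0.
  apply: (interior_invariant Xc' Xc c'x ccx).
  by rewrite (cinvK Xc cx); case: cx.
split; last by rewrite /T (cmapK Xc') // (cinvK Xc cx).
by split; [exact: ichart_cmap|rewrite /preimage /T /= (cmapK Xc')].
Qed.

Let T'T x : tdom c' c x -> tdom c c' (T' x) /\ T (T' x) = x.
Proof.
move=> [cx c'x]; rewrite /T.
have ccx : cdom c' (cinv c' x) by exact: (cinv_dom Xc' cx).
have x0 : 0 < T' x 0 ord0.
  apply: (interior_invariant Xc Xc' c'x ccx).
  by rewrite (cinvK Xc' cx); case: cx.
split; last by rewrite /T' (cmapK Xc) // (cinvK Xc' cx).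
by split; [exact: ichart_cmap|rewrite /preimage /T' /= (cmapK Xc)].
Qed.

Let pbPhi x : V x -> pb (Phi x) = T (pa x).
Proof.
move=> [cx tx]; rewrite /pb /Phi del_ins -[RHS](ins_del l) Tab //.
by rewrite /pa ins_l.
Qed.

Let paPsi x : (pb @^-1` tdom c' c) x -> pa (Psi x) = T' (pb x).
Proof.
move=> tx; rewrite /pa /Psi del_ins -[RHS](ins_del l) Tba //.
by rewrite /pb ins_l.
Qed.

Let PsiPhi x : V x -> Psi (Phi x) = x.
Proof.
move=> Vx; rewrite /Psi pbPhi // (TT' Vx.2).2 /pa del_ins /Phi ins_l.
by rewrite ins_del.
Qed.

Let PhiPsi x : V' x -> Phi (Psi x) = x.
Proof.
move=> Vx; rewrite /Phi paPsi; last exact: Vx.1.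
by rewrite (T'T Vx.1).2 /pb del_ins /Psi ins_l ins_del.
Qed.

Let V'Phi x : V x -> V' (Phi x).
Proof.
move=> Vx; split; first by rewrite /preimage /= pbPhi //; exact: (TT' Vx.2).1.
by rewrite /preimage /= PsiPhi //; exact: Vx.1.
Qed.

Let VPsi x : V' x -> V (Psi x).
Proof.
move=> Vx; split; first exact: Vx.2.
by rewrite /preimage /= paPsi; [exact: (T'T Vx.1).1|exact: Vx.1].
Qed.

Let Cpa s k (U : set 'rV[R]_n.+2) j : open U -> Ck k U (fun x => ins l (del l x) s 0 j).
Proof.
move=> oU; apply: (Ck_eq oU (f := fun x => if j == l then s else x 0 j)).
  by move=> x _; rewrite insdelE.
by case: (j == l); [exact: Ck_cst|exact: Ck_coord].
Qed.

Let cpa s : continuous (fun x : 'rV[R]_n.+2 => ins l (del l x) s).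
Proof.
move=> x; have -> : (fun x => ins l (del l x) s) = (fun y => \row_j ins l (del l y) s 0 j).
  by apply/funext => y; apply/rowP => j; rewrite [RHS]mxE.
apply: (row_cvg (F := nbhs x)) => j.
have := @Ck_cont _ _ 0 _ _ x (@Cpa s 0%N setT j openT); exact.
Qed.

Let preim_open (U : set 'rV[R]_n.+2) s : open U -> open ((fun x => ins l (del l x) s) @^-1` U).
Proof. by move=> oU; apply: open_comp => // x _; exact: cpa. Qed.

Let oV : open V.
Proof. by apply: openI; [exact: (ichart_open Xc)|apply: preim_open; exact: (tdom_open Xc Xc')]. Qed.

(** Stated for two arbitrary charts in order to serve both [Phi] and [Psi]. *)
Let CPhi_gen (d d' : chart R n.+1 M) s k (U : set 'rV[R]_n.+2) j : atlas X d -> atlas X d' -> open U ->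
  U `<=` (fun x => ins l (del l x) s) @^-1` tdom d d' ->
  Ck k U (fun x => ins l (del l (cmap d' (cinv d (ins l (del l x) s)))) (x 0 l) 0 j).
Proof.
move=> Xd Xd' oU sU.
apply: (Ck_eq oU (f := fun x => if j == l then x 0 l else cmap d' (cinv d (ins l (del l x) s)) 0 j)).
  by move=> x _; rewrite insdelE.
case: (j == l); first exact: Ck_coord.
apply: (@Ck_compF _ _ _ k U _ (fun y => cmap d' (cinv d y) 0 j) (fun x => ins l (del l x) s) oU (tdom_open Xd Xd')) => //.
  by move=> i; exact: Cpa.
exact: (trans_Cinf j Xd Xd' k).
Qed.

Let oV' : open V'.
Proof.
have oW : open (pb @^-1` tdom c' c) by apply: preim_open; exact: (tdom_open Xc' Xc).
apply: continuous_preimage_open => //; first exact: (ichart_open Xc).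
move=> x Wx; have -> : Psi = (fun y => \row_j Psi y 0 j) by apply/funext => y; apply/rowP => j; rewrite [RHS]mxE.
apply: (row_cvg (F := nbhs x)) => j.
by apply: (@Ck_cont _ _ 0 (pb @^-1` tdom c' c) _ x) => //; exact: CPhi_gen.
Qed.

Let V'h : V' `<=` @hopen R n.+1.
Proof. by move=> x [[[_]]]; rewrite /hopen /= /pb insdelE. Qed.

Let c2 := rechart c V Phi Psi.

Let Xc2 : atlas X c2.
Proof.
apply: (rechart_atlas (V' := V')) => //.
- by move=> x [].
- by move=> j k; apply: CPhi_gen => // x [].
- by move=> j k; apply: CPhi_gen => // x [].
Qed.

Let c2_image : cmap c2 @` cdom c2 = V'.
Proof. by apply: (rechart_image Xc _ V'Phi VPsi PhiPsi) => x []. Qed.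

Let ic2 : ichart c2 = V'.
Proof. by rewrite /ichart c2_image; apply/seteqP; split => [x []//|x Vx]; split => //; exact: V'h. Qed.

(* the matrix of the restriction of the transition map to the slices *)
Let D x : 'M[R]_n.+1 := row' l (col' l (\matrix_(i, j) 'D_(e_ i) (fun y => T y 0 j) (pa x))).

(** In [Phi] the last coordinate is kept and the others do not depend on it, so the Jacobian matrix
    is block diagonal with blocks 1 and [D x]. *)
Let detJ x : V x -> \det (tjac c c2 (cinv c x)) = \det (D x).
Proof.
move=> Vx; have cx : ichart c x by case: Vx.
have ip := intdomP Xc cx.
have c2p : cdom c2 (cinv c x) by split; [exact: ip.1|rewrite /preimage /= (cinvK Xc cx)].
rewrite (tjacE Xc Xc2 ip c2p) (cinvK Xc cx).
have ind s (i : 'I_n.+2) : i != l -> forall t, ins l (del l (x + t *: e_ i)) s = ins l (del l x) s + t *: e_ i.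
  move=> il t; apply/rowP => j; rewrite insdelE !mxE.
  case: (unliftP l j) => [k ->|->]; first by rewrite eq_sym (negbTE (neq_lift _ _)) !mxE.
  by rewrite eqxx [l == i]eq_sym (negbTE il) andbF mulr0 addr0.
have indl s t : ins l (del l (x + t *: e_ l)) s = ins l (del l x) s.
  apply/rowP => j; rewrite !insdelE; case: ifP => // jl; rewrite !mxE jl andbF mulr0 addr0 //.
pose J : 'M[R]_n.+2 := \matrix_(i, j) 'D_(e_ i) (fun y => cmap c2 (cinv c y) 0 j) x.
have JE i j : J i j = 'D_(e_ i) (fun y : 'rV[R]_n.+2 => if j == l then y 0 l else T (pa y) 0 j) x.
  rewrite mxE; apply: near_eq_derive; have : nbhs x V by apply: open_nbhs_nbhs.
  by apply: filterS => y [cy _]; rewrite /= (cinvK Xc cy) /Phi insdelE.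
have Jil i : J i l = (i == l)%:R.
  rewrite JE eqxx (derive_val (is_derive := is_derive_coord x (e_ i) l)) mxE eqxx /= eq_sym //.
have Jij i j : i != l -> j != l -> J i j = 'D_(e_ i) (fun y => T y 0 j) (pa x).
  move=> il jl; rewrite JE (negbTE jl).
  have E1 : (fun s : R => T (pa (x + s *: e_ i)) 0 j) = (fun s => T (pa x + s *: e_ i) 0 j).
    by apply/funext => t; rewrite /pa ind.
  apply: (etrans (derive_line _ _ _)); apply/esym; apply: (etrans (derive_line _ _ _)); apply/esym.
  by rewrite E1.
have Jlj j : j != l -> J l j = 0.
  move=> jl; rewrite JE (negbTE jl) derive_line.
  rewrite (_ : (fun s => _) = cst (T (pa x) 0 j)); last by apply/funext => t; rewrite /pa indl.
  by rewrite derive_cst.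
rewrite -/J (expand_det_col J l) (bigD1 l) //= big1 ?addr0; last first.
  by move=> i il; rewrite Jil (negbTE il) mul0r.
rewrite Jil eqxx mul1r /cofactor -signr_odd oddD addbb expr0 mul1r.
congr determinant; apply/matrixP => i j; rewrite !mxE.
transitivity (J (lift l i) (lift l j)); first by rewrite mxE.
by rewrite Jij // eq_sym neq_lift.
Qed.

(** The volume densities of [c] and [c2], and by [mdens_rel] the area densities of [c] and [c'],
    differ by the same factor [|det (D x)|]. This coincidence is what makes the comparison work. *)
Let cdens_rel x : V x -> cdens g c x = `|\det (D x)| * cdens g c2 (Phi x) /\ 0 < cdens g c x.
Proof.
move=> Vx; have cx : ichart c x by case: Vx.
have ip := intdomP Xc cx.
have c2p : cdom c2 (cinv c x) by split; [exact: ip.1|rewrite /preimage /= (cinvK Xc cx)].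
split; last by rewrite (cdensE _ cx) sqrtr_gt0; exact: gmx_det_gt0.
rewrite (cdensE _ cx) cdensE; last by rewrite ic2; exact: V'Phi.
rewrite /= PsiPhi // (gmx_transition g Xc Xc2 ip.1 c2p ip.2) -/(tjac c c2 (cinv c x)).
rewrite !det_mulmx det_tr detJ // mulrAC -expr2 sqrtrM ?sqr_ge0 // sqrtr_sqr //.
Qed.

Let mdens_rel x : V x -> mdens c (pa x) = `|\det (D x)| * mdens c' (T (pa x)).
Proof.
move=> Vx; have [cz c'z] := Vx.2; set z := pa x in cz c'z *.
have iz := intdomP Xc cz.
rewrite (mdensE cz) mdensE; last by case: (TT' Vx.2) => -[].
rewrite /T (cmapK Xc') // /minor (gmx_transition g Xc Xc' iz.1 c'z iz.2) -/(tjac c c' (cinv c z)).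
rewrite (tjacE Xc Xc' iz c'z) (cinvK Xc cz) minor_conj; last first.
  move=> i; rewrite mxE derive_line.
  rewrite -[RHS](_ : 'D_1 (cst b) (0 : R) = 0); last by rewrite derive_cst.
  apply: near_eq_derive.
  have oTd := tdom_open Xc Xc'.
  have c0 : (fun s : R => z + s *: e_ (lift l i)) @ (0 : R) --> z.
    by have := @line_continuous R _ z (e_ (lift l i)) 0; rewrite /continuous_at scale0r addr0.
  have H : \forall s \near (0 : R), tdom c c' (z + s *: e_ (lift l i)).
    exact: (c0 _ (open_nbhs_nbhs (conj oTd Vx.2))).
  apply: filterS H => s ts.
  have zl : z 0 l = a by rewrite /z /pa ins_l.
  by rewrite /cst /= -/(T _) Tab // mxE zl !mxE eqxx /= (negbTE (neq_lift _ _)) mulr0 addr0.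
rewrite -/(D x) !det_mulmx det_tr mulrAC -expr2 sqrtrM ?sqr_ge0 // sqrtr_sqr //.
Qed.

(** A weight on the transversal line through [y], with total mass [L y]. The unit ball makes the
    mass finite; openness of the chart image makes it positive when the point of the line at height
    [a] lies in the chart. *)
Let E (y : borel 'rV[R]_n.+1) (t : R) : R := \1_(ichart c) (ins l y t) * \1_(ball a 1) t.
Let L y : \bar R := (\int[@lebesgue_measure R]_t (E y t)%:E)%E.

Let E_ge0 y t : 0 <= E y t.
Proof. by rewrite /E mulr_ge0 // indicE. Qed.

Let mball : measurable (ball a 1 : set R).
Proof. exact: measurable_ball. Qed.

Let mE : measurable_fun [set: borel 'rV[R]_n.+1 * R] (fun p : borel 'rV[R]_n.+1 * R => (E p.1 p.2)%:E).
Proof.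
apply/measurable_EFinP; apply: measurable_funM.
  apply: (@measurableT_comp _ _ _ _ _ _ (\1_(ichart c) : borel 'rV[R]_n.+2 -> R)).
    by apply: measurable_indic; exact: (measurable_ichart Xc).
  by apply: measurable_ins.
apply: (@measurableT_comp _ _ _ _ _ _ (\1_(ball a 1) : R -> R)) => //.
Qed.

Let mL : measurable_fun [set: borel 'rV[R]_n.+1] L.
Proof.
rewrite (_ : L = fubini_F (@lebesgue_measure R) (fun p : borel 'rV[R]_n.+1 * R => (E p.1 p.2)%:E)) //.
by apply: measurable_fun_fubini_tonelli_F => // p; rewrite lee_fin.
Qed.

Let L_ge0 y : (0 <= L y)%E.
Proof. by apply: integral_ge0 => t _; rewrite lee_fin. Qed.

Let mEy y : measurable_fun [set: R] (fun t => (E y t)%:E).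
Proof.
apply/measurable_EFinP; apply: measurable_funM; last by apply: measurable_indic; exact: measurable_ball.
apply: (@measurableT_comp _ _ _ _ _ _ (\1_(ichart c) : borel 'rV[R]_n.+2 -> R)).
  by apply: measurable_indic; exact: (measurable_ichart Xc).
by apply: measurable_ins.
Qed.

Let L_fin y : L y \is a fin_num.
Proof.
rewrite ge0_fin_numE //; apply: (@le_lt_trans _ _ (\int[@lebesgue_measure R]_t (\1_(ball a 1) t)%:E)%E).
  apply: ge0_le_integral => //.
  - by move=> t _; rewrite lee_fin.
  - exact: mEy.
  - by apply/measurable_EFinP; apply: measurable_indic; exact: measurable_ball.
  move=> t _; rewrite lee_fin /E; apply: ler_piMl; rewrite ?indicE //.
  by case: (_ \in _).
by rewrite integral_ball // ltry.
Qed.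

Let L_gt0 y : ichart c (ins l y a) -> 0 < fine (L y).
Proof.
move=> cy; rewrite fine_gt0 // ltey_eq L_fin /= andbT.
have cins : {for a, continuous (fun t : R => ins l y t : 'rV[R]_n.+2)}.
  apply: (row_cvg (F := nbhs a)) => j; case: (unliftP l j) => [k _|_]; first exact: cvg_cst.
  exact: cvg_id.
have /nbhs_ballP[r /= r0 Hr] : nbhs a [set t | ichart c (ins l y t)].
  exact: (cins _ (open_nbhs_nbhs (conj (ichart_open Xc) cy))).
pose s := Num.min r 1; have s0 : 0 < s by rewrite lt_min r0 /=.
apply: (@lt_le_trans _ _ (\int[@lebesgue_measure R]_t (\1_(ball a s) t)%:E)%E).
  by rewrite integral_ball ?ltW // lte_fin mulrn_wgt0.
apply: ge0_le_integral => //.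
- by apply/measurable_EFinP; apply: measurable_indic; exact: measurable_ball.
- exact: mEy.
move=> t _; rewrite lee_fin /E [leLHS]indicE.
have [bt|_] := boolP (t \in (ball a s : set R)); last by rewrite mulr_ge0 // indicE.
move: bt; rewrite inE => bt; rewrite !indicE !mem_set ?mulr1 //.
  by move: bt; apply: le_ball; rewrite ge_min lexx orbT.
by apply: Hr; move: bt; apply: le_ball; rewrite ge_min lexx.
Qed.

Let norm_int y K : (0 <= K)%E -> ichart c (ins l y a) ->
  (\int[@lebesgue_measure R]_t ((E y t / fine (L y))%:E * K) = K)%E.
Proof.
move=> K0 cy; have L0 := L_gt0 cy.
have E0 t : (0 <= (E y t / fine (L y))%:E)%E by rewrite lee_fin divr_ge0 // ltW.
under eq_integral do rewrite muleC.
rewrite ge0_integralZl //; last first.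
  by apply/measurable_EFinP; apply: measurable_funM => //; apply/measurable_EFinP; exact: mEy.
under eq_integral do rewrite mulrC EFinM.
rewrite ge0_integralZl_EFin //; last first.
- by rewrite invr_ge0 ltW.
- exact: mEy.
- by move=> t _; rewrite lee_fin.
by rewrite -/(L y) -{2}(fineK (L_fin y)) -EFinM mulVf ?mule1 // gt_eqF.
Qed.

(* Integrating [F] below over M in the chart c and in the third chart [c2] gives the two sides. *)
Lemma slice_int_indep (f : borel M -> \bar R) : measurable_fun setT f -> (forall p, 0 <= f p)%E ->
  (forall p, ~ (cdom c p /\ cdom c' p) -> f p = 0)%E -> slice_int c a f = slice_int c' b f.
Proof.
move=> mf f0 fs.
have mpa : measurable_fun [set: borel 'rV[R]_n.+2] (pa : borel 'rV[R]_n.+2 -> borel 'rV[R]_n.+2).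
  by apply: continuous_borel => x; exact: cpa.
have mdel : measurable_fun [set: borel 'rV[R]_n.+2] (del l : borel 'rV[R]_n.+2 -> borel 'rV[R]_n.+1).
  apply: measurable_rV => i; rewrite (_ : (fun t => _) = (fun t : borel 'rV[R]_n.+2 => t 0 (lift l i))).
    exact: measurable_coord.
  by apply/funext => x; rewrite mxE.
(* [G] spreads the slice integrand along the transversal lines: [E / L] has mass 1 on each line, and
   dividing by [cdens] cancels the volume density, so that integration over the chart leaves [mdens]
   times [f] on the slice. *)
pose G (x : borel 'rV[R]_n.+2) : \bar R := ((\1_V x * E (del l x) (x 0 l) *
   (mdens c (pa x) * (fine (L (del l x)) * cdens g c x)^-1))%:E * f (cpt c (pa x)))%E.
have mG : measurable_fun setT G.
  apply: emeasurable_funM; last first.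
    by apply: (measurableT_comp mf); apply: (measurableT_comp (measurable_cpt Xc)).
  apply/measurable_EFinP; apply: measurable_funM.
    apply: measurable_funM; first by apply: measurable_indic; apply: open_borel; exact: oV.
    have mc : measurable_fun [set: borel 'rV[R]_n.+2] (fun x : borel 'rV[R]_n.+2 => x 0 l) by exact: measurable_coord.
    have H := measurableT_comp mE (measurable_fun_pair mdel mc).
    exact/measurable_EFinP.
  apply: measurable_funM; first by apply: (measurableT_comp (measurable_mdens Xc)).
  apply: measurable_inv_ge0; first by move=> x; rewrite mulr_ge0 ?fine_ge0 ?cdens_ge0.
  apply: measurable_funM; last exact: (measurable_cdens g Xc).
  have mLf : measurable_fun setT (fun y => fine (L y)).
    by apply/measurable_EFinP; rewrite (_ : _ \o _ = L) //; apply/funext => y; rewrite /= fineK.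
  exact: (measurableT_comp mLf mdel).
have G0 x : (0 <= G x)%E.
  rewrite mule_ge0 // lee_fin !mulr_ge0 ?mdens_ge0 ?invr_ge0 ?mulr_ge0 ?fine_ge0 ?cdens_ge0 // indicE //.
pose F : borel M -> \bar R := (G \o cmap c) \_ (cdom c2).
have oc2 : open (cdom c2) by exact: (chart_open Xc2).
have mF : measurable_fun setT F.
  apply: (measurable_restrictT _ (open_borel oc2)).1; apply: (measurableT_comp mG).
  apply: within_continuous_borel; first exact: open_borel.
  by apply: continuous_in_subspaceT => p; rewrite inE => -[cp _]; exact: (cmap_continuous Xc).
have F0 p : (0 <= F p)%E by rewrite /F patchE; case: ifP => // _; exact: G0.
have Fin p : cdom c2 p -> F p = G (cmap c p) by move=> c2p; rewrite /F patchE mem_set.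
have Fout p : ~ cdom c2 p -> F p = 0%E by move=> c2p; rewrite /F patchE memNset.
have B : (\int[v]_(p in intdom X c2) F p = slice_int c a f)%E.
  transitivity (\int[v]_(p in intdom X c) F p)%E.
    rewrite [LHS]integral_mkcond [RHS]integral_mkcond; apply: eq_integral => p _; rewrite !patchE.
    have [ip|ip] := pselect (intdom X c p); last first.
      by rewrite (memNset ip) memNset // => -[[cp _] bp]; apply: ip; split.
    rewrite (mem_set ip); have [cp|cp] := pselect (cdom c2 p).
      by rewrite mem_set //; split => //; case: ip.
    by rewrite memNset ?Fout // => -[].
  rewrite (integral_chart hv Xc mF F0) (leb_ins_swap l); last 2 first.
  - apply: emeasurable_funM; last by apply: (measurableT_comp mF); exact: (measurable_cpt Xc).
    by apply/measurable_EFinP; exact: (measurable_cdens g Xc).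
  - by move=> x; rewrite mule_ge0 // lee_fin cdens_ge0.
  apply: eq_integral => y _; set K : \bar R := (_ * f _)%E.
  have K0 : (0 <= K)%E by rewrite mule_ge0 // lee_fin mdens_ge0.
  have [ty|ty] := pselect (tdom c c' (ins l y a)); last first.
    have -> : K = 0%E.
      have [cy|cy] := pselect (ichart c (ins l y a)); last by rewrite /K mdens_out // mul0e.
      rewrite /K fs ?mule0 // (cptE cy) => -[_ c'y]; by apply: ty.
    rewrite [LHS]integral0_eq // => t _.
    have [cy|cy] := pselect (ichart c (ins l y t)); last by rewrite cdens_out // mul0e.
    rewrite (cptE cy) Fout ?mule0 // => -[_]; rewrite /preimage /= (cinvK Xc cy) => -[_].
    by rewrite /preimage /pa /= del_ins.
  rewrite -[RHS](norm_int K0 ty.1); apply: eq_integral => t _.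
  have [cy|cy] := pselect (ichart c (ins l y t)); last first.
    by rewrite cdens_out // mul0e /E indicE memNset // !mul0r mul0e.
  have Vt : V (ins l y t) by split => //; rewrite /preimage /pa /= del_ins.
  have c2t : cdom c2 (cinv c (ins l y t)).
    by split; [exact: (cinv_dom Xc cy)|rewrite /preimage /= (cinvK Xc cy)].
  rewrite (cptE cy) (Fin _ c2t) (cinvK Xc cy) /G del_ins ins_at /pa del_ins indicE (mem_set Vt).
  rewrite /K !muleA -!EFinM; congr (_%:E * _)%E.
  have [_ cd0] := cdens_rel Vt; have L0 := L_gt0 ty.1.
  by rewrite -[true%:R]/(1 : R); field; rewrite !gt_eqF.
(* The second evaluation of the same integral, now in [c2]. A line of [c2] over the point [z'] of
   the slice of [c'] is a line of [c] over [T' z'], and the factor from [mdens_rel] cancels the one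
   from [cdens_rel]. *)
rewrite -B (integral_chart hv Xc2 mF F0) (leb_ins_swap l); last 2 first.
- apply: emeasurable_funM; last by apply: (measurableT_comp mF); exact: (measurable_cpt Xc2).
  by apply/measurable_EFinP; exact: (measurable_cdens g Xc2).
- by move=> x; rewrite mule_ge0 // lee_fin cdens_ge0.
apply: eq_integral => y _; set K : \bar R := (_ * f _)%E.
have K0 : (0 <= K)%E by rewrite mule_ge0 // lee_fin mdens_ge0.
have pbi t : pb (ins l y t) = ins l y b by rewrite /pb del_ins.
have [ty|ty] := pselect (tdom c' c (ins l y b)); last first.
  have -> : K = 0%E.
    have [cy|cy] := pselect (ichart c' (ins l y b)); last by rewrite /K mdens_out // mul0e.
    rewrite /K fs ?mule0 // (cptE cy) => -[cy' _]; by apply: ty.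
  rewrite [LHS]integral0_eq // => t _; rewrite cdens_out ?mul0e // ic2 => -[+ _].
  by rewrite /preimage /= pbi.
set z' := ins l y b; have [tz Tz] := T'T ty; rewrite -/z' in tz Tz.
have za : T' z' 0 l = a by apply: Tba => //; rewrite /z' ins_at.
set y1 : 'rV[R]_n.+1 := del l (T' z').
have zE : ins l y1 a = T' z' by rewrite /y1 -za ins_del.
have cy1 : ichart c (ins l y1 a) by rewrite zE; case: tz.
rewrite -[RHS](norm_int K0 cy1); apply: eq_integral => t _.
have PsiE : Psi (ins l y t) = ins l y1 t by rewrite /Psi pbi ins_at.
have [Vt|Vt] := pselect (V' (ins l y t)); last first.
  rewrite cdens_out ?mul0e; last by rewrite ic2.
  rewrite /E indicE memNset ?mul0r ?mul0e // -PsiE => H; apply: Vt; split => //.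
  by rewrite /preimage /= pbi.
have Vx := VPsi Vt; have xc : ichart c (ins l y1 t) by rewrite -PsiE; case: Vx.
have ict : ichart c2 (ins l y t) by rewrite ic2.
have c2t : cdom c2 (cinv c (ins l y1 t)).
  by split; [exact: (cinv_dom Xc xc)|rewrite /preimage /= (cinvK Xc xc) -PsiE].
rewrite (cptE ict) /= PsiE (Fin _ c2t) (cinvK Xc xc) /G del_ins ins_at indicE mem_set; last by rewrite -PsiE.
have [cr cd0] := cdens_rel Vx; have mr := mdens_rel Vx.
move: cr cd0 mr; rewrite PhiPsi // PsiE /pa del_ins zE Tz => cr cd0 mr.
have cz' : cpt c (T' z') = cpt c' z'.
  by rewrite (cptE tz.1) (cptE ty.1) /T' (cmapK Xc) //; case: ty.
rewrite /K cz' !muleA -!EFinM; congr (_%:E * _)%E; rewrite mr cr.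
have L0 := L_gt0 cy1.
move: cd0; rewrite cr; set J := `|_|; set d2 := cdens g c2 _ => cd0.
have J0 : J != 0 by apply: contraTneq cd0 => ->; rewrite mul0r ltxx.
have d20 : d2 != 0 by apply: contraTneq cd0 => ->; rewrite mulr0 ltxx.
by rewrite -[true%:R]/(1 : R); field; rewrite J0 d20 gt_eqF.
Qed.

End Independence.

End Slice.

(** * Charts adapted to a function *)

Section LevelCharts.
Context {R : realType} {n : nat} {M : ptopologicalType} (X : smoothStructure R n.+1 M).
Context (compactM : compact [set: M]).
Notation e_ i := (delta_mx 0 i).
Notation l := (@ord_max n.+1).
Implicit Types (c : chart R n.+1 M) (p : M) (x : 'rV[R]_n.+2).
Variables (f : M -> R) (sf : smf X f).

(** One such chart serves all levels at once: its slice at height [t] is the part of the level set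
    of [t] in its domain. *)
Definition level_chart c := atlas X c /\ forall p, cdom c p -> ~ mboundary X p /\ cmap c p 0 l = f p.

(* f becomes the last coordinate; x_l moves to the place of x_i, and the first coordinate is
   shifted to stay in the half-space. *)
Lemma level_chart_at c x i : atlas X c -> ichart c x -> 'D_(e_ i) (f \o cinv c) x != 0 ->
  exists2 c2, level_chart c2 & exists O, [/\ open O, O x & O `<=` ichart c `&` cinv c @^-1` cdom c2].
Proof.
move=> Xc cx dx; pose w := f \o cinv c.
have Cwc : Cinf (ichart c) w by exact: (smf_Cinf sf Xc).
have [r r0 [rc Cw dw]] := straighten_box (ichart_open Xc) Cwc cx dx.
(* On the ball every coordinate exceeds [- (r + |x|)], so adding [A] makes the new first coordinate
   positive. The coordinate that lands in first place is never [w], since [l] differs from [ord0];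
   this uses that the dimension is at least 2. *)
pose A : R := r + `|x| + 1.
pose S := (fun x => repl i x (w x)) @` ball x r.
pose Phi (y : 'rV[R]_n.+2) : 'rV[R]_n.+2 := \row_j (repl i y (w y) 0 (tperm i l j) + (j == ord0)%:R * A).
pose sh (y : 'rV[R]_n.+2) : 'rV[R]_n.+2 := \row_j (y 0 (tperm i l j) - (tperm i l j == ord0)%:R * A).
pose Psi y := straighten_inv w i x r (sh y).
have oS : open S by apply: (straighten_open r0 Cw dx dw); [exact: ball_open|].
have shPhi y : sh (Phi y) = repl i y (w y).
  by apply/rowP => j; rewrite !mxE tpermK addrK.
have l0 : (l == ord0) = false by [].
pose V' := sh @^-1` S.
have Csh k U j : open U -> Ck k U (fun y => sh y 0 j).
  move=> oU; apply: (Ck_eq oU (f := fun y => y 0 (tperm i l j) - (tperm i l j == ord0)%:R * A)).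
    by move=> y _; rewrite mxE.
  by apply: (CkB oU); [exact: Ck_coord|exact: Ck_cst].
have oV' : open V'.
  rewrite /V' -[X in open X]setTI; apply: continuous_preimage_open => //; first exact: openT.
  move=> y _; have -> : sh = (fun y => \row_j sh y 0 j) by apply/funext => z; apply/rowP => j; rewrite mxE.
  by apply: (row_cvg (F := nbhs y)) => j; apply: (Ck_cont (Csh 0%N setT j openT)).
have V'E y : V' y -> exists z, [/\ ball x r z, Psi y = z & sh y = repl i z (w z)].
  move=> [z xz zy]; exists z; split => //.
  by rewrite /Psi -zy (straighten_invP r0 Cw dw).
have PhiPsi y : V' y -> Phi (Psi y) = y.
  move=> /V'E[z [xz -> zE]]; apply/rowP => j; rewrite mxE -zE mxE tpermK.
  by rewrite subrK.
have V'h : V' `<=` hopen.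
  move=> y /V'E[z [xz _ zE]]; have /rowP/(_ (tperm i l ord0)) := zE.
  rewrite !mxE tpermK eqxx mul1r.
  have ti : (tperm i l ord0 == i) = false.
    by apply/negbTE/eqP => H; have := tpermK i l ord0; rewrite H tpermL => /eqP; rewrite l0.
  rewrite ti => /(canRL (subrK _)) yE; rewrite /hopen /= yE.
  set j := tperm i l ord0; have /(ball_coordP _ _ r0)/(_ j) := xz.
  have := le_mx_norm x j; rewrite /A; set a := `|x|; rewrite ltr_norml ler_norml.
  by move=> /andP[] H1 H2 /andP[] H3 H4; lra.
have Cr k j : Ck k (ball x r) (fun y => repl i y (w y) 0 j).
  have oB : open (ball x r) by exact: ball_open.
  have [->|ji] := eqVneq j i.
    by apply: (Ck_eq oB (f := w)) (Cw k) => y _; rewrite mxE eqxx.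
  by apply: (Ck_eq oB (f := fun y => y 0 j)) (Ck_coord k _ j) => y _; rewrite mxE (negbTE ji).
pose c2 := rechart c (ball x r) Phi Psi.
have oB : open (ball x r) by exact: ball_open.
have Xc2 : atlas X c2.
  apply: (@rechart_atlas _ _ _ X c (ball x r) V' Phi Psi Xc oB rc oV' V'h).
  - by move=> z xz; rewrite /V' /preimage /= shPhi; exists z.
  - by move=> y /V'E[z [xz -> _]].
  - by move=> z xz; rewrite /Psi shPhi (straighten_invP r0 Cw dw).
  - exact: PhiPsi.
  - move=> j k; apply: (Ck_eq oB (f := fun y => repl i y (w y) 0 (tperm i l j) + (j == ord0)%:R * A)).
      by move=> y _; rewrite [RHS]mxE.
    by apply: CkD; [exact: ball_open|exact: Cr|exact: Ck_cst].
  - move=> j k; apply: (@Ck_compF _ _ _ k _ S (fun y => straighten_inv w i x r y 0 j) sh oV' oS).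
    + by [].
    + by move=> j'; exact: Csh.
    + exact: (straighten_Cinf r0 Cw dx dw).
exists c2.
  split=> // p [cp Vp]; split; last by rewrite /= !mxE l0 mul0r addr0 tpermR eqxx /w /= (cmapK Xc).
  have [_ p0] := rc _ Vp; exact/(mboundaryPn Xc cp).
exists (ball x r); split => //; [exact: ballxx|] => y xy.
have cy := rc _ xy; split => //; split; first exact: (cinv_dom Xc cy).
by rewrite /preimage /= (cinvK Xc cy).
Qed.

(** A filler for the idle indices of an enumeration. *)
Definition empty_chart c : chart R n.+1 M := rechart c set0 id id.

Lemma level_chart_empty c : atlas X c -> level_chart (empty_chart c).
Proof.
move=> Xc; split; last by move=> p [].
by apply: (@rechart_atlas _ _ _ X c set0 set0 id id Xc) ; try exact: open0; by move=> // j k; exact: Ck_coord.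
Qed.

(** The charts come as a sequence so that the measure on a level set can be defined as a series. *)
Definition level_covered (A : set M) := exists2 F : nat -> chart R n.+1 M,
  forall k, level_chart (F k) & A `<=` \bigcup_k cdom (F k).

Lemma level_covered0 A : A `<=` set0 -> level_covered A.
Proof.
move=> A0; exists (fun=> empty_chart (chart_at X point)); last by move=> p /A0.
by move=> k; exact: level_chart_empty (chart_atP X _).
Qed.

Lemma level_covered_bigcup (A : nat -> set M) : (forall k, level_covered (A k)) -> level_covered (\bigcup_k A k).
Proof.
move=> HA; have /choice[G GP] : forall k, exists F : nat -> chart R n.+1 M,
    (forall k, level_chart (F k)) /\ A k `<=` \bigcup_k cdom (F k) by move=> k; have [F ? ?] := HA k; exists F.
pose F k := if @unpickle (nat * nat)%type k is Some ij then G ij.1 ij.2 else empty_chart (chart_at X point).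
exists F => [k|p [i _ /(GP i).2[j _ Gp]]].
  rewrite /F; case: unpickle => [[i j]|]; first exact: (GP i).1.
  exact: level_chart_empty (chart_atP X _).
by exists (pickle (i, j)) => //; rewrite /F pickleK.
Qed.

(** By [dform_transition] the vanishing of the differential at an interior point is independent of
    the chart chosen at it. *)
Definition critical p := ~ mboundary X p /\ dform (chart_at X p) f p = 0.

Lemma level_covered_regular : level_covered [set p | ~ mboundary X p /\ ~ critical p].
Proof.
have [|p|N [q qc]] := @finite_subcover M compactM (fun p => cdom (chart_at X p)).
- by move=> p; exact: (chart_open (chart_atP X p)).
- exact: chart_at_dom.
pose A c := [set x | ichart c x /\ exists i, 'D_(e_ i) (f \o cinv c) x != 0].
have cov c : atlas X c -> level_covered (cinv c @` A c).
  move=> Xc; apply: (@rV_lindelof _ _ (fun B => level_covered (cinv c @` B))).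
  - by apply: level_covered0; rewrite image_set0.
  - move=> B C BC [F FP FC]; exists F => // p [x /BC Cx <-]; apply: FC; by exists x.
  - by move=> B HB; rewrite image_bigcup; exact: level_covered_bigcup.
  - move=> x [cx [i dx]]; have [c2 gc2 [U [oU Ux Uc]]] := level_chart_at Xc cx dx.
    exists U; split => //; exists (fun=> c2) => // _ [y [_ /Uc[_ Oy]] <-]; by exists 0%N.
pose B k : set M := if insub k is Some i then cinv (chart_at X (q i)) @` A (chart_at X (q i)) else set0.
have [F FP FC] : level_covered (\bigcup_k B k).
  apply: level_covered_bigcup => k; rewrite /B; case: insubP => [i _ _|_]; last exact: level_covered0.
  exact: (cov _ (chart_atP X (q i))).
exists F => // p [bp crp]; apply: FC; have [i ip] := qc p; exists (nat_of_ord i) => //.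
rewrite /B valK; set c := chart_at X (q i); have Xc : atlas X c := chart_atP X (q i).
have intp : intdom X c p by split.
exists (cmap c p); last exact: (cmapK Xc).
split; first exact: (ichart_intdom Xc intp).
apply: contrapT => /forallNP H; apply: crp; split => //.
have Xp := chart_atP X p; have pp := chart_at_dom X p.
rewrite (@dform_transition _ _ _ X (chart_at X p) c) //; last exact: (smf_Cinf sf Xc 1%N).
rewrite (_ : dform c f p = 0) ?mul0mx //.
by apply/rowP => j; rewrite !mxE; apply/eqP/negPn/negP => Hj; apply: (H j).
Qed.

Lemma Sard_manifold : (@lebesgue_measure R).-negligible (f @` critical).
Proof.
have [|p|N [q qc]] := @finite_subcover M compactM (fun p => cdom (chart_at X p)).
- by move=> p; exact: (chart_open (chart_atP X p)).
- exact: chart_at_dom.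
pose B (i : 'I_N) := let c := chart_at X (q i) in
  (f \o cinv c) @` [set x | ichart c x /\ forall j, 'D_(e_ j) (f \o cinv c) x = 0].
have : (@lebesgue_measure R).-negligible (\big[setU/set0]_(i < N) B i).
  elim/big_ind : _ => [|? ?|i _]; [exact: negligible_set0|exact: negligibleU|].
  have Xc := chart_atP X (q i).
  by apply: Sard; [exact: (ichart_open Xc)|exact: (smf_Cinf sf Xc)].
apply: negligibleS => _ [p [bp dp] <-]; have [i ip] := qc p.
apply: (bigsetU_ord_sup (U := B) (i := i)); rewrite /B.
set c := chart_at X (q i); have Xc : atlas X c := chart_atP X (q i).
have intp : intdom X c p by split.
exists (cmap c p); last by rewrite /= (cmapK Xc).
split; first exact: (ichart_intdom Xc intp).
have Xp := chart_atP X p; have pp := chart_at_dom X p.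
have : dform c f p = 0.
  by rewrite (@dform_transition _ _ _ X c (chart_at X p)) ?dp ?mul0mx //; exact: (smf_Cinf sf Xp 1%N).
by move=> /rowP H j; have := H j; rewrite !mxE.
Qed.

End LevelCharts.

Section GradSquare.
Context {R : realType} {n : nat} {M : ptopologicalType} (X : smoothStructure R n M).
Context (g : riemannianMetric X).
Notation e_ i := (delta_mx 0 i).
Implicit Types (c : chart R n M) (p : M) (x : 'rV[R]_n.+1).

(** The boundary is negligible for [v]; the default 0 on it keeps the function Borel and nonnegative
    everywhere. *)
Definition gsq (f : M -> R) : M -> R :=
  (fun p => gnorm2 g (chart_at X p) p (dform (chart_at X p) f p)) \_ (~` mboundary X).

Lemma gsqE f c p : smf X f -> atlas X c -> intdom X c p -> gsq f p = gnorm2 g c p (dform c f p).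
Proof.
move=> sf Xc [cp bp]; rewrite /gsq patchE mem_set //.
apply: gnorm2_dform => //; first exact: chart_atP.
by split => //; exact: chart_at_dom.
Qed.

Lemma gsq_ge0 f p : 0 <= gsq f p.
Proof.
rewrite /gsq patchE; case: ifP => // _; apply: gnorm2_ge0; [exact: chart_atP|exact: chart_at_dom].
Qed.

Lemma gsqN f p : smf X f -> gsq (fun p => - f p) p = gsq f p.
Proof.
move=> sf; rewrite /gsq !patchE; case: ifP => // bp; rewrite inE in bp.
set c := chart_at X p; have Xc : atlas X c := chart_atP X p; have cp : cdom c p := chart_at_dom X p.
have -> : dform c (fun p => - f p) p = (-1) *: dform c f p.
  apply/rowP => j; rewrite !mxE mulN1r -deriveN //.
  exact: (Ck_derivable (smf_Cinf sf Xc 1%N) (ichart_intdom Xc (conj cp bp))).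
by rewrite /gnorm2 bformZl bformZr mulN1r mulN1r opprK.
Qed.

Lemma gsq_continuous f p : smf X f -> ~ mboundary X p -> {for p, continuous (gsq f)}.
Proof.
move=> sf bp; set c := chart_at X p; have Xc : atlas X c := chart_atP X p.
have ip : intdom X c p by split => //; exact: chart_at_dom.
pose w i x := 'D_(e_ i) (f \o cinv c) x.
pose h x := \sum_i \sum_j w i x * invmx (gmx g c (cinv c x)) i j * w j x.
have oI := ichart_open Xc.
have Ch : Ck 0 (ichart c) h.
  apply: Ck_sum => // i _; apply: Ck_sum => // j _.
  have Cw k : Ck 0 (ichart c) (w k) by apply: CkD1; exact: (smf_Cinf sf Xc 1%N).
  apply: CkM => //; apply: CkM => //; apply: invmx_Ck => //.
    by move=> x cx; rewrite gt_eqF // gmx_det_gt0.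
  by move=> i' j'; exact: gmx_Ck.
have E q : intdom X c q -> gsq f q = h (cmap c q).
  move=> iq; rewrite (gsqE sf Xc iq) /gnorm2 bformE /h (cmapK Xc) ?iq.1 //; last exact: iq.1.
  by apply: eq_bigr => i _; apply: eq_bigr => j _; rewrite !mxE.
have H : {for p, continuous (h \o cmap c)}.
  apply: continuous_comp; first exact: (cmap_continuous Xc ip.1).
  by apply: (Ck_cont Ch); exact: (ichart_intdom Xc ip).
rewrite /prop_for /continuous_at E //; apply: cvg_trans H; apply: near_eq_cvg.
have : nbhs p (intdom X c) by apply: open_nbhs_nbhs; split => //; exact: intdom_open.
by apply: filterS => q iq; rewrite /= E.
Qed.

Lemma measurable_gsq f : smf X f -> measurable_fun [set: borel M] (gsq f : borel M -> R).
Proof.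
move=> sf; have mb : measurable (~` mboundary X : set (borel M)).
  by apply: measurableC; exact: measurable_mboundary.
have -> : gsq f = (gsq f) \_ (~` mboundary X).
  by apply/funext => p; rewrite /gsq !patchE; case: ifP.
apply: (measurable_restrictT _ mb).1; apply: within_continuous_borelR => //.
by apply: continuous_in_subspaceT => p; rewrite inE => bp; exact: gsq_continuous.
Qed.

End GradSquare.

(** * The coarea formula *)

Section Coarea.
Context {R : realType} {n : nat} {M : ptopologicalType} (X : smoothStructure R n.+1 M).
Context (g : riemannianMetric X) (v : {measure set borel M -> \bar R}) (hv : is_volume g v).
Notation e_ i := (delta_mx 0 i).
Notation l := (@ord_max n.+1).
Implicit Types (c : chart R n.+1 M) (p : M) (x : 'rV[R]_n.+2) (t : R).
Variables (f : M -> R) (sf : smf X f).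

Lemma measurable_slice c (phi : borel M -> \bar R) : atlas X c -> measurable_fun setT phi ->
  measurable_fun [set: borel 'rV[R]_n.+2] (fun x => (mdens g c x)%:E * phi (cpt c x))%E.
Proof.
move=> Xc mp; apply: emeasurable_funM; last by apply: (measurableT_comp mp); exact: (measurable_cpt Xc).
by apply/measurable_EFinP; exact: (measurable_mdens g Xc).
Qed.

Lemma slice_int_ge0 c t (phi : borel M -> \bar R) : (forall p, 0 <= phi p)%E -> (0 <= slice_int g c t phi)%E.
Proof. by move=> p0; apply: integral_ge0 => y _; rewrite mule_ge0 // lee_fin mdens_ge0. Qed.

Lemma measurable_slice_int c (phi : borel M -> \bar R) : atlas X c -> measurable_fun setT phi ->
  (forall p, 0 <= phi p)%E -> measurable_fun [set: R] (fun t => slice_int g c t phi).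
Proof.
move=> Xc mp p0.
apply: (@measurable_fun_fubini_tonelli_F _ _ R (borel 'rV[R]_n.+1) R (@leb R n.+1)
  (fun q : R * borel 'rV[R]_n.+1 => (mdens g c (ins l q.2 q.1))%:E * phi (cpt c (ins l q.2 q.1)))%E).
  by apply: (measurableT_comp (measurable_slice Xc mp)); exact: measurable_ins.
by move=> q; rewrite mule_ge0 // lee_fin mdens_ge0.
Qed.

Lemma level_dform c p : level_chart X f c -> cdom c p -> dform c f p = e_ l.
Proof.
move=> [Xc lc] cp; have [bp _] := lc p cp.
have ic : ichart c (cmap c p) by apply: (ichart_intdom Xc); split.
apply/rowP => j; rewrite !mxE.
have H : 'D_(e_ j) (f \o cinv c) (cmap c p) = 'D_(e_ j) (fun y : 'rV[R]_n.+2 => y 0 l) (cmap c p).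
  apply: near_eq_derive; have : nbhs (cmap c p) (ichart c).
    by apply: open_nbhs_nbhs; split => //; exact: (ichart_open Xc).
  apply: filterS => y cy /=; have [_ <-] := lc _ (cinv_dom Xc cy).
  by rewrite (cinvK Xc cy).
by rewrite H (derive_val (is_derive := is_derive_coord (cmap c p) (e_ j) l)) !mxE eqxx /= eq_sym.
Qed.

(** In a level chart the differential of [f] is [e_ l], so [gsq] is the last diagonal entry of the
    inverse metric and [invmx_last] applies. *)
Lemma mdens_level c x : level_chart X f c -> ichart c x ->
  mdens g c x = cdens g c x * Num.sqrt (gsq g f (cinv c x)).
Proof.
move=> lc cx; have Xc := lc.1; have cp := cinv_dom Xc cx.
rewrite mdensE // cdensE // -sqrtrM; last by rewrite ltW // gmx_det_gt0.
congr Num.sqrt; rewrite (gsqE g sf Xc (intdomP Xc cx)) (level_dform lc cp) /minor -invmx_last.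
  congr (_ * _); rewrite /gnorm2 bformE (bigD1 l) //= [X in _ + X]big1 ?addr0; last first.
    by move=> i il; rewrite big1 // => j _; rewrite !mxE (negbTE il) andbF !mul0r.
  rewrite (bigD1 l) //= [X in _ + X]big1 ?addr0; last first.
    by move=> j jl; rewrite [X in _ * X]mxE (negbTE jl) andbF !mulr0.
  by rewrite !mxE !eqxx mul1r mulr1.
by apply: posdef_unit; exact: gmx_posdef.
Qed.

Variables (F : nat -> chart R n.+1 M) (FP : forall k, level_chart X f (F k)).

Definition piece k : set M := seqDU (fun k => cdom (F k)) k.

Lemma measurable_piece k : measurable (piece k : set (borel M)).
Proof.
have mF j : measurable (cdom (F j) : set (borel M)).
  by apply: open_borel; exact: (chart_open (FP j).1).
by apply: measurableD => //; apply: bigsetU_measurable => j _; exact: mF.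
Qed.

Lemma piece_sub k : piece k `<=` cdom (F k).
Proof. exact: subset_seqDU. Qed.

Local Open Scope ereal_scope.

Let wt k t (y : borel 'rV[R]_n.+1) : R := (mdens g (F k) (ins l y t) * \1_(piece k) (cpt (F k) (ins l y t)))%R.
Let st k t (y : borel 'rV[R]_n.+1) : borel M := cpt (F k) (ins l y t).

Let mins t : measurable_fun [set: borel 'rV[R]_n.+1] ((fun y => ins l y t) : _ -> borel 'rV[R]_n.+2).
Proof. by apply: measurable_ins => //; exact: measurable_id. Qed.

Let mst k t : measurable_fun setT (st k t).
Proof. exact: (measurableT_comp (measurable_cpt (FP k).1) (mins t)). Qed.

Let mwt k t : measurable_fun setT (wt k t).
Proof.
apply: measurable_funM; first exact: (measurableT_comp (measurable_mdens g (FP k).1) (mins t)).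
apply: (@measurableT_comp _ _ _ _ _ _ (\1_(piece k) : borel M -> R)); last exact: mst.
apply: measurable_indic; exact: measurable_piece.
Qed.

Let wt_ge0 k t y : (0 <= wt k t y)%R.
Proof. by rewrite mulr_ge0 ?mdens_ge0 // indicE. Qed.

(** The area measure of the level set, glued from the slices in disjoint pieces of the level charts.
    The pieces do not depend on [t], which makes integrals against it measurable in [t]. *)
Definition level_measure t : {measure set borel M -> \bar R} :=
  mseries (fun k => imdens_measure (@leb R n.+1) (mwt k t) (wt_ge0 k t) (mst k t)) 0%N.

Definition on_piece k (phi : borel M -> \bar R) (p : borel M) : \bar R := phi p * (\1_(piece k) p)%:E.

Lemma measurable_on_piece k (phi : borel M -> \bar R) : measurable_fun setT phi -> measurable_fun setT (on_piece k phi).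
Proof.
move=> mp; apply: emeasurable_funM => //; apply/measurable_EFinP.
by apply: measurable_indic; exact: measurable_piece.
Qed.

Lemma on_piece_ge0 k (phi : borel M -> \bar R) p : (forall p, 0 <= phi p) -> 0 <= on_piece k phi p.
Proof. by move=> p0; rewrite mule_ge0 // lee_fin indicE. Qed.

Lemma integral_level_measure t (phi : borel M -> \bar R) : measurable_fun setT phi -> (forall p, 0 <= phi p) ->
  \int[level_measure t]_p phi p = \sum_(k <oo) slice_int g (F k) t (on_piece k phi).
Proof.
move=> mp p0; rewrite /level_measure ge0_integral_measure_series //.
apply: eq_eseriesr => k _.
rewrite /= integral_imdens //.
apply: eq_integral => y _; rewrite /on_piece /wt EFinM -muleA; congr (_ * _); exact: muleC.
Qed.

Lemma measurable_level_integral (phi : borel M -> \bar R) : measurable_fun setT phi -> (forall p, 0 <= phi p) ->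
  measurable_fun [set: R] (fun t => \int[level_measure t]_p phi p).
Proof.
move=> mp p0; under eq_fun do rewrite integral_level_measure //.
apply: ge0_emeasurable_sum => [k t _ _|k _].
  by apply: slice_int_ge0 => p; exact: on_piece_ge0.
apply: measurable_slice_int; [exact: (FP k).1|exact: measurable_on_piece|].
by move=> p; exact: on_piece_ge0.
Qed.

(** On each piece Tonelli's theorem in the last coordinate and [mdens_level] give an equality. The
    sum over the pieces is the integral over the union of the charts, which is at most the integral
    over [M]. *)
Lemma coarea_le (phi : borel M -> \bar R) : measurable_fun setT phi -> (forall p, 0 <= phi p) ->
  \int[@lebesgue_measure R]_t \int[level_measure t]_p phi p <=
  \int[v]_p (phi p * (Num.sqrt (gsq g f p))%:E).
Proof.
move=> mp p0.
pose h (p : borel M) := phi p * (Num.sqrt (gsq g f p))%:E.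
have mh : measurable_fun [set: borel M] h.
  apply: emeasurable_funM => //; apply/measurable_EFinP.
  exact: (measurableT_comp (continuous_measurable_fun (@sqrt_continuous R)) (measurable_gsq g sf)).
have h0 p : 0 <= h p by rewrite mule_ge0 // lee_fin sqrtr_ge0.
under eq_integral do rewrite integral_level_measure //.
rewrite integral_nneseries //; last 2 first.
- move=> k; apply: measurable_slice_int; [exact: (FP k).1|exact: measurable_on_piece|].
  by move=> p; exact: on_piece_ge0.
- by move=> k t _; apply: slice_int_ge0 => p; exact: on_piece_ge0.
have E k : \int[@lebesgue_measure R]_t slice_int g (F k) t (on_piece k phi) = \int[v]_(p in piece k) h p.
  have [Xc lc] := FP k; have mop := measurable_on_piece k mp.
  have op0 p : 0 <= on_piece k phi p by exact: on_piece_ge0.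
  transitivity (\int[@leb R n.+2]_x ((mdens g (F k) x)%:E * on_piece k phi (cpt (F k) x))).
    rewrite (leb_ins l) //; first exact: measurable_slice.
    by move=> x; rewrite mule_ge0 // lee_fin mdens_ge0.
  transitivity (\int[@leb R n.+2]_x ((cdens g (F k) x)%:E * on_piece k h (cpt (F k) x))).
    apply: eq_integral => x _; have [cx|cx] := pselect (ichart (F k) x); last first.
      by rewrite cdens_out // mdens_out // !mul0e.
    rewrite (mdens_level (FP k) cx) (cptE cx) /on_piece /h EFinM -muleA; congr (_ * _).
    by rewrite muleCA muleA.
  rewrite -(integral_chart hv Xc (measurable_on_piece k mh)); last by move=> p; exact: on_piece_ge0.
  rewrite [LHS]integral_mkcond [RHS]integral_mkcond; apply: eq_integral => p _; rewrite !patchE.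
  have [pk|pk] := pselect (piece k p).
    rewrite (mem_set pk) mem_set; first by rewrite /on_piece indicE mem_set // mule1.
    by split; [exact: piece_sub|exact: (lc p (piece_sub pk)).1].
  by rewrite (memNset pk); case: ifP => // _; rewrite /on_piece indicE memNset // mule0.
under eq_eseriesr do rewrite E.
rewrite -ge0_integral_bigcup //.
- apply: ge0_subset_integral => //.
  by apply: bigcupT_measurable => k; exact: measurable_piece.
- by move=> k; exact: measurable_piece.
- exact: measurable_funTS.
- exact: trivIset_seqDU.
Qed.

End Coarea.

(** * Level sets *)

Section LevelSets.
Context {R : realType} {n : nat} {M : ptopologicalType} (X : smoothStructure R n.+1 M).
Context (g : riemannianMetric X) (v : {measure set borel M -> \bar R}) (hv : is_volume g v).
Notation e_ i := (delta_mx 0 i).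
Notation l := (@ord_max n.+1).
Implicit Types (c : chart R n.+1 M) (p : M) (x : 'rV[R]_n.+2) (t : R).
Variables (f : M -> R) (sf : smf X f).
Variables (F : nat -> chart R n.+1 M) (FP : forall k, level_chart X f (F k)).
Hypothesis FC : [set p | ~ mboundary X p /\ ~ critical X f p] `<=` \bigcup_k cdom (F k).

Definition level_set t : set M := [set p | ~ mboundary X p /\ f p = t].
Definition superlevel t : set M := [set p | t < f p].

Let cf : continuous f. Proof. exact: (smf_continuous sf). Qed.

Lemma superlevel_open t : open (superlevel t).
Proof.
by apply: (@open_comp _ _ f [set s : R | t < s]); [move=> p _; exact: cf|exact: open_gt].
Qed.

Lemma measurable_level_set t : measurable (level_set t : set (borel M)).
Proof.
apply: measurableI; first by apply: measurableC; exact: measurable_mboundary.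
apply: closed_borel; apply: (@closed_comp _ _ f [set t]); last exact: closed_eq.
by move=> p _; exact: cf.
Qed.

Section RegularLevel.
Variables (t : R) (regt : ~ (f @` critical X f) t).

Let levelP p : level_set t p -> exists k, cdom (F k) p.
Proof.
move=> [bp ft]; have [//|k _ Fk] := FC (_ : [set p | ~ mboundary X p /\ ~ critical X f p] p).
  by split => // cp; apply: regt; exists p.
by exists k.
Qed.

Let tr (s : R) x : 'rV[R]_n.+2 := x + s *: e_ l.

Let trl s x : tr s x 0 l = x 0 l + s.
Proof. by rewrite !mxE !eqxx mulr1. Qed.

Let tr0 s x : tr s x 0 ord0 = x 0 ord0.
Proof. by rewrite !mxE mulr0 addr0. Qed.

Let trK s s' x : s + s' = 0 -> tr s (tr s' x) = x.
Proof. by move=> ss; rewrite /tr -addrA -scalerDl addrC [s' + s]addrC ss scale0r add0r. Qed.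

Let Ctr s k (U : set 'rV[R]_n.+2) j : open U -> Ck k U (fun x => tr s x 0 j).
Proof.
move=> oU; apply: (Ck_eq oU (f := fun x => x 0 j + (s *: e_ l) 0 j)).
  by move=> x _; rewrite [RHS]mxE.
by apply: CkD => //; [exact: Ck_coord|exact: Ck_cst].
Qed.

Let ctr s : continuous (tr s).
Proof. by move=> x; apply: (cvgD (F := nbhs x)); [exact: cvg_id|exact: cvg_cst]. Qed.

(** [slice_chart] wants the slice at height 0, so a level chart is translated by [- t] in its last
    coordinate, which leaves the first coordinate and the half-space alone. As [t] is a regular
    value, every point of the level set has a level chart. *)
Lemma level_hypersurface : smooth_hypersurface X (level_set t).
Proof.
move=> p Sp; have [k Fp] := levelP Sp; have [Xc lc] := FP k; set c := F k in Fp Xc lc.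
have oV : open (ichart c) := ichart_open Xc.
pose V' := tr t @^-1` ichart c.
have oV' : open V' by apply: open_comp => // x _; exact: ctr.
exists (rechart c (ichart c) (tr (- t)) (tr t)); last first.
  by split => //; apply: (ichart_intdom Xc); split => //; case: Sp.
split.
  apply: (@rechart_atlas _ _ _ X c (ichart c) V' (tr (- t)) (tr t) Xc oV _ oV').
  - by [].
  - by move=> x [_]; rewrite /hopen /= tr0.
  - by move=> x cx; rewrite /V' /preimage /= trK ?subrr.
  - by [].
  - by move=> x _; rewrite trK // subrr.
  - by move=> x _; rewrite trK // addNr.
  - by move=> j k'; exact: Ctr.
  - by move=> j k'; exact: Ctr.
move=> q [cq Vq]; rewrite /= trl; have [bq ->] := lc _ cq.
by split => [[_ ->]|/eqP]; rewrite ?subrr // subr_eq0 => /eqP.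
Qed.

(** For a regular value no interior point of the level set is a local maximum: in a level chart one
    increases the last coordinate and reaches points with [f > t] arbitrarily near. *)
Lemma superlevel_frontier : (closure (superlevel t) `\` interior (superlevel t)) `\` mboundary X = level_set t.
Proof.
have oD := superlevel_open t; apply/seteqP; split => p.
  move=> [[clp] + bp]; rewrite ((interior_id _).1 oD) /superlevel /= => /negP; rewrite -leNgt => le.
  split => //; apply/eqP; rewrite eq_le le /=.
  have : closure (superlevel t) `<=` [set p | t <= f p].
    rewrite closureE; apply: smallest_sub; last by move=> q /ltW.
    apply: (@closed_comp _ _ f [set s : R | t <= s]); last exact: closed_ge.
    by move=> q _; exact: cf.
  by apply.
move=> Sp; have [bp ft] := Sp; split => //; split; last first.
  by rewrite ((interior_id _).1 oD) /superlevel /= ft ltxx.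
move=> B Bp; have [k Fp] := levelP Sp; have [Xc lc] := FP k; set c := F k in Fp Xc lc.
have ic : ichart c (cmap c p) by apply: (ichart_intdom Xc).
have : \forall y \near cmap c p, ichart c y /\ B (cinv c y).
  apply: (@filterI _ (nbhs (cmap c p))).
    by apply: open_nbhs_nbhs; split => //; exact: (ichart_open Xc).
  by apply: (cinv_continuous Xc ic); rewrite /= (cmapK Xc).
move=> /nbhs_ballP[r /= r0 rB].
have /rB[cy By] : ball (cmap c p) r (tr (r / 2) (cmap c p)).
  apply/(ball_coordP _ _ r0) => j; rewrite !mxE opprD addrA subrr sub0r normrN normrM.
  have : `|((0 == 0 :> 'I_1) && (j == l))%:R : R| <= 1 by case: (_ && _); rewrite ?normr1 ?normr0 //.
  have r2 : 0 < r / 2 by rewrite divr_gt0.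
  rewrite (gtr0_norm r2); move=> a; apply: (@le_lt_trans _ _ (r / 2)); first by rewrite ler_piMr // ltW.
  by rewrite ltr_pdivrMr // ltr_pMr // ltr1n.
exists (cinv c (tr (r / 2) (cmap c p))); split => //; rewrite /superlevel /=.
have [_ <-] := lc _ (cinv_dom Xc cy); rewrite (cinvK Xc cy) trl; have [_ ->] := lc _ Fp.
by rewrite ft ltrDl divr_gt0.
Qed.

Local Open Scope ereal_scope.

Let slice_level k y : ichart (F k) (ins l y t) -> level_set t (cinv (F k) (ins l y t)).
Proof.
move=> cy; have [Xc lc] := FP k; have cp := cinv_dom Xc cy; have [bp fp] := lc _ cp.
by split => //; rewrite -fp (cinvK Xc cy) ins_at.
Qed.

Lemma level_measure_out : level_measure g FP t (~` level_set t) = 0.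
Proof.
have mS : measurable (~` level_set t : set (borel M)) by apply: measurableC; exact: measurable_level_set.
rewrite -[LHS]mul1e -integral_cst // integral_mkcond integral_level_measure.
- apply: eseries0 => k _ _; apply: integral0_eq => y _.
  have [cy|cy] := pselect (ichart (F k) (ins l y t)); last by rewrite mdens_out // mul0e.
  rewrite (cptE cy) /on_piece patchE memNset ?mul0e ?mule0 //.
  by move=> /(_ (slice_level cy)).
- by apply: (measurable_restrictT _ mS).1; exact: measurable_cst.
- by move=> p; rewrite patchE; case: ifP.
Qed.

(** The measure was defined with one fixed sequence of charts, but the definition must be met in
    every adapted chart [c]. By [slice_int_indep] the integral over each piece may be computed in
    [c] at height 0, and countable additivity reassembles the pieces. *)
Lemma level_measureP : is_hypersurface_measure g (level_set t) (level_measure g FP t).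
Proof.
split; first exact: level_measure_out.
move=> c A [Xc Sc] mA Ac.
pose phi (p : borel M) : \bar R := (\1_A p)%:E.
have mphi : measurable_fun setT phi by apply/measurable_EFinP; exact: measurable_indic.
have phi0 p : 0 <= phi p by rewrite lee_fin indicE.
have cS x : ichart c x -> x 0%R l = 0%R -> level_set t (cinv c x).
  move=> cx x0; apply/(Sc _ (cinv_dom Xc cx)); by rewrite (cinvK Xc cx).
transitivity (slice_int g c 0%R phi); last first.
  rewrite /slice_int leb_ge0_integral.
  - congr integralRn; apply/funext => y.
    have -> : slice_embedding y = ins l y 0%R.
      by apply/rowP => j; rewrite !mxE; case: unlift.
    set x := ins l y 0%R; rewrite -EFinM; congr (_%:E).
    have x0 : x 0%R l = 0%R by rewrite /x ins_at.
    have [cx|cx] := pselect (ichart c x).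
      rewrite (mdensE g cx) (cptE cx) /minor mulrC; congr (_ * _)%R.
      rewrite !indicE; congr (_%:R); congr nat_of_bool; apply/idP/idP; rewrite !inE.
        by move=> Ax; exists (cinv c x) => //; rewrite (cinvK Xc cx).
      by move=> [p Ap <-]; rewrite (cmapK Xc) //; exact: Ac.
    rewrite mdens_out // mul0r indicE memNset ?mul0r // => -[p Ap px]; apply: cx.
    have cp := Ac _ Ap; have [bp _] : level_set t p by apply/(Sc _ cp); rewrite px.
    by rewrite -px; apply: (ichart_intdom Xc); split.
  - by apply: (measurableT_comp (measurable_slice g Xc mphi)); apply: measurable_ins => //; exact: measurable_id.
  - by move=> y; rewrite mule_ge0 // lee_fin mdens_ge0.
transitivity (\int[level_measure g FP t]_p phi p).
  by rewrite /phi integral_indic // setIT.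
rewrite integral_level_measure //.
transitivity (\sum_(k <oo) slice_int g c 0%R (on_piece F k phi)).
  apply: eq_eseriesr => k _; have [Xk lk] := FP k.
  apply: (slice_int_indep hv Xk Xc).
  - move=> x [kx cx] xt; have := slice_level (k := k) (y := del l x); rewrite -xt ins_del => /(_ kx).
    by rewrite xt => H; exact: (Sc _ cx).1.
  - move=> x [cx kx] x0; have [_ <-] := cS x cx x0; by have [] := lk _ kx.
  - exact: measurable_on_piece.
  - by move=> p; exact: on_piece_ge0.
  - move=> p ncp; rewrite /on_piece /phi.
    have [pk|pk] := pselect (piece F k p); last by rewrite [X in _ * X%:E]indicE memNset // mule0.
    rewrite indicE memNset ?mul0e // => Ap; apply: ncp; split; last exact: Ac.
    exact: piece_sub pk.
have mo k : measurable_fun setT (on_piece F k phi) by exact: measurable_on_piece.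
have mi : measurable_fun [set: borel 'rV[R]_n.+1] ((fun y => ins l y 0%R) : _ -> borel 'rV[R]_n.+2).
  by apply: measurable_ins => //; exact: measurable_id.
rewrite /slice_int -integral_nneseries //; last 2 first.
- by move=> k; exact: (measurableT_comp (measurable_slice g Xc (mo k)) mi).
- by move=> k y _; rewrite mule_ge0 ?lee_fin ?mdens_ge0 // on_piece_ge0.
apply: eq_integral => y _; set x := ins l y 0%R.
have [cx|cx] := pselect (ichart c x); last first.
  rewrite mdens_out // mul0e; apply: eseries0 => k _ _; by rewrite mul0e.
rewrite nneseriesZl; last by move=> k _; exact: on_piece_ge0.
congr (_ * _); rewrite /on_piece nneseriesZl; last by move=> k _; rewrite lee_fin indicE.
rewrite -[RHS]mule1; congr (_ * _).
have [k _ kp] : (\bigcup_k piece F k) (cpt c x).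
  rewrite -seqDU_bigcup_eq (cptE cx).
  by have [|k Fk] := levelP (cS x cx _); [rewrite /x ins_at|exists k].
have dE B : (\1_B (cpt c x))%:E = \d_(cpt c x) B :> \bar R by rewrite diracE.
under eq_eseriesr do rewrite dE.
transitivity (\d_(cpt c x) (\bigcup_k piece F k) : \bar R).
  apply/esym; apply: measure_semi_bigcup => //.
  - by move=> j; exact: (measurable_piece FP).
  - exact: trivIset_seqDU.
  - by apply: bigcupT_measurable => j; exact: (measurable_piece FP).
by rewrite diracE mem_set //; exists k.
Qed.

Lemma cheeger_superlevel (rho sigma : M -> R) : superlevel t !=set0 ->
  weighted_volume v sigma (superlevel t) <= (2^-1)%:E * weighted_volume v sigma [set: M] ->
  cheeger g v rho sigma <=
    (\int[level_measure g FP t]_(p in level_set t) (sigma p)%:E) / weighted_volume v rho (superlevel t).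
Proof.
move=> D0 Dm; apply: ereal_inf_lbound; exists (superlevel t), (level_measure g FP t).
rewrite superlevel_frontier; split => //.
- by split => //; exact: superlevel_open.
- exact: level_hypersurface.
- exact: level_measureP.
Qed.

End RegularLevel.

End LevelSets.

(** * Layer cake formula and medians *)

Section LayerCake.
Context {R : realType}.
Local Open Scope ereal_scope.

Let pos (a : R) : R := Num.max 0%R a.

(** The weight [2 (t - m)^+] is the derivative of the square of [(t - m)^+]; its factor 2 reappears
    on the gradient side of [cheeger_coarea]. *)
Lemma integral_ramp (m F : R) :
  \int[@lebesgue_measure R]_t ((2 * pos (t - m) * \1_([set s : R | s < F]) t)%R)%:E = ((pos (F - m)) ^+ 2)%R%:E.
Proof.
have [Fm|mF] := leP F m.
  rewrite integral0_eq; last first.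
    move=> t _; rewrite /pos indicE; have [tF|tF] := ltP t F; last by rewrite memNset ?mulr0 //= ltNge tF.
    by rewrite max_l ?mulr0 ?mul0r // subr_le0 ltW // (lt_le_trans tF).
  by rewrite /pos max_l ?expr0n // subr_le0.
pose h (t : R) : R := (2 * (t - m))%R.
have E : (fun t : R => ((2 * pos (t - m) * \1_([set s : R | s < F]) t)%R)%:E) = (EFin \o h) \_ `[m, F[.
  apply/funext => t; rewrite patchE indicE /h /pos.
  have [tF|tF] := ltP t F; last first.
    rewrite memNset ?mulr0; last by rewrite /= ltNge tF.
    by rewrite memNset // => /=; rewrite in_itv /= ltNge tF andbF.
  rewrite mem_set //= mulr1; have [mt|tm] := leP m t.
    by rewrite mem_set /=; [rewrite max_r // subr_ge0|rewrite in_itv /= mt tF].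
  by rewrite memNset /=; [rewrite max_l ?mulr0 // subr_le0 ltW|rewrite in_itv /= leNgt tm].
have ch : continuous h.
  by move=> t; apply: (cvgM (F := nbhs t)); [exact: cvg_cst|apply: (cvgB (F := nbhs t)); [exact: cvg_id|exact: cvg_cst]].
rewrite E -integral_mkcond integral_itv_bndo_bndc; last first.
  by apply: measurable_funTS; apply/measurable_EFinP; exact: continuous_measurable_fun.
pose G (t : R) := ((t - m) ^+ 2)%R.
have dG (t : R) : is_derive t (1 : R)%R G (h t).
  rewrite /G; apply: is_derive_eq.
  by rewrite /h subr0 /GRing.scale /=; ring.
rewrite (@continuous_FTC2 _ h G) //.
- by rewrite /G subrr expr0n /= sube0 /pos max_r // subr_ge0 ltW.
- exact: continuous_subspaceT.
- have cG : continuous G.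
    by move=> t; apply: differentiable_continuous; apply/derivable1_diffP; exact: (ex_derive (is_derive := dG t)).
  by split => [t _||]; [exact: (ex_derive (is_derive := dG t))|apply: cvg_at_right_filter; exact: cG|apply: cvg_at_left_filter; exact: cG].
- by move=> t _; rewrite derive1E (derive_val (is_derive := dG t)).
Qed.

Context d {T : measurableType d} (mu : {measure set T -> \bar R}).
Hypothesis mu_fin : mu setT < +oo.

(** A copy of [mu] with the finiteness proof as an argument, so that the sigma-finiteness required
    by Tonelli's theorem can be declared as an instance. *)
Definition as_finite (H : mu setT < +oo) : set T -> \bar R := mu.
HB.instance Definition _ H := Measure.on (as_finite H).
Let as_finite_sigma H : sigma_finite setT (as_finite H).
Proof.
exists (fun=> setT) => [|k]; last by split.
by apply/seteqP; split => // x _; exists 0%N.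
Qed.
HB.instance Definition _ H := Measure_isSigmaFinite.Build _ _ _ (as_finite H) (as_finite_sigma H).

Variables (f tau : T -> R) (m : R).
Hypotheses (mf : measurable_fun setT f) (mtau : measurable_fun setT tau) (tau0 : forall p, (0 <= tau p)%R).

Let K (q : R * T) : \bar R := ((2 * pos (q.1 - m) * \1_([set s : R | s < f q.2]) q.1 * tau q.2)%R)%:E.

Let mpos : measurable_fun setT pos.
Proof. by apply: measurable_maxr; [exact: measurable_cst|exact: measurable_id]. Qed.

Let mK : measurable_fun setT K.
Proof.
apply/measurable_EFinP; apply: measurable_funM; last exact: (measurableT_comp mtau measurable_snd).
apply: measurable_funM.
  apply: measurable_funM; first exact: measurable_cst.
  by apply: (measurableT_comp mpos); apply: measurable_funB; [exact: measurable_fst|exact: measurable_cst].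
rewrite (_ : (fun x => _) = \1_([set q : R * T | (q.1 < f q.2)%R])); last first.
  by apply/funext => q; rewrite !indicE.
apply: measurable_indic; rewrite -[X in measurable X]setTI.
by apply: measurable_fun_ltr => //; exact: (measurableT_comp mf measurable_snd).
Qed.

Let K0 q : 0 <= K q.
Proof. by rewrite lee_fin !mulr_ge0 // /pos ?le_max ?lexx // indicE. Qed.

Let mD t : measurable [set p | (t < f p)%R].
Proof. by rewrite -[X in measurable X]setTI; apply: measurable_fun_ltr. Qed.

Let KE t : \int[mu]_p K (t, p) = (2 * pos (t - m))%R%:E * \int[mu]_(p in [set p | (t < f p)%R]) (tau p)%:E.
Proof.
rewrite [X in _ * X]integral_mkcond -ge0_integralZl //.
- apply: eq_integral => p _; rewrite patchE /K /= indicE /=.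
  have [tf|tf] := ltP t (f p); first by rewrite !mem_set //= mulr1 EFinM.
  by rewrite !memNset ?mulr0 ?mul0r ?mule0 //= ltNge tf.
- by apply: (measurable_restrictT _ (mD t)).1; apply: measurable_funTS; exact/measurable_EFinP.
- by move=> p _; rewrite patchE; case: ifP => // _; rewrite lee_fin.
- by rewrite lee_fin mulr_ge0 // /pos le_max lexx.
Qed.

Lemma layer_cake :
  \int[@lebesgue_measure R]_t ((2 * pos (t - m))%R%:E * \int[mu]_(p in [set p | (t < f p)%R]) (tau p)%:E) =
  \int[mu]_p ((pos (f p - m)) ^+ 2 * tau p)%R%:E.
Proof.
transitivity (\int[@lebesgue_measure R]_t \int[mu]_p K (t, p)); first by apply: eq_integral => t _; rewrite KE.
transitivity (\int[@lebesgue_measure R]_t \int[as_finite mu_fin]_p K (t, p)) => //.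
rewrite (@fubini_tonelli _ _ _ _ _ (@lebesgue_measure R) (as_finite mu_fin) K mK K0).
apply: eq_integral => p _; rewrite EFinM -integral_ramp muleC -ge0_integralZl //.
- by apply: eq_integral => t _; rewrite /K /= EFinM muleC.
- apply/measurable_EFinP; apply: measurable_funM.
    apply: measurable_funM; first exact: measurable_cst.
    by apply: (measurableT_comp mpos); apply: measurable_funB; [exact: measurable_id|exact: measurable_cst].
  by apply: measurable_indic; apply: open_measurable; exact: open_lt.
- by move=> t _; rewrite lee_fin !mulr_ge0 // /pos ?le_max ?lexx // indicE.
- by rewrite lee_fin.
Qed.

Lemma measurable_layer :
  measurable_fun [set: R] (fun t : R => (2 * pos (t - m))%R%:E * \int[mu]_(p in [set p | (t < f p)%R]) (tau p)%:E).
Proof.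
rewrite (_ : (fun t => _) = (fun t => \int[mu]_p K (t, p))); last by apply/funext => t; rewrite KE.
exact: (@measurable_fun_fubini_tonelli_F _ _ _ _ _ (as_finite mu_fin) K mK K0).
Qed.

End LayerCake.

(** [m] is the infimum of the levels above which at most half of the mass lies. Both sets are
    increasing unions, of [f > m + 1 / k.+1] and of [f <= m - 1 / k.+1]. The former have at most
    half of the mass, and the complement of each of the latter has more than half. *)
Lemma median_exists (R : realType) d (T : measurableType d) (mu : {measure set T -> \bar R}) (f : T -> R) (K : R) :
  (mu setT < +oo)%E -> measurable_fun setT f -> (forall p, `|f p| <= K) ->
  exists m, (mu [set p | (m < f p)%R] <= (2^-1)%:E * mu setT)%E /\ (mu [set p | (f p < m)%R] <= (2^-1)%:E * mu setT)%E.
Proof.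
move=> fin mf fK.
have mgt t : measurable [set p | t < f p] by rewrite -[X in measurable X]setTI; apply: measurable_fun_ltr.
have mle t : measurable [set p | f p <= t] by rewrite -[X in measurable X]setTI; apply: measurable_fun_le.
have WT : mu setT = (fine (mu setT))%:E by rewrite fineK // ge0_fin_numE.
set w := fine (mu setT) in WT; have w0 : 0 <= w by rewrite fine_ge0.
have hw : ((2^-1)%:E * mu setT = (2^-1 * w)%:E)%E by rewrite WT EFinM.
(* For the zero measure every level is a median, but [B] would have no lower bound. *)
have [wz|wn] := eqVneq w 0.
  have mz A : measurable A -> (mu A <= (2^-1)%:E * mu setT)%E.
    by move=> mA; rewrite hw wz mulr0 -wz -WT; apply: le_measure; rewrite ?inE.
  exists 0; split; apply: mz => //.
  by rewrite -[X in measurable X]setTI; apply: measurable_fun_ltr.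
have wp : 0 < w by rewrite lt0r wn.
pose B : set R := [set t | (mu [set p | (t < f p)%R] <= (2^-1 * w)%:E)%E].
have BK : B K.
  rewrite /B /= (_ : [set p | _] = set0) ?measure0 ?lee_fin ?mulr_ge0 ?invr_ge0 //.
  by apply/seteqP; split => // p /=; rewrite ltNge (le_trans (ler_norm _) (fK p)).
have Blb : lbound B (- K - 1).
  move=> t Bt; rewrite leNgt; apply/negP => tK; move: Bt; rewrite /B /= (_ : [set p | _] = setT).
    by rewrite WT lee_fin; move: wp; lra.
  apply/seteqP; split => // p _ /=; have := fK p; rewrite ler_norml => /andP[+ _]; lra.
have hB : has_inf B by split; [exists K|exists (- K - 1)].
exists (inf B); rewrite hw; split.
  have -> : [set p | inf B < f p] = \bigcup_k [set p | inf B + k.+1%:R^-1 < f p].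
    apply/seteqP; split => p /=.
      move=> H; have [k kP] := ltr_add_invr H; exists k => //=.
    by move=> [k _ /=]; apply: lt_trans; rewrite ltrDl.
  have := @nondecreasing_cvg_mu _ _ _ mu (fun k => [set p | inf B + k.+1%:R^-1 < f p]) (fun k => mgt _)
    (bigcupT_measurable _ (fun k => mgt _)) _.
  move=> C; rewrite -(cvg_lim _ (C _)) //; last first.
    move=> a b ab; apply/subsetPset => p /=; apply: le_lt_trans; rewrite lerD2l lef_pV2 ?posrE // ler_nat ltnS //.
  apply: lime_le.
    apply: cvgP (C _) => a b ab; apply/subsetPset => p /=; apply: le_lt_trans.
    by rewrite lerD2l lef_pV2 ?posrE // ler_nat ltnS //.
  apply: nearW => k /=.
  have k0 : 0 < k.+1%:R^-1 :> R by rewrite invr_gt0 ltr0Sn.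
  have [t Bt tk] := inf_adherent k0 hB.
  apply: le_trans Bt; apply: le_measure; rewrite ?inE //.
  by move=> p /=; apply: le_lt_trans; exact: ltW.
have -> : [set p | f p < inf B] = \bigcup_k [set p | f p <= inf B - k.+1%:R^-1].
  apply/seteqP; split => p /=.
    move=> H; have [k kP] := ltr_add_invr H; exists k => //=.
    by rewrite lerBrDr ltW.
  by move=> [k _ /=]; move/le_lt_trans; apply; rewrite ltrBlDr ltrDl.
have := @nondecreasing_cvg_mu _ _ _ mu (fun k => [set p | f p <= inf B - k.+1%:R^-1]) (fun k => mle _)
    (bigcupT_measurable _ (fun k => mle _)) _.
move=> C; rewrite -(cvg_lim _ (C _)) //; last first.
  move=> a b ab; apply/subsetPset => p /=; move/le_trans; apply.
  by rewrite lerD2l lerN2 lef_pV2 ?posrE // ler_nat ltnS.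
apply: lime_le.
  apply: cvgP (C _) => a b ab; apply/subsetPset => p /=; move/le_trans; apply.
  by rewrite lerD2l lerN2 lef_pV2 ?posrE // ler_nat ltnS.
apply: nearW => k /=; set t := inf B - _.
have : ~ B t.
  move=> Bt; have := ge_inf hB.2 Bt; rewrite /t lerBrDr -[leRHS]addr0 lerD2l leNgt invr_gt0 ltr0Sn //.
rewrite /B /= => /negP; rewrite -ltNge => H1.
have : (mu setT = mu [set p | (t < f p)%R] + mu [set p | (f p <= t)%R])%E.
  rewrite -measureU //.
    by congr (mu _); apply/seteqP; split => // p _ /=; case: (ltP t (f p)); [left|right].
  by apply/seteqP; split => // p [/= a]; rewrite leNgt a.
have fA A : measurable A -> mu A \is a fin_num.
  by move=> mA; rewrite ge0_fin_numE //; apply: le_lt_trans fin; apply: le_measure; rewrite ?inE.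
move: H1; rewrite WT -(fineK (fA _ (mgt t))) -(fineK (fA _ (mle t))) -EFinD lte_fin lee_fin => H1 [].
by move: H1; set a := fine _; set b := fine _; lra.
Qed.

(** * Cheeger's inequality for smooth functions *)

(** For [V = 0] the product form reduces to [0 <= I]; this absorbs the convention for division by
    zero in the Cheeger quotient. *)
Lemma ereal_le_div (R : realType) (a : R) (I V : \bar R) : (0 <= I)%E -> (0 <= V)%E -> V \is a fin_num ->
  (a%:E <= I / V)%E -> (a%:E * V <= I)%E.
Proof.
move=> I0; case: V => // r; rewrite lee_fin le0r => /orP[/eqP-> _ _|r0 _]; first by rewrite mule0.
rewrite inver gt_eqF //; case: I I0 => [s _||//]; last by move=> _ _; exact: leey.
by rewrite -!EFinM !lee_fin ler_pdivlMr.
Qed.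

Lemma compact_continuous_bounded (R : realType) (M : ptopologicalType) (f : M -> R) :
  compact [set: M] -> continuous f -> exists2 K, 0 < K & forall p, `|f p| <= K.
Proof.
move=> cM cf; have : compact (f @` setT) by apply: continuous_compact => //; exact: continuous_subspaceT.
move=> /compact_bounded[K [_ KP]]; exists (Num.max K 0 + 1).
  by rewrite ltr_wpDl // le_max lexx orbT.
move=> p; apply: (KP (Num.max K 0 + 1)); last by exists p.
by rewrite (@le_lt_trans _ _ (Num.max K 0)) ?le_max ?lexx // ltrDl.
Qed.

Section SmoothCheeger.
Context {R : realType} {n : nat} {M : ptopologicalType} (X : smoothStructure R n.+1 M).
Context (compactM : compact [set: M]).
Context (g : riemannianMetric X) (v : {measure set borel M -> \bar R}) (hv : is_volume g v).
Implicit Types (p : borel M) (t : R).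
Variables (rho sigma : M -> R).
Hypotheses (rho_cont : continuous rho) (rho_pos : forall x, 0 < rho x).
Hypotheses (sigma_cont : continuous sigma) (sigma_pos : forall x, 0 < sigma x).

Let vfin : (v setT < +oo)%E := v_finite hv compactM.

Lemma integrable_continuous (f : M -> R) : continuous f -> v.-integrable setT (EFin \o (f : borel M -> R)).
Proof.
move=> cf; have [K K0 fK] := compact_continuous_bounded compactM cf.
apply: measurable_bounded_integrable => //; first exact: continuous_borelR.
by exists K; split; [exact: num_real|move=> k Kk p _; apply: le_trans (fK p) (ltW Kk)].
Qed.

Lemma integral_continuous_fin (f : M -> R) (D : set (borel M)) : measurable D -> continuous f ->
  (\int[v]_(p in D) (f p)%:E)%E \is a fin_num.
Proof.
by move=> mD cf; apply: integrable_fin_num => //; apply: integrableS (integrable_continuous cf).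
Qed.

Let pos (a : R) : R := Num.max 0 a.

Let pos_ge0 a : 0 <= pos a.
Proof. by rewrite /pos le_max lexx. Qed.

Let cpos (f : M -> R) : continuous f -> forall m, continuous (fun p => pos (f p - m)).
Proof.
move=> cf m p; apply: (@continuous_comp _ _ _ (fun p => f p - m) pos).
  by apply: (cvgB (F := nbhs p)); [exact: cf|exact: cvg_cst].
by apply: (@continuous_max R R^o (fun=> 0) id); [exact: cvg_cst|exact: cvg_id].
Qed.

Let cmul (f h : M -> R) : continuous f -> continuous h -> continuous (fun p => f p * h p).
Proof. by move=> cf ch p; apply: (cvgM (F := nbhs p)); [exact: cf|exact: ch]. Qed.

Let csqr (f : M -> R) : continuous f -> continuous (fun p => f p ^+ 2).
Proof. by move=> cf; under eq_fun do rewrite expr2; exact: cmul. Qed.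

Variables (f : M -> R) (sf : smf X f).
Let cf : continuous f := smf_continuous sf.

Local Open Scope ereal_scope.

(** Almost every [t > m] is a regular value, and then the superlevel set, being contained in that of
    [m], is admissible if it is nonempty. The inequality between its [tau]-volume and the area of
    the level set is integrated against [2 (t - m) dt]: the layer cake formula gives the left side,
    the coarea formula the right side. *)
Lemma cheeger_coarea (tau : M -> R) (a m : R) : continuous tau -> (forall x, 0 < tau x)%R -> (0 < a)%R ->
  a%:E <= cheeger g v tau sigma ->
  weighted_volume v sigma (superlevel f m) <= (2^-1)%:E * weighted_volume v sigma [set: M] ->
  a%:E * \int[v]_p ((pos (f p - m)) ^+ 2 * tau p)%R%:E <=
  \int[v]_p (2 * pos (f p - m) * sigma p * Num.sqrt (gsq g f p))%R%:E.
Proof.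
move=> ctau tau0 a0 ah Dm.
have [F FP FC] := level_covered_regular compactM sf.
have mS := continuous_borelR sigma_cont.
pose phi p : \bar R := (2 * pos (f p - m) * sigma p)%R%:E.
have cpf : continuous (fun p => pos (f p - m)) by exact: cpos.
have mphi : measurable_fun setT phi.
  apply/measurable_EFinP; apply: continuous_borelR; apply: cmul => //; apply: cmul => //.
  by move=> p; exact: cvg_cst.
have phi0 p : 0 <= phi p by rewrite lee_fin !mulr_ge0 // ltW.
have -> : \int[v]_p (2 * pos (f p - m) * sigma p * Num.sqrt (gsq g f p))%R%:E =
    \int[v]_p (phi p * (Num.sqrt (gsq g f p))%:E).
  by apply: eq_integral => p _; rewrite EFinM.
apply: le_trans (coarea_le hv sf FP mphi phi0).
have mtau := continuous_borelR ctau.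
have mf : measurable_fun [set: borel M] (f : borel M -> R) by exact: continuous_borelR.
rewrite -(layer_cake vfin m mf mtau); last by move=> p; rewrite ltW.
set L := fun t : R => _ : \bar R.
have L0 t : 0 <= L t.
  rewrite /L mule_ge0 ?lee_fin ?mulr_ge0 // ?le_max ?lexx //.
  by apply: integral_ge0 => p _; rewrite lee_fin ltW.
have mL : measurable_fun [set: R] L by apply: measurable_layer => // p; rewrite ltW.
rewrite -ge0_integralZl //; [|by move=> t _; exact: L0|by rewrite lee_fin ltW].
apply: ae_ge0_le_integral => //.
- by move=> t _; apply: mule_ge0; [rewrite lee_fin ltW|exact: L0].
- by apply: measurable_funeM.
- by move=> t _; exact: integral_ge0.
- exact: measurable_level_integral.
apply: negligibleS (Sard_manifold compactM sf) => t /= H; apply: contrapT => regt; apply: H => _.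
rewrite /L; have [tm|mt] := leP t m.
  rewrite max_l ?subr_le0 // mulr0 mul0e mule0; exact: integral_ge0.
have mSt := measurable_level_set sf t.
have -> : \int[level_measure g FP t]_p phi p = \int[level_measure g FP t]_(p in level_set X f t) phi p.
  have nN : (level_measure g FP t).-negligible (~` level_set X f t).
    by apply/negligibleP; [exact: measurableC|exact: level_measure_out].
  rewrite [RHS]integral_mkcond; apply: ae_eq_integral => //.
    by apply: (measurable_restrictT _ mSt).1; exact: measurable_funTS.
  apply: negligibleS nN => p /= H Sp; apply: H => _; by rewrite patchE mem_set.
have -> : \int[level_measure g FP t]_(p in level_set X f t) phi p =
   (2 * pos (t - m))%R%:E * \int[level_measure g FP t]_(p in level_set X f t) (sigma p)%:E.
  rewrite -ge0_integralZl //.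
  - by apply: eq_integral => p; rewrite inE => -[_ fp]; rewrite /phi fp EFinM.
  - by apply: measurable_funTS; exact/measurable_EFinP.
  - by move=> p _; rewrite lee_fin ltW.
  - by rewrite lee_fin mulr_ge0.
rewrite muleCA; apply: lee_wpmul2l; first by rewrite lee_fin mulr_ge0.
have I0 : 0 <= \int[level_measure g FP t]_(p in level_set X f t) (sigma p)%:E.
  by apply: integral_ge0 => p _; rewrite lee_fin ltW.
have mD s : measurable (superlevel f s : set (borel M)).
  apply: open_borel; exact: (superlevel_open sf).
(* The infimum runs over nonempty sets; for an empty superlevel set the left side is zero. *)
have [D0|/set0P D0] := eqVneq (superlevel f t) set0.
  rewrite (_ : [set p | _] = set0); last exact: D0.
  by rewrite integral_set0 mule0.
apply: (@ereal_le_div _ _ _ (weighted_volume v tau (superlevel f t))) => //.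
- by apply: integral_ge0 => p _; rewrite lee_fin ltW.
- exact: integral_continuous_fin.
apply: le_trans ah _; apply: (cheeger_superlevel hv sf FP FC) => //.
apply: le_trans Dm; apply: ge0_subset_integral => //.
- by apply: measurable_funTS; exact/measurable_EFinP.
- by move=> p _; rewrite lee_fin ltW.
- by move=> p; exact: lt_trans.
Qed.

(** With [B] and [A] the integrals of [((f - m)^+)^2] against [sigma] and [rho], and [G] the energy
    on [f > m], Young's inequality with parameter [a1 / 2] bounds the common right side of [C1] and
    [C2] by [a1 / 2 * B + 2 / a1 * G]. In [C1] half of [a1 * B] is absorbed, whence
    [a1 ^+ 2 * B <= 4 G]; inserted into [C2] this gives [a1 * a2 * A <= 2 G + 2 G]. *)
Lemma half_cheeger (a1 a2 m : R) : (0 < a1)%R -> (0 < a2)%R ->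
  a1%:E <= cheeger g v sigma sigma -> a2%:E <= cheeger g v rho sigma ->
  weighted_volume v sigma (superlevel f m) <= (2^-1)%:E * weighted_volume v sigma [set: M] ->
  (a1 * a2)%:E * \int[v]_p ((pos (f p - m)) ^+ 2 * rho p)%R%:E <=
  4%:E * \int[v]_(p in superlevel f m) (gsq g f p * sigma p)%:E.
Proof.
move=> a10 a20 h1 h2 Dm.
have C1 := cheeger_coarea sigma_cont sigma_pos a10 h1 Dm.
have C2 := cheeger_coarea rho_cont rho_pos a20 h2 Dm.
have mD : measurable (superlevel f m : set (borel M)).
  apply: open_borel; exact: (superlevel_open sf).
have mS := continuous_borelR sigma_cont.
have mgs := measurable_gsq g sf.
have mgS : measurable_fun [set: borel M] (fun p => (gsq g f p * sigma p)%:E).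
  by apply/measurable_EFinP; exact: measurable_funM.
have gS0 p : 0 <= (gsq g f p * sigma p)%:E by rewrite lee_fin mulr_ge0 ?gsq_ge0 // ltW.
set G := \int[v]_(p in superlevel f m) _ in C1 C2 *.
have G0 : 0 <= G by exact: integral_ge0.
have cp2 tau : continuous tau -> continuous (fun p => ((pos (f p - m)) ^+ 2 * tau p)%R).
  by move=> ct; apply: cmul => //; apply: csqr; exact: cpos.
pose B := \int[v]_p ((pos (f p - m)) ^+ 2 * sigma p)%R%:E.
pose A := \int[v]_p ((pos (f p - m)) ^+ 2 * rho p)%R%:E.
have Bf : B \is a fin_num by apply: integral_continuous_fin => //; exact: cp2.
have Af : A \is a fin_num by apply: integral_continuous_fin => //; exact: cp2.
have B0 : 0 <= B by apply: integral_ge0 => p _; rewrite lee_fin mulr_ge0 ?sqr_ge0 // ltW.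
have A0 : 0 <= A by apply: integral_ge0 => p _; rewrite lee_fin mulr_ge0 ?sqr_ge0 // ltW.
have CE : \int[v]_p (2 * pos (f p - m) * sigma p * Num.sqrt (gsq g f p))%R%:E <=
    (a1 / 2)%:E * B + (a1 / 2)^-1%:E * G.
  have s0 : (0 < a1 / 2)%R by rewrite divr_gt0.
  rewrite /B /G [X in _ + _ * X]integral_mkcond -!ge0_integralZl //; last first.
  all: try by rewrite lee_fin ?invr_ge0 ltW.
  - by move=> p _; rewrite patchE; case: ifP.
  - by apply: (measurable_restrictT _ mD).1; exact: measurable_funTS.
  - by move=> p _; rewrite lee_fin mulr_ge0 ?sqr_ge0 // ltW.
  - by apply/measurable_EFinP; apply: continuous_borelR; exact: cp2.
  have mB : measurable_fun [set: borel M] (fun p => (a1 / 2)%:E * ((pos (f p - m)) ^+ 2 * sigma p)%R%:E).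
    by apply: measurable_funeM; apply/measurable_EFinP; apply: continuous_borelR; exact: cp2.
  have mG : measurable_fun [set: borel M] (fun p => (a1 / 2)^-1%:E *
      ((fun p => (gsq g f p * sigma p)%:E) \_ (superlevel f m)) p).
    by apply: measurable_funeM; apply: (measurable_restrictT _ mD).1; exact: measurable_funTS.
  have B'0 p : 0 <= (a1 / 2)%:E * ((pos (f p - m)) ^+ 2 * sigma p)%R%:E.
    by rewrite -EFinM lee_fin !mulr_ge0 ?sqr_ge0 ?invr_ge0 // ltW.
  have G'0 p : 0 <= (a1 / 2)^-1%:E * ((fun p => (gsq g f p * sigma p)%:E) \_ (superlevel f m)) p.
    by rewrite mule_ge0 // ?lee_fin ?invr_ge0 ?(ltW s0) // patchE; case: ifP.
  rewrite -ge0_integralD //; apply: ge0_le_integral => //.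
  - by move=> p _; rewrite lee_fin !mulr_ge0 ?sqrtr_ge0 // ltW.
  - apply/measurable_EFinP; apply: measurable_funM; last first.
      exact: (measurableT_comp (continuous_measurable_fun (@sqrt_continuous R)) mgs).
    apply: continuous_borelR; apply: cmul => //; apply: cmul; last exact: cpos.
    by move=> p; exact: cvg_cst.
  - exact: emeasurable_funD.
  move=> p _; rewrite patchE; case: ifPn => [_|]; last first.
    rewrite notin_setE /superlevel /= => /negP; rewrite -leNgt => fm.
    by rewrite /pos max_l ?subr_le0 // mulr0 !mul0r mule0 adde0 expr0n /= mul0r mule0.
  rewrite -!EFinM -EFinD lee_fin; set s := (a1 / 2)%R in s0 *; set P := pos _; set q := gsq g f p.
  have q0 : (0 <= q)%R by exact: gsq_ge0.
  have : (0 <= s^-1 * sigma p * (s * P - Num.sqrt q) ^+ 2)%R.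
    by apply: mulr_ge0; [apply: mulr_ge0; [rewrite invr_ge0 ltW|exact: ltW]|exact: sqr_ge0].
  have -> : (s^-1 * sigma p * (s * P - Num.sqrt q) ^+ 2 =
     s * (P ^+ 2 * sigma p) + s^-1 * (q * sigma p) - 2 * P * sigma p * Num.sqrt q)%R.
    by rewrite -{2}(sqr_sqrtr q0); field; rewrite gt_eqF.
  by rewrite subr_ge0.
have {}C1 := le_trans C1 CE; have {}C2 := le_trans C2 CE.
rewrite -/A -/B in C1 C2 *; move: C1 C2 A0 B0 G0.
rewrite -(fineK Af) -(fineK Bf); set b := fine B; set a := fine A.
(* An infinite energy makes the claim trivial; otherwise everything is real. *)
case: G {CE} => [G|_ _ _ _ _|//]; last by rewrite gt0_muley ?lte_fin // leey.
rewrite -!EFinM -!EFinD !lee_fin => C1 C2 a0 b0 G0.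
have Z : ((a1 / 2)^-1 = 2 / a1)%R by rewrite invf_div.
rewrite Z in C1 C2.
have K1 : (a1 * (a1 * b) <= 4 * G)%R.
  have : (a1 / 2 * b <= 2 / a1 * G)%R by move: C1; lra.
  rewrite -(ler_pM2l a10) => H; have -> : (4 * G = 2 * (a1 * (2 / a1 * G)))%R by field; rewrite gt_eqF.
  by have -> : (a1 * (a1 * b) = 2 * (a1 * (a1 / 2 * b)))%R by [field]; rewrite ler_pM2l.
have : (a1 * (a2 * a) <= a1 * (a1 / 2 * b + 2 / a1 * G))%R by rewrite ler_pM2l.
have -> : (a1 * (a1 / 2 * b + 2 / a1 * G) = a1 * (a1 * b) / 2 + 2 * G)%R by field; rewrite gt_eqF.
by rewrite mulrA; move: K1; lra.
Qed.

End SmoothCheeger.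

Section SmoothCheegerMedian.
Context {R : realType} {n : nat} {M : ptopologicalType} (X : smoothStructure R n.+1 M).
Context (compactM : compact [set: M]).
Context (g : riemannianMetric X) (v : {measure set borel M -> \bar R}) (hv : is_volume g v).
Implicit Types (p : borel M) (t : R).
Variables (rho sigma : M -> R).
Hypotheses (rho_cont : continuous rho) (rho_pos : forall x, 0 < rho x).
Hypotheses (sigma_cont : continuous sigma) (sigma_pos : forall x, 0 < sigma x).
Variables (f : M -> R) (sf : smf X f).
Local Open Scope ereal_scope.

(** A median for the measure [sigma v], realised as [imdens_measure] with the identity map. The two
    halves of the median property are the volume conditions for [f] and for [- f]. *)
Lemma median_continuous : exists m,
  weighted_volume v sigma (superlevel f m) <= (2^-1)%:E * weighted_volume v sigma [set: M] /\
  weighted_volume v sigma (superlevel (fun p => - f p)%R (- m)) <= (2^-1)%:E * weighted_volume v sigma [set: M].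
Proof.
have cf := smf_continuous sf; have [K _ fK] := compact_continuous_bounded compactM cf.
have mS := continuous_borelR sigma_cont.
pose W := imdens_measure v mS (fun p => ltW (sigma_pos p)) (@measurable_id _ (borel M) setT).
have WE (A : set (borel M)) : measurable A -> W A = weighted_volume v sigma A.
  move=> mA; rewrite /weighted_volume integral_mkcond; apply: eq_integral => p _.
  rewrite patchE indicE; case: ifPn => pA; first by rewrite mule1.
  by rewrite mule0.
have mf := continuous_borelR cf.
have Wfin : W setT < +oo.
  rewrite WE //; have := integral_continuous_fin compactM hv measurableT sigma_cont.
  by rewrite ge0_fin_numE // integral_ge0 // => p _; rewrite lee_fin ltW.
have [m [H1 H2]] := median_exists Wfin mf fK; exists m.
have mgt (h : M -> R) t : continuous h -> measurable ([set p | (t < h p)%R] : set (borel M)).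
  by move=> ch; apply: open_borel; apply: (@open_comp _ _ h [set s : R | (t < s)%R]); [move=> p _; exact: ch|exact: open_gt].
rewrite -!WE //; last 2 first.
- by apply: mgt => p; apply: (cvgN (F := nbhs p)); exact: cf.
- exact: mgt.
split => //; rewrite (_ : superlevel _ _ = [set p | (f p < m)%R]) //.
by apply/seteqP; split => p; rewrite /superlevel /= ltrN2.
Qed.

(** [(f - m) ^+ 2] is the sum of the squares of the positive parts of [f - m] and [m - f]. The
    corresponding energies live on the disjoint sets [f > m] and [f < m], so their sum is at most
    the full energy and the constant 4 is not doubled. *)
Lemma smooth_cheeger (a1 a2 : R) : (0 < a1)%R -> (0 < a2)%R ->
  a1%:E <= cheeger g v sigma sigma -> a2%:E <= cheeger g v rho sigma ->
  exists m, (a1 * a2)%:E * \int[v]_p ((f p - m) ^+ 2 * rho p)%R%:E <=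
    4%:E * \int[v]_p (gsq g f p * sigma p)%:E.
Proof.
move=> a10 a20 h1 h2; have [m [m1 m2]] := median_continuous; exists m.
have sfN : smf X (fun p => - f p)%R.
  have -> : (fun p => - f p)%R = (fun p => -1 * f p)%R by apply/funext => p; rewrite mulN1r.
  by apply: smfM => //; exact: smf_cst.
have cf := smf_continuous sf.
have C1 := half_cheeger compactM hv rho_cont rho_pos sigma_cont sigma_pos sf a10 a20 h1 h2 m1.
have C2 := half_cheeger compactM hv rho_cont rho_pos sigma_cont sigma_pos sfN a10 a20 h1 h2 m2.
have mS := continuous_borelR sigma_cont.
have mR := continuous_borelR rho_cont.
have mf := continuous_borelR cf.
have mgS : measurable_fun [set: borel M] (fun p => (gsq g f p * sigma p)%:E).
  by apply/measurable_EFinP; apply: measurable_funM => //; exact: measurable_gsq.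
have gS0 p : 0 <= (gsq g f p * sigma p)%:E by rewrite lee_fin mulr_ge0 ?gsq_ge0 // ltW.
have mpos (h : borel M -> R) : measurable_fun setT h -> measurable_fun setT (fun p => Num.max 0%R (h p)).
  by move=> mh; apply: measurable_maxr => //; exact: measurable_cst.
have mD : measurable (superlevel f m : set (borel M)) by apply: open_borel; exact: (superlevel_open sf).
have mDN : measurable (superlevel (fun p => - f p)%R (- m) : set (borel M)).
  by apply: open_borel; exact: (superlevel_open sfN).
have := leeD C1 C2; rewrite -ge0_muleDr; last 2 first.
- by apply: integral_ge0 => p _; rewrite lee_fin mulr_ge0 ?sqr_ge0 // ltW.
- by apply: integral_ge0 => p _; rewrite lee_fin mulr_ge0 ?sqr_ge0 // ltW.
rewrite -ge0_muleDr; last 2 first.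
- exact: integral_ge0.
- by apply: integral_ge0 => p _; rewrite lee_fin mulr_ge0 ?gsq_ge0 // ltW.
have -> : \int[v]_p ((f p - m) ^+ 2 * rho p)%R%:E =
   \int[v]_p (Num.max 0 (f p - m) ^+ 2 * rho p)%R%:E + \int[v]_p (Num.max 0 (- f p - - m) ^+ 2 * rho p)%R%:E.
  rewrite -ge0_integralD //.
  - apply: eq_integral => p _; rewrite -EFinD -mulrDl; congr ((_ * _)%R%:E).
    have [fm|fm] := leP (f p) m.
      by rewrite max_l ?subr_le0 // max_r; [ring|rewrite opprK addrC subr_ge0].
    by rewrite max_r ?subr_ge0 1?ltW // max_l; [ring|rewrite opprK addrC subr_le0 ltW].
  - by move=> p _; rewrite lee_fin mulr_ge0 ?sqr_ge0 // ltW.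
  - apply/measurable_EFinP; apply: measurable_funM => //; apply: measurable_funX; apply: mpos.
    by apply: measurable_funB.
  - by move=> p _; rewrite lee_fin mulr_ge0 ?sqr_ge0 // ltW.
  - apply/measurable_EFinP; apply: measurable_funM => //; apply: measurable_funX; apply: mpos.
    by apply: measurable_funB => //; exact: measurable_funN.
move/le_trans; apply; apply: lee_wpmul2l; first by rewrite lee_fin.
have -> : \int[v]_(p in superlevel (fun p => - f p)%R (- m)) (gsq g (fun p => - f p)%R p * sigma p)%:E =
  \int[v]_(p in superlevel (fun p => - f p)%R (- m)) (gsq g f p * sigma p)%:E.
  by apply: eq_integral => p _; rewrite gsqN.
rewrite -ge0_integral_setU //.
- apply: ge0_subset_integral => //; exact: measurableU.
- exact: measurable_funTS.
- by apply/disj_setPS => p []; rewrite /superlevel /= ltrN2 => /ltW; rewrite leNgt => /negP.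
Qed.

End SmoothCheegerMedian.

(** * Smoothing in one chart *)

Section CellSmoothing.
Context {R : realType} {n : nat} {M : ptopologicalType} (X : smoothStructure R n M).
Context (hausdorffM : hausdorff_space M) (compactM : compact [set: M]).
Context (g : riemannianMetric X) (v : {measure set borel M -> \bar R}) (hv : is_volume g v).
Notation e_ i := (delta_mx 0 i).
Local Notation leb := (@leb R n.+1).
Local Notation rV := 'rV[R]_n.+1.
Local Notation mfun V := (measurable_fun [set: borel rV] (V : borel rV -> R)).
Local Notation L1 V := (leb.-integrable [set: borel rV] (EFin \o V)).

Variables (c : chart R n M) (x0 : rV) (r B : R) (chi : M -> R).
Hypotheses (Xc : atlas X c) (r0 : 0 < r) (B0 : 0 < B).
Hypothesis sub : closed_ball x0 (3 * r) `&` @halfspace R n `<=` cmap c @` cdom c.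
Hypothesis bnd : forall x, closed_ball x0 (3 * r) x -> hopen x ->
      [/\ forall i j, `|gmx g c (cinv c x) i j| <= B,
         forall i j, `|invmx (gmx g c (cinv c x)) i j| <= B,
         cdens g c x <= B & 1 <= B * cdens g c x].
Hypotheses (schi : smf X chi) (chi0 : forall p, 0 <= chi p) (chi1 : forall p, chi p <= 1).
Hypothesis chis : forall p, chi p != 0 -> cdom c p /\ ball x0 r (cmap c p).

Let r30 : 0 < 3 * r. Proof. by rewrite mulr_gt0. Qed.

Let cb x : closed_ball x0 (3 * r) x <-> `|x0 - x| <= 3 * r.
Proof. by rewrite closed_ballE. Qed.

(** Here and in [chart_integral_le] the bounds on the density make [v] and Lebesgue measure
    comparable on the ball of radius [3 * r], with the constant [B] in both directions. *)
Lemma lift_integral_le (W : rV -> R) : mfun W -> (forall x, 0 <= W x) ->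
  (forall x, ~ closed_ball x0 (3 * r) x -> W x = 0) ->
  (\int[v]_p (lift_chart c W p)%:E <= B%:E * \int[leb]_x (W x)%:E)%E /\
  measurable_fun [set: borel M] (lift_chart c W : borel M -> R).
Proof.
move=> mW W0 Wo; have oc := chart_open Xc.
have mc : measurable (cdom c : set (borel M)) by exact: open_borel.
have L0 p : 0 <= lift_chart c W p by rewrite /lift_chart; case: ifP.
have mL : measurable_fun [set: borel M] (lift_chart c W : borel M -> R).
  have -> : (lift_chart c W : borel M -> R) = ((W : borel rV -> R) \o cmap c) \_ (cdom c).
    apply/funext => p; rewrite patchE; have [cp|cp] := pselect (cdom c p).
      by rewrite mem_set // lift_chartE.
    by rewrite memNset // lift_chart_out.
  apply: (measurable_restrictT _ mc).1; apply: (measurableT_comp mW).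
  apply: within_continuous_borel => //.
  by apply: continuous_in_subspaceT => p; rewrite inE => cp; exact: (cmap_continuous Xc).
split => //; have mEL : measurable_fun [set: borel M] (fun p => (lift_chart c W p)%:E) by exact/measurable_EFinP.
have mb := measurable_mboundary X.
rewrite (ge0_negligible_integral mb) //; last 2 first.
- by move=> p _; rewrite lee_fin.
- exact: (v_boundary hv compactM).
have -> : (\int[v]_(p in [set: borel M] `\` mboundary X) (lift_chart c W p)%:E =
  \int[v]_(p in intdom X c) (lift_chart c W p)%:E)%E.
  rewrite [LHS]integral_mkcond [RHS]integral_mkcond; apply: eq_integral => p _; rewrite !patchE.
  have [[cp bp]|ip] := pselect (intdom X c p); first by rewrite !mem_set //.
  rewrite (memNset ip); case: ifP => //; rewrite inE => -[_ bp].
  by rewrite lift_chart_out // => cp; apply: ip.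
rewrite (integral_chart hv Xc mEL); last by move=> p; rewrite lee_fin.
rewrite -ge0_integralZl //; last first.
- by rewrite lee_fin ltW.
- by move=> x _; rewrite lee_fin.
- exact/measurable_EFinP.
apply: ge0_le_integral => //.
- by move=> x _; rewrite mule_ge0 // lee_fin // cdens_ge0.
- apply: emeasurable_funM; first by apply/measurable_EFinP; exact: (measurable_cdens g Xc).
  by apply: (measurableT_comp mEL); exact: (measurable_cpt Xc).
- by apply: measurable_funeM; exact/measurable_EFinP.
move=> x _; have [cx|cx] := pselect (ichart c x); last first.
  by rewrite cdens_out // mul0e mule_ge0 // lee_fin // ltW.
rewrite (cptE cx) lift_chartE; last exact: (cinv_dom Xc cx).
rewrite (cinvK Xc cx) -!EFinM lee_fin.
have [bx|bx] := pselect (closed_ball x0 (3 * r) x); last by rewrite Wo // !mulr0.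
by apply: ler_wpM2r => //; have [_ _ ? _] := bnd bx cx.2.
Qed.

Lemma chart_integral_le (W : rV -> R) (h : borel M -> R) : mfun W -> (forall x, 0 <= W x) ->
  measurable_fun setT h -> (forall p, 0 <= h p) ->
  (forall x, ~ (ichart c x /\ closed_ball x0 (3 * r) x) -> W x = 0) ->
  (forall x, ichart c x -> closed_ball x0 (3 * r) x -> W x <= h (cinv c x)) ->
  (\int[leb]_x (W x)%:E <= B%:E * \int[v]_p (h p)%:E)%E.
Proof.
move=> mW W0 mh h0 Wo Wh.
have mEh : measurable_fun [set: borel M] (fun p => (h p)%:E) by exact/measurable_EFinP.
apply: (@le_trans _ _ (B%:E * \int[v]_(p in intdom X c) (h p)%:E)%E); last first.
  apply: lee_wpmul2l; first by rewrite lee_fin ltW.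
  apply: ge0_subset_integral => //; first by apply: open_borel; exact: intdom_open.
  by move=> p _; rewrite lee_fin.
rewrite (integral_chart hv Xc mEh); last by move=> p; rewrite lee_fin.
have m1 : measurable_fun [set: borel rV] (fun x => (cdens g c x)%:E * (h (cpt c x))%:E)%E.
  apply: emeasurable_funM; first by apply/measurable_EFinP; exact: (measurable_cdens g Xc).
  by apply: (measurableT_comp mEh); exact: (measurable_cpt Xc).
have p1 x : (0 <= (cdens g c x)%:E * (h (cpt c x))%:E)%E by rewrite mule_ge0 // lee_fin // cdens_ge0.
rewrite -ge0_integralZl //; last by rewrite lee_fin ltW.
apply: ge0_le_integral => //.
- by move=> x _; rewrite lee_fin.
- exact/measurable_EFinP.
- exact: measurable_funeM.
move=> x _; have [[cx bx]|H] := pselect (ichart c x /\ closed_ball x0 (3 * r) x); last first.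
  by rewrite Wo // mule_ge0 // lee_fin ltW.
have [_ _ _ b1] := bnd bx cx.2; rewrite (cptE cx) muleA -!EFinM lee_fin.
apply: le_trans (Wh x cx bx) _; by rewrite ler_peMl.
Qed.

Let a1 : rV := \row_i (x0 0 i - 2 * r).
Let a2 : rV := \row_i (x0 0 i + 2 * r).

Let boxE y : box a1 a2 y <-> ball x0 (2 * r) y.
Proof.
rewrite (ball_coordP _ _ _) ?mulr_gt0 //; split => H i; have := H i; rewrite !mxE.
  by rewrite ltr_norml => /andP[]; lra.
by rewrite ltr_norml => /andP[] *; apply/andP; split; lra.
Qed.

Let box_cb y : box a1 a2 y -> closed_ball x0 (3 * r) y.
Proof.
move=> /boxE; rewrite -ball_normE /= => H; apply/cb/ltW; apply: lt_trans H _.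
by move: r0; lra.
Qed.

Lemma L1_of_sqint (V : rV -> R) : mfun V -> (sqint V < +oo)%E -> (forall y, ~ box a1 a2 y -> V y = 0) -> L1 V.
Proof.
move=> mV sV Vo; apply/integrableP; split; first exact/measurable_EFinP.
have mb : measurable (box a1 a2 : set (borel rV)) by exact: box_borel.
have m2 := measurable_sqr mV.
apply: (@le_lt_trans _ _ (\int[leb]_x ((\1_(box a1 a2) x)%:E + (V x ^+ 2)%:E))%E).
  apply: ge0_le_integral => //.
  - by apply: measurableT_comp => //; exact/measurable_EFinP.
  - by apply: emeasurable_funD => //; apply/measurable_EFinP; exact: measurable_indic.
  move=> x _; rewrite -EFinD /= lee_fin indicE.
  have [bx|bx] := pselect (box a1 a2 x).
    rewrite mem_set //; have := sqr_ge0 (`|V x| - 1); rewrite -[V x ^+ 2]real_normK ?num_real //.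
    by rewrite -[true%:R]/(1 : R); have := normr_ge0 (V x); nra.
  by rewrite Vo // normr0 addr_ge0 // sqr_ge0.
rewrite ge0_integralD //; last 2 first.
- by apply/measurable_EFinP; exact: measurable_indic.
- by move=> x _; rewrite lee_fin sqr_ge0.
rewrite integral_indic // setIT lte_add_pinfty //.
by apply: (@le_lt_trans _ _ (vol a1 a2)%:E); [rewrite -leb_box|exact: ltry].
Qed.

Variables (u e : borel M -> R) (w : M -> rV).
Hypotheses (mu : measurable_fun setT u) (u2 : v.-integrable setT (fun p => (u p ^+ 2)%:E)).
Hypothesis ei : v.-integrable setT (EFin \o e).
Hypothesis wP : weak_partials X c u w.
Hypothesis eE : forall p, cdom c p -> ~ mboundary X p -> e p = gnorm2 g c p (w p).

Let oI : open (ichart c) := ichart_open Xc.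
Let tchi x := chi (cinv c x).
Let tchi0 x : 0 <= tchi x. Proof. exact: chi0. Qed.
Let tchi1 x : tchi x ^+ 2 <= 1. Proof. by rewrite expr_le1 //; exact: chi1. Qed.
Let Ctchi : Cinf (ichart c) tchi := smf_Cinf schi Xc.

Let tchi_out x : ichart c x -> ~ box a1 a2 x -> tchi x = 0 /\ forall k, 'D_(e_ k) tchi x = 0.
Proof.
move=> cx /boxE bx; have xr : r < `|x0 - x|.
  rewrite ltNge; apply/negP => H; apply: bx; rewrite -ball_normE /=; apply: le_lt_trans H _.
  by move: r0; lra.
have z0 y : ichart c y -> r < `|x0 - y| -> tchi y = 0.
  move=> cy yr; apply/eqP/negPn/negP => /chis[_]; rewrite (cinvK Xc cy) -ball_normE /= ltNge.
  by rewrite ltW.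
split; first exact: z0.
move=> k; rewrite (@near_eq_derive _ _ _ tchi (fun=> 0) x (e_ k)); first by rewrite derive_cst.
near=> y; apply: z0; near: y; first exact: open_nbhs_nbhs.
have : `|x0 - y| @[y --> x] --> `|x0 - x|.
  by apply: (cvg_norm (F := nbhs x)); apply: (cvgB (F := nbhs x)); [exact: cvg_cst|exact: cvg_id].
by move/cvgr_gt; apply.
Unshelve. all: by end_near. Qed.

(** The function [chi u] in coordinates; [cell_grad1] and [cell_grad2] are the terms [chi du] and
    [u dchi] of its weak differential. They stay apart because the first comes from the weak
    derivative of [u] and the second from differentiating the test function. *)
Definition cell_fun : rV -> R := (fun x => tchi x * u (cinv c x)) \_ (ichart c).
Definition cell_grad1 k : rV -> R := (fun x => tchi x * w (cinv c x) 0 k) \_ (ichart c).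
Definition cell_grad2 k : rV -> R := (fun x => u (cinv c x) * 'D_(e_ k) tchi x) \_ (ichart c).

Let cell_funE x : ichart c x -> cell_fun x = tchi x * u (cinv c x).
Proof. by move=> cx; rewrite /cell_fun patchE mem_set. Qed.
Let cell_grad1E k x : ichart c x -> cell_grad1 k x = tchi x * w (cinv c x) 0 k.
Proof. by move=> cx; rewrite /cell_grad1 patchE mem_set. Qed.
Let cell_grad2E k x : ichart c x -> cell_grad2 k x = u (cinv c x) * 'D_(e_ k) tchi x.
Proof. by move=> cx; rewrite /cell_grad2 patchE mem_set. Qed.

Let patch_out (F : rV -> R) x : ~ ichart c x -> (F \_ (ichart c)) x = 0.
Proof. by move=> cx; rewrite patchE memNset. Qed.

Let cell_fun_out x : ~ box a1 a2 x -> cell_fun x = 0.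
Proof.
move=> bx; have [cx|cx] := pselect (ichart c x); last exact: patch_out.
by rewrite cell_funE // (tchi_out cx bx).1 mul0r.
Qed.
Let cell_grad1_out k x : ~ box a1 a2 x -> cell_grad1 k x = 0.
Proof.
move=> bx; have [cx|cx] := pselect (ichart c x); last exact: patch_out.
by rewrite cell_grad1E // (tchi_out cx bx).1 mul0r.
Qed.
Let cell_grad2_out k x : ~ box a1 a2 x -> cell_grad2 k x = 0.
Proof.
move=> bx; have [cx|cx] := pselect (ichart c x); last exact: patch_out.
by rewrite cell_grad2E // (tchi_out cx bx).2 mulr0.
Qed.

Let mI : measurable (ichart c : set (borel rV)) := measurable_ichart Xc.

Let m_open (F : rV -> R) : Ck 0 (ichart c) F -> measurable_fun (ichart c : set (borel rV)) (F : borel rV -> R).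
Proof.
move=> CF; apply: within_continuous_borelR => //.
by apply: continuous_in_subspaceT => x; rewrite inE => cx; exact: (Ck_cont CF).
Qed.

Let m_cpt (F : borel M -> R) : measurable_fun (cdom c : set (borel M)) F ->
  measurable_fun (ichart c : set (borel rV)) (fun x : borel rV => F (cinv c x)).
Proof.
move=> mF; have oc := chart_open Xc.
have mc : measurable (cdom c : set (borel M)) by exact: open_borel.
apply: (@measurable_comp _ _ _ _ _ _ (cdom c : set (borel M)) F) => //.
  by move=> _ [x cx <-]; exact: (cinv_dom Xc cx).
apply: within_continuous_borel => //.
by apply: continuous_in_subspaceT => x; rewrite inE => cx; exact: (cinv_continuous Xc).
Qed.

Let m_cell_fun : mfun cell_fun.
Proof.
apply: (measurable_restrictT _ mI).1; apply: measurable_funM; first exact: m_open (Ctchi 0).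
by apply: m_cpt; exact: measurable_funTS.
Qed.
Let m_cell_grad1 k : mfun (cell_grad1 k).
Proof.
apply: (measurable_restrictT _ mI).1; apply: measurable_funM; first exact: m_open (Ctchi 0).
exact: (m_cpt (wP k).1).
Qed.
Let m_cell_grad2 k : mfun (cell_grad2 k).
Proof.
apply: (measurable_restrictT _ mI).1; apply: measurable_funM; last exact: m_open (CkD1 k (Ctchi 1)).
by apply: m_cpt; exact: measurable_funTS.
Qed.

Let sq_cell (V : rV -> R) (h : borel M -> R) K : mfun V -> measurable_fun setT h -> (forall p, 0 <= h p) ->
  (\int[v]_p (h p)%:E < +oo)%E -> 0 <= K -> (forall x, ~ box a1 a2 x -> V x = 0) ->
  (forall x, ~ ichart c x -> V x = 0) ->
  (forall x, ichart c x -> closed_ball x0 (3 * r) x -> V x ^+ 2 <= K * h (cinv c x)) ->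
  (sqint V < +oo)%E.
Proof.
move=> mV mh h0 hf K0 Vb Vc VK.
have := @chart_integral_le (fun x => V x ^+ 2) (fun p => K * h p) _ _ _ _ _ VK.
move=> /(_ _ _ _ _ _)/le_lt_trans; apply.
- exact: measurable_funX.
- by move=> x; exact: sqr_ge0.
- by apply: measurable_funM => //; exact: measurable_cst.
- by move=> p; rewrite mulr_ge0.
- move=> x H; have [bx|bx] := pselect (box a1 a2 x); last by rewrite Vb // expr0n.
  by rewrite Vc ?expr0n // => cx; apply: H; split => //; exact: box_cb.
under eq_integral do rewrite EFinM.
rewrite ge0_integralZl //; [|exact/measurable_EFinP|by move=> p _; rewrite lee_fin].
rewrite muleA -EFinM; apply: lte_mul_pinfty => //; first by rewrite lee_fin mulr_ge0 // ltW.
Qed.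

Let mu2 : measurable_fun [set: borel M] (fun p => u p ^+ 2). Proof. exact: measurable_funX. Qed.

Let u2f : (\int[v]_p (u p ^+ 2)%:E < +oo)%E.
Proof.
have /integrableP[_] := u2; apply: le_lt_trans; rewrite le_eqVlt; apply/orP; left; apply/eqP.
by apply: eq_integral => p _; rewrite gee0_abs // lee_fin sqr_ge0.
Qed.

Let sq_cell_fun : (sqint cell_fun < +oo)%E.
Proof.
apply: (@sq_cell _ (fun p => u p ^+ 2) 1) => //.
- by move=> p; exact: sqr_ge0.
- by move=> x cx; exact: patch_out.
move=> x cx _; by rewrite cell_funE // exprMn ler_wpM2r ?sqr_ge0.
Qed.

Let sq_cell_grad1 k : (sqint (cell_grad1 k) < +oo)%E.
Proof.
have me : measurable_fun setT e by apply/measurable_EFinP; exact: measurable_int ei.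
apply: (@sq_cell _ (fun p => `|e p|) B) => //.
- exact: measurableT_comp.
- by have /integrableP[_] := ei.
- exact: ltW.
- exact: cell_grad1_out.
- by move=> x cx; exact: patch_out.
move=> x cx bx; rewrite cell_grad1E // exprMn.
have [gb _ _ _] := bnd bx cx.2; have cp := cinv_dom Xc cx.
have [_ bp] := intdomP Xc cx.
have H := coord_le_bform (w (cinv c x)) k (gmx_posdef g Xc cp).
apply: (@le_trans _ _ (w (cinv c x) 0 k ^+ 2)).
  by rewrite ler_piMl ?sqr_ge0.
apply: le_trans H _; rewrite -[bform _ _ _]/(gnorm2 g c (cinv c x) (w (cinv c x))) -eE //.
have e0 : 0 <= e (cinv c x) by rewrite eE // gnorm2_ge0.
rewrite (ger0_norm e0); apply: ler_wpM2r => //; apply: le_trans (ler_norm _) (gb k k).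
Qed.

Let sq_cell_grad2 k : (sqint (cell_grad2 k) < +oo)%E.
Proof.
have [C HC] := smf_partial_bounded schi Xc r30 sub.
apply: (@sq_cell _ (fun p => u p ^+ 2) (C ^+ 2)) => //.
- by move=> p; exact: sqr_ge0.
- exact: sqr_ge0.
- exact: cell_grad2_out.
- by move=> x cx; exact: patch_out.
move=> x cx bx; rewrite cell_grad2E // exprMn mulrC ler_wpM2r ?sqr_ge0 //.
by rewrite -[leLHS]real_normK ?num_real // lerXn2r ?nnegrE ?(le_trans _ (HC x bx cx.2 k)) // HC.
Qed.

Definition cell_grad k x := cell_grad1 k x + cell_grad2 k x.

Let sq_cell_grad k : (sqint (cell_grad k) < +oo)%E.
Proof.
apply: le_lt_trans (sqintD (m_cell_grad1 k) (m_cell_grad2 k)) _.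
by apply: lte_add_pinfty; apply: lte_mul_pinfty => //; rewrite lee_fin.
Qed.

Let cell_grad_out k x : ~ box a1 a2 x -> cell_grad k x = 0.
Proof. by move=> bx; rewrite /cell_grad cell_grad1_out // cell_grad2_out // addr0. Qed.

Let m_cell_grad k : mfun (cell_grad k).
Proof. exact: measurable_funD. Qed.

Let L1_cell_fun : L1 cell_fun. Proof. exact: L1_of_sqint. Qed.
Let L1_cell_grad1 k : L1 (cell_grad1 k). Proof. by apply: L1_of_sqint => // y; exact: cell_grad1_out. Qed.
Let L1_cell_grad2 k : L1 (cell_grad2 k). Proof. by apply: L1_of_sqint => // y; exact: cell_grad2_out. Qed.

Let compact_inner s : 0 < s ->
  let K := closed_ball x0 (3 * r) `&` [set y : rV | s <= y 0 ord0] in compact K /\ K `<=` ichart c.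
Proof.
move=> s0 K; split.
  apply: compact_closedI; first exact: compact_closed_ball.
  apply: (@closed_comp _ _ (fun x : rV => x 0 ord0) [set t : R | s <= t]).
    by move=> y _; exact: coord_continuous.
  exact: closed_ge.
move=> y [by_ /= sy]; have y0 : 0 < y 0 ord0 by exact: lt_le_trans sy.
by split => //; apply: sub; split => //; exact: ltW.
Qed.

(* the weak derivative is tested on the cut-off function times the translated mollifier, whose
   support lies in the interior because the mollifier is supported in positive first coordinate *)
Lemma conv_cell_grad (eta : rV -> R) s (x : rV) k : Cinf setT eta -> bounded_support eta -> 0 < s ->
  (forall z, eta z != 0 -> s < z 0 ord0) -> 0 <= x 0 ord0 ->
  conv cell_fun ('D_(e_ k) eta) x = - conv (cell_grad k) eta x.
Proof.
move=> Ce be s0 es x_ge0.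
pose et y := eta (y - x).
have Cet : Cinf setT et.
  move=> j; apply: (@Ck_compF _ _ _ j setT setT eta (fun y : rV => y - x) openT openT) => // i.
  apply: (Ck_eq openT (f := fun y => y 0 i - x 0 i)); first by move=> y _; rewrite !mxE.
  by apply: CkB; [exact: openT|exact: Ck_coord|exact: Ck_cst].
have Det y : 'D_(e_ k) et y = 'D_(e_ k) eta (y - x).
  apply: (etrans (derive_line _ _ _)); apply/esym; apply: (etrans (derive_line _ _ _)).
  by rewrite (_ : (fun t : R => eta _) = (fun t : R => et (y + t *: e_ k))) //; apply/funext => t; rewrite /et addrAC.
pose psi : rV -> R := (fun y => tchi y * et y) \_ (ichart c).
have psiE y : ichart c y -> psi y = tchi y * et y by move=> cy; rewrite /psi patchE mem_set.
(* The translated kernel is supported above the height [x 0 ord0 + s], and [x 0 ord0] is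
   nonnegative, so [K] is a compact set of interior coordinates even when [x] lies on the
   boundary. *)
pose K := closed_ball x0 (3 * r) `&` [set y : rV | s <= y 0 ord0].
have [cK KI] := compact_inner s0.
have oK : open (~` K) by apply: closed_openC; by apply: compact_closed cK; exact: norm_hausdorff.
have psi0 y : ~ K y -> psi y = 0.
  move=> Ky; have [cy|cy] := pselect (ichart c y); last exact: patch_out.
  rewrite psiE //; have [by_|by_] := pselect (box a1 a2 y); last by rewrite (tchi_out cy by_).1 mul0r.
  apply/eqP/negPn/negP; rewrite mulf_eq0 negb_or => /andP[_ /es]; rewrite !mxE => sy.
  by apply: Ky; split; [exact: box_cb|rewrite /= ltW //; move: sy x_ge0; lra].
have Cpsi : Cinf setT psi.
  move=> j; apply: Ck_local => y _; have [cy|cy] := pselect (ichart c y).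
    exists (ichart c); split => //; apply: (Ck_eq oI (f := fun y => tchi y * et y)).
      by move=> z cz; rewrite psiE.
    by apply: CkM => //; apply: Ck_sub (Cet j).
  exists (~` K); split; first by move=> /KI.
  by apply: (Ck_eq oK (f := fun=> 0)); [move=> z Kz; rewrite psi0|exact: Ck_cst].
have Dpsi y : 'D_(e_ k) psi y = if `[<ichart c y>] then tchi y * 'D_(e_ k) et y + 'D_(e_ k) tchi y * et y else 0.
  case: asboolP => cy.
    have -> : 'D_(e_ k) psi y = 'D_(e_ k) (fun z => tchi z * et z) y.
      apply: near_eq_derive; have : nbhs y (ichart c) by exact: open_nbhs_nbhs.
      by apply: filterS => z cz; rewrite psiE.
    have d1 := Ck_derivable (i := k) (Ctchi 1) cy.
    have d2 := Ck_derivable (i := k) (Cet 1%N) (Logic.I : setT y).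
    by rewrite (deriveM d1 d2) /GRing.scale /= [et y * _]mulrC.
  rewrite (@near_eq_derive _ _ _ psi (fun=> 0) y (e_ k)); first by rewrite derive_cst.
  have : nbhs y (~` K) by apply: open_nbhs_nbhs; split => //; move/KI.
  by apply: filterS => z Kz; rewrite psi0.
have tpsi : test_function (cmap c @` (cdom c `\` mboundary X)) psi.
  split => //; exists K; split => //; apply: subset_trans KI _ => y /(ichartE _ Xc)[p [cp bp <-]].
  by exists p.
have := (wP k).2 psi tpsi.
have -> : (fun y => (u (cinv c y) * 'D_(delta_mx 0 k) psi y)%:E) =
    EFin \o (fun y => cell_fun y * 'D_(e_ k) eta (y - x) + cell_grad2 k y * eta (y - x)).
  apply/funext => y; rewrite /= Dpsi; case: asboolP => cy.
    by rewrite cell_funE // cell_grad2E // Det /et; congr (_%:E); ring.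
  by rewrite /cell_fun /cell_grad2 !patch_out // !mul0r addr0 mulr0.
have -> : (fun y => (w (cinv c y) 0 k * psi y)%:E) = EFin \o (fun y => cell_grad1 k y * eta (y - x)).
  apply/funext => y; rewrite /=; have [cy|cy] := pselect (ichart c y).
    by rewrite psiE // cell_grad1E // /et; congr (_%:E); ring.
  by rewrite /cell_grad1 /psi !patch_out // mul0r mulr0.
have be' := bounded_support_derive k be.
have Ce' : Ck 0 setT ('D_(e_ k) eta) by apply: CkD1; exact: Ce.
have i1 := L1conv x L1_cell_fun Ce' be'.
have i2 := L1conv x (L1_cell_grad2 k) (Ce 0%N) be.
have i3 := L1conv x (L1_cell_grad1 k) (Ce 0%N) be.
rewrite -!integral_leb //; last exact: L1D.
move=> /(congr1 fine); rewrite fineN => E.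
have {}E : \int[leb]_y (cell_fun y * 'D_(e_ k) eta (y - x) + cell_grad2 k y * eta (y - x)) =
  - conv (cell_grad1 k) eta x by exact: E.
have {}E : conv cell_fun ('D_(e_ k) eta) x + conv (cell_grad2 k) eta x = - conv (cell_grad1 k) eta x.
  by rewrite -E /conv -RintegralD.
rewrite (canRL (addrK _) E) -opprD; congr (- _).
rewrite /conv -RintegralD //; apply: eq_Rintegral => y _; by rewrite /cell_grad mulrDl.
Qed.

Let box_far x y : ~ closed_ball x0 (3 * r) x -> box a1 a2 y -> r <= `|y - x|.
Proof.
move=> /cb/negP; rewrite -ltNge => xr /boxE; rewrite -ball_normE /= => yr.
have := ler_normD (x0 - y) (y - x); rewrite addrA subrK.
by move: xr yr; lra.
Qed.

(** Bundling the function with its partial derivatives in one finite family lets a single mollifier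
    serve them all. *)
Let transl_cell : exists2 V : option 'I_n.+1 -> rV -> R,
  V None = cell_fun /\ (forall k, V (Some k) = cell_grad k) &
  forall k, [/\ mfun (V k), (sqint (V k) < +oo)%E & forall y, ~ box a1 a2 y -> V k y = 0].
Proof.
exists (fun k => if k is Some k then cell_grad k else cell_fun) => // -[k|]; split => //.
by move=> y; exact: cell_grad_out.
Qed.

Lemma cell_approx eps : 0 < eps -> exists G (E : option 'I_n.+1 -> rV -> R),
  [/\ Cinf setT G, forall x, ~ closed_ball x0 (3 * r) x -> G x = 0,
   forall k, [/\ mfun (E k), (sqint (E k) <= eps%:E)%E & forall x, ~ closed_ball x0 (3 * r) x -> E k x = 0],
   forall x, E None x = G x - cell_fun x &
   forall k x, ichart c x -> E (Some k) x = 'D_(e_ k) G x - cell_grad k x].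
Proof.
move=> eps0; have [V [VN VS] VP] := transl_cell.
have /choice[D HD] : forall k, exists d, 0 < d /\
    forall z, `|z| < d -> (sqint (fun x => (V k (x + z) - V k x)%R) <= eps%:E)%E.
  move=> k; have [mV sV Vo] := VP k; have [_ /(_ _ eps0)[d d0 dP]] := transl_cont_L2 mV sV Vo.
  by exists d.
(* The bound [d <= r] keeps the convolutions supported in the ball of radius [3 * r], and [d <= D k]
   makes every L^2 error at most [eps]. *)
pose d := \big[Num.min/r]_k D k.
have d0 : 0 < d by apply: lt_bigmin => // k _; case: (HD k).
have dr : d <= r by exact: bigmin_le_id.
have dD k : d <= D k by exact: bigmin_le_cond.
have [eta [Ce be eta0 eta1 [s s0 es]]] := mollifier_exists (ord0 : 'I_n.+1) d0.
have ed z : d <= `|z| -> eta z = 0.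
  by move=> dz; apply/eqP/negPn/negP => /es[_]; rewrite ltNge dz.
have L1V k : L1 (V k) by have [mV sV Vo] := VP k; exact: L1_of_sqint.
have cV k x : ~ closed_ball x0 (3 * r) x -> conv (V k) eta x = 0.
  move=> bx; have [_ _ Vo] := VP k; apply: (conv_support Vo ed) => y by_.
  by apply: le_trans dr _; exact: box_far.
exists (conv cell_fun eta), (fun k x => conv (V k) eta x - V k x); split.
- exact: conv_Cinf.
- by move=> x bx; rewrite -VN; exact: cV.
- move=> k; have [mV sV Vo] := VP k; split.
  + apply: measurable_funB => //.
    by apply: (Ck_measurable (k := 0%N)); exact: (conv_Cinf (L1V k) Ce be).
  + apply: (conv_L2 d0 (L1V k)) => // z zd; apply: (HD k).2.
    by apply: lt_le_trans zd _.
  + move=> x bx; rewrite cV // Vo ?subrr // => /box_cb; exact: bx.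
- by move=> x; rewrite VN.
- move=> k x cx; rewrite VS; congr (_ - _).
  have H := conv_derive x k L1_cell_fun (Ce 2%N) be.
  rewrite (derive_val (is_derive := H)) (conv_cell_grad (s := s)) ?opprK //.
    by move=> z /es[].
  exact: ltW cx.2.
Qed.

(** [h] is a multiple of the sum of the squared coordinate errors of the differential. The bound on
    the inverse metric and [bform_le_sqr], which costs the factor [C = N * B], turn them into an
    error in the dual norm. *)
Lemma cell_smoothing eps : 0 < eps -> exists G (h : borel M -> R),
  [/\ smf X (lift_chart c G) /\ (forall p, ~ chart_ball c x0 (3 * r) p -> lift_chart c G p = 0),
   (\int[v]_p ((lift_chart c G p - chi p * u p) ^+ 2)%:E <= eps%:E)%E,
   measurable_fun setT h /\ (forall p, 0 <= h p),
   (\int[v]_p (h p)%:E <= eps%:E)%E &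
   forall p, intdom X c p ->
     gnorm2 g c p (dform c (lift_chart c G) p - (chi p *: w p + u p *: dform c chi p)) <= h p].
Proof.
move=> eps0; pose N : R := n.+1%:R; pose C := N * B.
have N0 : 0 < N by rewrite ltr0Sn.
have C0 : 0 < C by rewrite mulr_gt0.
(* The function contributes [B * e1] and the [N] partial derivatives contribute
   [B * (C * (N * e1))]; together they make [eps]. *)
pose e1 := eps / (B * (1 + C * N)).
have CN0 : 0 < 1 + C * N by rewrite addr_gt0 // mulr_gt0.
have D0 : 0 < B * (1 + C * N) by rewrite mulr_gt0.
have e10 : 0 < e1 by rewrite divr_gt0.
have e1E : B * e1 + B * (C * (N * e1)) = eps.
  have -> : B * e1 + B * (C * (N * e1)) = e1 * (B * (1 + C * N)) by ring.
  by rewrite /e1 divfK // gt_eqF.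
clearbody e1.
have [G [E [CG G0 EP E0 Ek]]] := cell_approx e10.
have GE p : cdom c p -> lift_chart c G p = G (cmap c p) by exact: lift_chartE.
pose W x := C * \sum_k E (Some k) x ^+ 2.
have mW : mfun W.
  apply: measurable_funM; first exact: measurable_cst.
  by apply: measurable_sum => k; apply: measurable_funX; have [] := EP (Some k).
have W0 x : 0 <= W x by rewrite mulr_ge0 ?(ltW C0) // sumr_ge0 // => k _; exact: sqr_ge0.
have Wo x : ~ closed_ball x0 (3 * r) x -> W x = 0.
  move=> bx; rewrite /W big1 ?mulr0 // => k _; have [_ _ ->] := EP (Some k); rewrite ?expr0n //.
have [Wi mh] := lift_integral_le mW W0 Wo.
exists G, (lift_chart c W); split.
- split; first by apply: (smf_lift hausdorffM Xc r30 CG sub) => x; exact: G0.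
  move=> p np; have [cp|cp] := pselect (cdom c p); last by rewrite lift_chart_out.
  by rewrite lift_chartE // G0 // => bp; apply: np.
- have [mE sE Eo] := EP None.
  have mE2 : mfun (fun x => E None x ^+ 2) by exact: measurable_funX.
  have [|H mL] := lift_integral_le mE2 (fun x => sqr_ge0 _).
    by move=> x bx; rewrite Eo ?expr0n.
  have -> : (\int[v]_p ((lift_chart c G p - chi p * u p) ^+ 2)%:E =
     \int[v]_p (lift_chart c (fun x => E None x ^+ 2) p)%:E)%E.
    have msm (f : M -> R) : smf X f -> measurable_fun [set: borel M] (f : borel M -> R).
      by move=> sf; apply: continuous_borelR; exact: (smf_continuous sf).
    apply: ae_eq_integral => //.
    + apply/measurable_EFinP; apply: measurable_funX; apply: measurable_funB.
        by apply: msm; apply: (smf_lift hausdorffM Xc r30 CG sub) => x; exact: G0.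
      by apply: measurable_funM => //; exact: msm.
    + exact/measurable_EFinP.
    have nb : v.-negligible (mboundary X).
      by apply/negligibleP; [exact: measurable_mboundary|exact: (v_boundary hv compactM)].
    apply: negligibleS nb => p /= H1; apply: contrapT => bp; apply: H1 => _.
    have [cp|cp] := pselect (cdom c p).
      have ip := ichart_intdom Xc (conj cp bp).
      by rewrite !lift_chartE // E0 cell_funE // /tchi (cmapK Xc).
    rewrite !lift_chart_out // (_ : chi p = 0) ?mul0r ?subrr ?expr0n //.
    by apply/eqP/negPn/negP => /chis[].
  apply: le_trans H _; apply: (@le_trans _ _ (B%:E * e1%:E)%E).
    by apply: lee_wpmul2l => //; rewrite lee_fin ltW.
  by rewrite -EFinM lee_fin -e1E lerDl !mulr_ge0 ?(ltW B0) ?(ltW C0) ?(ltW N0) ?(ltW e10).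
- split => // p; rewrite /lift_chart; case: ifP => // _; exact: W0.
- apply: le_trans Wi _; apply: (@le_trans _ _ (B%:E * (C * (N * e1))%:E)%E); last first.
    by rewrite -EFinM lee_fin -e1E lerDr mulr_ge0 ?(ltW B0) ?(ltW e10).
  apply: lee_wpmul2l; first by rewrite lee_fin ltW.
  have -> : (\int[leb]_x (W x)%:E = C%:E * \sum_k sqint (E (Some k)))%E.
    rewrite /sqint -ge0_integral_sum //; last 2 first.
    + by move=> k; apply: measurable_sqr; have [] := EP (Some k).
    + by move=> k x _; rewrite lee_fin sqr_ge0.
    rewrite -ge0_integralZl //; last 3 first.
    + by apply: emeasurable_sum => k; apply: measurable_sqr; have [] := EP (Some k).
    + by move=> x _; apply: sume_ge0 => k _; rewrite lee_fin sqr_ge0.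
    + by rewrite lee_fin ltW.
    by apply: eq_integral => x _; rewrite /W EFinM sumEFin.
  rewrite [(C * _)%:E]EFinM; apply: lee_wpmul2l; first by rewrite lee_fin ltW.
  apply: (@le_trans _ _ (\sum_(k < n.+1) e1%:E)%E).
    by apply: lee_sum => k _; have [] := EP (Some k).
  by rewrite sumEFin sumr_const card_ord lee_fin /N mulr_natl.
- move=> p ip; have [cp bp] := ip; have icp := ichart_intdom Xc ip.
  rewrite lift_chartE //; set x := cmap c p.
  have -> : dform c (lift_chart c G) p - (chi p *: w p + u p *: dform c chi p) = \row_k E (Some k) x.
    apply/rowP => k; rewrite !mxE Ek // /cell_grad cell_grad1E // cell_grad2E // /tchi /x (cmapK Xc) //.
    congr (_ - _); apply: near_eq_derive; have : nbhs (cmap c p) (ichart c) by exact: open_nbhs_nbhs.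
    by apply: filterS => y cy; rewrite /= GE ?(cinvK Xc cy) //; exact: (cinv_dom Xc cy).
  have [bx|bx] := pselect (closed_ball x0 (3 * r) x); last first.
    rewrite (_ : \row_k _ = 0) ?/gnorm2 ?bform0l //.
    by apply/rowP => k; rewrite !mxE; have [_ _ ->] := EP (Some k).
  have [_ ib _ _] := bnd bx icp.2; rewrite /x (cmapK Xc cp) -/x in ib.
  apply: le_trans (bform_le_sqr _ ib) _.
  rewrite /W /C ler_wpM2l // ?mulr_ge0 ?(ltW B0) ?(ltW N0) //.
  by apply: ler_sum => k _; rewrite mxE.
Qed.

End CellSmoothing.

(** * Smoothing on the manifold *)

Section Smoothing.
Context {R : realType} {n : nat} {M : ptopologicalType} (X : smoothStructure R n M).
Context (hausdorffM : hausdorff_space M) (compactM : compact [set: M]).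
Context (g : riemannianMetric X) (v : {measure set borel M -> \bar R}) (hv : is_volume g v).
Notation e_ i := (delta_mx 0 i).
Implicit Types (c : chart R n M) (p : M).

Lemma sqr_sum_le (I : finType) (z : I -> R) : (\sum_i z i) ^+ 2 <= #|I|%:R * \sum_i z i ^+ 2.
Proof.
have pd1 : posdef (1%:M : 'M[R]_1).
  split; first exact: trmx1.
  move=> w w0; rewrite /bform mulmx1 mxE big_ord1 mxE -expr2 exprn_even_gt0 //=.
  by apply: contraNneq w0 => w00; apply/eqP/rowP => j; rewrite ord1 mxE.
have bE (w : 'rV[R]_1) : bform 1%:M w w = w 0 0 ^+ 2 by rewrite /bform mulmx1 mxE big_ord1 mxE -expr2.
have := bform_sum_le (fun i => const_mx (z i) : 'rV[R]_1) pd1.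
rewrite bE summxE; under [X in X ^+ 2 <= _]eq_bigr do rewrite mxE.
by under [X in _ <= _ * X]eq_bigr do rewrite bE mxE.
Qed.

Lemma dform_near c f h p : atlas X c -> intdom X c p -> (\forall q \near p, f q = h q) ->
  dform c f p = dform c h p.
Proof.
move=> Xc ip fh; apply/rowP => k; rewrite !mxE; apply: near_eq_derive.
have cc := cinv_continuous Xc (ichart_intdom Xc ip).
rewrite /prop_for /continuous_at (cmapK Xc ip.1) in cc; exact: (cc _ fh).
Qed.

Lemma dform_cst c (a : R) p : dform c (fun=> a) p = 0.
Proof. by apply/rowP => k; rewrite !mxE (_ : _ \o _ = cst a) // derive_cst. Qed.

Lemma dform_sum c N (F : 'I_N -> M -> R) p : atlas X c -> intdom X c p -> (forall i, smf X (F i)) ->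
  dform c (fun q => \sum_i F i q) p = \sum_i dform c (F i) p.
Proof.
move=> Xc ip sF; apply/rowP => k; rewrite summxE !mxE.
rewrite (_ : _ \o _ = \sum_i (F i \o cinv c)); last by apply/funext => x; rewrite fct_sumE.
rewrite derive_sum; first by apply: eq_bigr => i _; rewrite !mxE.
by move=> i; exact: (Ck_derivable (smf_Cinf (sF i) Xc 1%N) (ichart_intdom Xc ip)).
Qed.

Variables (u e : borel M -> R).
Hypotheses (mu : measurable_fun setT u) (u2 : v.-integrable setT (fun p => (u p ^+ 2)%:E)).
Hypothesis ue : is_gradsq g v u e.

(** The number [N] of cells is fixed before [eps], so all errors stay multiples of [eps]. In a chart
    at [p] the differential of [f] is [sum chi_i A_i + sum E_i], with [A_i] the transported weak
    differentials, because the terms [u dchi_i] cancel when the [chi_i] sum to 1. [bform_young]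
    separates the two sums, at the cost of the factors in [t]. *)
Lemma smoothing_pointwise : exists N : nat, forall eps : R, 0 < eps -> exists (f : M -> R) (h : borel M -> R),
  [/\ smf X f, measurable_fun setT h /\ (forall p, 0 <= h p), (\int[v]_p (h p)%:E <= (N%:R * eps)%:E)%E,
   (\int[v]_p ((f p - u p) ^+ 2)%:E <= (N%:R * (N%:R * eps))%:E)%E &
   forall t p, 0 < t -> ~ mboundary X p -> 0 <= e p /\ gsq g f p <= (1 + t) * e p + (1 + t^-1) * (N%:R * h p)].
Proof.
have [N [a [aP a1]]] := partition_of_unity hausdorffM g compactM; exists N => eps eps0.
have Xa i : atlas X (uchart X (a i)) by exact: chart_atP.
have achi0 i p : 0 <= ufun (a i) p by have [_ _ _ [_ +] _] := aP i; exact.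
have achi1 i p : ufun (a i) p <= 1.
  by rewrite -(a1 p) (bigD1 i) //= lerDl sumr_ge0.
have /choice[w wP] : forall i, exists w, weak_partials X (uchart X (a i)) u w /\
    forall p, cdom (uchart X (a i)) p -> ~ mboundary X p -> e p = gnorm2 g (uchart X (a i)) p (w p).
  by move=> i; have [w ww we] := ue.2 _ (Xa i); exists w.
have /choice[Gh GhP] : forall i, exists Gh : ('rV[R]_n.+1 -> R) * (borel M -> R),
   let c := uchart X (a i) in let chi := ufun (a i) in
   [/\ smf X (lift_chart c Gh.1) /\ (forall p, ~ chart_ball c (upoint X (a i)) (3 * uradius (a i)) p -> lift_chart c Gh.1 p = 0),
   (\int[v]_p ((lift_chart c Gh.1 p - chi p * u p) ^+ 2)%:E <= eps%:E)%E,
   measurable_fun setT Gh.2 /\ (forall p, 0 <= Gh.2 p),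
   (\int[v]_p (Gh.2 p)%:E <= eps%:E)%E &
   forall p, intdom X c p ->
     gnorm2 g c p (dform c (lift_chart c Gh.1) p - (chi p *: w i p + u p *: dform c chi p)) <= Gh.2 p].
  move=> i; have [[r0 B0] sub bnd [schi _] chis] := aP i; have [ww we] := wP i.
  have [G [h H]] := cell_smoothing hausdorffM compactM hv (Xa i) r0 B0 sub bnd schi (achi0 i) (achi1 i) chis
    mu u2 ue.1 ww we eps0.
  by exists (G, h).
pose c i := uchart X (a i); pose chi i := ufun (a i); pose f i := lift_chart (c i) (Gh i).1.
have sf i : smf X (f i) by have [[]] := GhP i.
have schi i : smf X (chi i) by have [_ _ _ [+ _] _] := aP i.
have mh i : measurable_fun setT (Gh i).2 by have [_ _ []] := GhP i.
have h0 i p : 0 <= (Gh i).2 p by have [_ _ [_ +] _ _] := GhP i; exact.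
have msm (k : M -> R) : smf X k -> measurable_fun [set: borel M] (k : borel M -> R).
  by move=> sk; apply: continuous_borelR; exact: (smf_continuous sk).
exists (fun p => \sum_i f i p), (fun p => \sum_i (Gh i).2 p); split.
- exact: smf_sum.
- by split; [exact: measurable_sum|move=> p; exact: sumr_ge0].
- under eq_integral do rewrite -sumEFin.
  rewrite ge0_integral_sum //; last 2 first.
  + by move=> i; exact/measurable_EFinP.
  + by move=> i p _; rewrite lee_fin.
  apply: (@le_trans _ _ (\sum_(i < N) eps%:E)%E); last by rewrite sumEFin sumr_const card_ord lee_fin mulr_natl.
  by apply: lee_sum => i _; have [] := GhP i.
- pose z i (p : borel M) := f i p - chi i p * u p.
  have mz i : measurable_fun [set: borel M] (fun p => (z i p ^+ 2)%:E).
    apply/measurable_EFinP; apply: measurable_funX; apply: measurable_funB; first exact: msm.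
    by apply: measurable_funM => //; exact: msm.
  have msz : measurable_fun [set: borel M] (fun p => \sum_i (z i p ^+ 2)%:E)%E by exact: emeasurable_sum.
  have sz0 p : (0 <= \sum_i (z i p ^+ 2)%:E)%E by apply: sume_ge0 => i _; rewrite lee_fin sqr_ge0.
  apply: (@le_trans _ _ (\int[v]_p (N%:R%:E * \sum_i (z i p ^+ 2)%:E))%E).
    apply: ge0_le_integral => //.
    + by move=> p _; rewrite lee_fin sqr_ge0.
    + apply/measurable_EFinP; apply: measurable_funX; apply: measurable_funB => //.
      by apply: measurable_sum => i; exact: msm.
    + exact: measurable_funeM.
    move=> p _; rewrite sumEFin -EFinM lee_fin.
    have -> : \sum_i f i p - u p = \sum_i z i p.
      by rewrite /z sumrB; congr (_ - _); rewrite -mulr_suml a1 mul1r.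
    by apply: le_trans (sqr_sum_le _) _; rewrite card_ord.
  rewrite ge0_integralZl //.
  rewrite [(N%:R * (N%:R * eps))%:E]EFinM; apply: lee_wpmul2l; first by rewrite lee_fin.
  rewrite ge0_integral_sum //; last by move=> i p _; rewrite lee_fin sqr_ge0.
  apply: (@le_trans _ _ (\sum_(i < N) eps%:E)%E); last by rewrite sumEFin sumr_const card_ord lee_fin mulr_natl.
  by apply: lee_sum => i _; have [] := GhP i.
move=> t p t0 bp; pose c0 := chart_at X p; have Xc0 : atlas X c0 := chart_atP X p.
have c0p : cdom c0 p := chart_at_dom X p; have ip : intdom X c0 p by split.
have pI := posdef_inv (gmx_posdef g Xc0 c0p).
have e0 : 0 <= e p.
  have [w0 _ ->] // := ue.2 _ Xc0; exact: gnorm2_ge0.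
split => //; rewrite (gsqE g _ Xc0 ip); last exact: smf_sum.
(* Outside [cdom (c i)] the default 0 fits, because by [out] both [f i] and [chi i] vanish near such
   a point. *)
pose A i := if `[<cdom (c i) p>] then w i p *m (tjac c0 (c i) p)^T else 0.
pose E i := dform c0 (f i) p - (chi i p *: A i + u p *: dform c0 (chi i) p).
have out i : ~ cdom (c i) p -> \forall q \near p, f i q = 0 /\ chi i q = 0.
  move=> cp; have [[r0 B0] sub _ _ chis] := aP i.
  have r30 : 0 < 3 * uradius (a i) by rewrite mulr_gt0.
  have oU : open (~` chart_ball (c i) (upoint X (a i)) (3 * uradius (a i))).
    by apply: closed_openC; exact: (closed_chart_ball hausdorffM (Xa i) r30 sub).
  have : nbhs p (~` chart_ball (c i) (upoint X (a i)) (3 * uradius (a i))).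
    by apply: open_nbhs_nbhs; split => // -[].
  apply: filterS => q bq; split; first by have [[_ +] _ _ _ _] := GhP i; apply.
  apply/eqP/negPn/negP => /chis[cq qb]; apply: bq; split => //.
  apply: subset_closed_ball; move: qb; apply: le_ball; move: r0; lra.
have Eh i : gnorm2 g c0 p (E i) <= (Gh i).2 p.
  have [cp|cp] := pselect (cdom (c i) p); last first.
    have oi := out i cp; rewrite /E /A asboolF // scaler0 add0r.
    rewrite (@dform_near c0 (f i) (fun=> 0)) //; last by apply: filterS oi => q [].
    rewrite (@dform_near c0 (chi i) (fun=> 0)) //; last by apply: filterS oi => q [].
    by rewrite !dform_cst scaler0 subr0 /gnorm2 bform0l.
  have ici : intdom X (c i) p by split.
  rewrite /E /A asboolT // (dform_transition Xc0 (Xa i) ip cp (smf_Cinf (sf i) (Xa i) 1%N)).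
  rewrite (dform_transition Xc0 (Xa i) ip cp (smf_Cinf (schi i) (Xa i) 1%N)).
  rewrite !scalemxAl -mulmxDl -mulmxBl gnorm2_transport //.
  by have [_ _ _ _] := GhP i; apply.
have -> : dform c0 (fun q => \sum_i f i q) p = \sum_i chi i p *: A i + \sum_i E i.
  rewrite (dform_sum Xc0 ip sf) /E sumrB big_split /= -scaler_sumr.
  rewrite -(dform_sum Xc0 ip schi).
  have -> : dform c0 (fun q => \sum_i chi i q) p = 0.
    rewrite (_ : (fun q => _) = fun=> 1) ?dform_cst //; apply/funext => q; exact: a1.
  by rewrite scaler0 addr0 addrC subrK.
apply: le_trans (bform_young _ _ pI t0) _; apply: lerD.
  apply: ler_wpM2l; first by rewrite addr_ge0 // ltW.
  apply: le_trans (bform_jensen _ pI (fun i _ => achi0 i p) (a1 p)) _.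
  rewrite -[leRHS]mul1r -(a1 p) mulr_suml; apply: ler_sum => i _.
  have [->|ci] := eqVneq (ufun (a i) p) 0; first by rewrite !mul0r.
  have [_ _ _ _ /(_ _ ci)[cp _]] := aP i.
  apply: ler_wpM2l => //; rewrite /A asboolT // -[bform _ _ _]/(gnorm2 g c0 p _).
  rewrite gnorm2_transport //; last exact: (Xa i).
  by rewrite -(wP i).2.
apply: ler_wpM2l; first by rewrite addr_ge0 // invr_ge0 ltW.
apply: le_trans (bform_sum_le _ pI) _; rewrite card_ord; apply: ler_wpM2l => //.
by apply: ler_sum => i _; exact: Eh.
Qed.

End Smoothing.

(** * Cheeger's inequality on H^1 *)

Section Poincare.
Context {R : realType} {n : nat} {M : ptopologicalType} (X : smoothStructure R n.+1 M).
Context (hausdorffM : hausdorff_space M) (compactM : compact [set: M]).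
Context (g : riemannianMetric X) (v : {measure set borel M -> \bar R}) (hv : is_volume g v).
Variables (rho sigma : M -> R).
Hypotheses (rho_cont : continuous rho) (rho_pos : forall x, 0 < rho x).
Hypotheses (sigma_cont : continuous sigma) (sigma_pos : forall x, 0 < sigma x).
Local Notation L1 V := (v.-integrable [set: borel M] (EFin \o V)).

Lemma integrable_mul_continuous (h : borel M -> R) (k : M -> R) : L1 h -> continuous k -> L1 (fun p => h p * k p).
Proof.
move=> ih ck; have [K K0 kK] := compact_continuous_bounded compactM ck.
rewrite (_ : EFin \o _ = (EFin \o h) \* (EFin \o (k : borel M -> R)))%E; last by apply/funext => p; rewrite /= EFinM.
apply: integrableMl => //; first exact: continuous_borelR.
by exists K; split; [exact: num_real|move=> K' KK p _; apply: le_trans (kK p) (ltW KK)].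
Qed.

Lemma integrable_of_sqr (h : borel M -> R) : measurable_fun setT h -> L1 (fun p => h p ^+ 2) -> L1 h.
Proof.
move=> mh ih; have i1 : L1 (fun=> 1) by apply: (integrable_continuous compactM hv) => p; exact: cvg_cst.
apply: (le_integrable _ _ _ (integrableD measurableT i1 ih)) => //; first exact/measurable_EFinP.
move=> p _; rewrite /= lee_fin [leRHS]ger0_norm ?addr_ge0 ?sqr_ge0 //.
by rewrite -[h p ^+ 2]real_normK ?num_real //; have := normr_ge0 (h p); have := sqr_ge0 (`|h p| - 1); nra.
Qed.

Variables (u e : borel M -> R).
Hypotheses (mu : measurable_fun setT u) (u2 : v.-integrable setT (fun p => (u p ^+ 2)%:E)).
Hypothesis ue : is_gradsq g v u e.

Let es : L1 (fun p => e p * sigma p). Proof. exact: integrable_mul_continuous ue.1 sigma_cont. Qed.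
Let e_ge0 p : ~ mboundary X p -> 0 <= e p.
Proof.
move=> bp; have [w _ ->] // := ue.2 _ (chart_atP X p); last exact: chart_at_dom.
by apply: gnorm2_ge0; [exact: chart_atP|exact: chart_at_dom].
Qed.

Let mb := measurable_mboundary X.
Let mbC : measurable ([set: borel M] `\` mboundary X). Proof. exact: measurableD. Qed.
Let vb := v_boundary hv compactM.

(** [e] is a norm only off the boundary, and the boundary is negligible. *)
Lemma gradsq_integral_ge0 : (0 <= \int[v]_p (e p * sigma p)%:E)%E.
Proof.
rewrite (negligible_integral mb _ es vb) //; apply: integral_ge0 => p [_ bp].
by rewrite lee_fin mulr_ge0 ?e_ge0 // ltW.
Qed.

Let iU : L1 (fun p => u p ^+ 2 * rho p). Proof. exact: integrable_mul_continuous u2 rho_cont. Qed.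
Let U := \int[v]_p (u p ^+ 2 * rho p).
Let Gs := \int[v]_p (e p * sigma p).

(** [smoothing_pointwise] integrated against [sigma]. The constant [C] depends neither on [t] nor on
    [eps], so [eps] can be chosen after [t]. *)
Let energy_approx : exists2 C, 0 <= C & forall t eps, 0 < t -> 0 < eps -> exists f, [/\ smf X f,
   (\int[v]_p ((f p - u p) ^+ 2)%:E <= (C * eps)%:E)%E &
   (\int[v]_p (gsq g f p * sigma p)%:E <= ((1 + t) * Gs + (1 + t^-1) * (C * eps))%:E)%E].
Proof.
have [K K0 sK] := compact_continuous_bounded compactM sigma_cont.
have [N HN] := smoothing_pointwise hausdorffM compactM hv mu u2 ue.
(* The factor [K + 1] dominates both 1, for the distance to [u], and [K], for the energy. *)
pose C : R := N%:R * N%:R * (K + 1).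
have N0 : 0 <= N%:R * N%:R :> R by rewrite mulr_ge0.
exists C => [|t eps t0 eps0]; first by rewrite mulr_ge0 // addr_ge0 // ltW.
have [f [h [sf [mh h0] hI uI pw]]] := HN eps eps0.
have t1 : 0 <= 1 + t by rewrite addr_ge0 // ltW.
have t2 : 0 <= 1 + t^-1 by rewrite addr_ge0 // invr_ge0 ltW.
exists f; split => //.
  apply: le_trans uI _; rewrite lee_fin /C; have := ltW eps0; move: N0; set a := N%:R * N%:R => a0 e0.
  by rewrite -[leRHS]mulrA mulrA -/a ler_wpM2l // ler_peMl // lerDr ltW.
have mS := continuous_borelR sigma_cont.
have me : measurable_fun setT e by apply/measurable_EFinP; exact: measurable_int ue.1.
have s0 p : 0 <= sigma p by exact: ltW.
have GsE : (\int[v]_(p in [set: borel M] `\` mboundary X) (e p * sigma p)%:E = Gs%:E)%E.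
  rewrite -(negligible_integral mb _ es vb) // /Gs /Rintegral fineK //.
  exact: integrable_fin_num.
have m1 : measurable_fun [set: borel M] (fun p => (gsq g f p * sigma p)%:E).
  by apply/measurable_EFinP; apply: measurable_funM => //; exact: measurable_gsq.
have m2 : measurable_fun ([set: borel M] `\` mboundary X) (fun p => (e p * sigma p)%:E).
  by apply: measurable_funTS; apply/measurable_EFinP; exact: measurable_funM.
have m3 : measurable_fun ([set: borel M] `\` mboundary X) (fun p => (h p)%:E).
  by apply: measurable_funTS; apply/measurable_EFinP.
rewrite (ge0_negligible_integral mb _ m1 _ vb) //; last by move=> p _; rewrite lee_fin mulr_ge0 ?gsq_ge0.
apply: (@le_trans _ _ (\int[v]_(p in [set: borel M] `\` mboundary X)
   ((1 + t)%:E * (e p * sigma p)%:E + ((1 + t^-1) * (N%:R * K))%:E * (h p)%:E))%E).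
  apply: ge0_le_integral => //.
  - by move=> p _; rewrite lee_fin mulr_ge0 ?gsq_ge0.
  - exact: measurable_funTS.
  - by apply: emeasurable_funD; exact: measurable_funeM.
  move=> p [_ bp]; have [e0 pwp] := pw t p t0 bp.
  rewrite -!EFinM -EFinD lee_fin.
  apply: (@le_trans _ _ (((1 + t) * e p + (1 + t^-1) * (N%:R * h p)) * sigma p)); first exact: ler_wpM2r.
  rewrite mulrDl -!mulrA lerD2l ler_wpM2l // ler_wpM2l // mulrC ler_wpM2r //.
  exact: le_trans (ler_norm _) (sK p).
have k0 : 0 <= (1 + t^-1) * (N%:R * K) by rewrite mulr_ge0 // mulr_ge0 // ltW.
rewrite ge0_integralD //; last 4 first.
- by move=> p [_ bp]; rewrite mule_ge0 // lee_fin // mulr_ge0 // e_ge0.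
- exact: measurable_funeM.
- by move=> p _; rewrite mule_ge0 // lee_fin.
- exact: measurable_funeM.
rewrite ge0_integralZl //; last by move=> p [_ bp]; rewrite lee_fin mulr_ge0 // e_ge0.
rewrite ge0_integralZl //; last by move=> p _; rewrite lee_fin.
rewrite GsE -EFinM EFinD; apply: leeD => //.
apply: (@le_trans _ _ (((1 + t^-1) * (N%:R * K))%:E * (N%:R * eps)%:E)%E).
  apply: lee_wpmul2l; first by rewrite lee_fin.
  apply: le_trans hI; apply: ge0_subset_integral => //; first exact/measurable_EFinP.
  by move=> p _; rewrite lee_fin.
rewrite -EFinM lee_fin -mulrA ler_wpM2l // /C.
have -> : N%:R * K * (N%:R * eps) = N%:R * N%:R * (K * eps) by ring.
by rewrite -[leRHS]mulrA ler_wpM2l // ler_wpM2r ?lerDl // ltW.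
Qed.

(** When the square is expanded the linear term vanishes by the mean condition and [m ^+ 2 * rho]
    remains. The statement is for every [m] because the median comes from the approximation of [u]
    and varies with it. *)
Lemma weighted_variance (m : R) : \int[v]_p (u p * rho p) = 0 -> U <= \int[v]_p ((u p - m) ^+ 2 * rho p).
Proof.
move=> u0; have iu : L1 (fun p => u p * rho p).
  by apply: integrable_mul_continuous => //; exact: integrable_of_sqr.
have ir : L1 rho by exact: (integrable_continuous compactM hv).
have i1 : L1 (fun p => - (2 * m) * (u p * rho p)).
  rewrite (_ : EFin \o _ = (fun p => (- (2 * m))%:E * (u p * rho p)%:E)%E); first exact: integrableZl.
  by apply/funext => p; rewrite /= -EFinM.
have i2 : L1 (fun p => m ^+ 2 * rho p).
  rewrite (_ : EFin \o _ = (fun p => (m ^+ 2)%:E * (rho p)%:E)%E); first exact: integrableZl.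
  by apply/funext => p; rewrite /= -EFinM.
rewrite (_ : (fun p : borel M => (u p - m) ^+ 2 * rho p) =
   (fun p => u p ^+ 2 * rho p + (- (2 * m) * (u p * rho p) + m ^+ 2 * rho p))); last first.
  by apply/funext => p; ring.
have i12 : L1 (fun p => - (2 * m) * (u p * rho p) + m ^+ 2 * rho p) by exact: (integrableD measurableT i1 i2).
rewrite (RintegralD measurableT iU i12) (RintegralD measurableT i1 i2) (RintegralZl (- (2 * m)) measurableT iu) u0 mulr0 add0r lerDl.
by apply: Rintegral_ge0 => p _; rewrite mulr_ge0 ?sqr_ge0 // ltW.
Qed.

Lemma sqr_split (a b t : R) : 0 < t -> (a + b) ^+ 2 <= (1 + t) * a ^+ 2 + (1 + t^-1) * b ^+ 2.
Proof.
move=> t0; have : 0 <= t^-1 * (t * a - b) ^+ 2 by rewrite mulr_ge0 ?sqr_ge0 // invr_ge0 ltW.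
have -> : t^-1 * (t * a - b) ^+ 2 = (1 + t) * a ^+ 2 + (1 + t^-1) * b ^+ 2 - (a + b) ^+ 2.
  by field; rewrite gt_eqF.
by rewrite subr_ge0.
Qed.

(** Two limits in this order: for fixed [t] the smoothing error [eps] tends to 0, which leaves the
    factor [(1 + t) ^+ 2]; then [t] tends to 0. *)
Lemma poincare (a1 a2 : R) : 0 < a1 -> 0 < a2 ->
  (a1%:E <= cheeger g v sigma sigma)%E -> (a2%:E <= cheeger g v rho sigma)%E ->
  \int[v]_p (u p * rho p) = 0 -> a1 * a2 * U <= 4 * Gs.
Proof.
move=> a10 a20 h1 h2 u0; pose A := a1 * a2; have A0 : 0 < A by rewrite mulr_gt0.
have [C C0 HC] := energy_approx.
have [K K0 rK] := compact_continuous_bounded compactM rho_cont.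
have mR := continuous_borelR rho_cont.
have step t : 0 < t -> A * U <= (1 + t) * (4 * ((1 + t) * Gs)).
  move=> t0; apply/ler_addgt0Pr => d d0.
  have t1 : 0 <= 1 + t by rewrite addr_ge0 // ltW.
  have t2 : 0 <= 1 + t^-1 by rewrite addr_ge0 // invr_ge0 ltW.
  (* [D] collects the coefficients of [eps] from the energy estimate [F1] and from the distance
     estimate [F2]. *)
  pose D := (1 + t) * (4 * ((1 + t^-1) * C)) + A * ((1 + t^-1) * (K * C)).
  have D0 : 0 <= D by rewrite addr_ge0 // !mulr_ge0 // ltW.
  pose eps := d / (D + 1); have D1 : 0 < D + 1 by rewrite ltr_wpDl.
  have eps0 : 0 < eps by rewrite divr_gt0.
  have [f [sf fu fg]] := HC t eps t0 eps0.
  have cf := smf_continuous sf; have mf := continuous_borelR cf.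
  have [m Hm] := smooth_cheeger compactM hv rho_cont rho_pos sigma_cont sigma_pos sf a10 a20 h1 h2.
  have cfm : continuous (fun p => (f p - m) ^+ 2 * rho p).
    move=> p; apply: (cvgM (F := nbhs p)); last exact: rho_cont.
    under eq_fun do rewrite expr2.
    by apply: (cvgM (F := nbhs p)); apply: (cvgB (F := nbhs p)) => //; first [exact: cf|exact: cvg_cst].
  have if1 := integrable_continuous compactM hv cfm.
  have F1 : A * \int[v]_p ((f p - m) ^+ 2 * rho p) <= 4 * ((1 + t) * Gs + (1 + t^-1) * (C * eps)).
    rewrite -lee_fin [leLHS]EFinM [leRHS]EFinM /Rintegral fineK; last exact: integrable_fin_num.
    by apply: le_trans Hm _; apply: lee_wpmul2l; rewrite ?lee_fin.
  have mfu : measurable_fun [set: borel M] (fun p => (f p - u p) ^+ 2).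
    by apply: measurable_funX; exact: measurable_funB.
  have ifu : L1 (fun p => (f p - u p) ^+ 2).
    apply/integrableP; split; first exact/measurable_EFinP.
    apply: le_lt_trans (ltry (C * eps)); apply: le_trans fu; rewrite le_eqVlt; apply/orP; left; apply/eqP.
    by apply: eq_integral => p _; rewrite /= ger0_norm // sqr_ge0.
  have if2 := integrable_mul_continuous ifu rho_cont.
  have F2 : \int[v]_p ((f p - u p) ^+ 2 * rho p) <= K * (C * eps).
    apply: (@le_trans _ _ (\int[v]_p (K * (f p - u p) ^+ 2))).
      apply: le_Rintegral => //.
        rewrite (_ : EFin \o _ = (fun p => K%:E * ((f p - u p) ^+ 2)%:E)%E); first exact: integrableZl.
        by apply/funext => p; rewrite /= -EFinM.
      move=> p _; rewrite mulrC ler_wpM2r ?sqr_ge0 //; exact: le_trans (ler_norm _) (rK p).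
    rewrite RintegralZl // ler_wpM2l ?(ltW K0) // -lee_fin /Rintegral fineK //.
    exact: integrable_fin_num.
  have iZ (h : borel M -> R) a : L1 h -> L1 (fun p => a * h p).
    move=> ih; rewrite (_ : EFin \o _ = (fun p => a%:E * (h p)%:E)%E); first exact: integrableZl.
    by apply/funext => p; rewrite /= -EFinM.
  have i3 : L1 (fun p => (1 + t) * ((f p - m) ^+ 2 * rho p) + (1 + t^-1) * ((f p - u p) ^+ 2 * rho p)).
    exact: (integrableD measurableT (iZ _ _ if1) (iZ _ _ if2)).
  have F3 : U <= (1 + t) * \int[v]_p ((f p - m) ^+ 2 * rho p) + (1 + t^-1) * \int[v]_p ((f p - u p) ^+ 2 * rho p).
    rewrite -!RintegralZl // -RintegralD //; [|exact: iZ|exact: iZ].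
    apply: le_trans (weighted_variance m u0) _; apply: le_Rintegral => //.
      have ium : L1 (fun p => (u p - m) ^+ 2).
        apply: (le_integrable _ _ _ (integrableD measurableT (iZ _ 2 u2) (integrable_continuous compactM hv (f := fun=> 2 * m ^+ 2) _))) => //.
        - by apply/measurable_EFinP; apply: measurable_funX; apply: measurable_funB.
        - move=> p _; have P : 0 <= 2 * u p ^+ 2 + 2 * m ^+ 2 by have := sqr_ge0 (u p); have := sqr_ge0 m; lra.
          rewrite /= lee_fin ger0_norm ?sqr_ge0 // [leRHS](ger0_norm P).
          by have := sqr_ge0 (u p + m); nra.
        - by move=> p; exact: cvg_cst.
      exact: integrable_mul_continuous ium rho_cont.
    move=> p _; rewrite [X in _ <= X + _]mulrA [X in _ <= _ + X]mulrA -mulrDl ler_wpM2r ?(ltW (rho_pos p)) //.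
    have -> : u p - m = (f p - m) + (u p - f p) by ring.
    have -> : (f p - u p) ^+ 2 = (u p - f p) ^+ 2 by ring.
    exact: sqr_split.
  have := ler_wpM2l (ltW A0) F3; move/le_trans; apply.
  have G1 := ler_wpM2l t1 F1; have G2 := ler_wpM2l (ltW A0) (ler_wpM2l t2 F2).
  have E1 : D * eps <= d.
    rewrite /eps mulrA mulrAC -[leRHS]mul1r ler_wpM2r ?(ltW d0) // ler_pdivrMr // mul1r lerDl //.
  move: G1 G2 E1; rewrite /D; set I1 := \int[v]_p ((f p - m) ^+ 2 * rho p).
  set I2 := \int[v]_p ((f p - u p) ^+ 2 * rho p); set s := t^-1 => G1 G2 E1.
  have -> : A * ((1 + t) * I1 + (1 + s) * I2) = (1 + t) * (A * I1) + A * ((1 + s) * I2) by ring.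
  apply: le_trans (lerD G1 G2) _.
  apply: le_trans (_ : _ <= (1 + t) * (4 * ((1 + t) * Gs)) + ((1 + t) * (4 * ((1 + s) * C)) + A * ((1 + s) * (K * C))) * eps) _.
    by rewrite le_eqVlt; apply/orP; left; apply/eqP; ring.
  by rewrite lerD2l.
have Gs0 : 0 <= Gs by rewrite /Gs /Rintegral fine_ge0 // gradsq_integral_ge0.
apply/ler_addgt0Pr => d d0.
(* For [t <= 1] the excess [4 * Gs * ((1 + t) ^+ 2 - 1)] is at most [12 * t * Gs], hence at most
   [d]; the summand 1 keeps the denominator positive when [Gs = 0]. *)
pose t := Num.min 1 (d / (12 * Gs + 1)).
have D1 : 0 < 12 * Gs + 1 by rewrite ltr_wpDl // mulr_ge0.
have t0 : 0 < t by rewrite lt_min ltr01 divr_gt0.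
have t1 : t <= 1 by rewrite ge_min lexx.
have td : t * (12 * Gs + 1) <= d by rewrite -ler_pdivlMr // ge_min lexx orbT.
apply: le_trans (step t t0) _.
have : t * Gs * (1 - t) >= 0 by rewrite !mulr_ge0 ?subr_ge0 // ltW.
move: td Gs0; nra.
Qed.

Lemma rayleigh_ge (a1 a2 : R) : 0 < a1 -> 0 < a2 ->
  (a1%:E <= cheeger g v sigma sigma)%E -> (a2%:E <= cheeger g v rho sigma)%E ->
  \int[v]_p (u p * rho p) = 0 -> ~ aeeq v u (fun=> 0) ->
  ((4^-1 * (a1 * a2))%:E <= (\int[v]_p (e p * sigma p)%:E) / (\int[v]_p (u p ^+ 2 * rho p)%:E))%E.
Proof.
move=> a10 a20 h1 h2 u0 un; have P := poincare a10 a20 h1 h2 u0.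
have EU : (\int[v]_p (u p ^+ 2 * rho p)%:E = U%:E)%E.
  by rewrite /U /Rintegral fineK //; exact: integrable_fin_num.
have EG : (\int[v]_p (e p * sigma p)%:E = Gs%:E)%E.
  by rewrite /Gs /Rintegral fineK //; exact: integrable_fin_num.
have U0 : 0 < U.
  rewrite lt0r; apply/andP; split; last by apply: Rintegral_ge0 => p _; rewrite mulr_ge0 ?sqr_ge0 // ltW.
  apply/eqP => Uz; apply: un; move: EU; rewrite Uz => EU.
  have H : ae_eq v setT (EFin \o (fun p => u p ^+ 2 * rho p)) (cst 0%E).
    apply/ae_eq_integral_abs => //; first exact: measurable_int iU.
    rewrite -[RHS]EU; apply: eq_integral => p _.
    by rewrite /= ger0_norm // mulr_ge0 ?sqr_ge0 // ltW.
  apply: filterS H => p /(_ Logic.I)/= [/eqP]; rewrite mulf_eq0 sqrf_eq0.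
  by rewrite (gt_eqF (rho_pos p)) orbF => /eqP.
rewrite EU EG inver gt_eqF // -EFinM lee_fin ler_pdivlMr //.
by rewrite -mulrA; move: P; set A := a1 * a2 * U; lra.
Qed.

End Poincare.

(** * From real lower bounds to the first eigenvalue *)

Section SpectralGap.
Context {R : realType}.
Local Open Scope ereal_scope.

(** For finite factors take [a1] and [a2] equal to them. If one factor is infinite and the other
    positive, arbitrarily large bounds contradict a finite [x]; a factor 0 makes the left side 0. *)
Lemma ereal_prod_le (h1 h2 x : \bar R) : 0 <= h1 -> 0 <= h2 -> 0 <= x ->
  (forall a1 a2 : R, (0 < a1)%R -> (0 < a2)%R -> a1%:E <= h1 -> a2%:E <= h2 -> (4^-1 * (a1 * a2))%:E <= x) ->
  (4^-1)%:E * h1 * h2 <= x.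
Proof.
move=> h10 h20; case: x => [x x0 H|_ _|//]; last exact: leey.
have x0' : (0 <= x)%R by rewrite -lee_fin.
have big (a : R) (h h' : \bar R) : (0 < a)%R -> a%:E <= h ->
    (forall a1 a2 : R, (0 < a1)%R -> (0 < a2)%R -> a1%:E <= h -> a2%:E <= +oo -> (4^-1 * (a1 * a2))%:E <= x%:E) -> False.
  move=> a0 ah /(_ a (4 * (x + 1) / a)%R a0 _ ah (leey _)).
  rewrite lee_fin => K; have : (4^-1 * (a * (4 * (x + 1) / a)) <= x)%R.
    by apply: K; rewrite divr_gt0 // mulr_gt0 // ltr_wpDl.
  have -> : (4^-1 * (a * (4 * (x + 1) / a)) = x + 1)%R by field; rewrite gt_eqF.
  by rewrite gerDl ler10.
have pick h : 0 <= h -> h = 0 \/ exists2 a : R, (0 < a)%R & a%:E <= h.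
  case: h => [r|_|//]; last by right; exists 1%R => //; exact: leey.
  by rewrite lee_fin le0r => /orP[/eqP->|r0]; [left|right; exists r].
have [->|[b1 b10 b1h]] := pick h1 h10; first by rewrite mule0 mul0e.
have [->|[b2 b20 b2h]] := pick h2 h20; first by rewrite mule0.
case: h1 h10 b1h H => [r1|_ _|//]; last first.
  move=> H; exfalso; apply: (big b2 h2 h2 b20 b2h) => a1 a2 p1 p2 q1 q2.
  by rewrite (mulrC a1); exact: H.
move=> r10 b1h; case: h2 h20 b2h => [r2|_ _|//]; last first.
  by move=> H; exfalso; exact: (big b1 r1%:E r1%:E b10 b1h H).
move=> r20 b2h H; rewrite -!EFinM -mulrA; apply: H; rewrite ?lexx //.
  by apply: lt_le_trans b10 _; rewrite -lee_fin.
by apply: lt_le_trans b20 _; rewrite -lee_fin.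
Qed.

Context {n : nat} {M : ptopologicalType} (X : smoothStructure R n.+1 M).
Context (hausdorffM : hausdorff_space M) (compactM : compact [set: M]).
Context (g : riemannianMetric X) (v : {measure set borel M -> \bar R}) (hv : is_volume g v).
Variables (rho sigma : M -> R).
Hypotheses (rho_cont : continuous rho) (rho_pos : forall x, (0 < rho x)%R).
Hypotheses (sigma_cont : continuous sigma) (sigma_pos : forall x, (0 < sigma x)%R).

Lemma cheeger_ge0 (tau : M -> R) : (forall x, (0 < tau x)%R) -> 0 <= cheeger g v tau sigma.
Proof.
move=> tau0; apply: le_ereal_inf_tmp => _ [D [nu [_ _ _ _ ->]]].
by apply: mule_ge0; [|rewrite inve_ge0]; apply: integral_ge0 => p _; rewrite lee_fin ltW.
Qed.

(* the linear functional u |-> int u rho vanishes on a line of every plane *)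
Lemma mean_zero_exists E : subspaceH1 g v 2 E -> exists u, [/\ E u, ~ aeeq v u (fun=> 0%R) &
  Rintegral v setT (fun p => (u p * rho p)%R) = 0%R].
Proof.
move=> [EH Eae E0 Elin [b [Eb bind _]]].
have iE u : E u -> v.-integrable [set: borel M] (EFin \o (fun p => (u p * rho p)%R)).
  move=> /EH[mu u2 _]; apply: (integrable_mul_continuous compactM) => //.
  exact: (integrable_of_sqr compactM hv).
pose i0 : 'I_2 := ord0; pose i1 : 'I_2 := ord_max.
pose I i := Rintegral v setT (fun p => (b i p * rho p)%R).
(* The solution [(- I i1, I i0)] of the linear equation is replaced by [(1, 0)] when [I i0 = 0], so
   the coefficients never vanish together. *)
pose s i : R := if i == i0 then (if I i0 == 0 then 1 else - I i1)%R else I i0.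
have sI : (s i0 * I i0 + s i1 * I i1 = 0)%R.
  by rewrite /s /=; case: eqVneq => [->|_]; ring.
pose u : M -> R := fun p => (s i0 * b i0 p + (s i1 * b i1 p + 0))%R.
have uE : u = lincomb s b.
  by apply/funext => p; rewrite /lincomb big_ord_recl big_ord1 /u addr0; congr (_ + s _ * b _ _)%R; exact/val_inj.
have Eu : E u by apply: (Elin (s i0)) => //; exact: (Elin (s i1)).
exists u; split => //.
  rewrite uE => /bind sz; have := sz i0; have := sz i1; rewrite /s /= => -> /eqP.
  by rewrite eqxx oner_eq0.
have iZ i : v.-integrable [set: borel M] (EFin \o (fun p => (s i * (b i p * rho p))%R)).
  rewrite (_ : EFin \o _ = (fun p => (s i)%:E * (b i p * rho p)%:E)); first by apply: integrableZl => //; exact: (iE _ (Eb i)).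
  by apply/funext => p; rewrite /= -EFinM.
rewrite (_ : (fun p : M => (u p * rho p)%R) = (fun p => s i0 * (b i0 p * rho p) + s i1 * (b i1 p * rho p))%R).
  rewrite (RintegralD measurableT (iZ i0) (iZ i1)).
  by rewrite !RintegralZl //; [exact: (iE _ (Eb i1))|exact: (iE _ (Eb i0))].
by apply/funext => p; rewrite /u; ring.
Qed.

Lemma mu1_ge : (4^-1)%:E * cheeger g v sigma sigma * cheeger g v rho sigma <= Defs.mu g v 1 rho sigma.
Proof.
apply: le_ereal_inf_tmp => _ [E SE <-].
have [u [Eu un u0]] := mean_zero_exists SE; have [EH _ _ _ _] := SE.
have [mu u2 ex] := EH _ Eu.
(* Membership in [H1] provides some witness, so the choice made by [gradsq] satisfies the
   property. *)
have ue : is_gradsq g v u (gradsq g v u) by exact: xgetPex.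
apply: (@le_trans _ _ (rayleigh g v rho sigma u)); last by apply: ereal_sup_ubound; exists u.
apply: ereal_prod_le; [exact: cheeger_ge0|exact: cheeger_ge0| |].
  apply: mule_ge0; first exact: (gradsq_integral_ge0 compactM hv sigma_cont sigma_pos ue).
  by rewrite inve_ge0; apply: integral_ge0 => p _; rewrite lee_fin mulr_ge0 ?sqr_ge0 // ltW.
move=> a1 a2 a10 a20 h1 h2.
exact: (rayleigh_ge hausdorffM compactM hv rho_cont rho_pos sigma_cont sigma_pos mu u2 ue a10 a20 h1 h2 u0 un).
Qed.

End SpectralGap.

Local Open Scope ereal_scope.

Theorem theorem3p2 (R : realType) (n : nat) (hn : (2 <= n.+1)%N)
    (M : ptopologicalType) (hausdorffM : hausdorff_space M)
    (compactM : compact [set: M])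
    (X : smoothStructure R n M) (g : riemannianMetric X)
    (v : {measure set (borel M) -> \bar R}) (hv : is_volume g v)
    (rho sigma : M -> R)
    (rho_cont : continuous rho) (rho_pos : forall x, (0 < rho x)%R)
    (sigma_cont : continuous sigma) (sigma_pos : forall x, (0 < sigma x)%R) :
  mu g v 1 rho sigma >=
    (4^-1)%:E * cheeger g v sigma sigma * cheeger g v rho sigma.
Proof.
(* In dimension [n.+2] the last coordinate, used for the function, differs from the first one, used
   for the half-space. *)
case: n hn X g hv => // n _ X g hv.
exact: mu1_ge.
Qed.
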